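(* Let $f:[0,1]^2\to[0,1]$ be a symmetric bounded measurable function, and let $Q:[0,1]\to\mathbb R$ be a normalized eigenfunction of $f$ with eigenvalue $\lambda$, i.e. $\int_0^1Q(y)^2\,dy=1$ and $\int_0^1f(x,y)Q(y)\,dy=\lambda Q(x)$ for all $x\in[0,1]$. Let $\mathbf U=(U_1,\dots,U_n)^\top$ have i.i.d. $\mathrm{Unif}[0,1]$ coordinates, let $0\le\gamma<1/2$, and given $\mathbf U$ let $G_n$ be the random adjacency matrix (symmetric, zero diagonal) with independent entries $G_n(i,j)\sim\mathrm{Ber}\big(f(U_i,U_j)/n^\gamma\big)$ for $i<j$. Let $\theta\in\mathbb R$ and $A_n=\frac{\theta G_n}{n^{1-\gamma}}$. Let $c_1,\dots,c_n$ be i.i.d. from a distribution $F$ on $\mathbb R$ with $\mathbb E_F\psi'(c_1)=0$, and given $c=(c_1,\dots,c_n)^\top$ and $(\mathbf U,G_n)$ let $\boldsymbol\sigma$ be drawn from the quadratic interaction model with coupling matrix $A_n$, field vector $c$ and common base measure $\mu$. Assume $\mathbb Ef(U_1,U_2)>0$ and $|\theta|<1$. Then, as $n\to\infty$, conditionally on $(\mathbf U,G_n)$, $$\frac1{\sqrt n}\sum_{i=1}^nQ(U_i)(\sigma_i-u_i)\,\Big|\,c\ \xrightarrow{d}\ N\Big(0,\frac{\mathbb E_F\psi''(c_1)}{1-\theta\lambda\,\mathbb E_F\psi''(c_1)}\Big),$$ $$\frac1{\sqrt n}\sum_{i=1}^nQ(U_i)\sigma_i\ \xrightarrow{d}\ N\Big(0,\frac{\mathbb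 E_F\psi''(c_1)}{1-\theta\lambda\,\mathbb E_F\psi''(c_1)}+\frac{\mathbb E_F[\psi'(c_1)^2]}{(1-\theta\lambda\,\mathbb E_F\psi''(c_1))^2}\Big).$$
   Context: Model: $\mu$ is a fixed non-degenerate probability measure supported on $[-1,1]$ with both $-1$ and $1$ in its support. The quadratic interaction model with coupling matrix $A_n$ (real symmetric, zero diagonal), field $c$ and base measure $\mu$ is the law on $[-1,1]^n$ with density $\frac1{Z_n}\exp(\frac12\boldsymbol\sigma^\top A_n\boldsymbol\sigma+c^\top\boldsymbol\sigma)$ with respect to $\mu^{\otimes n}$. The field $c$ is independent of $(\mathbf U,G_n)$; $\mathbb E_F$ is expectation over $c$. $\psi(\theta)=\log\int e^{\theta z}\,d\mu(z)$. Mean-Field optimizer: $\phi:(-1,1)\to\mathbb R$ is the inverse of $\psi':\mathbb R\to(-1,1)$, $I(z)=z\phi(z)-\psi(\phi(z))$ (extended to $\pm1$ by its limits in $[0,\infty]$), and $u=u(A_n,c)$ is the maximizer over $[-1,1]^n$ of $z\mapsto\frac12z^\top A_nz+z^\top c-\sum_iI(z_i)$. It is unique when the $\ell_2$ operator norm of $A_n$ is less than $1$ (which here holds with probability tending to one); otherwise choose any maximizer. Convergence: all statements are conditional on $(\mathbf U,G_n)$. ''$X_n\mid c\xrightarrow{d}\nu$'' means that the Kolmogorov–Smirnov distance between the conditional law of $X_n$ given $(c,\mathbf U,G_n)$ and $\nu$ tends to $0$ in probability; ''$X_n\xrightarrow{d}\nu$'' means that the Kolmogorov–Smirnov distance between the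 conditional law of $X_n$ given $(\mathbf U,G_n)$ (with $c$ averaged out) and $\nu$ tends to $0$ in probability. *)

(* Defs.v *)
(* Vectors of R^n are n.-tuples, since these carry the product sigma-algebra. *)
From HB Require Import structures.
From mathcomp Require Import all_boot all_order all_algebra.
From mathcomp Require Import all_classical all_reals all_analysis.

Set Implicit Arguments.
Unset Strict Implicit.
Unset Printing Implicit Defensive.

Import Order.TTheory GRing.Theory Num.Theory.
Import numFieldNormedType.Exports.

Local Open Scope classical_set_scope.
Local Open Scope ring_scope.

Notation Borel R := (measurableTypeR R).

Section product_power.
Context d (T : measurableType d) (R : realType) (nu : probability T R).

Definition tcons n (x : T * n.-tuple T) : n.+1.-tuple T :=
  [the n.+1.-tuple T of x.1 :: x.2].

Lemma measurable_tcons n : measurable_fun [set: T * n.-tuple T] (@tcons n).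
Proof. exact: measurable_cons. Qed.

HB.instance Definition _ n :=
  isMeasurableFun.Build _ _ _ _ (@tcons n) (@measurable_tcons n).

(* The n-fold product measure: the law of n i.i.d. draws from nu. *)
Fixpoint prob_pow n : probability (n.-tuple T) R :=
  match n with
  | 0 => \d_([tuple of [::]] : 0.-tuple T)
  | m.+1 => distribution (nu \x prob_pow m)%E (@tcons m)
  end.

End product_power.

Section base_measure.
Context (R : realType).
Implicit Type mu : probability (Borel R) R.

Definition msupport mu : set R :=
  [set x | forall V : set R, open V -> V x -> (0 < mu V)%E].

Definition base_measure mu : Prop :=
  [/\ mu `[-1, 1]%classic = 1%E, forall x : R, mu [set x] != 1%E,
      msupport mu (-1) & msupport mu 1].

Definition psi mu (t : R) : R := ln (\int[mu]_z expR (t * z)).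

(* phi is only meaningful on ]-1, 1[, where psi' has exactly one preimage. *)
Definition phi mu (z : R) : R := xget 0 [set t | derive1 (psi mu) t = z].

Definition rate0 mu (z : R) : R := z * phi mu z - psi mu (phi mu z).

(* The limit branch is used at z = 1 and z = -1 only. *)
Definition rate mu (z : R) : \bar R :=
  if `|z| < 1 then (rate0 mu z)%:E
  else lim ((rate0 mu x)%:E @[x --> within `]-1, 1[ (nbhs z)]).

End base_measure.

Section quadratic_interaction.
Context (R : realType) (mu : probability (Borel R) R) (n : nat).
Implicit Types (A : 'M[R]_n) (c z s : n.-tuple (Borel R)).

Definition coupling_matrix A : Prop := A^T = A /\ forall i, A i i = 0.

Definition energy A c s : R :=
  2^-1 * (\sum_i \sum_j tnth s i * A i j * tnth s j)
  + \sum_i tnth c i * tnth s i.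

(* The total mass of the model sits on [-1, 1]^n because that of mu sits on
   [-1, 1]; so there is no need to restrict the integrals. *)
Definition partition_function A c : R :=
  \int[prob_pow mu n]_s expR (energy A c s).

Definition gibbs A c (B : set (n.-tuple (Borel R))) : \bar R :=
  (((partition_function A c)^-1)%:E
   * \int[prob_pow mu n]_(s in B) (expR (energy A c s))%:E)%E.

Definition mf_objective A c z : \bar R :=
  ((energy A c z)%:E - \sum_i rate mu (tnth z i))%E.

Definition cube : set (n.-tuple (Borel R)) :=
  [set z | forall i, -1 <= tnth z i <= 1].

Definition mf_optimizer A c z : Prop :=
  cube z /\ forall z', cube z' -> (mf_objective A c z' <= mf_objective A c z)%E.

End quadratic_interaction.

Section random_graph.
Context (R : realType).

Definition I01 : set (Borel R) := [set x : R | 0 <= x <= 1].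

Definition unif01 : probability (Borel R) R := uniform_prob (@ltr01 R).

Definition adjacency n (g : 'M[bool]_n) : Prop :=
  g^T = g /\ forall i, g i i = false.

Definition edge_pmf (f : R -> R -> R) (gamma : R) n
    (u : n.-tuple (Borel R)) (g : 'M[bool]_n) : R :=
  \prod_(i < n) \prod_(j < n | (i < j)%N)
    bernoulli_pmf (f (tnth u i) (tnth u j) / n%:R `^ gamma) (g i j).

(* Joint law of (U, G, c). The field gs_graph is the statement that edge_pmf is
   the conditional law of G given U; U takes its values in [0, 1] everywhere
   (not just almost surely) since f is only specified on [0, 1]^2. *)
Record graphon_sample (f : R -> R -> R) (gamma : R) (F : probability (Borel R) R)
    (n : nat) d (T : measurableType d) (P : probability T R)
    (U : {RV P >-> n.-tuple (Borel R)}) (G : T -> 'M[bool]_n)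
    (c : {RV P >-> n.-tuple (Borel R)}) : Prop := GraphonSample {
  gs_U01 : forall w i, 0 <= tnth (U w) i <= 1 ;
  gs_U : forall B, measurable B -> distribution P U B = prob_pow unif01 n B ;
  gs_adj : forall w, adjacency (G w) ;
  gs_Gmeas : forall g, measurable [set w | G w = g] ;
  gs_graph : forall B g, measurable B -> adjacency g ->
    (P (U @^-1` B `&` [set w | G w = g])
     = \int[P]_(w in U @^-1` B) (edge_pmf f gamma (U w) g)%:E)%E ;
  gs_c : forall C, measurable C -> distribution P c C = prob_pow F n C ;
  gs_indep : forall B g C, measurable B -> measurable C ->
    (P (U @^-1` B `&` [set w | G w = g] `&` c @^-1` C)
     = P (U @^-1` B `&` [set w | G w = g]) * P (c @^-1` C))%E
}.

Definition coupling (theta gamma : R) n (g : 'M[bool]_n) : 'M[R]_n :=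
  \matrix_(i, j) (theta * (g i j)%:R / n%:R `^ (1 - gamma)).

Definition lin_stat (Q : R -> R) n (u s m : n.-tuple (Borel R)) : R :=
  (Num.sqrt n%:R)^-1 * \sum_(i < n) Q (tnth u i) * (tnth s i - tnth m i).

(* Conditional law, given U = u and (A_n, c) = (A, c), of
   n^(-1/2) sum_i Q(U_i) (sigma_i - m_i). *)
Definition stat_law (mu : probability (Borel R) R) (Q : R -> R) n
    (u : n.-tuple (Borel R)) (A : 'M[R]_n) (c m : n.-tuple (Borel R)) :
    set R -> \bar R :=
  pushforward (gibbs mu A c) (fun s => lin_stat Q u s m).

(* Conditional law given (U, A_n) only: c is averaged out under F^n, the
   centering m being constant. *)
Definition avg_stat_law (mu F : probability (Borel R) R) (Q : R -> R) n
    (u : n.-tuple (Borel R)) (A : 'M[R]_n) (m : n.-tuple (Borel R)) :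
    set R -> \bar R :=
  fun B => (\int[prob_pow F n]_c stat_law mu Q u A c m B)%E.

End random_graph.

Arguments I01 : clear implicits.
Arguments unif01 : clear implicits.

Section convergence.
Context (R : realType).

Definition KS_dist (nu1 nu2 : set R -> \bar R) : R :=
  sup [set `|fine (nu1 `]-oo, t]%classic) - fine (nu2 `]-oo, t]%classic)| | t in [set: R]].

(* The X n may live on different probability spaces. The outer measure makes
   the definition meaningful when X n is not measurable (an arbitrary selection
   of mean-field optimizers need not be); it is P on measurable sets. *)
Definition cvg_in_prob0 (d : nat -> measure_display)
    (T : forall n, measurableType (d n)) (P : forall n, probability (T n) R)
    (X : forall n, T n -> R) : Prop :=
  forall e : R, 0 < e ->
    mu_ext (P n) [set w | e <= `|X n w|] @[n --> \oo] --> 0%E.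

End convergence.

(* Main.v *)
Require Import Defs.
From HB Require Import structures.
From mathcomp Require Import all_boot all_order all_algebra.
From mathcomp Require Import all_classical all_reals all_analysis.
From mathcomp Require Import ring lra measurable_realfun.
Import Order.TTheory GRing.Theory Num.Theory.
Import numFieldNormedType.Exports.
Local Open Scope classical_set_scope.
Local Open Scope ring_scope.

Set Implicit Arguments.
Unset Strict Implicit.
Unset Printing Implicit Defensive.

(** Under the Gibbs law the conditional mean of sigma_i given the other spins is
    b_i = psi'((A sigma)_i + c_i), and the mean-field optimizer solves u = psi'(A u + c). Put
    q_i = Q(U_i) / sqrt n and ups = E psi''(c_1). On typical graphs A q is close to theta lambda q, and
    psi''((A u)_j + c_j) may be replaced by ups in weighted sums; linearizing b at u therefore gives
    sum_i q_i (sigma_i - b_i) = (1 - theta lambda ups) X + error, with X = sum_i q_i (sigma_i - u_i).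
    Integrating by parts one spin at a time turns this into an approximate Stein identity
    E[X g(X)] = v1 E[g'(X)] + error, and a rotation interpolating between the law of X and a Gaussian turns
    Stein identities into bounds on distribution functions. Errors are controlled by a Poincare inequality
    for the Gibbs law, obtained from the contraction of the Glauber dynamics since the row sums of |A| stay
    below 1. For the averaged law, sum_i q_i u_i is close to a multiple of sum_i q_i psi'(c_i), a sum of
    independent centered terms. The typical graphs come from truncating Q at delta sqrt n, second moments of
    A q - theta lambda q, and a Chernoff bound on the degrees. *)

(** Two sizes govern every estimate: N = n^gamma and alpha = N / n, which bounds the row sums of the
    squared entries of A. The mean-field approximation misses each Gibbs mean by O(alpha), and the
    squared errors add up to n alpha^2 = N^2 / n; this is where gamma < 1/2 enters. The vector A u
    is controlled in l2 only up to order sqrt N, but it is small in l4; hence the fourth moments,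
    and hence residuals that must stay small after multiplication by N. One parameter y measures all
    smallness: graph errors are O(y^6), field errors O(y^4) off an event of probability O(y^2), and
    what remains is O(y) once the smoothing level e is fixed. A selection of optimizers may fail to
    be measurable in c, so u is used pointwise only, through its fixed-point equation; what is
    integrated over c is a Gibbs expectation. The averaged law is compared with a Gaussian mixture
    that satisfies a Stein identity of its own, so both limits use the same rotation. *)

Section bounded_expectation.
Context d (T : measurableType d) (R : realType).
Implicit Types (P : probability T R) (D : set T) (f g : T -> R).

(** The bound is asked only on [D], a set of full measure such as the cube carrying the spins, while
    measurability is global so that it survives composition and sections. Integrals run over [D],
    and the pair gives integrability at once. *)
Definition bounded_on D f :=
  measurable_fun [set: T] f /\ exists M, forall x, D x -> `|f x| <= M.

Lemma bnd_meas D f : bounded_on D f -> measurable_fun [set: T] f.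
Proof. by case. Qed.

Lemma bnd_cst D r : bounded_on D (fun=> r).
Proof. by split=> //; exists `|r|. Qed.

Lemma bndD D f g : bounded_on D f -> bounded_on D g ->
  bounded_on D (fun x => f x + g x).
Proof.
move=> [mf [M fM]] [mg [N gN]]; split; first exact: measurable_funD.
by exists (M + N) => x Dx; rewrite (le_trans (ler_normD _ _))// lerD ?fM ?gN.
Qed.

Lemma bndN D f : bounded_on D f -> bounded_on D (fun x => - f x).
Proof.
move=> [mf [M fM]]; split; first exact: measurableT_comp.
by exists M => x Dx; rewrite normrN fM.
Qed.

Lemma bndB D f g : bounded_on D f -> bounded_on D g ->
  bounded_on D (fun x => f x - g x).
Proof. by move=> bf bg; apply: bndD => //; apply: bndN. Qed.

Lemma bndM D f g : bounded_on D f -> bounded_on D g ->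
  bounded_on D (fun x => f x * g x).
Proof.
move=> [mf [M fM]] [mg [N gN]]; split; first exact: measurable_funM.
by exists (M * N) => x Dx; rewrite normrM ler_pM ?fM ?gN.
Qed.

Lemma bndX D f n : bounded_on D f -> bounded_on D (fun x => f x ^+ n).
Proof.
move=> [mf [M fM]]; split; first exact: measurable_funX.
by exists (M ^+ n) => x Dx; rewrite normrX lerXn2r ?nnegrE ?fM// (le_trans _ (fM _ Dx)).
Qed.

Lemma bnd_norm D f : bounded_on D f -> bounded_on D (fun x => `|f x|).
Proof.
move=> [mf [M fM]]; split; first exact: measurableT_comp.
by exists M => x Dx; rewrite normr_id fM.
Qed.

Lemma bnd_sum D (I : Type) (r : seq I) (Q : pred I) (F : I -> T -> R) :
  (forall i, Q i -> bounded_on D (F i)) ->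
  bounded_on D (fun x => \sum_(i <- r | Q i) F i x).
Proof.
move=> h; elim: r => [|i r IH].
  by under eq_fun do rewrite big_nil; exact: bnd_cst.
under eq_fun do rewrite big_cons.
by have [Qi|Qi] := boolP (Q i); [apply: bndD => //; exact: h|].
Qed.

Lemma bnd_prod D (I : Type) (r : seq I) (Q : pred I) (F : I -> T -> R) :
  (forall i, Q i -> bounded_on D (F i)) ->
  bounded_on D (fun x => \prod_(i <- r | Q i) F i x).
Proof.
move=> h; elim: r => [|i r IH].
  by under eq_fun do rewrite big_nil; exact: bnd_cst.
under eq_fun do rewrite big_cons.
by have [Qi|Qi] := boolP (Q i); [apply: bndM => //; exact: h|].
Qed.

Lemma bnd_expR D f : bounded_on D f -> bounded_on D (fun x => expR (f x)).
Proof.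
move=> [mf [M fM]]; split; first exact: measurableT_comp.
exists (expR M) => x Dx; rewrite ger0_norm ?expR_ge0// ler_expR.
by rewrite (le_trans (ler_norm _))// fM.
Qed.

Lemma bnd_le D f M : measurable_fun [set: T] f ->
  (forall x, D x -> `|f x| <= M) -> bounded_on D f.
Proof. by split=> //; exists M. Qed.

Lemma bnd_comp D f (k : R -> R) M : (forall x, D x -> `|k (f x)| <= M) ->
  measurable_fun [set: R] k -> measurable_fun [set: T] f ->
  bounded_on D (fun x => k (f x)).
Proof. by move=> kM mk mf; apply: (bnd_le (M := M)) => //; exact: measurableT_comp. Qed.

Section fixed.
Context (P : probability T R) (D : set T).
Hypotheses (mD : measurable D) (PD : P D = 1%E).

Let PD' : (P : {measure set T -> \bar R}) D = 1%E := PD.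

Local Notation E f := (\int[P]_(x in D) f x).

Lemma bnd_integrable f : bounded_on D f -> P.-integrable D (EFin \o f).
Proof.
move=> [mf [M fM]]; apply: measurable_bounded_integrable => //.
- by rewrite PD' ltry.
- exact: measurable_funTS.
- exists M; split; first exact: num_real.
  by move=> r /ltW Mr x Dx; exact: le_trans (fM _ Dx) Mr.
Qed.

Lemma expect_cst r : E (fun=> r) = r.
Proof. by rewrite Rintegral_cst// PD'/= mulr1. Qed.

Lemma expectD f g : bounded_on D f -> bounded_on D g ->
  E (fun x => f x + g x) = E f + E g.
Proof. by move=> bf bg; rewrite RintegralD//; exact: bnd_integrable. Qed.

Lemma expectB f g : bounded_on D f -> bounded_on D g ->
  E (fun x => f x - g x) = E f - E g.
Proof. by move=> bf bg; rewrite RintegralB//; exact: bnd_integrable. Qed.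

Lemma expectZl r f : bounded_on D f -> E (fun x => r * f x) = r * E f.
Proof. by move=> bf; rewrite RintegralZl//; exact: bnd_integrable. Qed.

Lemma expectZr r f : bounded_on D f -> E (fun x => f x * r) = E f * r.
Proof. by move=> bf; rewrite RintegralZr//; exact: bnd_integrable. Qed.

Lemma expect_le f g : bounded_on D f -> bounded_on D g ->
  (forall x, D x -> f x <= g x) -> E f <= E g.
Proof. by move=> bf bg fg; apply: le_Rintegral => //; exact: bnd_integrable. Qed.

Lemma expect_eq f g : (forall x, D x -> f x = g x) -> E f = E g.
Proof. by move=> fg; apply: eq_Rintegral => x /[!inE] /fg. Qed.

Lemma expect_sum (I : Type) (r : seq I) (Q : pred I) (F : I -> T -> R) :
  (forall i, Q i -> bounded_on D (F i)) ->
  E (fun x => \sum_(i <- r | Q i) F i x) = \sum_(i <- r | Q i) E (F i).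
Proof.
move=> h; elim: r => [|i r IH].
  by under eq_Rintegral do rewrite big_nil; rewrite big_nil expect_cst.
under eq_Rintegral do rewrite big_cons; rewrite big_cons.
case: ifPn => Qi //; rewrite expectD ?IH//; first exact: h.
exact: bnd_sum.
Qed.

Lemma expect_norm f : bounded_on D f -> `|E f| <= E (fun x => `|f x|).
Proof. by move=> bf; apply: le_normr_Rintegral => //; exact: bnd_integrable. Qed.

Lemma expect_le_cst f M : bounded_on D f -> (forall x, D x -> f x <= M) -> E f <= M.
Proof.
move=> bf fM; rewrite -[leRHS]expect_cst; apply: expect_le => //.
exact: bnd_cst.
Qed.

Lemma expect_norm_le f M : bounded_on D f -> (forall x, D x -> `|f x| <= M) ->
  `|E f| <= M.
Proof.
move=> bf fM; rewrite (le_trans (expect_norm bf))// expect_le_cst//.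
exact: bnd_norm.
Qed.

(** Were the integral zero, [f] would vanish almost everywhere on [D], and [D] would lie in a null
    set. *)
Lemma expect_gt0 f : bounded_on D f -> (forall x, D x -> 0 < f x) -> 0 < E f.
Proof.
move=> bf f0; rewrite lt_neqAle Rintegral_ge0 ?andbT; last by move=> x Dx; rewrite ltW ?f0.
apply/eqP => Ef0.
have iE : (\int[P]_(x in D) (f x)%:E = 0)%E.
  by rewrite -[LHS]fineK ?integrable_fin_num//; [rewrite -/(Rintegral _ _ _) -Ef0|exact: bnd_integrable].
have : (\int[P]_(x in D) `|(EFin \o f) x| = 0)%E.
  rewrite -[RHS]iE; apply: eq_integral => x /[!inE] Dx /=.
  by rewrite ger0_norm// ltW ?f0.
have mf : measurable_fun D (EFin \o f : T -> \bar R).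
  by apply/measurable_EFinP/measurable_funTS; case: bf.
move=> /(ae_eq_integral_abs _ mD mf) [N [mN N0 h]].
have : (P D <= P N)%E.
  apply: le_measure; rewrite ?inE// => x Dx; apply: h => /= /(_ Dx) [] /eqP.
  by rewrite gt_eqF ?f0.
by rewrite PD' N0 lee_fin ler10.
Qed.

End fixed.
End bounded_expectation.

Lemma bnd_indic d (T : measurableType d) (R : realType) (D A : set T) : measurable A -> bounded_on D (\1_A : T -> R).
Proof.
move=> mA; apply: (bnd_le (M := 1)) => [|s _]; first exact: measurable_indic.
by rewrite indicE; case: (_ \in _); rewrite ?normr1 ?normr0.
Qed.

(** * Parameter integrals, Fubini and product measures *)

Section sigma_finite_param.
Context d1 d2 (T1 : measurableType d1) (T2 : measurableType d2) (R : realType).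
Context (m : {sigma_finite_measure set T2 -> \bar R}) (D2 : set T2).

(** Tonelli applies to the positive and the negative part separately; no integrability of the
    sections is assumed, [fine] giving a value to infinite integrals. *)
Lemma measurable_Rintegral_param (F : T1 * T2 -> R) : measurable D2 ->
  measurable_fun [set: T1 * T2] F ->
  measurable_fun [set: T1] (fun x => \int[m]_(y in D2) F (x, y)).
Proof.
move=> mD2 mF; pose G := ((EFin \o F) \_ (setT `*` D2)).
have mG : measurable_fun [set: T1 * T2] G.
  apply/(measurable_restrictT _ _).1 => //; first exact: measurableX.
  by apply/measurable_EFinP/measurable_funTS.
rewrite (_ : (fun _ => _) = fun x => fine (fubini_F m (G^\+) x - fubini_F m (G^\-) x)%E).
  apply: measurableT_comp => //; apply: emeasurable_funB.
    by apply: measurable_fun_fubini_tonelli_F => //; exact: measurable_funepos.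
  by apply: measurable_fun_fubini_tonelli_F => //; exact: measurable_funeneg.
apply/funext => x; rewrite /Rintegral integral_mkcond integralE /fubini_F.
congr (fine (_ - _)); apply: eq_integral => y _.
  by rewrite !funeposE /G !patchE in_setX in_setT.
by rewrite !funenegE /G !patchE in_setX in_setT.
Qed.

End sigma_finite_param.

Section fubini_expectation.
Context d1 d2 (T1 : measurableType d1) (T2 : measurableType d2) (R : realType).
Context (P1 : probability T1 R) (P2 : probability T2 R) (D1 : set T1) (D2 : set T2).
Hypotheses (mD1 : measurable D1) (PD1 : P1 D1 = 1%E).
Hypotheses (mD2 : measurable D2) (PD2 : P2 D2 = 1%E).
Implicit Type F : T1 * T2 -> R.

Lemma bnd_section F x : D1 x -> bounded_on (D1 `*` D2) F ->
  bounded_on D2 (fun y => F (x, y)).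
Proof.
move=> Dx [mF [M FM]]; split; first exact: measurableT_comp.
by exists M => y Dy; apply: FM.
Qed.

Lemma bnd_expect F : bounded_on (D1 `*` D2) F ->
  bounded_on D1 (fun x => \int[P2]_(y in D2) F (x, y)).
Proof using mD2 PD2.
move=> bF; have [mF [M FM]] := bF; split; first exact: (measurable_Rintegral_param P2 mD2).
exists M => x Dx; apply: (expect_norm_le mD2 PD2); first exact: bnd_section bF.
by move=> y Dy; apply: FM.
Qed.

Lemma prob_setX : (P1 \x P2)%E (D1 `*` D2) = 1%E.
Proof using mD1 mD2 PD1 PD2. by rewrite product_measure1E// [X in (X * _)%E]PD1 [X in (_ * X)%E]PD2 mule1. Qed.

Lemma expect_fubini F : bounded_on (D1 `*` D2) F ->
  \int[(P1 \x P2)%E]_(z in D1 `*` D2) F z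
  = \int[P1]_(x in D1) \int[P2]_(y in D2) F (x, y).
Proof using mD1 mD2 PD1 PD2.
move=> bF; rewrite /Rintegral; congr fine.
rewrite integral_mkcond.
have iF : (P1 \x P2)%E.-integrable setT ((EFin \o F) \_ (D1 `*` D2)).
  apply/(integrable_mkcond _ _).1; first exact: measurableX.
  apply: bnd_integrable bF; [exact: measurableX|exact: prob_setX].
rewrite -integral12_prod_meas1// /fubini_F [RHS]integral_mkcond.
apply: eq_integral => x _; rewrite patchE.
have [xD|xD] := boolP (x \in D1); last first.
  by rewrite integral0_eq// => y _; rewrite patchE in_setX (negbTE xD).
have Dx := set_mem xD.
have -> : (fine (\int[P2]_(y in D2) (F (x, y))%:E))%:E = (\int[P2]_(y in D2) (F (x, y))%:E)%E.
  rewrite fineK//; apply: integrable_fin_num => //.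
  by apply: (bnd_integrable mD2 PD2); exact: bnd_section bF.
rewrite [RHS]integral_mkcond; apply: eq_integral => y _.
by rewrite !patchE in_setX xD.
Qed.

End fubini_expectation.

Section fubini_swap.
Context d1 d2 (T1 : measurableType d1) (T2 : measurableType d2) (R : realType).
Context (P1 : probability T1 R) (P2 : probability T2 R) (D1 : set T1) (D2 : set T2).
Hypotheses (mD1 : measurable D1) (PD1 : P1 D1 = 1%E).
Hypotheses (mD2 : measurable D2) (PD2 : P2 D2 = 1%E).

Lemma expect_swap (F : T1 * T2 -> R) : bounded_on (D1 `*` D2) F ->
  \int[P1]_(x in D1) \int[P2]_(y in D2) F (x, y)
  = \int[P2]_(y in D2) \int[P1]_(x in D1) F (x, y).
Proof using mD1 mD2 PD1 PD2.
move=> bF; rewrite -expect_fubini//.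
rewrite /Rintegral; congr fine.
rewrite integral_mkcond.
have iF : (P1 \x P2)%E.-integrable setT ((EFin \o F) \_ (D1 `*` D2)).
  apply/(integrable_mkcond _ _).1; first exact: measurableX.
  apply: bnd_integrable bF; [exact: measurableX|exact: prob_setX].
rewrite -integral21_prod_meas1// /fubini_G [RHS]integral_mkcond.
apply: eq_integral => y _; rewrite patchE.
have [yD|yD] := boolP (y \in D2); last first.
  by rewrite integral0_eq// => x _; rewrite patchE in_setX (negbTE yD) andbF.
have Dy := set_mem yD.
have -> : (fine (\int[P1]_(x in D1) (F (x, y))%:E))%:E = (\int[P1]_(x in D1) (F (x, y))%:E)%E.
  rewrite fineK//; apply: integrable_fin_num => //.
  apply: (bnd_integrable mD1 PD1).
  have [mF [M FM]] := bF; split; first exact: measurableT_comp.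
  by exists M => x Dx; apply: FM.
rewrite [RHS]integral_mkcond; apply: eq_integral => x _.
by rewrite !patchE in_setX yD andbT.
Qed.

End fubini_swap.

Section power_expectation.
Context d (T : measurableType d) (R : realType) (nu : probability T R) (D : set T).
Hypotheses (mD : measurable D) (nuD : nu D = 1%E).

Definition box n : set (n.-tuple T) := [set s | forall i, D (tnth s i)].

Definition upd n (s : n.-tuple T) (j : 'I_n) (z : T) : n.-tuple T :=
  [tuple if i == j then z else tnth s i | i < n].

Lemma tnth_upd n (s : n.-tuple T) j z i :
  tnth (upd s j z) i = if i == j then z else tnth s i.
Proof. by rewrite tnth_mktuple. Qed.

Lemma upd_upd n (s : n.-tuple T) j z z' : upd (upd s j z) j z' = upd s j z'.
Proof. by apply: eq_from_tnth => i; rewrite !tnth_upd; case: eqP. Qed.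

Lemma upd_id n (s : n.-tuple T) j : upd s j (tnth s j) = s.
Proof. by apply: eq_from_tnth => i; rewrite !tnth_upd; case: eqP => // ->. Qed.

Lemma box_upd n (s : n.-tuple T) j z : box s -> D z -> box (upd s j z).
Proof. by move=> bs Dz i; rewrite tnth_upd; case: ifP. Qed.

Lemma measurable_upd n (j : 'I_n) :
  measurable_fun [set: n.-tuple T * T] (fun x => upd x.1 j x.2).
Proof.
apply/measurable_fun_tnthP => i; rewrite /comp.
under eq_fun do rewrite tnth_upd.
case: (i == j); first exact: measurable_snd.
exact: (measurableT_comp (measurable_tnth i) measurable_fst).
Qed.

Lemma measurable_updl n (j : 'I_n) z :
  measurable_fun [set: n.-tuple T] (fun s => upd s j z).
Proof.
apply/measurable_fun_tnthP => i; rewrite /comp.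
under eq_fun do rewrite tnth_upd.
by case: (i == j); [exact: measurable_cst|exact: measurable_tnth].
Qed.

Lemma upd_tcons0 n x (s : n.-tuple T) z : upd (tcons (x, s)) ord0 z = tcons (z, s).
Proof.
apply: eq_from_tnth => i; rewrite tnth_upd.
have [->|/eqP] := eqVneq i ord0; first by [].
case: (unliftP ord0 i) => [j ->|->] // _.
by rewrite !tnthS.
Qed.

Lemma upd_tconsS n x (s : n.-tuple T) j z :
  upd (tcons (x, s)) (lift ord0 j) z = tcons (x, upd s j z).
Proof.
apply: eq_from_tnth => i; rewrite tnth_upd.
case: (unliftP ord0 i) => [k ->|->].
  by rewrite !tnthS tnth_upd (inj_eq lift_inj).
by rewrite (negbTE (neq_lift _ _)).
Qed.

Lemma measurable_box n : measurable (@box n).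
Proof.
rewrite (_ : @box n = \big[setI/setT]_(i < n) ((fun s => tnth s i) @^-1` D)).
  apply: bigsetI_measurable => i _.
  by rewrite -[X in measurable X]setTI; exact: measurable_tnth.
apply/seteqP; split => s.
  by move=> bs; elim/big_ind: _ => // i _; exact: bs.
move=> + i; rewrite (bigD1 i)//= => -[+ _].
exact.
Qed.

Lemma box_cons n x (s : n.-tuple T) : box (tcons (x, s)) <-> D x /\ box s.
Proof.
split=> [h|[Dx bs] i].
  by split=> [|i]; [have := h ord0|have := h (lift ord0 i); rewrite tnthS].
case: (unliftP ord0 i) => [j ->|->]; last exact: Dx.
by rewrite tnthS; exact: bs.
Qed.

Lemma preimage_box n : @tcons _ T n @^-1` @box n.+1 = D `*` @box n.
Proof. by apply/seteqP; split => -[x s] /= /box_cons. Qed.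

Lemma prob_pow_box n : prob_pow nu n (@box n) = 1%E.
Proof.
elim: n => [|n IH].
  by rewrite /= diracE mem_set// => -[].
rewrite /= /distribution /pushforward preimage_box.
by apply: prob_setX => //; exact: measurable_box.
Qed.

Lemma bnd_tcons n (F : n.+1.-tuple T -> R) : bounded_on (@box n.+1) F ->
  bounded_on (D `*` @box n) (fun x => F (tcons x)).
Proof.
move=> [mF [M FM]]; split; first exact: measurableT_comp.
by exists M => -[x s] [/= Dx bs]; apply: FM; apply/box_cons.
Qed.

Lemma expect_cons n (F : n.+1.-tuple T -> R) : bounded_on (@box n.+1) F ->
  \int[prob_pow nu n.+1]_(s in @box n.+1) F s
  = \int[nu]_(x in D) \int[prob_pow nu n]_(s in @box n) F (tcons (x, s)).
Proof.
move=> bF; rewrite -(expect_fubini mD nuD (@measurable_box n) (prob_pow_box n) (bnd_tcons bF)).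
rewrite /Rintegral; congr fine.
transitivity (\int[pushforward (nu \x prob_pow nu n)%E (@tcons _ T n)]_(s in @box n.+1) (F s)%:E)%E => //.
rewrite integral_pushforward ?preimage_box//; last exact: measurable_box.
- by apply/measurable_EFinP; case: bF.
- apply: (bnd_integrable _ _ (bnd_tcons bF)).
    by apply: measurableX => //; exact: measurable_box.
  by apply: prob_setX => //; [exact: measurable_box|exact: prob_pow_box].
Qed.

Lemma bnd_upd n (F : n.-tuple T -> R) (j : 'I_n) : bounded_on (@box n) F ->
  bounded_on (@box n `*` D) (fun x => F (upd x.1 j x.2)).
Proof.
move=> [mF [M FM]]; split; first exact: (measurableT_comp mF (measurable_upd j)).
by exists M => -[x s] [/= bs Dx]; apply: FM; exact: box_upd.
Qed.

Lemma bnd_expect_upd n (F : n.-tuple T -> R) (j : 'I_n) : bounded_on (@box n) F ->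
  bounded_on (@box n) (fun s => \int[nu]_(z in D) F (upd s j z)).
Proof.
move=> /(bnd_upd j) /(@bnd_expect _ _ _ _ _ nu _ _ mD nuD).
exact.
Qed.

Lemma bnd_updr n (F : n.-tuple T -> R) (j : 'I_n) s : box s -> bounded_on (@box n) F ->
  bounded_on D (fun z => F (upd s j z)).
Proof. by move=> bs /(bnd_upd j) /(bnd_section bs). Qed.

(** Induction on [n]: for the first coordinate this is an exchange of integrals, for a later one the
    induction hypothesis on the tail. The independence arguments rest on it: a function ignores
    coordinate [j] when [upd] at [j] leaves it unchanged. *)
Lemma expect_resample n (F : n.-tuple T -> R) (j : 'I_n) : bounded_on (@box n) F ->
  \int[prob_pow nu n]_(s in @box n) F s
  = \int[prob_pow nu n]_(s in @box n) \int[nu]_(z in D) F (upd s j z).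
Proof.
elim: n F j => [|n IH] F j bF; first by case: j.
rewrite [RHS]expect_cons; last exact: bnd_expect_upd.
rewrite (expect_cons bF).
case: (unliftP ord0 j) => [k ->|->].
  apply: expect_eq => x Dx; under [RHS]eq_Rintegral do under eq_Rintegral do rewrite upd_tconsS.
  rewrite (IH (fun s => F (tcons (x, s))) k)//.
  by move/bnd_tcons : bF => /(bnd_section Dx).
(* The head is overwritten, so the outer integral on the right is that of a constant. *)
under [RHS]eq_Rintegral do under eq_Rintegral do under eq_Rintegral do rewrite upd_tcons0.
rewrite [RHS]expect_cst//.
exact: (expect_swap mD nuD (@measurable_box n) (prob_pow_box n) (bnd_tcons bF)).
Qed.

Lemma expect_coord n (k : T -> R) (j : 'I_n) : bounded_on D k ->
  \int[prob_pow nu n]_(s in @box n) k (tnth s j) = \int[nu]_(z in D) k z.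
Proof.
move=> bk; rewrite (expect_resample j).
  under eq_Rintegral do under eq_Rintegral do rewrite tnth_upd eqxx.
  by rewrite expect_cst//; [exact: measurable_box|exact: prob_pow_box].
have [mk [M kM]] := bk; split; first exact: (measurableT_comp mk (measurable_tnth j)).
by exists M => s bs; exact: kM.
Qed.

End power_expectation.

(** * Quantitative calculus in one variable *)

Section calculus.
Context (R : realType).
Implicit Types (f df : R -> R) (x y t : R).

(** A quadratic remainder makes the error of the difference quotient linear in the increment.
    Increments up to 1/2 suffice, which is the range of [expR_quadratic]. *)
Lemma quadratic_is_derive f t l C :
  (forall h, `|h| <= 2^-1 -> `|f (t + h) - f t - h * l| <= C * h ^+ 2) ->
  is_derive t 1 f l.
Proof.
move=> H.
have cvgf : h^-1 *: ((f \o shift t) (h *: 1) - f t) @[h --> 0^'] --> l.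
  apply/cvgrPdist_le => e e0; near=> h.
  have h0 : h != 0 by near: h; exact: nbhs_dnbhs_neq.
  (* No sign is assumed for [C]; adding 1 keeps the denominator positive. *)
  have hC : `|h| <= e / (`|C| + 1).
    near: h; apply: dnbhs0_le; by rewrite divr_gt0// ltr_wpDl.
  have h2 : `|h| <= 2^-1 by near: h; apply: dnbhs0_le.
  have {}H := H h h2.
  rewrite /= /shift/= [h *: 1]mulr1 [h + t]addrC.
  rewrite (_ : l - _ = - (h^-1 * (f (t + h) - f t - h * l))); last first.
    by rewrite [_ *: _]/(_ * _) mulrBr mulKf// opprB.
  rewrite normrN normrM normfV ler_pdivrMl ?normr_gt0// (le_trans H)//.
  rewrite -(real_normK (num_real h)) expr2 mulrA mulrC ler_wpM2l// (@le_trans _ _ ((`|C| + 1) * `|h|))//.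
    by rewrite ler_wpM2r// (le_trans (ler_norm _))// lerDl.
  by rewrite mulrC -ler_pdivlMr// ltr_wpDl.
split; first by apply/cvg_ex; exists l.
by rewrite /derive; apply/cvg_lim.
Unshelve. all: by end_near. Qed.

Lemma is_derive_continuous f df : (forall x, is_derive x 1 f (df x)) -> continuous f.
Proof.
move=> dfP x; apply: differentiable_continuous.
by apply/derivable1_diffP; have [] := dfP x.
Qed.

(** The location of the intermediate point is stated by distances to [x], so that both orders of [x]
    and [y] are covered by one formula. *)
Lemma is_derive_mvt f df x y : (forall x, is_derive x 1 f (df x)) ->
  exists c, `|c - x| <= `|y - x| /\ f y - f x = df c * (y - x).
Proof.
move=> dfP; have cf := is_derive_continuous dfP.
have [xy|/ltW yx] := leP x y.
  have [|c] := @MVT_segment R f df x y xy (fun z _ => dfP z); first exact: continuous_subspaceT.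
  rewrite in_itv/= => /andP[xc cy] ->; exists c; split=> //.
  by rewrite !ger0_norm ?subr_ge0// lerB.
have [|c] := @MVT_segment R f df y x yx (fun z _ => dfP z); first exact: continuous_subspaceT.
rewrite in_itv/= => /andP[yc cx] fE; exists c; split; last by rewrite -opprB fE; ring.
by rewrite !ler0_norm ?subr_le0// lerN2 lerB.
Qed.

Lemma is_derive_lipschitz f df B x y : (forall x, is_derive x 1 f (df x)) ->
  (forall x, `|df x| <= B) -> `|f y - f x| <= B * `|y - x|.
Proof.
move=> dfP dfB; have [c [_ ->]] := is_derive_mvt x y dfP.
by rewrite normrM ler_wpM2r.
Qed.

Lemma is_derive_taylor f df B x y : (forall x, is_derive x 1 f (df x)) ->
  (forall x y, `|df y - df x| <= B * `|y - x|) ->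
  `|f y - f x - df x * (y - x)| <= B * (y - x) ^+ 2.
Proof.
move=> dfP dfB; have [c [cxy ->]] := is_derive_mvt x y dfP.
rewrite -mulrBl normrM (le_trans (ler_wpM2r _ (dfB x c)))//.
rewrite -[_ ^+ 2]ger0_norm ?sqr_ge0// normrX expr2 mulrA ler_wpM2r//.
have [yx|yx] := eqVneq y x.
  move: cxy; rewrite yx subrr normr0 normr_le0 => /eqP ->.
  by rewrite normr0.
(* That [B] is nonnegative is read off the Lipschitz bound, which is why [y = x] was treated
   apart. *)
rewrite ler_wpM2l// -(pmulr_lge0 _ (_ : 0 < `|y - x|)) ?normr_gt0 ?subr_eq0//.
exact: le_trans (dfB x y).
Qed.

(** The lower bound is exp x >= 1 + x. The same inequality at -x gives (1 - x) exp x <= 1, and 1 <=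
    (1 - x)(1 + x + 2 x^2) for x at most 1/2. *)
Lemma expR_quadratic x : `|x| <= 2^-1 -> `|expR x - 1 - x| <= 2 * x ^+ 2.
Proof.
rewrite ler_norml => /andP[x1 x2]; rewrite ler_norml.
have h1 := expR_ge1Dx x; have h2 := expR_ge1Dx (- x).
have e0 := expR_gt0 x; rewrite expRN in h2.
have e1 : expR x * (1 - x) <= 1.
  by rewrite -[leRHS](mulfV (lt0r_neq0 e0)) ler_wpM2l// ltW.
apply/andP; split; first by nra.
have : 0 <= (1 - x) * (1 + x + 2 * x ^+ 2) - expR x * (1 - x) by nra.
rewrite [expR x * _]mulrC -mulrBr pmulr_rge0; last lra.
by lra.
Qed.

End calculus.

Lemma Rintegral_full d (T : measurableType d) (R : realType) (P : probability T R)
    (D : set T) (f : T -> R) : measurable D -> P D = 1%E -> measurable_fun setT f ->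
  \int[P]_x f x = \int[P]_(x in D) f x.
Proof.
move=> mD PD mf; rewrite /Rintegral; congr fine.
rewrite [RHS]integral_mkcond; apply: ae_eq_integral => //.
- exact/measurable_EFinP.
- apply/(measurable_restrictT _ _).1 => //.
  exact/measurable_EFinP/measurable_funTS.
exists (~` D); split; first exact: measurableC.
  by rewrite [LHS]probability_setC// [X in (_ - X)%E]PD subee.
move=> x /= h Dx; apply: h => _; rewrite patchE.
by rewrite (mem_set Dx).
Qed.

Lemma integral_fullE d (T : measurableType d) (R : realType) (P : probability T R)
    (D : set T) (f : T -> R) : measurable D -> P D = 1%E -> bounded_on D f ->
  (\int[P]_x (f x)%:E = (\int[P]_(x in D) f x)%:E)%E.
Proof.
move=> mD PD bf; have [mf _] := bf; have fi := bnd_integrable mD PD bf.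
rewrite /Rintegral fineK; last exact: integrable_fin_num.
rewrite [RHS]integral_mkcond; apply: ae_eq_integral => //.
- exact/measurable_EFinP.
- apply/(measurable_restrictT _ _).1 => //.
  exact/measurable_EFinP/measurable_funTS.
exists (~` D); split; first exact: measurableC.
  by rewrite [LHS]probability_setC// [X in (_ - X)%E]PD subee.
by move=> x /= h Dx; apply: h => _; rewrite patchE (mem_set Dx).
Qed.

Fact lock_key : unit. Proof. by []. Qed.

(** * The log-Laplace transform of the base measure *)

Section tilt.
Context (R : realType) (mu : probability (Borel R) R).
Local Notation I := (`[-1, 1]%classic : set (Borel R)).
Hypothesis muI : mu I = 1%E.
Implicit Types (k : R -> R) (t : R).
Local Notation E f := (\int[mu]_(z in I) f z).

Let mI : measurable I. Proof. exact: measurable_itv. Qed.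

Lemma itvN11P (z : R) : I z <-> `|z| <= 1.
Proof. by rewrite /= in_itv/= ler_norml. Qed.

Definition tmom k t : R := E (fun z => k z * expR (t * z)).

(** Expectation under the exponential tilt of [mu], with density proportional to exp(t z). This is
    the law of one spin given the others, [t] being its total field. *)
Definition tilt t k : R := locked_with lock_key (tmom k t / tmom (fun=> 1) t).

Lemma tiltE t k : tilt t k = tmom k t / tmom (fun=> 1) t.
Proof. by rewrite /tilt unlock. Qed.

Lemma bnd_id : bounded_on I (fun z : Borel R => z : R).
Proof. by split=> //; exists 1 => z /itvN11P. Qed.

Lemma bnd_exp t : bounded_on I (fun z : Borel R => expR (t * z)).
Proof. by apply: bnd_expR; apply: bndM; [exact: bnd_cst|exact: bnd_id]. Qed.

Lemma bnd_tmom k t : bounded_on I k -> bounded_on I (fun z => k z * expR (t * z)).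
Proof. by move=> bk; apply: bndM => //; exact: bnd_exp. Qed.

Lemma tmom1_gt0 t : 0 < tmom (fun=> 1) t.
Proof.
apply: (expect_gt0 mI muI) => [|z _]; first by apply: bnd_tmom; exact: bnd_cst.
by rewrite mul1r expR_gt0.
Qed.
#[local] Hint Resolve tmom1_gt0 : core.

Let tmom1_neq0 t : tmom (fun=> 1) t != 0. Proof. by rewrite gt_eqF. Qed.
#[local] Hint Resolve tmom1_neq0 : core.

Lemma tmomD k1 k2 t : bounded_on I k1 -> bounded_on I k2 ->
  tmom (fun z => k1 z + k2 z) t = tmom k1 t + tmom k2 t.
Proof.
move=> b1 b2; rewrite /tmom -(expectD mI muI); [|exact: bnd_tmom..].
by apply: expect_eq => z _; rewrite mulrDl.
Qed.

Lemma tmomZ r k t : bounded_on I k -> tmom (fun z => r * k z) t = r * tmom k t.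
Proof.
move=> b; rewrite /tmom -(expectZl mI muI); [|exact: bnd_tmom].
by apply: expect_eq => z _; rewrite mulrA.
Qed.

Lemma eq_tilt t k1 k2 : (forall z, I z -> k1 z = k2 z) -> tilt t k1 = tilt t k2.
Proof.
by move=> h; rewrite !tiltE; congr (_ / _); apply: expect_eq => z Iz; rewrite h.
Qed.

Lemma tilt_cst t r : tilt t (fun=> r) = r.
Proof.
rewrite tiltE (_ : tmom (fun=> r) t = r * tmom (fun=> 1) t) ?mulfK//.
rewrite -tmomZ; last exact: bnd_cst.
by apply: expect_eq => z _; rewrite mulr1.
Qed.

Lemma tiltD t k1 k2 : bounded_on I k1 -> bounded_on I k2 ->
  tilt t (fun z => k1 z + k2 z) = tilt t k1 + tilt t k2.
Proof. by move=> b1 b2; rewrite !tiltE tmomD// mulrDl. Qed.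

Lemma tiltZ t r k : bounded_on I k -> tilt t (fun z => r * k z) = r * tilt t k.
Proof. by move=> b; rewrite !tiltE tmomZ// mulrA. Qed.

Lemma tiltB t k1 k2 : bounded_on I k1 -> bounded_on I k2 ->
  tilt t (fun z => k1 z - k2 z) = tilt t k1 - tilt t k2.
Proof.
move=> b1 b2; rewrite tiltD//; last exact: bndN.
congr (_ + _); rewrite -mulN1r -tiltZ//.
by apply: eq_tilt => z _; rewrite mulN1r.
Qed.

Lemma tilt_le t k1 k2 : bounded_on I k1 -> bounded_on I k2 ->
  (forall z, I z -> k1 z <= k2 z) -> tilt t k1 <= tilt t k2.
Proof.
move=> b1 b2 h; rewrite !tiltE ler_pM2r ?invr_gt0//.
apply: (expect_le mI muI); [exact: bnd_tmom..|move=> z Iz].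
by rewrite ler_wpM2r ?expR_ge0// h.
Qed.

Lemma tilt_norm_le t k M : bounded_on I k -> (forall z, I z -> `|k z| <= M) ->
  `|tilt t k| <= M.
Proof.
move=> b h; rewrite ler_norml; apply/andP; split.
  rewrite -(tilt_cst t (- M)); apply: tilt_le => //; first exact: bnd_cst.
  by move=> z Iz; have := h z Iz; rewrite ler_norml => /andP[].
rewrite -[leRHS](tilt_cst t); apply: tilt_le => //; first exact: bnd_cst.
by move=> z Iz; have := h z Iz; rewrite ler_norml => /andP[].
Qed.

(** Differentiation under the integral with an explicit remainder: on the carrier |z| <= 1, so the
    increment of the exponential is controlled by [expR_quadratic] uniformly in z. *)
Lemma tmom_is_derive k t : bounded_on I k ->
  is_derive t 1 (tmom k) (tmom (fun z => k z * z) t).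
Proof.
move=> bk; have bkz : bounded_on I (fun z => k z * z) by apply: bndM => //; exact: bnd_id.
have [_ [K kK]] := bnd_tmom t bk.
apply: (@quadratic_is_derive _ _ _ _ (2 * K)) => h h2.
rewrite -(expectZl mI muI); last exact: bnd_tmom.
have b1 := bnd_tmom (t + h) bk; have b2 := bnd_tmom t bk; have b3 := bnd_tmom t bkz.
have b3' : bounded_on I (fun z => h * (k z * z * expR (t * z))).
  by apply: bndM => //; exact: bnd_cst.
rewrite -(expectB mI muI)// -(expectB mI muI)//; last exact: bndB.
apply: (expect_norm_le mI muI); first by apply: bndB => //; apply: bndB.
move=> z Iz; have z1 : `|z| <= 1 by exact/itvN11P.
have hz : `|h * z| <= 2^-1.
  by rewrite normrM (le_trans _ h2)// ler_piMr.
rewrite (_ : _ - _ = k z * expR (t * z) * (expR (h * z) - 1 - h * z)); last first.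
  by rewrite mulrDl expRD; ring.
have K0 : 0 <= K by rewrite (le_trans _ (kK _ Iz)).
rewrite normrM -mulrA [2 * _]mulrC -mulrA; apply: ler_pM => //; first exact: kK.
rewrite (le_trans (expR_quadratic hz))// [leRHS]mulrC ler_wpM2l//.
rewrite exprMn ler_piMr ?sqr_ge0// -[z ^+ 2]ger0_norm ?sqr_ge0//.
by rewrite normrX exprn_ile1.
Qed.

(** The derivative is the covariance of [k] and the identity under the tilted law. *)
Lemma tilt_is_derive k t : bounded_on I k ->
  is_derive t 1 (tilt ^~ k) (tilt t (fun z => k z * z) - tilt t k * tilt t id).
Proof.
move=> bk; have d1 := tmom_is_derive t bk.
have -> : tilt ^~ k = (fun t => tmom k t / tmom (fun=> 1) t) by apply/funext => x; rewrite tiltE.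
have d2 := tmom_is_derive t (bnd_cst I (1 : R)).
have d3 := is_deriveV (tmom1_neq0 t) d2.
move: (is_deriveM d1 d3); rewrite [X in is_derive _ _ _ X -> _](_ : _ =
  tilt t (fun z => k z * z) - tilt t k * tilt t id); first exact.
have e1 : tmom (fun z => 1 * z) t = tmom id t.
  by apply: expect_eq => z _; rewrite mul1r.
rewrite e1 !tiltE; have := tmom1_neq0 t.
set Z := tmom (fun=> 1) t => Z0.
change (tmom k t * (- Z ^- 2 * tmom id t) + Z^-1 * tmom (fun z => k z * z) t =
  tmom (fun z => k z * z) t / Z - tmom k t / Z * (tmom id t / Z)).
by field.
Qed.

(** With m the tilted mean, the covariance equals the tilted mean of (k(z) - k(m))(z - m), hence is
    at most L times the tilted variance, itself at most 1. The point m lies in [-1, 1], where [k] is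
    Lipschitz. *)
Lemma tilt_lipschitz k L t t' : bounded_on I k -> 0 <= L ->
  (forall z z', I z -> I z' -> `|k z - k z'| <= L * `|z - z'|) ->
  `|tilt t k - tilt t' k| <= L * `|t - t'|.
Proof.
move=> bk L0 kL; apply: (is_derive_lipschitz _ _ (fun x => tilt_is_derive x bk)) => x.
set m := tilt x id.
have Im : I m.
  by apply/itvN11P; apply: tilt_norm_le; [exact: bnd_id|move=> z /itvN11P].
have bkz : bounded_on I (fun z => k z * z) by apply: bndM => //; exact: bnd_id.
have -> : tilt x (fun z => k z * z) - tilt x k * m = tilt x (fun z => (k z - k m) * (z - m)).
  rewrite [RHS](@eq_tilt _ _ (fun z => (k z * z - m * k z) - (k m * z - k m * m))); last first.
    by move=> z _; ring.
  have b1 : bounded_on I (fun z => m * k z) by apply: bndM => //; exact: bnd_cst.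
  have b2 : bounded_on I (fun z => k m * z) by apply: bndM; [exact: bnd_cst|exact: bnd_id].
  have b3 : bounded_on I (fun=> k m * m) by exact: bnd_cst.
  rewrite tiltB; [|exact: bndB..].
  rewrite tiltB// tiltB// (tiltZ _ _ bk) (tiltZ _ _ bnd_id).
  by rewrite tilt_cst -/m; ring.
have bm : bounded_on I (fun z : Borel R => z - m) by apply: bndB; [exact: bnd_id|exact: bnd_cst].
have bkm : bounded_on I (fun z => (k z - k m) * (z - m)).
  by apply: bndM => //; apply: bndB => //; exact: bnd_cst.
have bm2 : bounded_on I (fun z : Borel R => L * (z - m) ^+ 2).
  by apply: bndM; [exact: bnd_cst|exact: bndX].
have h z : I z -> `|(k z - k m) * (z - m)| <= L * (z - m) ^+ 2.
  move=> Iz; rewrite normrM -[(z - m) ^+ 2]ger0_norm ?sqr_ge0// normrX expr2 mulrA.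
  by rewrite ler_wpM2r// kL.
apply: (@le_trans _ _ (tilt x (fun z => L * (z - m) ^+ 2))).
  rewrite ler_norml -[X in X <= _]mulN1r -tiltZ//.
  apply/andP; split; apply: tilt_le => //.
  - by apply: bndM => //; exact: bnd_cst.
  - by move=> z /h; rewrite ler_norml mulN1r => /andP[].
  - by move=> z /h; rewrite ler_norml => /andP[].
rewrite tiltZ; last exact: bndX.
rewrite ler_piMr//.
rewrite (@eq_tilt _ _ (fun z => z ^+ 2 - (m * 2 * z - m ^+ 2))); last by move=> z _; ring.
have bz2 : bounded_on I (fun z : Borel R => z ^+ 2) by apply: bndX; exact: bnd_id.
have b2 : bounded_on I (fun z : Borel R => m * 2 * z) by apply: bndM; [exact: bnd_cst|exact: bnd_id].
rewrite tiltB//; last by apply: bndB => //; exact: bnd_cst.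
rewrite tiltB//; last exact: bnd_cst.
rewrite tiltZ; last exact: bnd_id.
rewrite tilt_cst -/m.
have : tilt x (fun z => z ^+ 2) <= 1.
  rewrite -(tilt_cst x 1); apply: tilt_le => //; first exact: bnd_cst.
  by move=> z /itvN11P z1; rewrite -[_ ^+ 2]ger0_norm ?sqr_ge0// normrX exprn_ile1.
by have := sqr_ge0 m; lra.
Qed.

End tilt.

Section log_mgf.
Context (R : realType) (mu : probability (Borel R) R).
Local Notation I := (`[-1, 1]%classic : set (Borel R)).
Hypothesis hmu : base_measure mu.
Implicit Types (t z : R).
Local Notation E f := (\int[mu]_(z in I) f z).

Lemma base_measureI : mu I = 1%E. Proof. by case: hmu. Qed.
Local Notation muI := base_measureI.
Let mI : measurable I. Proof. exact: measurable_itv. Qed.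

(** The derivatives psi' and psi'' in closed form, as tilted mean and tilted variance; [derive1_psi]
    and [derive2_psi] tie them to [psi]. *)
Definition psi1 t : R := locked_with lock_key (tilt mu t id).
Definition psi2 t : R := locked_with lock_key (tilt mu t (fun z => z ^+ 2) - psi1 t ^+ 2).

Lemma psi1E t : psi1 t = tilt mu t id.
Proof. by rewrite /psi1 unlock. Qed.

Lemma psi2_def t : psi2 t = tilt mu t (fun z => z ^+ 2) - psi1 t ^+ 2.
Proof. by rewrite /psi2 unlock. Qed.

Let bid := bnd_id R.
Let bsq : bounded_on I (fun z : Borel R => z ^+ 2).
Proof. by apply: bndX; exact: bid. Qed.

Lemma psiE t : psi mu t = ln (tmom mu (fun=> 1) t).
Proof.
rewrite /psi (Rintegral_full mI muI); last by case: (bnd_exp t).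
by congr ln; apply: expect_eq => z _; rewrite mul1r.
Qed.

Lemma is_derive_psi t : is_derive t 1 (psi mu) (psi1 t).
Proof.
have d1 := tmom_is_derive muI t (bnd_cst I (1 : R)).
have d2 := is_derive1_ln (tmom1_gt0 muI t).
have -> : psi mu = (@ln R) \o (tmom mu (fun=> 1)) by apply/funext => x; exact: psiE.
have e1 : tmom mu (fun z => 1 * z) t = tmom mu id t.
  by apply: expect_eq => z _; rewrite mul1r.
have := is_derive1_comp d2 d1; rewrite e1.
by rewrite [X in is_derive _ _ _ X -> _](_ : _ = psi1 t)// psi1E tiltE mulrC.
Qed.

Lemma derive1_psi : derive1 (psi mu) = psi1.
Proof. by apply/funext => t; rewrite derive1E; have [_ ->] := is_derive_psi t. Qed.

Lemma is_derive_psi1 t : is_derive t 1 psi1 (psi2 t).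
Proof.
have := tilt_is_derive muI t bid.
rewrite (_ : tilt mu ^~ id = psi1); last by apply/funext => x; rewrite psi1E.
by rewrite psi2_def psi1E expr2 (@eq_tilt _ _ t (fun z => z ^+ 2) (fun z => id z * z)).
Qed.

Lemma derive2_psi : derive1n 2 (psi mu) = psi2.
Proof.
apply/funext => t; rewrite /= derive1_psi derive1E.
by have [_ ->] := is_derive_psi1 t.
Qed.

Lemma psi1_le1 t : `|psi1 t| <= 1.
Proof. by rewrite psi1E; apply: (tilt_norm_le muI); [exact: bid|move=> z /itvN11P]. Qed.

Lemma psi2E t : psi2 t = tilt mu t (fun z => (z - psi1 t) ^+ 2).
Proof.
rewrite psi2_def [RHS](@eq_tilt _ _ _ _ (fun z => z ^+ 2 - (2 * psi1 t * z - psi1 t ^+ 2))); last by move=> z _; ring.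
have b2 : bounded_on I (fun z : Borel R => 2 * psi1 t * z) by apply: bndM; [exact: bnd_cst|exact: bid].
rewrite (tiltB muI)//; last by apply: bndB => //; exact: bnd_cst.
rewrite (tiltB muI)//; last exact: bnd_cst.
rewrite (tiltZ muI _ _ bid) (tilt_cst muI) -(psi1E t); ring.
Qed.

(** A vanishing tilted variance would put all the mass of [mu] on the single point [psi1 t], against
    non-degeneracy. *)
Lemma psi2_gt0 t : 0 < psi2 t.
Proof.
have b : bounded_on I (fun z : Borel R => (z - psi1 t) ^+ 2).
  by apply: bndX; apply: bndB; [exact: bid|exact: bnd_cst].
have bt := bnd_tmom t b.
rewrite psi2E tiltE divr_gt0 ?(tmom1_gt0 muI)//.
rewrite lt_neqAle Rintegral_ge0 ?andbT; last first.
  by move=> z _; rewrite mulr_ge0 ?sqr_ge0 ?expR_ge0.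
apply/eqP => Ef0.
set f := (fun z => _) in b bt Ef0.
have iE : (\int[mu]_(x in I) ((f x * expR (t * x))%:E) = 0)%E.
  rewrite -[LHS]fineK; last by apply: integrable_fin_num => //; exact: (bnd_integrable mI muI).
  by congr EFin; rewrite Ef0.
have ga : (\int[mu]_(x in I) `|(f x * expR (t * x))%:E| = 0)%E.
  rewrite -[RHS]iE; apply: eq_integral => x _ /=.
  by rewrite ger0_norm// mulr_ge0 ?sqr_ge0 ?expR_ge0.
have mf : measurable_fun I (fun x => (f x * expR (t * x))%:E).
  by apply/measurable_EFinP/measurable_funTS; case: bt.
have := ae_eq_integral_abs mu mI mf.
move=> [+ _] => /(_ ga) [N [mN N0 h]].
case: hmu => _ /(_ (psi1 t)) /eqP + _ _; apply.
have s1 : measurable [set psi1 t] by exact: measurable_set1.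
apply/eqP; rewrite eq_le probability_le1//=.
rewrite -muI (@le_trans _ _ (mu ([set psi1 t] `|` N)))//.
  apply: le_measure; rewrite ?inE//; first exact: measurableU.
  move=> x Ix; have [->|xn] := eqVneq x (psi1 t); first by left.
  right; apply: h => /= /(_ Ix) [] /eqP.
  by rewrite mulf_eq0 (gt_eqF (expR_gt0 _)) orbF sqrf_eq0 subr_eq0 (negbTE xn).
apply: (le_trans (measureU2 _ _ _)) => //.
by rewrite [X in (_ + X)%E]N0 adde0.
Qed.

Lemma psi2_le1 t : psi2 t <= 1.
Proof.
have : tilt mu t (fun z => z ^+ 2) <= 1.
  rewrite -(tilt_cst muI t 1); apply: (tilt_le muI) => //; first exact: bnd_cst.
  by move=> z /itvN11P z1; rewrite -[_ ^+ 2]ger0_norm ?sqr_ge0// normrX exprn_ile1.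
by rewrite psi2_def; have := sqr_ge0 (psi1 t); lra.
Qed.

Lemma psi2_norm_le1 t : `|psi2 t| <= 1.
Proof. by rewrite ger0_norm ?psi2_le1// ltW ?psi2_gt0. Qed.

Lemma psi1_lipschitz x y : `|psi1 y - psi1 x| <= `|y - x|.
Proof.
by rewrite -[leRHS]mul1r; apply: (is_derive_lipschitz _ _ is_derive_psi1 psi2_norm_le1).
Qed.

(** The 4 is 2 + 2: the square is 2-Lipschitz on [-1, 1], which serves once for the second moment
    through [tilt_lipschitz] and once for the square of [psi1]. *)
Lemma psi2_lipschitz x y : `|psi2 y - psi2 x| <= 4 * `|y - x|.
Proof.
have h1 : `|tilt mu y (fun z => z ^+ 2) - tilt mu x (fun z => z ^+ 2)| <= 2 * `|y - x|.
  apply: (tilt_lipschitz muI) => // z z' /itvN11P z1 /itvN11P z'1.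
  rewrite (_ : _ - _ = (z + z') * (z - z')); last by ring.
  by rewrite normrM ler_wpM2r// (le_trans (ler_normD _ _))//; lra.
have h2 : `|psi1 y ^+ 2 - psi1 x ^+ 2| <= 2 * `|y - x|.
  have := psi1_le1 x; have := psi1_le1 y; have := psi1_lipschitz x y.
  move: (psi1 x) (psi1 y) => a b ab a1 b1.
  rewrite subr_sqr mulrC normrM ler_pM// (le_trans (ler_normD _ _))//.
  by rewrite -[2]/(1 + 1) lerD.
rewrite (psi2_def x) (psi2_def y); move: h1 h2; move: (psi1 x ^+ 2) (psi1 y ^+ 2) (tilt mu x (fun z => z ^+ 2)) (tilt mu y (fun z => z ^+ 2)) => a b c d h1 h2.
rewrite (_ : d - b - (c - a) = (d - c) - (b - a)); last by ring.
rewrite (le_trans (ler_normB _ _))// (le_trans (lerD h1 h2))//.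
by rewrite -mulrDl ler_wpM2r//; lra.
Qed.

Lemma psi1_taylor x y : `|psi1 y - psi1 x - psi2 x * (y - x)| <= 4 * (y - x) ^+ 2.
Proof. exact: (is_derive_taylor _ _ is_derive_psi1 psi2_lipschitz). Qed.

Lemma continuous_psi1 : continuous psi1.
Proof. exact: (is_derive_continuous is_derive_psi1). Qed.

Lemma measurable_psi1 : measurable_fun [set: Borel R] (psi1 : Borel R -> Borel R).
Proof. by apply: continuous_measurable_fun; exact: continuous_psi1. Qed.

Lemma measurable_psi2 : measurable_fun [set: Borel R] (psi2 : Borel R -> Borel R).
Proof.
apply: continuous_measurable_fun => x; apply/cvgrPdist_le => e e0; near=> y.
rewrite distrC (le_trans (psi2_lipschitz _ _))// -ler_pdivlMl// distrC.
near: y; apply: cvgr_dist_le; first exact: cvg_id.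
by rewrite mulr_gt0// invr_gt0.
Unshelve. all: by end_near. Qed.

Lemma psi1_mono x y : x < y -> psi1 x < psi1 y.
Proof.
move=> xy; have [c [_]] := is_derive_mvt x y is_derive_psi1.
rewrite -[_ < _]subr_gt0 => ->.
by rewrite mulr_gt0 ?psi2_gt0 ?subr_gt0.
Qed.

Lemma psi1_lt1 t : `|psi1 t| < 1.
Proof.
have h1 : psi1 t < psi1 (t + 1) by apply: psi1_mono; rewrite ltrDl.
have h2 : psi1 (t - 1) < psi1 t by apply: psi1_mono; rewrite gtrDl oppr_lt0.
have := psi1_le1 (t + 1); have := psi1_le1 (t - 1); rewrite !ler_norml ltr_norml.
move=> /andP[h3 h4] /andP[h5 h6].
by rewrite (le_lt_trans h3 h2) (lt_le_trans h1 h6).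
Qed.

Lemma psi0 : psi mu 0 = 0.
Proof.
rewrite psiE /tmom (@expect_eq _ _ _ _ _ _ (fun=> 1)) ?expect_cst ?ln1//.
  exact: muI.
by move=> z _; rewrite mul0r expR0 mulr1.
Qed.

(** Strict convexity of psi: t psi'(h) - psi(t) is strictly concave in t with its critical point at
    h. The mean value theorem and strict monotonicity of psi' give the strict gap. *)
Lemma psi_conjugate_lt t h : t != h ->
  t * psi1 h - psi mu t < h * psi1 h - psi mu h.
Proof.
have cpsi : continuous (psi mu) := is_derive_continuous is_derive_psi.
have [th|ht|//] := ltgtP t h => _.
  have [|c] := @MVT R (psi mu) psi1 t h th (fun z _ => is_derive_psi z); first exact: continuous_subspaceT.
  rewrite in_itv/= => /andP[tc /psi1_mono ch]; move: (psi1 c) (psi1 h) (psi mu t) (psi mu h) ch => a b p q ab e.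
  have : 0 < (b - a) * (h - t) by rewrite mulr_gt0 ?subr_gt0.
  by move: e; rewrite mulrBl => <-; rewrite mulrBr; lra.
have [|c] := @MVT R (psi mu) psi1 h t ht (fun z _ => is_derive_psi z); first exact: continuous_subspaceT.
rewrite in_itv/= => /andP[/psi1_mono ch ct]; move: (psi1 c) (psi1 h) (psi mu t) (psi mu h) ch => a b p q ab e.
have : 0 < (a - b) * (t - h) by rewrite mulr_gt0 ?subr_gt0.
by move: e; rewrite mulrBl => <-; rewrite mulrBr; lra.
Qed.

Lemma psi_conjugate_le t h : t * psi1 h - psi mu t <= h * psi1 h - psi mu h.
Proof. by have [->//|/psi_conjugate_lt/ltW] := eqVneq t h. Qed.

(** If psi' stayed below z in the direction [e], integration would give psi(e t) <= z t for t >= 0.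
    But [e] is in the support, so [mu] has mass m > 0 beyond the midpoint (1 + z) / 2, and psi(e t)
    grows at least with that larger slope, up to the constant ln m. *)
Lemma psi1_approx_end (e z : R) : e = 1 \/ e = -1 -> z < 1 -> exists t, z < e * psi1 t.
Proof.
move=> he z1; apply: contrapT => hn.
have ee : e * e = 1 by case: he => ->; rewrite ?mulrNN mulr1.
have ub t : e * psi1 t <= z by rewrite leNgt; apply/negP => h; apply: hn; exists t.
pose V : set R := [set x | (1 + z) / 2 < e * x].
have oV : open V.
  rewrite (_ : V = (fun x => e * x) @^-1` [set y | (1 + z) / 2 < y])//.
  apply: open_comp => [x _|]; last exact: open_gt.
  by apply: continuousM; [exact: cvg_cst|exact: cvg_id].
have mV : measurable (V : set (Borel R)) by exact: open_measurable.
have V0 : (0 < mu V)%E.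
  have Ve : V e by rewrite /V/= ee; lra.
  by case: hmu => _ _ sN1 s1; case: he oV Ve => -> oV Ve; [exact: s1|exact: sN1].
set m := fine (mu (V `&` I)).
have m0 : 0 < m.
  rewrite fine_gt0//; apply/andP; split; last first.
    by rewrite (le_lt_trans (probability_le1 _ _)) ?ltry//; exact: measurableI.
  rewrite (lt_le_trans V0)// (@le_trans _ _ (mu ((V `&` I) `|` ~` I)))//.
    apply: le_measure; rewrite ?inE//; first by apply: measurableU; [exact: measurableI|exact: measurableC].
    by move=> x Vx; have [Ix|nIx] := pselect (I x); [left|right].
  rewrite (le_trans (measureU2 _ _ _))//; [exact: measurableI|exact: measurableC|].
  by rewrite [X in (_ + X <= _)%E]probability_setC// [X in (_ + (_ - X) <= _)%E]muI subee// adde0.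
have m1 : m <= 1.
  rewrite -lee_fin fineK ?probability_le1//; first exact: measurableI.
  rewrite ge0_fin_numE//.
  by rewrite (le_lt_trans (probability_le1 _ _)) ?ltry//; exact: measurableI.
have lb t : 0 <= t -> ln m + t * ((1 + z) / 2) <= psi mu (e * t).
  move=> t0; rewrite psiE -[X in _ + X]expRK -lnM ?posrE ?expR_gt0//.
  rewrite ler_ln ?posrE ?mulr_gt0 ?expR_gt0 ?(tmom1_gt0 muI)//.
  have mE : m = E (\1_V).
    rewrite /Rintegral (integral_indic mu mI mV)/=.
    by rewrite /m.
  have b1V : bounded_on I (\1_V : Borel R -> R).
    split; first exact: measurable_indic.
    by exists 1 => x _; rewrite indicE; case: (_ \in _); rewrite ?normr1 ?normr0.
  rewrite mE -(expectZr mI muI)//; apply: (expect_le mI muI).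
  - by apply: bndM => //; exact: bnd_cst.
  - exact: (bnd_tmom _ (bnd_cst _ 1)).
  move=> x _; rewrite mul1r indicE; have [xV|xV] := boolP (x \in V); last by rewrite mul0r expR_ge0.
  rewrite mul1r ler_expR mulrAC [e * x * t]mulrC ler_wpM2l// ltW//.
  exact: set_mem xV.
have ub' t : 0 <= t -> psi mu (e * t) <= z * t.
  move=> t0; have [c [_]] := is_derive_mvt 0 (e * t) is_derive_psi.
  rewrite psi0 !subr0 => ->; rewrite mulrA ler_wpM2r// mulrC; exact: ub.
have lnm0 : ln m <= 0 by exact: ln_le0.
(* Chosen so that t (1 - z) / 2 = 1 - ln m, which turns the two bounds into 1 <= 0. *)
set t := 2 * (1 - ln m) / (1 - z).
have t0 : 0 <= t by rewrite divr_ge0//; lra.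
have tE : t * (1 - z) = 2 * (1 - ln m) by rewrite divfK// gt_eqF// subr_gt0.
by have := le_trans (lb t t0) (ub' t t0); lra.
Qed.

Lemma psi1_surj z : `|z| < 1 -> exists t, psi1 t = z.
Proof.
rewrite ltr_norml => /andP[z1 z2].
have [t2] := psi1_approx_end (or_introl erefl) z2; rewrite mul1r => h2.
have [|t1] := @psi1_approx_end (-1) (- z) (or_intror erefl); first by rewrite ltrNl.
rewrite mulN1r ltrN2 => h1.
have t12 : t1 <= t2.
  by rewrite leNgt; apply/negP => /psi1_mono; rewrite ltNge (ltW (lt_trans h1 h2)).
have [||c _ <-] := @IVT R psi1 t1 t2 z t12; last by exists c.
  by apply: continuous_subspaceT; exact: continuous_psi1.
apply/andP; split.
  by rewrite ge_min; apply/orP; left; exact: ltW.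
by rewrite le_max; apply/orP; right; exact: ltW.
Qed.

End log_mgf.

Lemma tmomE (R : realType) (mu : probability (Borel R) R) k t :
  tmom mu k t = \int[mu]_(z in `[-1, 1]%classic) (k z * expR (t * z)).
Proof. by []. Qed.

#[local] Opaque tmom psi.

(** * Mean-field optimizers *)

Section mean_field.
Context (R : realType) (mu : probability (Borel R) R).
Hypothesis hmu : base_measure mu.
Implicit Types (t h z : R).
Local Notation psi1 := (psi1 mu).
Local Notation psi2 := (psi2 mu).

(** [phi] is a choice among preimages; strict monotonicity of psi' leaves only one. *)
Lemma phi_psi1 t : phi mu (psi1 t) = t.
Proof.
have /= := @xgetPex R 0 [set s | derive1 (psi mu) s = psi1 t].
rewrite -/(phi _ _) (derive1_psi hmu) => /(_ (ex_intro _ t erefl)) e.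
have [lt|gt|//] := ltgtP (phi mu (psi1 t)) t.
  by have := psi1_mono hmu lt; rewrite e ltxx.
by have := psi1_mono hmu gt; rewrite e ltxx.
Qed.

Lemma rate0_psi1 t : rate0 mu (psi1 t) = t * psi1 t - psi mu t.
Proof. by rewrite /rate0 phi_psi1 mulrC. Qed.

Lemma rate_psi1 t : rate mu (psi1 t) = (t * psi1 t - psi mu t)%:E.
Proof. by rewrite /rate (psi1_lt1 hmu) rate0_psi1. Qed.

Lemma rate0_ge z h : `|z| < 1 -> z * h - psi mu h <= rate0 mu z.
Proof.
move=> /(psi1_surj hmu)[t <-]; rewrite rate0_psi1 mulrC.
exact: psi_conjugate_le.
Qed.

(** The limit defining [rate] at an endpoint determines a value only along a proper filter. The
    witness moves from [e] inwards by a step below 2, so as to stay in the open interval. *)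
Lemma within_end_proper (e : R) : e = 1 \/ e = -1 ->
  ProperFilter (within `]-1, 1[ (nbhs e)).
Proof.
move=> he; apply: Build_ProperFilter_ex => P [r /= r0 hP].
have [s [s0 s1 sr]] : exists s : R, [/\ 0 < s, s < 2 & s < r].
  exists (Num.min 1 (r / 2)); split.
  - by rewrite lt_min ltr01 divr_gt0.
  - by rewrite gt_min ltr1n.
  - by rewrite gt_min ltr_pdivrMr// ltr_pMr// ltr1n orbT.
exists (e - s * e); apply: hP.
  by rewrite /ball/= opprB addrC subrK normrM; case: he => ->; rewrite ?normrN normr1 mulr1 gtr0_norm.
by rewrite /= in_itv/=; case: he => ->; apply/andP; split; lra.
Qed.

(** The limit is the Legendre transform at the endpoint. From below, [rate0] dominates every affine
    function x h - psi(h). From above, at x = psi'(t) it equals t psi'(t) - psi(t), which is at most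
    e t - psi(t) when e t >= 0. *)
Lemma rate_end (e : R) : e = 1 \/ e = -1 ->
  rate mu e = ereal_sup [set (e * h - psi mu h)%:E | h in [set: R]].
Proof.
move=> he; have ne : `|e| = 1 by case: he => ->; rewrite ?normrN normr1.
have ee : e * e = 1 by case: he => ->; rewrite ?mulrNN mulr1.
rewrite /rate ne ltxx; set S := ereal_sup _.
have PF := within_end_proper he.
apply/cvg_lim => //.
have ge h : ((e * h - psi mu h)%:E <= S)%E by apply: ereal_sup_ubound; exists h.
have L a h : a < e * h - psi mu h -> \forall x \near within `]-1, 1[ (nbhs e), a < rate0 mu x.
  move=> ah; have : \forall x \near e, a < x * h - psi mu h.
    have c : {for e, continuous (fun x : R => x * h - psi mu h)}.
      by apply: continuousB; [apply: continuousM; [exact: cvg_id|exact: cvg_cst]|exact: cvg_cst].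
    exact: (c _ (open_nbhs_nbhs (conj (@open_gt R a) ah))).
  move=> nx; rewrite near_withinE; near=> x => xI.
  apply: (@lt_le_trans _ _ (x * h - psi mu h)); first by near: x.
  by apply: rate0_ge; move: xI; rewrite /= in_itv/= ltr_norml.
(* Close to [e] the value exceeds psi'(0) in the direction [e], so its preimage t has the sign of
   [e]. *)
have Up : \forall x \near within `]-1, 1[ (nbhs e), ((rate0 mu x)%:E <= S)%E.
  have : \forall x \near e, e * psi1 0 < e * x.
    have c : {for e, continuous (fun x : R => e * x)}.
      by apply: continuousM; [exact: cvg_cst|exact: cvg_id].
    apply: (c _ (open_nbhs_nbhs (conj (@open_gt R (e * psi1 0)) _))) => /=.
    rewrite ee (le_lt_trans (ler_norm _))// normrM ne mul1r.
    exact: psi1_lt1.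
  move=> nx; rewrite near_withinE; near=> x => xI.
  have [t xt] : exists t, psi1 t = x.
    by apply: (psi1_surj hmu); move: xI; rewrite /= in_itv/= ltr_norml.
  rewrite -xt rate0_psi1 (le_trans _ (ge t))// lee_fin lerB// mulrC.
  have et : 0 <= e * t.
    have : e * psi1 0 < e * psi1 t by rewrite xt; near: x.
    case: he => ->; [rewrite !mul1r|rewrite !mulN1r ltrN2].
      by move=> lt; rewrite leNgt; apply/negP => /(psi1_mono hmu); rewrite ltNge (ltW lt).
    move=> lt; rewrite oppr_ge0 leNgt; apply/negP => /(psi1_mono hmu).
    by rewrite ltNge (ltW lt).
  have : `|psi1 t| < 1 by exact: psi1_lt1.
  move: (psi1 t) => p; rewrite ltr_norml => /andP[p1 p2].
  by case: he et => -> et; nra.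
have S0 : (0%:E <= S)%E by have := ge 0; rewrite mulr0 psi0// subrr.
(* The supremum may be finite or infinite; minus infinity is ruled out by the slope 0. *)
case SE : S S0 ge Up => [s| |] //= _ ge Up.
  apply: cvg_EFin; first by near=> x.
  apply/cvgrPdist_le => d d0.
  have [_ [h _ <-]] : exists2 y, [set (e * h - psi mu h)%:E | h in [set: R]] y & ((s - d)%:E < y)%E.
    by apply: ereal_sup_gt; rewrite -/S SE lte_fin gtrBl.
  move=> ah; have hL := L (s - d) h ltac:(by rewrite -lte_fin); near=> x.
  have h1 : rate0 mu x <= s by rewrite -lee_fin; near: x.
  have h2 : s - d < rate0 mu x by near: x.
  by move: h1 h2 => /=; move: (rate0 mu x) => r h1 h2; rewrite ler_norml; lra.
apply/cvgeyPgt => a.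
have [_ [h _ <-]] : exists2 y, [set (e * h - psi mu h)%:E | h in [set: R]] y & (a%:E < y)%E.
  by apply: ereal_sup_gt; rewrite -/S SE ltry.
move=> ah'; have ah : a < e * h - psi mu h by rewrite -lte_fin.
have := L a h ah; apply: filterS => x ax.
by rewrite lte_fin.
Unshelve. all: by end_near. Qed.

Lemma rate_ge z h : `|z| <= 1 -> ((z * h - psi mu h)%:E <= rate mu z)%E.
Proof.
rewrite le_eqVlt => /predU1P[z1|z1]; last first.
  by rewrite /rate z1 lee_fin; exact: rate0_ge.
rewrite rate_end; last first.
  by move/eqP : z1; rewrite eqr_norml ler01 andbT => /orP[] /eqP; [left|right].
by apply: ereal_sup_ubound; exists h.
Qed.

(** Inside the interval this is strictness in the Fenchel inequality. At an endpoint z, the slope h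
    + z already beats h: psi increases by psi'(c) z < 1, while the linear term gains z^2 = 1. *)
Lemma rate_gt z h : `|z| <= 1 -> z != psi1 h -> ((z * h - psi mu h)%:E < rate mu z)%E.
Proof.
rewrite le_eqVlt => /predU1P[z1|z1] zh; last first.
  have [t zt] := psi1_surj hmu z1; rewrite -zt rate_psi1 lte_fin [psi1 t * h]mulrC.
  apply: (psi_conjugate_lt hmu); apply: contra zh => /eqP ->.
  by rewrite zt.
rewrite (lt_le_trans _ (@rate_ge z (h + z) _)) ?z1// lte_fin.
have zz : z * z = 1 by rewrite -expr2 -[_ ^+ 2]ger0_norm ?sqr_ge0// normrX z1 expr1n.
have [c [_]] := is_derive_mvt h (h + z) (is_derive_psi hmu).
have : `|psi1 c * z| < 1 by rewrite normrM z1 mulr1; exact: psi1_lt1.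
rewrite [h + z]addrC addrK addrC; move: (psi1 c * z) (psi mu h) (psi mu (h + z)) => p a b.
by rewrite ltr_norml => /andP[p1 p2] e; rewrite mulrDr zz; lra.
Qed.

Variables (n : nat) (A : 'M[R]_n) (b u : n.-tuple (Borel R)).
Hypotheses (hA : coupling_matrix A).

Definition local_field (s : n.-tuple (Borel R)) (i : 'I_n) : R :=
  locked_with lock_key (\sum_j A i j * tnth s j).

Lemma local_fieldE (s : n.-tuple (Borel R)) i : local_field s i = \sum_j A i j * tnth s j.
Proof. by rewrite /local_field unlock. Qed.

(** As the diagonal vanishes, the energy is affine in each coordinate, with slope the total field on
    that spin. Hence the law of one spin given the others is an exponential tilt of [mu]. *)
Lemma energy_upd (s : n.-tuple (Borel R)) i (z : R) :
  energy A b (upd s i z)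
  = energy A b s + (z - tnth s i) * (local_field s i + tnth b i).
Proof.
have [At A0] := hA.
have Aij j k : A j k = A k j by rewrite -[in LHS]At mxE.
have lfE k : \sum_j A k j * tnth (upd s i z) j = local_field s k + A k i * (z - tnth s i).
  rewrite local_fieldE (bigD1 i)//= [in RHS](bigD1 i)//= tnth_upd eqxx.
  rewrite (eq_bigr (fun j => A k j * tnth s j)); last by move=> j ji; rewrite tnth_upd (negbTE ji).
  ring.
have sE : \sum_k \sum_j tnth (upd s i z) k * A k j * tnth (upd s i z) j
    = \sum_k tnth (upd s i z) k * (local_field s k + A k i * (z - tnth s i)).
  by apply: eq_bigr => k _; rewrite -lfE mulr_sumr; apply: eq_bigr => j _; rewrite mulrA.
have sE' : \sum_k \sum_j tnth s k * A k j * tnth s j = \sum_k tnth s k * local_field s k.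
  by apply: eq_bigr => k _; rewrite local_fieldE mulr_sumr; apply: eq_bigr => j _; rewrite mulrA.
rewrite /energy sE sE'.
have e1 : \sum_k tnth (upd s i z) k * (local_field s k + A k i * (z - tnth s i)) =
    \sum_k tnth s k * local_field s k + (z - tnth s i) * local_field s i + (z - tnth s i) * local_field s i.
  rewrite (bigD1 i)//= [in RHS](bigD1 i)//= tnth_upd eqxx A0 mul0r addr0.
  rewrite (eq_bigr (fun k => tnth s k * local_field s k + (z - tnth s i) * (A i k * tnth s k))); last first.
    by move=> k ki; rewrite tnth_upd (negbTE ki) [A i k]Aij; ring.
  rewrite big_split/= -mulr_sumr.
  rewrite [X in _ + (_ + _ * X)](_ : _ = local_field s i); last first.
    by rewrite local_fieldE [RHS](bigD1 i)//= A0 mul0r add0r.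
  ring.
have e2 : \sum_k tnth b k * tnth (upd s i z) k = \sum_k tnth b k * tnth s k + tnth b i * (z - tnth s i).
  rewrite (bigD1 i)//= [in RHS](bigD1 i)//= tnth_upd eqxx.
  rewrite (eq_bigr (fun k => tnth b k * tnth s k)); last by move=> k ki; rewrite tnth_upd (negbTE ki).
  ring.
by rewrite e1 e2; field.
Qed.

(** Otherwise replacing the single coordinate u_i by psi'(h) would strictly increase the objective,
    by strictness in the Fenchel inequality. This competitor argument covers coordinates on the
    boundary, where the rate has no derivative. *)
Lemma mf_optimizer_fixpoint : mf_optimizer mu A b u ->
  forall i, tnth u i = psi1 (local_field u i + tnth b i).
Proof.
move=> [cu hu] i; set h := local_field u i + tnth b i; apply/eqP; apply/negPn/negP => ne.
have u1 j : `|tnth u j| <= 1 by rewrite ler_norml; exact: cu.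
have r0 (s : n.-tuple (Borel R)) j : cube s -> (0 <= rate mu (tnth s j))%E.
  move=> cs; have := @rate_ge (tnth s j) 0; rewrite mulr0 psi0// subrr; apply.
  by rewrite ler_norml; exact: cs.
(* An infinite rate would make the objective minus infinity, which the constant vector psi'(0)
   beats. *)
have rfin : (\sum_j rate mu (tnth u j) < +oo)%E.
  rewrite ltey; apply/eqP => e.
  have := hu [tuple psi1 0 | _ < n]; rewrite /mf_objective e addeNy.
  have : cube [tuple psi1 0 | _ < n] :> Prop.
    by move=> j; rewrite tnth_mktuple -ler_norml; exact: psi1_le1.
  move=> /[swap] /[apply].
  under eq_bigr do rewrite tnth_mktuple rate_psi1.
  by rewrite sumEFin.
pose r j := fine (rate mu (tnth u j)).
have rE j : rate mu (tnth u j) = (r j)%:E.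
  rewrite fineK// ge0_fin_numE ?r0//.
  rewrite (le_lt_trans _ rfin)// (bigD1 j)//= leeDl// sume_ge0// => k _; exact: r0.
have cu' : cube (upd u i (psi1 h)).
  by move=> j; rewrite tnth_upd; case: ifP => // _; rewrite -ler_norml; exact: psi1_le1.
have := hu _ cu'; rewrite /mf_objective energy_upd -/h.
rewrite [X in (_ - X <= _)%E](bigD1 i)//= tnth_upd eqxx rate_psi1.
rewrite [X in (_ <= _ - X)%E](bigD1 i)//= rE.
rewrite (eq_bigr (fun j => (r j)%:E)); last by move=> j ji; rewrite tnth_upd (negbTE ji) rE.
rewrite [X in (_ <= _ - (_ + X))%E](eq_bigr (fun j => (r j)%:E)); last by move=> j ji; rewrite rE.
rewrite !sumEFin -!EFinD lee_fin; apply/negP; rewrite -ltNge.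
have := rate_gt (u1 i) ne; rewrite rE lte_fin.
move: (r i) (psi mu h) (\sum_(_ | _) _) (energy A b u) (psi1 h) (tnth u i) => a1 a2 a3 a4 a5 a6.
nra.
Qed.

End mean_field.

(** * Cauchy-Schwarz and contraction of symmetric kernels *)

Section finite_sums.
Context (R : realType) (n : nat).
Implicit Types (a x y : 'I_n -> R).

(** Cauchy-Schwarz with weights [a], by induction on the list so that no division by the total
    weight occurs. *)
Lemma sum_sqr_le (r : seq 'I_n) (P : pred 'I_n) a x : (forall i, 0 <= a i) ->
  (\sum_(i <- r | P i) a i * x i) ^+ 2
  <= (\sum_(i <- r | P i) a i) * \sum_(i <- r | P i) a i * x i ^+ 2.
Proof.
move=> a0; elim: r => [|i r IH]; first by rewrite !big_nil expr0n mul0r.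
rewrite !big_cons; case: (P i) => //.
set s := \sum_(j <- r | P j) a j * x j in IH *.
set t := \sum_(j <- r | P j) a j in IH *.
set v := \sum_(j <- r | P j) a j * x j ^+ 2 in IH *.
have t0 : 0 <= t by exact: sumr_ge0.
have v0 : 0 <= v by apply: sumr_ge0 => j _; rewrite mulr_ge0 ?sqr_ge0.
have ai := a0 i; move: (a i) (x i) ai => p z p0.
(* Nonnegativity of the quadratic t z^2 - 2 s z + v, whose discriminant condition is the induction
   hypothesis; for t = 0 it forces s = 0. *)
have h : 2 * z * s <= t * z ^+ 2 + v.
  have [t00|tn0] := eqVneq t 0.
    move: IH; rewrite t00 mul0r => s2; have /eqP : s ^+ 2 == 0 by rewrite eq_le s2 sqr_ge0.
    by move/eqP; rewrite sqrf_eq0 => /eqP ->; rewrite mulr0 mul0r add0r.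
  have tp : 0 < t by rewrite lt_neqAle eq_sym tn0.
  have : 0 <= t * (t * z ^+ 2 + v - 2 * z * s).
    rewrite (_ : t * _ = (t * z - s) ^+ 2 + (t * v - s ^+ 2)); last by ring.
    by rewrite addr_ge0 ?sqr_ge0 ?subr_ge0.
  by rewrite pmulr_rge0// subr_ge0.
have : p * (2 * z * s) <= p * (t * z ^+ 2 + v) by rewrite ler_wpM2l.
by move: IH; rewrite !expr2; nra.
Qed.

Lemma sum_sqr_le1 x : (\sum_i x i) ^+ 2 <= n%:R * \sum_i x i ^+ 2.
Proof.
have := @sum_sqr_le (index_enum _) predT (fun=> 1) x (fun=> ler01).
rewrite sumr_const card_ord.
by under eq_bigr do rewrite mul1r; under [X in _ <= _ * X -> _]eq_bigr do rewrite mul1r.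
Qed.

(** The weighted inequality with weights x^2 and values y / x. Where x vanishes the quotient is 0 by
    convention and the term drops out. *)
Lemma cauchy_schwarz_sum x y :
  (\sum_i x i * y i) ^+ 2 <= (\sum_i x i ^+ 2) * \sum_i y i ^+ 2.
Proof.
pose z i := y i / x i.
have h : \sum_i (x i ^+ 2 * z i ^+ 2) <= \sum_i y i ^+ 2.
  apply: ler_sum => i _; have [xi0|xi0] := eqVneq (x i) 0.
    by rewrite xi0 expr0n mul0r sqr_ge0.
  by rewrite -exprMn /z mulrC divfK.
have e : \sum_i x i * y i = \sum_i (x i ^+ 2 * z i).
  apply: eq_bigr => i _; have [xi0|xi0] := eqVneq (x i) 0.
    by rewrite xi0 expr0n !mul0r.
  by rewrite /z expr2 -mulrA [x i * (y i / x i)]mulrC divfK.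
rewrite e (le_trans (sum_sqr_le _ _ _ (fun i => sqr_ge0 (x i))))//.
by rewrite ler_wpM2l// sumr_ge0// => i _; exact: sqr_ge0.
Qed.

Section contraction.
Context (B : 'I_n -> 'I_n -> R) (rho : R).
Hypotheses (B0 : forall i j, 0 <= B i j) (Bs : forall i j, B i j = B j i).
Hypotheses (rho0 : 0 <= rho) (Brho : forall i, \sum_j B i j <= rho).

Lemma sum_contraction x : (forall j, 0 <= x j) ->
  \sum_i \sum_j B i j * x j <= rho * \sum_j x j.
Proof using B0 Bs Brho.
move=> x0; rewrite exchange_big/= mulr_sumr; apply: ler_sum => j _.
rewrite -mulr_suml ler_wpM2r// (eq_bigr (B j))// => i _; exact: Bs.
Qed.

(** Schur test: Jensen along each row, then symmetry turns row sums into column sums. *)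
Lemma l2_contraction x :
  \sum_i (\sum_j B i j * x j) ^+ 2 <= rho ^+ 2 * \sum_j x j ^+ 2.
Proof.
apply: (@le_trans _ _ (\sum_i rho * \sum_j B i j * x j ^+ 2)).
  apply: ler_sum => i _; rewrite (le_trans (sum_sqr_le _ _ _ (B0 i)))//.
  by rewrite ler_wpM2r// sumr_ge0// => j _; rewrite mulr_ge0 ?sqr_ge0.
rewrite -mulr_sumr expr2 -mulrA ler_wpM2l// sum_contraction// => j; exact: sqr_ge0.
Qed.

(** The same test for fourth powers, Jensen being used for two successive squarings. *)
Lemma l4_contraction x :
  \sum_i (\sum_j B i j * x j) ^+ 4 <= rho ^+ 4 * \sum_j x j ^+ 4.
Proof.
apply: (@le_trans _ _ (\sum_i rho ^+ 3 * \sum_j B i j * x j ^+ 4)).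
  apply: ler_sum => i _; rewrite (_ : 4%N = (2 * 2)%N)// exprM.
  have s0 : 0 <= \sum_j B i j by exact: sumr_ge0.
  have h1 := sum_sqr_le (index_enum 'I_n) predT x (B0 i).
  have h2 := sum_sqr_le (index_enum 'I_n) predT (fun j => x j ^+ 2) (B0 i).
  apply: (@le_trans _ _ ((rho * \sum_j B i j * x j ^+ 2) ^+ 2)).
    rewrite lerXn2r ?nnegrE ?sqr_ge0// ?mulr_ge0// ?sumr_ge0//; last first.
      rewrite (le_trans h1)// ler_wpM2r// sumr_ge0// => j _; by rewrite mulr_ge0 ?sqr_ge0.
    by move=> j _; rewrite mulr_ge0 ?sqr_ge0.
  rewrite exprMn (_ : rho ^+ 3 = rho ^+ 2 * rho); last by rewrite -exprSr.
  rewrite -mulrA ler_wpM2l ?sqr_ge0// (le_trans h2)//.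
  under [X in _ * X <= _]eq_bigr do rewrite -exprM.
  rewrite ler_wpM2r// sumr_ge0// => j _; by rewrite mulr_ge0// exprn_even_ge0.
rewrite -mulr_sumr [rho ^+ 4]exprSr -mulrA ler_wpM2l ?exprn_ge0//.
by apply: sum_contraction => j; rewrite exprn_even_ge0.
Qed.

End contraction.
End finite_sums.

Local Notation I11 R := (`[-1, 1]%classic : set (Borel R)).

(** The variance is at most the second moment about k(m), with m the tilted mean, and this is at
    most L^2 times the tilted variance of z. *)
Lemma tilt_var_le (R : realType) (mu : probability (Borel R) R) (k : R -> R) t L :
  mu `[-1, 1]%classic = 1%E -> 0 <= L -> bounded_on (I11 R) k ->
  (forall z z', `|z| <= 1 -> `|z'| <= 1 -> `|k z - k z'| <= L * `|z - z'|) ->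
  tilt mu t (fun z => k z ^+ 2) - tilt mu t k ^+ 2 <= L ^+ 2.
Proof.
move=> muI L0 bk kL; set m := tilt mu t id.
have bid := bnd_id R.
have m1 : `|m| <= 1.
  by apply: (tilt_norm_le muI); [exact: bid|move=> z /itvN11P].
have b1 : bounded_on (I11 R) (fun z : Borel R => k z ^+ 2) by exact: bndX.
have b2 : bounded_on (I11 R) (fun z : Borel R => 2 * k m * k z) by apply: bndM => //; exact: bnd_cst.
have e1 : tilt mu t (fun z => (k z - k m) ^+ 2) = tilt mu t (fun z => k z ^+ 2) - 2 * k m * tilt mu t k + k m ^+ 2.
  rewrite (@eq_tilt _ _ _ _ (fun z => k z ^+ 2 - 2 * k m * k z + k m ^+ 2)); last by move=> z _; ring.
  rewrite (tiltD muI)//; [|exact: bndB|exact: bnd_cst].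
  by rewrite (tiltB muI)// (tiltZ muI _ _ bk) (tilt_cst muI).
have bm : bounded_on (I11 R) (fun z : Borel R => (z - m) ^+ 2).
  by apply: bndX; apply: bndB; [exact: bid|exact: bnd_cst].
have h : tilt mu t (fun z => (k z - k m) ^+ 2) <= L ^+ 2 * tilt mu t (fun z => (z - m) ^+ 2).
  rewrite -(tiltZ muI)//; apply: (tilt_le muI).
  - by apply: bndX; apply: bndB => //; exact: bnd_cst.
  - by apply: bndM => //; exact: bnd_cst.
  move=> z /itvN11P z1; rewrite -exprMn -[leLHS]ger0_norm ?sqr_ge0// -[leRHS]ger0_norm ?sqr_ge0//.
  by rewrite !normrX lerXn2r ?nnegrE// normrM (ger0_norm L0) kL.
have e2 : tilt mu t (fun z => (z - m) ^+ 2) <= 1.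
  rewrite (@eq_tilt _ _ _ _ (fun z => z ^+ 2 - 2 * m * z + m ^+ 2)); last by move=> z _; ring.
  have bb : bounded_on (I11 R) (fun z : Borel R => 2 * m * z) by apply: bndM => //; exact: bnd_cst.
  have bb2 : bounded_on (I11 R) (fun z : Borel R => z ^+ 2) by exact: bndX.
  rewrite (tiltD muI)//; [|exact: bndB|exact: bnd_cst].
  rewrite (tiltB muI)// (tiltZ muI _ _ bid) (tilt_cst muI) -/m.
  have : tilt mu t (fun z => z ^+ 2) <= 1.
    rewrite -(tilt_cst muI t 1); apply: (tilt_le muI) => //; first exact: bnd_cst.
    by move=> z /itvN11P z1; rewrite -[_ ^+ 2]ger0_norm ?sqr_ge0// normrX exprn_ile1.
  by have := sqr_ge0 m; lra.
have : L ^+ 2 * tilt mu t (fun z => (z - m) ^+ 2) <= L ^+ 2 by rewrite ler_piMr ?sqr_ge0.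
have := sqr_ge0 (tilt mu t k - k m).
by move: h; rewrite e1 sqrrB mulr2n; lra.
Qed.

Lemma measurable_invr (R : realType) : measurable_fun [set: R] (@GRing.inv R).
Proof.
rewrite (_ : setT = [set 0] `|` ~` [set 0]); last by rewrite setUv.
apply/measurable_funU => //; first exact: measurableC.
split; first by apply: measurable_fun_set1.
apply: open_continuous_measurable_fun; first by exact/closed_openC/accessible_closed_set1/hausdorff_accessible/order_hausdorff.
move=> x /set_mem /= /eqP x0; exact: inv_continuous.
Qed.

(** * Gibbs expectations *)

Section gibbs_expectation.
Context (R : realType) (mu : probability (Borel R) R).
Hypothesis muI : mu `[-1, 1]%classic = 1%E.
Context (n : nat) (A : 'M[R]_n) (b : n.-tuple (Borel R)).
Hypothesis hA : coupling_matrix A.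
Implicit Types (s : n.-tuple (Borel R)) (F H : n.-tuple (Borel R) -> R) (i j : 'I_n).
Local Notation D := (@box _ (Borel R) (I11 R) n).
Local Notation E f := (\int[prob_pow mu n]_(s in D) f s).

Let mI : measurable (I11 R). Proof. exact: measurable_itv. Qed.
Let mD : measurable D. Proof. exact: measurable_box. Qed.
Let PD : prob_pow mu n D = 1%E. Proof. exact: prob_pow_box. Qed.

Lemma boxP s : D s <-> forall i, `|tnth s i| <= 1.
Proof. by split=> h i; have := h i; rewrite itvN11P. Qed.

Lemma bnd_coord i : bounded_on D (fun s => tnth s i : R).
Proof.
split; first exact: measurable_tnth.
by exists 1 => s /boxP.
Qed.

Lemma bnd_lin (w : 'I_n -> R) : bounded_on D (fun s => \sum_i w i * tnth s i).
Proof. by apply: bnd_sum => i _; apply: bndM; [exact: bnd_cst|exact: bnd_coord]. Qed.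

Lemma bnd_local_field i : bounded_on D (fun s => local_field A s i).
Proof.
have -> : (fun s => local_field A s i) = (fun s => \sum_j A i j * tnth s j).
  by apply/funext => s; rewrite local_fieldE.
exact: bnd_lin.
Qed.

Lemma bnd_energy : bounded_on D (energy A b).
Proof.
rewrite /energy; apply: bndD; last exact: bnd_lin.
apply: bndM; first exact: bnd_cst.
apply: bnd_sum => i _; apply: bnd_sum => j _.
by apply: bndM; [apply: bndM; [exact: bnd_coord|exact: bnd_cst]|exact: bnd_coord].
Qed.

Definition weight s := expR (energy A b s).

Lemma bnd_weight : bounded_on D weight.
Proof. by apply: bnd_expR; exact: bnd_energy. Qed.

Lemma partition_functionE : partition_function mu A b = E weight.
Proof.
rewrite /partition_function (Rintegral_full mD PD)//.
by case: bnd_weight.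
Qed.

Lemma partition_function_gt0 : 0 < E weight.
Proof. by apply: (expect_gt0 mD PD bnd_weight) => s _; exact: expR_gt0. Qed.

Definition gexp F : R := locked_with lock_key (E (fun s => F s * weight s) / E weight).

Lemma gexpE F : gexp F = E (fun s => F s * weight s) / E weight.
Proof. by rewrite /gexp unlock. Qed.

Let Z0 : E weight != 0. Proof. by rewrite gt_eqF// partition_function_gt0. Qed.

Lemma bndW F : bounded_on D F -> bounded_on D (fun s => F s * weight s).
Proof. by move=> bF; apply: bndM => //; exact: bnd_weight. Qed.

Lemma eq_gexp F H : (forall s, D s -> F s = H s) -> gexp F = gexp H.
Proof. by move=> h; rewrite !gexpE; congr (_ / _); apply: expect_eq => s Ds; rewrite h. Qed.

Lemma gexp_cst r : gexp (fun=> r) = r.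
Proof. by rewrite gexpE (expectZl mD PD) ?mulfK//; exact: bnd_weight. Qed.

Lemma gexpD F H : bounded_on D F -> bounded_on D H ->
  gexp (fun s => F s + H s) = gexp F + gexp H.
Proof.
move=> bF bH; rewrite !gexpE -mulrDl -(expectD mD PD); [|exact: bndW..].
by congr (_ / _); apply: expect_eq => s _; rewrite mulrDl.
Qed.

Lemma gexpZ r F : bounded_on D F -> gexp (fun s => r * F s) = r * gexp F.
Proof.
move=> bF; rewrite !gexpE mulrA -(expectZl mD PD); last exact: bndW.
by congr (_ / _); apply: expect_eq => s _; rewrite mulrA.
Qed.

Lemma gexpN F : bounded_on D F -> gexp (fun s => - F s) = - gexp F.
Proof.
move=> bF; rewrite -mulN1r -gexpZ//.
by apply: eq_gexp => s _; rewrite mulN1r.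
Qed.

Lemma gexpB F H : bounded_on D F -> bounded_on D H ->
  gexp (fun s => F s - H s) = gexp F - gexp H.
Proof. by move=> bF bH; rewrite gexpD ?gexpN//; exact: bndN. Qed.

Lemma gexp_sum (I : Type) (r : seq I) (P : pred I) (F : I -> n.-tuple (Borel R) -> R) :
  (forall i : I, P i -> bounded_on D (F i)) ->
  gexp (fun s => \sum_(i <- r | P i) F i s) = \sum_(i <- r | P i) gexp (F i).
Proof.
move=> h; elim: r => [|i r IH].
  rewrite big_nil -[RHS](gexp_cst 0).
  by apply: eq_gexp => s _; rewrite big_nil.
rewrite big_cons (@eq_gexp _ (fun s => if P i then F i s + \sum_(j <- r | P j) F j s
   else \sum_(j <- r | P j) F j s)); last by move=> s _; rewrite big_cons.
have [Pi|Pi] := boolP (P i); last exact: IH.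
rewrite gexpD ?IH//; first exact: h.
exact: bnd_sum.
Qed.

Lemma gexp_le F H : bounded_on D F -> bounded_on D H ->
  (forall s, D s -> F s <= H s) -> gexp F <= gexp H.
Proof.
move=> bF bH h; rewrite !gexpE ler_pM2r ?invr_gt0 ?partition_function_gt0//.
apply: (expect_le mD PD); [exact: bndW..|move=> s Ds].
by rewrite ler_wpM2r ?expR_ge0// h.
Qed.

Lemma gexp_ge0 F : bounded_on D F -> (forall s, D s -> 0 <= F s) -> 0 <= gexp F.
Proof. by move=> bF h; rewrite -(gexp_cst 0); apply: gexp_le => //; exact: bnd_cst. Qed.

Lemma gexp_norm F : bounded_on D F -> `|gexp F| <= gexp (fun s => `|F s|).
Proof.
move=> bF; have bnF := bnd_norm bF; rewrite ler_norml -gexpN//.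
apply/andP; split; apply: gexp_le => //; first exact: bndN.
- by move=> s _; rewrite lerNl -normrN ler_norm.
- by move=> s _; exact: ler_norm.
Qed.

Lemma gexp_norm_le F M : bounded_on D F -> (forall s, D s -> `|F s| <= M) ->
  `|gexp F| <= M.
Proof.
move=> bF h; rewrite (le_trans (gexp_norm bF))// -[leRHS]gexp_cst.
by apply: gexp_le => //; [exact: bnd_norm|exact: bnd_cst].
Qed.

Definition gvar F : R := gexp (fun s => F s ^+ 2) - gexp F ^+ 2.

Lemma gvarE F m : bounded_on D F ->
  gexp (fun s => (F s - m) ^+ 2) = gvar F + (gexp F - m) ^+ 2.
Proof.
move=> bF; rewrite (@eq_gexp _ (fun s => F s ^+ 2 - 2 * m * F s + m ^+ 2)); last by move=> s _; ring.
have b1 : bounded_on D (fun s => F s ^+ 2) by exact: bndX.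
have b2 : bounded_on D (fun s => 2 * m * F s) by apply: bndM => //; exact: bnd_cst.
rewrite gexpD; [|exact: bndB|exact: bnd_cst].
by rewrite gexpB// gexpZ// gexp_cst /gvar; ring.
Qed.

Lemma gvar_ge0 F : bounded_on D F -> 0 <= gvar F.
Proof.
move=> bF; have := gvarE (gexp F) bF; rewrite subrr expr0n addr0 => <-.
apply: gexp_ge0 => [|s _]; last exact: sqr_ge0.
by apply: bndX; apply: bndB => //; exact: bnd_cst.
Qed.

Lemma gexp_sqr_le F : bounded_on D F -> gexp F ^+ 2 <= gexp (fun s => F s ^+ 2).
Proof. by move=> /gvar_ge0; rewrite subr_ge0. Qed.

(** Conditional expectation under the Gibbs law given the spins other than [j], the conditional law
    being a tilt of [mu]. *)
Definition cexp j F s : R :=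
  tilt mu (local_field A s j + tnth b j) (fun z => F (upd s j z)).

Lemma local_field_upd s j z : local_field A (upd s j z) j = local_field A s j.
Proof.
have [_ A0] := hA.
rewrite !local_fieldE; apply: eq_bigr => k _; rewrite tnth_upd.
by case: eqP => [->|//]; rewrite A0 !mul0r.
Qed.

Lemma cexp_upd j F s z : cexp j F (upd s j z) = cexp j F s.
Proof.
rewrite /cexp local_field_upd; apply: eq_tilt => w _.
by rewrite upd_upd.
Qed.

Lemma bnd_upd_I j F s : D s -> bounded_on D F -> bounded_on (I11 R) (fun z => F (upd s j z)).
Proof. by move=> Ds bF; exact: bnd_updr. Qed.

Let bnd_cexp_num j F : bounded_on D F ->
  measurable_fun setT (fun s => tmom mu (fun z => F (upd s j z)) (local_field A s j + tnth b j)).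
Proof.
move=> [mF _].
have := @measurable_Rintegral_param _ _ _ _ _ mu _ (fun x : n.-tuple (Borel R) * Borel R =>
  F (upd x.1 j x.2) * expR ((local_field A x.1 j + tnth b j) * x.2)) mI.
apply; apply: measurable_funM; first exact: (measurableT_comp mF (measurable_upd j)).
apply: measurableT_comp => //; apply: measurable_funM; last exact: measurable_snd.
apply: measurable_funD; last exact: measurable_cst.
have [ml _] := bnd_local_field j.
exact: (measurableT_comp ml measurable_fst).
Qed.

Lemma bnd_cexp j F : bounded_on D F -> bounded_on D (cexp j F).
Proof.
move=> bF; split; last first.
  have [_ [M FM]] := bF; exists M => s Ds; apply: (tilt_norm_le muI).
    exact: bnd_upd_I.
  by move=> z Iz; apply: FM; exact: box_upd.
have m1 := bnd_cexp_num j bF.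
have m2 := bnd_cexp_num j (bnd_cst D 1).
rewrite (_ : cexp j F = fun s => tmom mu (fun z => F (upd s j z)) (local_field A s j + tnth b j)
  * (tmom mu (fun=> 1) (local_field A s j + tnth b j))^-1); last first.
  by apply/funext => s; rewrite /cexp tiltE.
apply: measurable_funM => //.
exact: (measurableT_comp (@measurable_invr R) m2).
Qed.

Lemma cexpM j F H s : (forall s z, H (upd s j z) = H s) -> D s -> bounded_on D F ->
  cexp j (fun s => F s * H s) s = cexp j F s * H s.
Proof.
move=> hH Ds bF; rewrite mulrC -(tiltZ muI); last exact: bnd_upd_I.
by apply: eq_tilt => z _; rewrite hH mulrC.
Qed.

(** Tower property. Both sides are resampled at [j] under the product measure; the remaining
    one-dimensional integrals agree because dividing by the tilted mass and integrating against it
    cancel. *)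
Lemma gexp_cexp j F : bounded_on D F -> gexp F = gexp (cexp j F).
Proof.
move=> bF; rewrite !gexpE; congr (_ / _).
have bc := bnd_cexp j bF.
rewrite (expect_resample mI muI j (bndW bF)) (expect_resample mI muI j (bndW bc)).
apply: expect_eq => s Ds.
set t := local_field A s j + tnth b j.
(* The weight splits into a factor free of coordinate [j] and the tilting factor. *)
have wE z : weight (upd s j z) = expR (energy A b s - tnth s j * t) * expR (t * z).
  rewrite /weight energy_upd// -/t -expRD; congr expR; ring.
have e1 : \int[mu]_(z in I11 R) (F (upd s j z) * weight (upd s j z))
    = expR (energy A b s - tnth s j * t) * tmom mu (fun z => F (upd s j z)) t.
  rewrite tmomE -(expectZl mI muI); last by apply: bnd_tmom; exact: bnd_upd_I.
  by apply: expect_eq => z _; rewrite wE; ring.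
have e2 : \int[mu]_(z in I11 R) (cexp j F (upd s j z) * weight (upd s j z))
    = expR (energy A b s - tnth s j * t) * (cexp j F s * tmom mu (fun=> 1) t).
  have b1 := bnd_tmom t (bnd_cst (I11 R) (1 : R)).
  have b2 := bndM (bnd_cst (I11 R) (cexp j F s)) b1.
  rewrite (tmomE mu (fun=> 1) t) -(expectZl mI muI _ b1) -(expectZl mI muI _ b2).
  by apply: expect_eq => z _; rewrite wE cexp_upd; ring.
rewrite e1 e2; congr (_ * _).
by rewrite /cexp tiltE -/t divfK// gt_eqF// tmom1_gt0.
Qed.

Lemma gexp_pull j F H : (forall s z, H (upd s j z) = H s) -> bounded_on D F -> bounded_on D H ->
  gexp (fun s => F s * H s) = gexp (fun s => cexp j F s * H s).
Proof.
move=> hH bF bH; rewrite (gexp_cexp j) ?bndM//; last exact: bndM.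
by apply: eq_gexp => s Ds; exact: cexpM.
Qed.

End gibbs_expectation.

(** * Poincare inequality through Glauber dynamics *)

Section poincare.
Context (R : realType) (mu : probability (Borel R) R).
Hypothesis muI : mu `[-1, 1]%classic = 1%E.
Context (n : nat) (A : 'M[R]_n) (b : n.-tuple (Borel R)) (rho : R).
Hypothesis hA : coupling_matrix A.
Hypotheses (rho0 : 0 <= rho) (rho1 : rho < 1) (Arho : forall i, \sum_j `|A i j| <= rho).
Implicit Types (s : n.-tuple (Borel R)) (F H : n.-tuple (Borel R) -> R) (i j : 'I_n).
Implicit Types L : 'I_n -> R.
Local Notation D := (@box _ (Borel R) (I11 R) n).
Local Notation gexp := (gexp mu A b).
Local Notation gvar := (gvar mu A b).
Local Notation cexp := (cexp mu A b).

Definition coord_lip F L := (forall i, 0 <= L i) /\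
  forall s i z z', D s -> `|z| <= 1 -> `|z'| <= 1 ->
    `|F (upd s i z) - F (upd s i z')| <= L i * `|z - z'|.

Lemma coupling_sym i j : `|A i j| = `|A j i|.
Proof. by have [At _] := hA; rewrite -[in LHS]At mxE. Qed.

Lemma upd_comm s i j z w : i != j -> upd (upd s i z) j w = upd (upd s j w) i z.
Proof.
move=> ij; apply: eq_from_tnth => k; rewrite !tnth_upd.
by case: eqP => [->|//]; case: eqP => // ji; move: ij; rewrite ji eqxx.
Qed.

(** Telescoping along configurations that pass from [t] to [s] one coordinate at a time; each move
    has length at most 2. *)
Lemma coord_lip_bound F L s t : coord_lip F L -> D s -> D t ->
  `|F s - F t| <= 2 * \sum_i L i.
Proof.
move=> [L0 FL] Ds Dt.
pose h k := [tuple if (i < k)%N then tnth s i else tnth t i | i < n].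
have Dh k : D (h k).
  by apply/boxP => i; rewrite tnth_mktuple; case: ifP => _; [exact: ((boxP s).1 Ds i)|exact: ((boxP t).1 Dt i)].
have h0 : h 0%N = t by apply: eq_from_tnth => i; rewrite tnth_mktuple.
have hn : h n = s by apply: eq_from_tnth => i; rewrite tnth_mktuple ltn_ord.
have hS (k : 'I_n) : `|F (h k.+1) - F (h k)| <= 2 * L k.
  have e1 : h k.+1 = upd (h k) k (tnth s k).
    apply: eq_from_tnth => i; rewrite tnth_upd !tnth_mktuple ltnS leq_eqVlt.
    have [->|ik] := eqVneq i k; first by rewrite eqxx.
    by rewrite (negbTE (_ : (i != k :> nat))).
  rewrite e1 -[X in _ - F X](upd_id (h k) k).
  have s1 : `|tnth s k| <= 1 by move/boxP : Ds; exact.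
  have h1 : `|tnth (h k) k| <= 1 by have /boxP := Dh k; exact.
  rewrite (le_trans (FL _ _ _ _ (Dh k) s1 h1))// mulrC ler_wpM2r//.
  by rewrite (le_trans (ler_normB _ _))//; lra.
rewrite -hn -[in X in _ - X]h0.
have -> : F (h n) - F (h 0%N) = \sum_(k < n) (F (h k.+1) - F (h k)).
  by rewrite -(big_mkord predT (fun k => F (h k.+1) - F (h k))) telescope_sumr.
rewrite (le_trans (ler_norm_sum _ _ _))// mulr_sumr.
by apply: ler_sum => k _; exact: hS.
Qed.

(** Averaging out spin [j] removes the dependence on it but passes influence on: moving spin [i]
    shifts the field on [j] by A i j times the move, and [tilt_lipschitz] converts this shift with
    constant [L j]. *)
Lemma coord_lip_cexp j F L : bounded_on D F -> coord_lip F L ->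
  coord_lip (cexp j F) (fun i => if i == j then 0 else L i + `|A i j| * L j).
Proof.
move=> bF [L0 FL]; split=> [i|s i z z' Ds z1 z'1].
  by case: ifP => // _; rewrite addr_ge0// mulr_ge0.
have [->|ij] := eqVneq i j; first by rewrite !cexp_upd// subrr normr0 mul0r.
have Dsz : D (upd s i z) by apply: box_upd => //; exact/itvN11P.
have Dsz' : D (upd s i z') by apply: box_upd => //; exact/itvN11P.
have bz := bnd_upd_I j Dsz bF; have bz' := bnd_upd_I j Dsz' bF.
rewrite /cexp; set t := local_field A (upd s i z) j + tnth b j.
set t' := local_field A (upd s i z') j + tnth b j.
have tt' : `|t - t'| = `|A i j| * `|z - z'|.
  rewrite [`|A i j|]coupling_sym -normrM; congr `| _ |.
  rewrite /t /t' !local_fieldE (bigD1 i)//= [in X in _ - X](bigD1 i)//= !tnth_upd eqxx.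
  rewrite (eq_bigr (fun k => A j k * tnth s k)); last by move=> k ki; rewrite tnth_upd (negbTE ki).
  rewrite [in X in _ - X](eq_bigr (fun k => A j k * tnth s k)); last by move=> k ki; rewrite tnth_upd (negbTE ki).
  ring.
have h1 : `|tilt mu t (fun w => F (upd (upd s i z) j w)) - tilt mu t (fun w => F (upd (upd s i z') j w))|
    <= L i * `|z - z'|.
  rewrite -(tiltB muI)//; apply: (tilt_norm_le muI); first exact: bndB.
  move=> w Iw; rewrite !(upd_comm _ _ _ ij); apply: FL => //.
  by apply: box_upd.
have h2 : `|tilt mu t (fun w => F (upd (upd s i z') j w)) - tilt mu t' (fun w => F (upd (upd s i z') j w))|
    <= L j * `|t - t'|.
  apply: (tilt_lipschitz muI) => // w w' /itvN11P w1 /itvN11P w'1.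
  exact: FL.
move: h1 h2; rewrite tt'.
set p := tilt mu t _; set q := tilt mu t _; set r := tilt mu t' _ => h1 h2.
rewrite -(subrKA q).
rewrite (le_trans (ler_normD _ _))// mulrDl lerD//.
by rewrite (le_trans h2)// mulrA [L j * _]mulrC.
Qed.

(** The left side is the mean of the conditional variance of [F] given the spins other than [j]. *)
Lemma gvar_split j F L : bounded_on D F -> coord_lip F L ->
  gexp (fun s => F s ^+ 2) - gexp (fun s => F s * cexp j F s) <= L j ^+ 2.
Proof.
move=> bF [L0 FL]; have bc := bnd_cexp muI A b j bF.
have bF2 := bndX 2 bF; have bc2 := bndX 2 bc.
rewrite (gexp_pull muI b hA (j := j) _ bF bc); last by move=> s z; rewrite cexp_upd.
rewrite (gexp_cexp muI b hA j bF2) -gexpB//; last exact: bnd_cexp.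
rewrite -[leRHS](gexp_cst muI A b); apply: gexp_le => //.
- by apply: bndB; [exact: bnd_cexp|exact: bndM].
- exact: bnd_cst.
move=> s Ds; rewrite -[cexp j F s * _]expr2; apply: (@tilt_var_le _ mu (fun z => F (upd s j z)) (local_field A s j + tnth b j) (L j) muI) => //.
  exact: bnd_upd_I.
by move=> z z' z1 z'1; exact: FL.
Qed.

(** One step of the heat-bath dynamics: a uniformly chosen spin is redrawn from its conditional
    law. *)
Definition glauber F s : R := n%:R^-1 * \sum_j cexp j F s.

Lemma bnd_glauber F : bounded_on D F -> bounded_on D (glauber F).
Proof.
move=> bF; apply: bndM; first exact: bnd_cst.
by apply: bnd_sum => j _; exact: bnd_cexp.
Qed.

Definition glauber_lip L i : R := n%:R^-1 * \sum_j (if i == j then 0 else L i + `|A i j| * L j).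

Lemma coord_lip_glauber F L : bounded_on D F -> coord_lip F L ->
  coord_lip (glauber F) (glauber_lip L).
Proof.
move=> bF hF; split=> [i|s i z z' Ds z1 z'1].
  rewrite mulr_ge0 ?invr_ge0// sumr_ge0// => j _.
  by have [/(_ i)] := coord_lip_cexp j bF hF.
rewrite /glauber -mulrBr -sumrB normrM ger0_norm ?invr_ge0// -mulrA ler_wpM2l ?invr_ge0//.
rewrite (le_trans (ler_norm_sum _ _ _))// mulr_suml; apply: ler_sum => j _.
by have [_ /(_ s i z z' Ds z1 z'1)] := coord_lip_cexp j bF hF.
Qed.

Let r : R := 1 - (1 - rho ^+ 2) / n%:R.

(** The new constants are bounded by the convex combination (1 - 1/n) L + (1/n) |A| L; convexity of
    the square and the l2 contraction of |A| give the factor r = 1 - (1 - rho^2) / n. *)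
Lemma glauber_lip_l2 L : (forall i, 0 <= L i) ->
  \sum_i glauber_lip L i ^+ 2 <= r * \sum_i L i ^+ 2.
Proof.
move=> L0; have [n0|n0] := posnP n.
  by rewrite !big1 ?mulr0// => i; have := ltn_ord i; rewrite [X in (_ < X)%N]n0.
have np : 0 < n%:R :> R by rewrite ltr0n.
have nn0 : n%:R != 0 :> R by rewrite gt_eqF.
pose B i := \sum_j `|A i j| * L j.
have B0 i : 0 <= B i by apply: sumr_ge0 => j _; rewrite mulr_ge0.
pose p : R := n%:R^-1.
have p0 : 0 <= p by rewrite invr_ge0.
have p1 : p <= 1 by rewrite invf_le1// ler1n.
have h i : glauber_lip L i <= (1 - p) * L i + p * B i.
  rewrite /glauber_lip -/p (_ : (1 - p) * L i = p * ((n%:R - 1) * L i)); last first.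
    by rewrite mulrA mulrBr mulr1 /p mulVf.
  rewrite -mulrDr ler_wpM2l// (bigD1 i)//= eqxx add0r.
  rewrite (eq_bigr (fun j => L i + `|A i j| * L j)); last by move=> j ji; rewrite eq_sym (negbTE ji).
  rewrite big_split/= sumr_const lerD//.
    rewrite -[leLHS]mulr_natl; apply: ler_wpM2r => //.
    rewrite -[1]/(1%:R) -natrB// ler_nat -[X in (_ <= X)%N]/(n - 1)%N.
    by rewrite cardC1 card_ord subn1.
  by rewrite [leRHS](bigD1 i)//= lerDr mulr_ge0.
have gl0 i : 0 <= glauber_lip L i.
  rewrite mulr_ge0 ?invr_ge0// sumr_ge0// => j _; case: ifP => // _.
  by rewrite addr_ge0// mulr_ge0.
apply: (@le_trans _ _ (\sum_i ((1 - p) * L i ^+ 2 + p * B i ^+ 2))).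
  apply: ler_sum => i _; apply: (@le_trans _ _ (((1 - p) * L i + p * B i) ^+ 2)).
    by rewrite lerXn2r ?nnegrE// (le_trans (gl0 i)).
  rewrite -subr_ge0 (_ : _ - _ = p * (1 - p) * (L i - B i) ^+ 2); last by ring.
  by rewrite mulr_ge0 ?sqr_ge0// mulr_ge0// subr_ge0.
rewrite big_split/= -!mulr_sumr.
have := @l2_contraction R n (fun i j => `|A i j|) rho (fun i j => normr_ge0 _) coupling_sym rho0 Arho L.
rewrite -/B => hB.
rewrite (le_trans (lerD (lexx _) (ler_wpM2l p0 hB)))//.
rewrite mulrA -mulrDl /r -/p (_ : 1 - p + p * rho ^+ 2 = 1 - (1 - rho ^+ 2) * p)//.
by ring.
Qed.

(** With T the Glauber step, Var F = E[F (F - T F)] + Cov(F, T F). The first term averages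
    conditional variances, the second is at most half the sum of both variances; solving for Var F
    yields 2/n plus the constant carried by T F. *)
Lemma gvar_step F L K : bounded_on D F -> coord_lip F L ->
  gvar (glauber F) <= K * \sum_i glauber_lip L i ^+ 2 ->
  (0 < n)%N -> 0 <= K ->
  gvar F <= (2 / n%:R + K * r) * \sum_i L i ^+ 2.
Proof.
move=> bF hF hK n0 K0; have np : 0 < n%:R :> R by rewrite ltr0n.
have nn0 : n%:R != 0 :> R by rewrite gt_eqF.
have bT := bnd_glauber bF.
have bc j := bnd_cexp muI A b j bF.
have bF2 := bndX 2 bF; have bT2 := bndX 2 bT; have bFT := bndM bF bT.
have gT : gexp (glauber F) = gexp F.
  rewrite /glauber (gexpZ muI); last by apply: bnd_sum.
  rewrite (gexp_sum muI)//; under eq_bigr do rewrite -(gexp_cexp muI b hA _ bF).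
  by rewrite sumr_const card_ord -[X in _ * X]mulr_natl mulKf.
have gFT : gexp (fun s => F s * glauber F s) = n%:R^-1 * \sum_j gexp (fun s => F s * cexp j F s).
  rewrite -(gexp_sum muI); last by move=> j _; exact: bndM.
  rewrite -(gexpZ muI); last by apply: bnd_sum => j _; exact: bndM.
  by apply: eq_gexp => s _; rewrite /glauber mulrCA mulr_sumr.
have h1 : gexp (fun s => F s ^+ 2) - gexp (fun s => F s * glauber F s) <= n%:R^-1 * \sum_j L j ^+ 2.
  have -> : gexp (fun s => F s ^+ 2) = n%:R^-1 * \sum_(j < n) gexp (fun s => F s ^+ 2).
    by rewrite sumr_const card_ord -[X in _ * X]mulr_natl mulKf.
  rewrite gFT -mulrBr -sumrB ler_wpM2l ?invr_ge0//.
  by apply: ler_sum => j _; exact: gvar_split.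
have h2 : gexp (fun s => F s * glauber F s) - gexp F * gexp (glauber F) <= 2^-1 * (gvar F + gvar (glauber F)).
  have bS := bndB bF bT.
  have := gvar_ge0 muI A b bS; rewrite /gvar (gexpB muI)// gT subrr expr0n subr0.
  rewrite (@eq_gexp _ _ _ _ _ _ (fun s => F s ^+ 2 + (- 2) * (F s * glauber F s) + glauber F s ^+ 2)); last first.
    by move=> s _; ring.
  rewrite (gexpD muI)//; last by apply: bndD => //; apply: bndM => //; exact: bnd_cst.
  rewrite (gexpD muI)//; last by apply: bndM => //; exact: bnd_cst.
  by rewrite (gexpZ muI)//; lra.
have hL := glauber_lip_l2 (hF.1).
have h3 : K * \sum_i glauber_lip L i ^+ 2 <= K * (r * \sum_i L i ^+ 2) by rewrite ler_wpM2l.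
move: h1 hK h3 h2; rewrite /gvar gT -expr2.
set e1 := gexp _; set e2 := gexp _; set e3 := gexp _; set e4 := gexp _.
move: (n%:R^-1) (\sum_j L j ^+ 2) (\sum_j _) => p S S'.
move: e1 e2 e3 e4 => e1 e2 e3 e4 h1 hK h3 h2.
rewrite (_ : (2 * p + K * r) * S' = 2 * (p * S') + K * (r * S')); last by ring.
lra.
Qed.

(** The constant 2 / (1 - rho^2) is the fixed point of K -> 2/n + K r. Iterating from the crude
    constant 4n leaves an error 4n r^m, which disappears as m grows. *)
Lemma gvar_poincare F L : bounded_on D F -> coord_lip F L ->
  gvar F <= 2 / (1 - rho ^+ 2) * \sum_i L i ^+ 2.
Proof.
move=> bF hF.
have S0 : 0 <= \sum_i L i ^+ 2 by apply: sumr_ge0 => i _; exact: sqr_ge0.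
have K0 : 0 <= 2 / (1 - rho ^+ 2).
  by rewrite divr_ge0// subr_ge0 exprn_ile1// ltW.
(* The second moment about the value at the zero configuration, with the l1 norm of the constants
   bounded through their l2 norm. *)
have base F' L' : bounded_on D F' -> coord_lip F' L' -> gvar F' <= 4 * n%:R * \sum_i L' i ^+ 2.
  move=> bF' hF'.
  pose t : n.-tuple (Borel R) := [tuple 0 | _ < n].
  have Dt : D t by apply/boxP => i; rewrite tnth_mktuple normr0.
  have bS : bounded_on D (fun s => (F' s - F' t) ^+ 2).
    by apply: bndX; apply: bndB => //; exact: bnd_cst.
  have := gvarE muI A b (F' t) bF'.
  have : gexp (fun s => (F' s - F' t) ^+ 2) <= (2 * \sum_i L' i) ^+ 2.
    rewrite -[leRHS](gexp_cst muI A b); apply: gexp_le => //; first exact: bnd_cst.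
    move=> s Ds; rewrite -[leLHS]ger0_norm ?sqr_ge0// normrX lerXn2r ?nnegrE//.
      by rewrite mulr_ge0// sumr_ge0// => i _; have [] := hF'.
    exact: coord_lip_bound.
  have := sum_sqr_le1 L'; have := sqr_ge0 (gexp F' - F' t).
  rewrite exprMn -[2 ^+ 2]/(2 * 2); move: (gexp _) (gvar F') (_ ^+ 2) (_ ^+ 2) => x y z w.
  by move=> *; rewrite -mulrA; lra.
have [n0|n0] := posnP n.
  rewrite (le_trans (base _ _ bF hF))// ler_wpM2r// [n%:R](_ : _ = 0) ?mulr0//.
  by rewrite [in LHS]n0.
have np : 0 < n%:R :> R by rewrite ltr0n.
have nn0 : n%:R != 0 :> R by rewrite gt_eqF.
have rho2 : rho ^+ 2 < 1 by rewrite exprn_ilt1.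
have r0 : 0 <= r.
  rewrite /r subr_ge0 ler_pdivrMr// mul1r (@le_trans _ _ 1)// ?ler1n//.
  by rewrite gerBl sqr_ge0.
have r1 : r < 1 by rewrite /r gtrBl divr_gt0// subr_gt0.
have iter m : forall F' L', bounded_on D F' -> coord_lip F' L' ->
    gvar F' <= (2 / (1 - rho ^+ 2) + 4 * n%:R * r ^+ m) * \sum_i L' i ^+ 2.
  elim: m => [|m IH] F' L' bF' hF'.
    rewrite expr0 mulr1 (le_trans (base _ _ bF' hF'))// ler_wpM2r ?lerDr//.
    by apply: sumr_ge0 => i _; exact: sqr_ge0.
  have K'0 : 0 <= 2 / (1 - rho ^+ 2) + 4 * n%:R * r ^+ m.
    by rewrite addr_ge0// mulr_ge0 ?exprn_ge0// mulr_ge0.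
  have := gvar_step bF' hF' (IH _ _ (bnd_glauber bF') (coord_lip_glauber bF' hF')) n0 K'0.
  move/le_trans; apply; rewrite ler_wpM2r ?sumr_ge0// => [i _|]; first exact: sqr_ge0.
  have q0 : 1 - rho ^+ 2 != 0 by rewrite gt_eqF// subr_gt0.
  rewrite [r ^+ m.+1]exprSr le_eqVlt; apply/orP; left; apply/eqP; move: (r ^+ m) => x.
  by rewrite /r; field; rewrite nn0 q0.
have lim : (2 / (1 - rho ^+ 2) + 4 * n%:R * r ^+ m) * \sum_i L i ^+ 2 @[m --> \oo]
    --> (2 / (1 - rho ^+ 2) + 4 * n%:R * 0) * \sum_i L i ^+ 2.
  apply: cvgMl; apply: cvgD; first exact: cvg_cst.
  by apply: cvgMr; apply: cvg_expr; rewrite ger0_norm.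
move: lim; rewrite mulr0 addr0 => lim.
rewrite -(cvg_lim _ lim)//; apply: limr_ge; first by apply/cvg_ex; eexists; exact: lim.
by near=> m; exact: iter.
Unshelve. all: by end_near. Qed.

Lemma gexp_lin_var (w : 'I_n -> R) :
  gexp (fun s => (\sum_i w i * (tnth s i - gexp (fun s => tnth s i))) ^+ 2)
  <= 2 / (1 - rho ^+ 2) * \sum_i w i ^+ 2.
Proof.
pose F s : R := \sum_i w i * tnth s i.
have bF : bounded_on D F by exact: bnd_lin.
have hF : coord_lip F (fun i => `|w i|).
  split=> // s i z z' _ _ _.
  rewrite /F (bigD1 i)//= [in X in _ - X](bigD1 i)//= !tnth_upd eqxx.
  rewrite (eq_bigr (fun k => w k * tnth s k)); last by move=> k ki; rewrite tnth_upd (negbTE ki).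
  rewrite [in X in _ - X](eq_bigr (fun k => w k * tnth s k)); last by move=> k ki; rewrite tnth_upd (negbTE ki).
  by rewrite opprD addrACA subrr addr0 -mulrBr normrM.
have := gvar_poincare bF hF.
under eq_bigr do rewrite real_normK ?num_real//.
apply: le_trans; have := gvarE muI A b (gexp F) bF; rewrite subrr expr0n addr0 => <-.
rewrite le_eqVlt; apply/orP; left; apply/eqP; apply: eq_gexp => s _; congr (_ ^+ 2).
rewrite /F (gexp_sum muI); last by move=> i _; apply: bndM; [exact: bnd_cst|exact: bnd_coord].
rewrite -sumrB; apply: eq_bigr => i _.
by rewrite (gexpZ muI) ?mulrBr//; exact: bnd_coord.
Qed.

End poincare.

Section sup_contraction.
Context (R : realType) (n : nat) (B : 'I_n -> 'I_n -> R) (rho : R).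
Hypotheses (B0 : forall i j, 0 <= B i j) (rho1 : rho < 1).
Hypotheses (Brho : forall i, \sum_j B i j <= rho).

(** The hypothesis at an index where |x| is maximal bounds that maximum by a + rho times itself. *)
Lemma sup_contraction (x : 'I_n -> R) a :
  (forall i, `|x i| <= a + \sum_j B i j * `|x j|) -> forall i, `|x i| <= a / (1 - rho).
Proof using B0 rho1 Brho.
move=> h i; case: (@Order.TotalTheory.arg_maxP _ _ _ i predT (fun k => `|x k|)) => // k _ km.
rewrite (le_trans (km i _))// ler_pdivlMr ?subr_gt0//.
have : \sum_j B k j * `|x j| <= rho * `|x k|.
  rewrite (le_trans _ (ler_wpM2r (normr_ge0 _) (Brho k)))// mulr_suml.
  by apply: ler_sum => j _; rewrite ler_wpM2l//; exact: km.
by have := h k; lra.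
Qed.

End sup_contraction.

(** * Stein identity for the Gibbs law *)

(* [g1] plays the role of the derivative of [g]; the last clause is the only link between them that the
   interpolation argument needs. *)
Definition C11_pair (R : realType) (B : R) (g g1 : R -> R) :=
  [/\ measurable_fun [set: R] g /\ measurable_fun [set: R] g1,
      (forall x, `|g x| <= B), (forall x, `|g1 x| <= B),
      (forall x y, `|g1 y - g1 x| <= B * `|y - x|) &
      (forall x y, `|g y - g x - (y - x) * g1 x| <= B * (y - x) ^+ 2)].

Section gibbs_stein.
Context (R : realType) (mu : probability (Borel R) R).
Hypothesis hmu : base_measure mu.
Context (n : nat) (A : 'M[R]_n) (b u : n.-tuple (Borel R)) (rho alpha : R).
Hypothesis hA : coupling_matrix A.
Hypotheses (rho0 : 0 <= rho) (rho1 : rho < 1) (Arho : forall i, \sum_j `|A i j| <= rho).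
Hypotheses (Aalpha : forall i, \sum_j A i j ^+ 2 <= alpha).
Local Notation psi1 := (psi1 mu).
Local Notation psi2 := (psi2 mu).
Hypothesis u_fix : forall i, tnth u i = psi1 (local_field A u i + tnth b i).
Implicit Types (s : n.-tuple (Borel R)) (i j : 'I_n).
Local Notation D := (@box _ (Borel R) (I11 R) n).
Local Notation gexp := (gexp mu A b).
Local Notation cexp := (cexp mu A b).
Local Notation muI := (base_measureI hmu).

Let K : R := 2 / (1 - rho ^+ 2).

Let K_ge0 : 0 <= K.
Proof. by rewrite divr_ge0// subr_ge0 exprn_ile1// ltW. Qed.

Lemma bnd_cmean i : bounded_on D (fun s => psi1 (local_field A s i + tnth b i)).
Proof.
have [ml _] := bnd_local_field A i.
apply: (bnd_comp (M := 1)) => [s _||].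
- exact: (psi1_le1 hmu).
- exact: (measurable_psi1 hmu).
- by apply: measurable_funD.
Qed.

Lemma bnd_cvar i : bounded_on D (fun s => psi2 (local_field A s i + tnth b i)).
Proof.
have [ml _] := bnd_local_field A i.
apply: (bnd_comp (M := 1)) => [s _||].
- exact: (psi2_norm_le1 hmu).
- exact: (measurable_psi2 hmu).
- by apply: measurable_funD.
Qed.

Lemma cexp_coord i s : cexp i (fun s => tnth s i) s = psi1 (local_field A s i + tnth b i).
Proof. by rewrite psi1E; apply: eq_tilt => z _; rewrite tnth_upd eqxx. Qed.

Let M i : R := gexp (fun s => tnth s i).

Lemma gexp_local_field i : gexp (fun s => local_field A s i) = \sum_j A i j * M j.
Proof.
rewrite (@eq_gexp _ _ _ _ _ _ (fun s => \sum_j A i j * tnth s j)); last first.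
  by move=> s _; rewrite local_fieldE.
rewrite (gexp_sum muI); last by move=> j _; apply: bndM; [exact: bnd_cst|exact: bnd_coord].
by apply: eq_bigr => j _; rewrite (gexpZ muI)//; exact: bnd_coord.
Qed.

(** The Gibbs mean of spin i is the mean of psi' at its total field. Expanding at the mean field
    kills the linear term, and the quadratic one is at most four times a variance, hence 4 K alpha.
    Comparison with the fixed-point equation for [u] then closes by contraction in the sup norm. *)
Lemma mean_field_approx i : `|M i - tnth u i| <= 4 * K * alpha / (1 - rho).
Proof.
apply: (@sup_contraction R n (fun i j => `|A i j|) rho _ rho1 Arho (fun i => M i - tnth u i) (4 * K * alpha) _ i) => {i} [i j//|i].
have bl := bnd_local_field A i.
have bm := bnd_cmean i.
set m := \sum_j A i j * M j.
have e1 : M i = gexp (fun s => psi1 (local_field A s i + tnth b i)).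
  rewrite /M (gexp_cexp muI b hA i (bnd_coord R i)).
  by apply: eq_gexp => s _; exact: cexp_coord.
have h1 : `|M i - psi1 (m + tnth b i)| <= 4 * K * alpha.
  have blm := bndB bl (bnd_cst D m).
  have bS := bndM (bnd_cst D (psi2 (m + tnth b i))) blm.
  have bk := bnd_cst D (psi1 (m + tnth b i)).
  have bc := bndB bm bk.
  have -> : M i - psi1 (m + tnth b i) = gexp (fun s => psi1 (local_field A s i + tnth b i)
      - psi1 (m + tnth b i) - psi2 (m + tnth b i) * (local_field A s i - m)).
    rewrite (gexpB muI _ _ bc bS) (gexpB muI _ _ bm bk) (gexpZ muI _ _ _ blm).
    rewrite (gexpB muI _ _ bl (bnd_cst D m)) !(gexp_cst muI) gexp_local_field.
    by rewrite subrr mulr0 subr0 e1.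
  have bsq := bndX 2 blm.
  rewrite (le_trans (gexp_norm muI A b (bndB bc bS)))//.
  apply: (@le_trans _ _ (gexp (fun s => 4 * (local_field A s i - m) ^+ 2))).
    apply: (gexp_le muI); [by apply: bnd_norm; exact: bndB|by apply: bndM => //; exact: bnd_cst|].
    move=> s _; have := psi1_taylor hmu (m + tnth b i) (local_field A s i + tnth b i).
    have -> : local_field A s i + tnth b i - (m + tnth b i) = local_field A s i - m by ring.
    exact.
  rewrite (gexpZ muI)// -mulrA ler_wpM2l//.
  have := gexp_lin_var muI b hA rho0 rho1 Arho (A i).
  rewrite -/K => h; apply: le_trans (le_trans h _); last by rewrite ler_wpM2l.
  rewrite le_eqVlt; apply/orP; left; apply/eqP; apply: eq_gexp => s _; congr (_ ^+ 2).
  by rewrite /m local_fieldE -sumrB; apply: eq_bigr => j _; rewrite mulrBr.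
have h2 : `|psi1 (m + tnth b i) - tnth u i| <= \sum_j `|A i j| * `|M j - tnth u j|.
  rewrite u_fix (le_trans (psi1_lipschitz hmu _ _))// opprD addrACA subrr addr0.
  rewrite /m local_fieldE -sumrB (le_trans (ler_norm_sum _ _ _))//.
  by apply: ler_sum => j _; rewrite -mulrBr normrM.
rewrite -(subrKA (psi1 (m + tnth b i))).
by rewrite (le_trans (ler_normD _ _))// lerD.
Qed.

Hypothesis nalpha : n%:R * alpha ^+ 2 <= 1.

(** [K] pays for the variance, the square for the bias; the added 1 lets the constant also bound its
    own square root. *)
Definition dev_cst : R := K + (4 * K / (1 - rho)) ^+ 2 + 1.

Lemma dev_cst_ge1 : 1 <= dev_cst.
Proof. by rewrite lerDr addr_ge0 ?sqr_ge0. Qed.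

Lemma bnd_dev (w : 'I_n -> R) : bounded_on D (fun s => \sum_i w i * (tnth s i - tnth u i)).
Proof.
apply: bnd_sum => i _; apply: bndM; first exact: bnd_cst.
by apply: bndB; [exact: bnd_coord|exact: bnd_cst].
Qed.

(** Variance plus squared bias. The coordinatewise bias is O(alpha), so Cauchy-Schwarz gives a
    squared bias of order n alpha^2 times the squared norm of [w], and n alpha^2 <= 1. *)
Lemma gexp_dev_sqr (w : 'I_n -> R) :
  gexp (fun s => (\sum_i w i * (tnth s i - tnth u i)) ^+ 2) <= dev_cst * \sum_i w i ^+ 2.
Proof.
have W0 : 0 <= \sum_i w i ^+ 2 by apply: sumr_ge0 => i _; exact: sqr_ge0.
pose F s : R := \sum_i w i * tnth s i.
have bF : bounded_on D F by exact: bnd_lin.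
have FE : gexp F = \sum_i w i * M i.
  rewrite (gexp_sum muI); last by move=> j _; apply: bndM; [exact: bnd_cst|exact: bnd_coord].
  by apply: eq_bigr => j _; rewrite (gexpZ muI)//; exact: bnd_coord.
have := gvarE muI A b (\sum_i w i * tnth u i) bF.
rewrite (@eq_gexp _ _ _ _ _ (fun s => (F s - _) ^+ 2) (fun s => (\sum_i w i * (tnth s i - tnth u i)) ^+ 2)); last first.
  by move=> s _; congr (_ ^+ 2); rewrite /F -sumrB; apply: eq_bigr => i _; rewrite mulrBr.
move=> ->.
have h1 : gvar mu A b F <= K * \sum_i w i ^+ 2.
  have := gexp_lin_var muI b hA rho0 rho1 Arho w; rewrite -/K; apply: le_trans.
  have := gvarE muI A b (gexp F) bF; rewrite subrr expr0n addr0 => <-.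
  rewrite le_eqVlt; apply/orP; left; apply/eqP; apply: eq_gexp => s _; congr (_ ^+ 2).
  by rewrite FE /F -sumrB; apply: eq_bigr => i _; rewrite mulrBr.
have h2 : (gexp F - \sum_i w i * tnth u i) ^+ 2 <= (4 * K / (1 - rho)) ^+ 2 * \sum_i w i ^+ 2.
  have -> : gexp F - \sum_i w i * tnth u i = \sum_i w i * (M i - tnth u i).
    by rewrite FE -sumrB; apply: eq_bigr => i _; rewrite mulrBr.
  rewrite (le_trans (cauchy_schwarz_sum _ _))// mulrC ler_wpM2r//.
  apply: (@le_trans _ _ (\sum_(i < n) (4 * K * alpha / (1 - rho)) ^+ 2)).
    apply: ler_sum => i _; rewrite -[leLHS]ger0_norm ?sqr_ge0// normrX lerXn2r ?nnegrE//.
      exact: le_trans (mean_field_approx i).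
    exact: mean_field_approx.
  rewrite sumr_const card_ord -[X in X <= _]mulr_natl.
  rewrite (_ : 4 * K * alpha / (1 - rho) = alpha * (4 * K / (1 - rho))); last by ring.
  by rewrite exprMn mulrA ler_piMl// sqr_ge0.
rewrite /dev_cst mulrDl mul1r [(K + _) * _]mulrDl (le_trans (lerD h1 h2))//.
by rewrite lerDl.
Qed.

Let C := dev_cst.

Let C0 : 0 <= C. Proof. by rewrite (le_trans _ dev_cst_ge1). Qed.

Lemma gexp_abs_dev (w : 'I_n -> R) (t : R) : 0 <= t -> \sum_i w i ^+ 2 <= t ^+ 2 ->
  gexp (fun s => `|\sum_i w i * (tnth s i - tnth u i)|) <= C * t.
Proof.
move=> t0 wt; rewrite -(ler_pXn2r (_ : (0 < 2)%N))// ?nnegrE; last 2 first.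
- by apply: (gexp_ge0 muI) => //; apply: bnd_norm; exact: bnd_dev.
- by rewrite mulr_ge0.
rewrite (le_trans (gexp_sqr_le muI _ _ (bnd_norm (bnd_dev w))))//.
rewrite (@eq_gexp _ _ _ _ _ _ (fun s => (\sum_i w i * (tnth s i - tnth u i)) ^+ 2)); last first.
  by move=> s _; rewrite real_normK// num_real.
rewrite (le_trans (gexp_dev_sqr w))// exprMn.
rewrite (le_trans (ler_wpM2l C0 wt))// ler_wpM2r ?sqr_ge0// expr2 ler_peMl//.
exact: dev_cst_ge1.
Qed.

Lemma local_field_dev s i : local_field A s i - local_field A u i = \sum_j A i j * (tnth s j - tnth u j).
Proof. by rewrite !local_fieldE -sumrB; apply: eq_bigr => j _; rewrite mulrBr. Qed.

Section statistic.
Variables (q : 'I_n -> R) (kappa v tau : R).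
Hypotheses (kappa0 : 0 <= kappa) (tau0 : 0 <= tau) (alpha_tau : alpha <= tau ^+ 2).
Hypotheses (q_tau : forall i, `|q i| <= tau) (q2 : \sum_i q i ^+ 2 <= 2).
Hypothesis q_alpha : alpha * \sum_i `|q i| <= tau.
Let dd i := psi2 (local_field A u i + tnth b i).
(** Residual of kappa (q - A D q) = q, with D the diagonal matrix of the [dd]. It vanishes when A q
    = tl q, D = ups and kappa (1 - tl ups) = 1, with tl the product theta lambda. *)
Let eta i := kappa * q i - kappa * (\sum_j A i j * (dd j * q j)) - q i.
Hypotheses (eta_tau : \sum_i eta i ^+ 2 <= tau ^+ 2).
Hypotheses (v_tau : `|kappa * \sum_i q i ^+ 2 * dd i - v| <= tau).

Let X s : R := \sum_i q i * (tnth s i - tnth u i).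
Let bX : bounded_on D X. Proof. exact: bnd_dev. Qed.

Lemma gexp_stat_sqr : gexp (fun s => X s ^+ 2) <= 2 * C.
Proof.
by rewrite (le_trans (gexp_dev_sqr q))// mulrC ler_wpM2r.
Qed.

(** Three parts: a sum of conditionally centered terms, a Taylor remainder of psi' at [u], and the
    residual [eta]. Symmetry of [A] moves the linear term from sigma - u onto [q]. *)
Lemma stat_decomp s : X s = \sum_i kappa * q i * (tnth s i - psi1 (local_field A s i + tnth b i))
  + \sum_i kappa * q i * (psi1 (local_field A s i + tnth b i) - tnth u i
      - dd i * (local_field A s i - local_field A u i))
  - \sum_i eta i * (tnth s i - tnth u i).
Proof.
have e : \sum_i kappa * q i * (dd i * (local_field A s i - local_field A u i))
    = \sum_i (kappa * \sum_j A i j * (dd j * q j)) * (tnth s i - tnth u i).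
  under eq_bigr do rewrite local_field_dev mulr_sumr mulr_sumr.
  rewrite exchange_big/=; apply: eq_bigr => j _; rewrite mulr_sumr mulr_suml.
  apply: eq_bigr => i _; have [At _] := hA; rewrite -[in LHS]At mxE; ring.
rewrite -big_split/= /X.
rewrite [X in _ = X - _](eq_bigr (fun i => kappa * q i * (tnth s i - tnth u i) -
  kappa * q i * (dd i * (local_field A s i - local_field A u i)))); last by move=> i _; ring.
rewrite sumrB e -!sumrB; apply: eq_bigr => i _; rewrite /eta; ring.
Qed.

(** Integration by parts in spin i. [Xi] is the statistic with spin i reset to u_i, so it is known
    given the other spins. Expanding g(X) at [Xi], the zeroth order vanishes because spin i minus
    its conditional mean is centered, and the first order produces the conditional variance. *)
Lemma gexp_term i (B : R) (g g1 : R -> R) : C11_pair B g g1 ->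
  `|gexp (fun s => (tnth s i - psi1 (local_field A s i + tnth b i)) * g (X s))
    - q i * dd i * gexp (fun s => g1 (X s))| <= B * (10 * q i ^+ 2 + 4 * `|q i| * (C * tau)).
Proof.
move=> [[mg mg1] gB g1B g1L gT].
have B0 : 0 <= B by exact: le_trans (gB 0).
pose Xi s := X (upd s i (tnth u i)).
have XiE s : X s = Xi s + q i * (tnth s i - tnth u i).
  rewrite /Xi /X [in RHS](bigD1 i)//= tnth_upd eqxx subrr mulr0 add0r (bigD1 i)//= addrC; congr (_ + _).
  by apply: eq_bigr => j ji; rewrite tnth_upd (negbTE ji).
have Xiu s z : Xi (upd s i z) = Xi s by rewrite /Xi upd_upd.
have mXi : measurable_fun setT Xi by case: bX => mX _; exact: (measurableT_comp mX (measurable_updl i _)).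
have [mX _] := bX.
have bg : bounded_on D (fun s => g (X s)) by apply: (bnd_comp (M := B)).
have bg1 : bounded_on D (fun s => g1 (X s)) by apply: (bnd_comp (M := B)).
have bgi : bounded_on D (fun s => g (Xi s)) by apply: (bnd_comp (M := B)).
have bg1i : bounded_on D (fun s => g1 (Xi s)) by apply: (bnd_comp (M := B)).
have bm := bnd_cmean i; have bv := bnd_cvar i; have bc := bnd_coord R i.
have bcu : bounded_on D (fun s => tnth s i - tnth u i) by apply: bndB => //; exact: bnd_cst.
have bcm := bndB bc bm.
have u1 : `|tnth u i| <= 1 by rewrite u_fix; exact: (psi1_le1 hmu).
have cm2 s : D s -> `|tnth s i - psi1 (local_field A s i + tnth b i)| <= 2.
  move=> /boxP/(_ i) s1; rewrite (le_trans (ler_normB _ _))//.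
  by have := psi1_le1 hmu (local_field A s i + tnth b i); lra.
have cu2 s : D s -> `|tnth s i - tnth u i| <= 2.
  by move=> /boxP/(_ i) s1; rewrite (le_trans (ler_normB _ _))//; lra.
pose T s := (tnth s i - psi1 (local_field A s i + tnth b i)) : R.
have z1 : gexp (fun s => T s * g (Xi s)) = 0.
  rewrite (gexp_pull muI b hA (j := i) _ bcm bgi); last by move=> s z; rewrite Xiu.
  rewrite -[RHS](gexp_cst muI A b); apply: eq_gexp => s Ds.
  rewrite /cexp (@eq_tilt _ _ _ _ (fun z => z - psi1 (local_field A s i + tnth b i))); last first.
    by move=> z _; rewrite /T tnth_upd eqxx local_field_upd.
  rewrite (tiltB muI) ?(tilt_cst muI) -?psi1E ?subrr ?mul0r//; [exact: bnd_id|exact: bnd_cst].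
(* Writing z - u_i as (z - psi1) + (psi1 - u_i), the second piece is constant given the other spins
   and meets a centered factor. *)
have z2 : gexp (fun s => T s * (tnth s i - tnth u i) * g1 (Xi s))
    = gexp (fun s => psi2 (local_field A s i + tnth b i) * g1 (Xi s)).
  rewrite (gexp_pull muI b hA (j := i) _ (bndM bcm bcu) bg1i); last by move=> s z; rewrite Xiu.
  apply: eq_gexp => s Ds; congr (_ * _).
  rewrite /cexp; set t := local_field A s i + tnth b i.
  rewrite (@eq_tilt _ _ _ _ (fun z => (z - psi1 t) ^+ 2 + (psi1 t - tnth u i) * (z - psi1 t))); last first.
    by move=> z _; rewrite /T tnth_upd eqxx (local_field_upd hA) -/t; ring.
  have b1 : bounded_on (I11 R) (fun z => z - psi1 t) by apply: bndB; [exact: bnd_id|exact: bnd_cst].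
  rewrite (tiltD muI); [|exact: bndX|by apply: bndM => //; exact: bnd_cst].
  rewrite (tiltZ muI _ _ b1) (tiltB muI); [|exact: bnd_id|exact: bnd_cst].
  by rewrite (tilt_cst muI) -psi1E subrr mulr0 addr0 -(psi2E hmu).
(* Three errors: the Taylor remainder, the return from [Xi] to X in g1, and the replacement of the
   conditional variance by its value at [u]. They contribute 8 q^2, 2 q^2 and 4 |q| C tau. *)
pose r1 s := (T s * (g (X s) - g (Xi s) - (X s - Xi s) * g1 (Xi s)) : R).
pose r2 s := (psi2 (local_field A s i + tnth b i) * (g1 (Xi s) - g1 (X s)) : R).
pose r3 s := ((psi2 (local_field A s i + tnth b i) - dd i) * g1 (X s) : R).
have br1 : bounded_on D r1.
  apply: bndM => //; apply: bndB; first exact: bndB.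
  apply: bndM => //; rewrite (_ : (fun s => X s - Xi s) = (fun s => q i * (tnth s i - tnth u i))).
    by apply: bndM => //; exact: bnd_cst.
  by apply/funext => s; rewrite XiE addrC addKr.
have br2 : bounded_on D r2 := bndM bv (bndB bg1i bg1).
have br3 : bounded_on D r3 := bndM (bndB bv (bnd_cst D (dd i))) bg1.
have mainE : gexp (fun s => T s * g (X s)) - q i * dd i * gexp (fun s => g1 (X s))
    = gexp (fun s => r1 s) + q i * (gexp r2 + gexp r3).
  have bT1 : bounded_on D (fun s => T s * g (Xi s)) by exact: bndM.
  have bT2 : bounded_on D (fun s => T s * (tnth s i - tnth u i) * g1 (Xi s)) by apply: bndM => //; exact: bndM.
  have bT3 : bounded_on D (fun s => psi2 (local_field A s i + tnth b i) * g1 (Xi s)) by exact: bndM.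
  rewrite (@eq_gexp _ _ _ _ _ (fun s => T s * g (X s)) (fun s => r1 s + (T s * g (Xi s) + q i * (T s * (tnth s i - tnth u i) * g1 (Xi s))))); last first.
    by move=> s _; rewrite /r1; rewrite (XiE s) -/(X s) [_ + _ - Xi s]addrC addKr; ring.
  have bq : bounded_on D (fun s => q i * (T s * (tnth s i - tnth u i) * g1 (Xi s))) by apply: bndM => //; exact: bnd_cst.
  rewrite (gexpD muI)//; last exact: bndD.
  rewrite (gexpD muI)// z1 add0r (gexpZ muI)// z2.
  rewrite -(gexpD muI _ _ br2 br3) -(mulrA (q i) (dd i) (gexp (fun s => g1 (X s)))) -(gexpZ muI _ _ (dd i) bg1).
  rewrite -addrA -mulrBr -(gexpB muI _ _ bT3 (bndM (bnd_cst D (dd i)) bg1)).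
  congr (_ + q i * _); apply: eq_gexp => s _; rewrite /r2 /r3; ring.
rewrite mainE.
have h1 : `|gexp r1| <= 8 * B * q i ^+ 2.
  apply: (gexp_norm_le muI) => // s Ds; rewrite normrM.
  rewrite (_ : 8 * B * q i ^+ 2 = 2 * (B * (4 * q i ^+ 2))); last by ring.
  apply: ler_pM => //; first exact: cm2.
  rewrite (le_trans (gT _ _))// ler_wpM2l// XiE [_ + _ - Xi s]addrC addKr exprMn mulrC ler_wpM2r ?sqr_ge0//.
  rewrite -[leLHS]ger0_norm ?sqr_ge0// normrX (_ : 4 = 2 ^+ 2) ?lerXn2r ?nnegrE// ?cu2//.
  by rewrite -natrX.
have h2 : `|gexp r2| <= 2 * B * `|q i|.
  apply: (gexp_norm_le muI) => // s Ds; rewrite normrM -[leRHS]mul1r.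
  apply: ler_pM => //; first exact: (psi2_norm_le1 hmu).
  rewrite (le_trans (g1L _ _))// [2 * B]mulrC -mulrA ler_wpM2l// XiE opprD addrA subrr add0r normrN normrM mulrC.
  by rewrite ler_wpM2r// cu2.
have h3 : `|gexp r3| <= 4 * B * (C * tau).
  rewrite (le_trans (gexp_norm muI A b br3))//.
  have bl : bounded_on D (fun s => `|\sum_j A i j * (tnth s j - tnth u j)|) by apply: bnd_norm; exact: bnd_dev.
  apply: (@le_trans _ _ (gexp (fun s => 4 * B * `|\sum_j A i j * (tnth s j - tnth u j)|))).
    apply: (gexp_le muI); [exact: bnd_norm|by apply: bndM => //; exact: bnd_cst|].
    move=> s Ds; rewrite normrM mulrAC; apply: ler_pM => //.
    rewrite (le_trans (psi2_lipschitz hmu _ _))// opprD addrACA subrr addr0 local_field_dev//.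
  rewrite (gexpZ muI)// ler_wpM2l ?mulr_ge0//; apply: gexp_abs_dev => //.
  exact: le_trans (Aalpha i) alpha_tau.
rewrite (le_trans (ler_normD _ _))// [`|_ * (_ + _)|]normrM.
have h23 : `|gexp r2 + gexp r3| <= 2 * B * `|q i| + 4 * B * (C * tau).
  by rewrite (le_trans (ler_normD _ _))// lerD.
rewrite (le_trans (lerD h1 (ler_wpM2l (normr_ge0 _) h23)))// le_eqVlt; apply/orP; left; apply/eqP.
by rewrite -[q i ^+ 2]real_normK ?num_real//; ring.
Qed.

(** kappa (20 + 8 C) comes from the integrations by parts with sum q^2 <= 2, 4 kappa C from the
    Taylor remainder of psi', C from the residual, 1 from the variance. *)
Definition stein_cst : R := kappa * (20 + 12 * C) + C + 1.

Lemma gibbs_stein (B : R) (g g1 : R -> R) : C11_pair B g g1 ->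
  `|gexp (fun s => X s * g (X s)) - v * gexp (fun s => g1 (X s))| <= B * (stein_cst * tau).
Proof.
move=> hg; have [[mg mg1] gB g1B g1L gT] := hg.
have B0 : 0 <= B by exact: le_trans (gB 0).
have [mX _] := bX.
have bg : bounded_on D (fun s => g (X s)) by apply: (bnd_comp (M := B)).
have bg1 : bounded_on D (fun s => g1 (X s)) by apply: (bnd_comp (M := B)).
pose T i s := (tnth s i - psi1 (local_field A s i + tnth b i)) : R.
pose W i s := (psi1 (local_field A s i + tnth b i) - tnth u i
      - dd i * (local_field A s i - local_field A u i)) : R.
have bT i : bounded_on D (T i) by apply: bndB; [exact: bnd_coord|exact: bnd_cmean].
have bW i : bounded_on D (W i).
  apply: bndB; first by apply: bndB; [exact: bnd_cmean|exact: bnd_cst].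
  apply: bndM; first exact: bnd_cst.
  by apply: bndB; [exact: bnd_local_field|exact: bnd_cst].
have bE : bounded_on D (fun s => \sum_i eta i * (tnth s i - tnth u i)) by exact: bnd_dev.
have bTg i := bndM (bT i) bg; have bWg i := bndM (bW i) bg.
have -> : gexp (fun s => X s * g (X s)) = \sum_i kappa * q i * gexp (fun s => T i s * g (X s))
   + \sum_i kappa * q i * gexp (fun s => W i s * g (X s))
   - gexp (fun s => (\sum_i eta i * (tnth s i - tnth u i)) * g (X s)).
  have b1 i : bounded_on D (fun s => kappa * q i * (T i s * g (X s))) by apply: bndM => //; exact: bnd_cst.
  have b2 i : bounded_on D (fun s => kappa * q i * (W i s * g (X s))) by apply: bndM => //; exact: bnd_cst.
  under [in RHS]eq_bigr do rewrite -(gexpZ muI)//.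
  under [X in _ + X - _]eq_bigr do rewrite -(gexpZ muI)//.
  rewrite -!(gexp_sum muI)// -(gexpD muI); [|exact: bnd_sum..].
  rewrite -(gexpB muI); [|by apply: bndD; exact: bnd_sum|exact: bndM].
  apply: eq_gexp => s _; rewrite {1}stat_decomp mulrBl mulrDl !mulr_suml.
  by congr (_ + _ - _); apply: eq_bigr => i _; rewrite mulrA.
have h1 : `|\sum_i kappa * q i * gexp (fun s => T i s * g (X s)) -
   (kappa * \sum_i q i ^+ 2 * dd i) * gexp (fun s => g1 (X s))| <= kappa * B * (20 + 8 * C) * tau.
  rewrite mulr_sumr mulr_suml -sumrB (le_trans (ler_norm_sum _ _ _))//.
  apply: (@le_trans _ _ (\sum_i kappa * B * (10 + 4 * C) * tau * q i ^+ 2)).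
    apply: ler_sum => i _; have := gexp_term i hg; rewrite -/(T i _) => ht.
    rewrite (_ : _ - _ = kappa * q i * (gexp (fun s => T i s * g (X s)) - q i * dd i * gexp (fun s => g1 (X s)))); last by ring.
    rewrite !normrM (ger0_norm kappa0) -[q i ^+ 2]real_normK ?num_real//.
    rewrite -mulrA -[q i ^+ 2]real_normK ?num_real// in ht *.
    rewrite -!mulrA ler_wpM2l//.
    apply: (le_trans (ler_wpM2l (normr_ge0 _) ht)).
    have := q_tau i; move: (normr_ge0 (q i)); move: `|q i| => x x0 xt.
    rewrite (_ : x * _ = B * (10 * (x * x ^+ 2) + 4 * C * tau * x ^+ 2)); last by ring.
    rewrite ler_wpM2l// (_ : (10 + 4 * C) * (tau * x ^+ 2) = 10 * (tau * x ^+ 2) + 4 * C * tau * x ^+ 2); last by ring.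
    by rewrite lerD2r ler_wpM2l// ler_wpM2r ?sqr_ge0.
  rewrite -mulr_sumr (_ : kappa * B * (20 + 8 * C) * tau = kappa * B * (10 + 4 * C) * tau * 2); last by ring.
  rewrite ler_wpM2l//; do 2 (apply: mulr_ge0 => //); first exact: mulr_ge0.
  by rewrite addr_ge0// mulr_ge0.
(* The remainder is at most four times the square of (A (sigma - u))_i, of mean at most C alpha;
   weighting by |q_i| calls for the bound on alpha times the l1 norm of [q]. *)
have h2 : `|\sum_i kappa * q i * gexp (fun s => W i s * g (X s))| <= kappa * B * (4 * C) * tau.
  rewrite (le_trans (ler_norm_sum _ _ _))//.
  apply: (@le_trans _ _ (\sum_i kappa * B * (4 * C) * (alpha * `|q i|))).
    apply: ler_sum => i _; rewrite normrM normrM (ger0_norm kappa0).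
    rewrite (_ : kappa * B * (4 * C) * (alpha * `|q i|) = kappa * `|q i| * (4 * B * (C * alpha))); last by ring.
    rewrite ler_wpM2l ?mulr_ge0//.
    have bl : bounded_on D (fun s => (\sum_j A i j * (tnth s j - tnth u j)) ^+ 2) by apply: bndX; exact: bnd_dev.
    rewrite (le_trans (gexp_norm muI A b (bWg i)))//.
    apply: (@le_trans _ _ (gexp (fun s => 4 * B * (\sum_j A i j * (tnth s j - tnth u j)) ^+ 2))).
      apply: (gexp_le muI); [exact: bnd_norm|by apply: bndM => //; exact: bnd_cst|].
      move=> s Ds; rewrite normrM mulrAC; apply: ler_pM => //.
      rewrite /W {1}u_fix; have := psi1_taylor hmu (local_field A u i + tnth b i) (local_field A s i + tnth b i).
      have -> : local_field A s i + tnth b i - (local_field A u i + tnth b i) = local_field A s i - local_field A u i by ring.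
      by rewrite local_field_dev.
    rewrite (gexpZ muI)// ler_wpM2l ?mulr_ge0//.
    by rewrite (le_trans (gexp_dev_sqr _))// ler_wpM2l.
  rewrite -!mulr_sumr ler_wpM2l//.
  by rewrite mulr_ge0// ?mulr_ge0.
have h3 : `|gexp (fun s => (\sum_i eta i * (tnth s i - tnth u i)) * g (X s))| <= B * (C * tau).
  rewrite (le_trans (gexp_norm muI A b (bndM bE bg)))//.
  apply: (@le_trans _ _ (gexp (fun s => B * `|\sum_i eta i * (tnth s i - tnth u i)|))).
    apply: (gexp_le muI); [by apply: bnd_norm; exact: bndM|by apply: bndM; [exact: bnd_cst|exact: bnd_norm]|].
    by move=> s Ds; rewrite normrM mulrC ler_wpM2r.
  rewrite (gexpZ muI); last exact: bnd_norm.
  by rewrite ler_wpM2l//; exact: gexp_abs_dev.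
have h4 : `|(kappa * (\sum_i q i ^+ 2 * dd i) - v) * gexp (fun s => g1 (X s))| <= tau * B.
  by rewrite normrM ler_pM//; apply: (gexp_norm_le muI).
move: h1 h2 h3 h4; rewrite mulrBl.
set a1 := \sum_i kappa * q i * gexp (fun s => T i s * g (X s)).
set a2 := \sum_i kappa * q i * gexp (fun s => W i s * g (X s)).
set a3 := gexp (fun s => (\sum_i eta i * (tnth s i - tnth u i)) * g (X s)).
set a4 := _ * gexp (fun s => g1 (X s)); set a5 := v * gexp _ => h1 h2 h3 h4.
rewrite (_ : a1 + a2 - a3 - a5 = (a1 - a4) + a2 - a3 + (a4 - a5)); last by ring.
rewrite (le_trans (ler_normD _ _))// (le_trans (lerD (ler_normB _ _) (lexx _)))//.
rewrite (le_trans (lerD (lerD (ler_normD _ _) (lexx _)) (lexx _)))//.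
rewrite (le_trans (lerD (lerD (lerD h1 h2) h3) h4))// le_eqVlt; apply/orP; left; apply/eqP.
by rewrite /stein_cst; ring.
Qed.

End statistic.
End gibbs_stein.

(** * From Stein identities to Gaussian limits *)

Section expectation_functional.
Context (R : realType).
Implicit Types (f g : R -> R) (E : (R -> R) -> R).

(** Quadratic growth is the least class containing what is tested: x g(x) with bounded g, and
    x^2. *)
Definition quad f := measurable_fun [set: R] f /\
  exists c, forall x, `|f x| <= c * (1 + x ^+ 2).

(** An abstract positive, normalized linear functional, so that the Gibbs law of the statistic, the
    Gaussian and the Gaussian mixture over the field are treated at once. *)
Definition expectation_on_quad E :=
  [/\ (forall f g a, quad f -> quad g -> E (fun x => f x + a * g x) = E f + a * E g),
      (forall f g, quad f -> quad g -> (forall x, f x <= g x) -> E f <= E g) &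
      (forall r, E (fun=> r) = r)].

Lemma one_sqr_ge1 (x : R) : 1 <= 1 + x ^+ 2.
Proof. by rewrite lerDl sqr_ge0. Qed.

Lemma quad_le f c : measurable_fun [set: R] f ->
  (forall x, `|f x| <= c * (1 + x ^+ 2)) -> quad f.
Proof. by split=> //; exists c. Qed.

Lemma quad_bnd f c : measurable_fun [set: R] f -> (forall x, `|f x| <= c) -> quad f.
Proof.
move=> mf fc; apply: (quad_le (c := c)) => // x; rewrite (le_trans (fc x))//.
by rewrite ler_peMr ?one_sqr_ge1// (le_trans _ (fc 0)).
Qed.

Lemma quad_cst r : quad (fun=> r).
Proof. exact: (quad_bnd (c := `|r|)). Qed.

Lemma quad_id : quad id.
Proof.
apply: (quad_le (c := 1)) => // x; rewrite mul1r.
have := sqr_ge0 (`|x| - 1); rewrite -[x ^+ 2]real_normK ?num_real//; have := normr_ge0 x.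
by move: `|x| => y y0; rewrite sqrrB1; nra.
Qed.

Lemma quad_sqr : quad (fun x => x ^+ 2).
Proof.
apply: (quad_le (c := 1)) => [|x]; first exact: measurable_funX.
by rewrite mul1r ger0_norm ?sqr_ge0// lerDr.
Qed.

Lemma quadD f g : quad f -> quad g -> quad (fun x => f x + g x).
Proof.
move=> [mf [c fc]] [mg [d gd]]; apply: (quad_le (c := c + d)) => [|x].
  exact: measurable_funD.
by rewrite (le_trans (ler_normD _ _))// mulrDl lerD.
Qed.

Lemma quadZ r f : quad f -> quad (fun x => r * f x).
Proof.
move=> [mf [c fc]]; apply: (quad_le (c := `|r| * c)) => [|x].
  exact: measurable_funM.
by rewrite normrM -mulrA ler_wpM2l.
Qed.

Lemma quadN f : quad f -> quad (fun x => - f x).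
Proof.
by move=> qf; rewrite (_ : (fun x => - f x) = (fun x => -1 * f x));
  [exact: quadZ|apply/funext => x; rewrite mulN1r].
Qed.

Lemma quadB f g : quad f -> quad g -> quad (fun x => f x - g x).
Proof. by move=> qf qg; apply: quadD => //; exact: quadN. Qed.

Lemma quad_idM f c : measurable_fun [set: R] f -> (forall x, `|f x| <= c) ->
  quad (fun x => x * f x).
Proof.
move=> mf fc; have [_ [d hd]] := quad_id.
apply: (quad_le (c := d * c)) => [|x]; first exact: measurable_funM.
by rewrite normrM mulrAC ler_pM.
Qed.

Section theory.
Variable E : (R -> R) -> R.
Hypothesis hE : expectation_on_quad E.

Lemma eoqD f g : quad f -> quad g -> E (fun x => f x + g x) = E f + E g.
Proof.
move=> qf qg; have [h _ _] := hE; have := h f g 1 qf qg; rewrite mul1r => <-.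
by congr E; apply/funext => x; rewrite mul1r.
Qed.

Lemma eoqZ r f : quad f -> E (fun x => r * f x) = r * E f.
Proof.
move=> qf; have [h _ h3] := hE; have := h (fun=> 0) f r (quad_cst 0) qf; rewrite h3 add0r => <-.
by congr E; apply/funext => x; rewrite add0r.
Qed.

Lemma eoqB f g : quad f -> quad g -> E (fun x => f x - g x) = E f - E g.
Proof.
move=> qf qg; have [h _ _] := hE; have := h f g (-1) qf qg; rewrite mulN1r => <-.
by congr E; apply/funext => x; rewrite mulN1r.
Qed.

Lemma eoq_le f g : quad f -> quad g -> (forall x, f x <= g x) -> E f <= E g.
Proof. by have [_ h _] := hE; exact: h. Qed.

Lemma eoq_cst r : E (fun=> r) = r. Proof. by have [] := hE. Qed.

Lemma eoq_norm_le f g : quad f -> quad g -> (forall x, `|f x| <= g x) -> `|E f| <= E g.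
Proof.
move=> qf qg fg; rewrite ler_norml -mulN1r -eoqZ//.
apply/andP; split; apply: eoq_le => //; first exact: quadZ.
- by move=> x; rewrite mulN1r lerNl (le_trans _ (fg x))// -normrN ler_norm.
- by move=> x; rewrite (le_trans (ler_norm _)).
Qed.

Lemma eoq_norm_le_cst f c : quad f -> (forall x, `|f x| <= c) -> `|E f| <= c.
Proof. by move=> qf fc; rewrite -[leRHS]eoq_cst; apply: eoq_norm_le => //; exact: quad_cst. Qed.

End theory.

Lemma C11_is_derive B g g1 (x : R) : C11_pair B g g1 -> is_derive x 1 g (g1 x).
Proof.
move=> [_ _ _ _ gT]; apply: (@quadratic_is_derive _ _ _ _ B) => h _.
by have := gT x (x + h); rewrite [x + h - x]addrC addKr.
Qed.

Lemma C11_continuous B g g1 : C11_pair B g g1 -> continuous g.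
Proof. by move=> hg; apply: is_derive_continuous => x; exact: (C11_is_derive x hg). Qed.

Lemma lipschitz_continuous B g : (forall x y, `|g y - g x| <= B * `|y - x|) -> continuous g.
Proof.
move=> gL x; apply/cvgrPdist_le => e e0; near=> y.
rewrite distrC (le_trans (gL _ _))//.
have B1 : 0 < `|B| + 1 by rewrite ltr_wpDl.
apply: (@le_trans _ _ ((`|B| + 1) * `|y - x|)).
  by rewrite ler_wpM2r// (le_trans (ler_norm _))// lerDl.
rewrite -ler_pdivlMl// distrC; near: y; apply: cvgr_dist_le; first exact: cvg_id.
by rewrite mulr_gt0// invr_gt0.
Unshelve. all: by end_near. Qed.

Lemma C11_ge0 B g g1 : C11_pair B g g1 -> 0 <= B.
Proof. by move=> [_ /(_ 0) h _ _ _]; exact: le_trans h. Qed.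

Lemma C11_affine B g g1 (a t : R) : C11_pair B g g1 -> `|a| <= 1 ->
  C11_pair B (fun y => g (t + a * y)) (fun y => a * g1 (t + a * y)).
Proof.
move=> hg a1; have B0 := C11_ge0 hg; have [[mg mg1] gB g1B g1L gT] := hg.
have ma : measurable_fun [set: R] (fun y => t + a * y).
  by apply: measurable_funD => //; exact: measurable_funM.
split=> [|x|x|x y|x y].
- split; first exact: (measurableT_comp mg ma).
  by apply: measurable_funM => //; exact: (measurableT_comp mg1 ma).
- exact: gB.
- by rewrite normrM -[leRHS]mul1r ler_pM.
- rewrite -mulrBr normrM -[leRHS]mul1r ler_pM// (le_trans (g1L _ _))//.
  rewrite opprD addrACA subrr add0r -mulrBr normrM ler_wpM2l//.
  by rewrite ler_piMl.
- have := gT (t + a * x) (t + a * y).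
  rewrite (_ : t + a * y - (t + a * x) = a * (y - x)); last by ring.
  rewrite -mulrA [a * (_ * _)]mulrCA => /le_trans; apply.
  rewrite exprMn ler_wpM2l// ler_piMl ?sqr_ge0//.
  by rewrite -[_ ^+ 2]ger0_norm ?sqr_ge0// normrX exprn_ile1.
Qed.

(** The bounds pass under [E] pointwise. As [E] is only a functional, measurability in x cannot come
    from Fubini; it is deduced from continuity, which the quantitative bounds provide. *)
Lemma C11_average E B g g1 (a b : R) : expectation_on_quad E -> C11_pair B g g1 -> `|a| <= 1 ->
  C11_pair B (fun x => E (fun y => g (a * x + b * y))) (fun x => a * E (fun y => g1 (a * x + b * y))).
Proof.
move=> hE hg a1; have B0 := C11_ge0 hg; have [[mg mg1] gB g1B g1L gT] := hg.
have ma x : measurable_fun [set: R] (fun y => a * x + b * y).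
  by apply: measurable_funD => //; exact: measurable_funM.
have q0 x : quad (fun y => g (a * x + b * y)).
  by apply: (quad_bnd (c := B)) => //; exact: (measurableT_comp mg (ma x)).
have q1 x : quad (fun y => g1 (a * x + b * y)).
  by apply: (quad_bnd (c := B)) => //; exact: (measurableT_comp mg1 (ma x)).
have e x y z : a * y + b * z - (a * x + b * z) = a * (y - x) by ring.
have bd1 x y : `|a * E (fun z => g1 (a * y + b * z)) - a * E (fun z => g1 (a * x + b * z))| <= B * `|y - x|.
  rewrite -mulrBr -(eoqB hE)// normrM -[leRHS]mul1r ler_pM//.
  apply: (eoq_norm_le_cst hE); first exact: quadB.
  move=> z; rewrite (le_trans (g1L _ _))// e normrM ler_wpM2l// ler_piMl//.
have bd0 x y : `|E (fun z => g (a * y + b * z)) - E (fun z => g (a * x + b * z)) -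
    (y - x) * (a * E (fun z => g1 (a * x + b * z)))| <= B * (y - x) ^+ 2.
  rewrite mulrA -(eoqB hE)// -(eoqZ hE)// -(eoqB hE); [|exact: quadB|exact: quadZ].
  apply: (eoq_norm_le_cst hE); first by apply: quadB; [exact: quadB|exact: quadZ].
  move=> z; have := gT (a * x + b * z) (a * y + b * z); rewrite e [(y - x) * a]mulrC => /le_trans; apply.
  rewrite ler_wpM2l// exprMn ler_piMl ?sqr_ge0//.
  by rewrite -[_ ^+ 2]ger0_norm ?sqr_ge0// normrX exprn_ile1.
split=> [|x|x|x y|x y].
- split; apply: continuous_measurable_fun.
    apply: (is_derive_continuous (df := fun x => a * E (fun y => g1 (a * x + b * y)))) => x.
    apply: (@quadratic_is_derive _ _ _ _ B) => h _.
    by have := bd0 x (x + h); rewrite [x + h - x]addrC addKr.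
  exact: (lipschitz_continuous bd1).
- by apply: (eoq_norm_le_cst hE).
- by rewrite normrM -[leRHS]mul1r ler_pM//; exact: (eoq_norm_le_cst hE).
- exact: bd1.
- exact: bd0.
Qed.

End expectation_functional.

Section trigonometric_bounds.
Context (R : realType).

Lemma sin_norm_le (x : R) : `|sin x| <= `|x|.
Proof.
have := @is_derive_lipschitz R (@sin R) (@cos R) 1 0 x (fun y => is_derive_sin y) (@cos_max R).
by rewrite sin0 !subr0 mul1r.
Qed.

Lemma cos_ge_quadratic (x : R) : 1 - cos x <= x ^+ 2 / 2.
Proof.
have xE : x = (x / 2) *+ 2 by rewrite -mulr_natr divfK.
rewrite [in cos x]xE cos_mulr2n cos2sin2.
have : sin (x / 2) ^+ 2 <= (x / 2) ^+ 2.
  rewrite -[leLHS]ger0_norm ?sqr_ge0// -[leRHS]ger0_norm ?sqr_ge0// !normrX lerXn2r ?nnegrE//.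
  exact: sin_norm_le.
rewrite exprMn exprVn -mulr_natl; move: (sin _ ^+ 2) (x ^+ 2) => s y.
by move=> h; lra.
Qed.

(** A chord of the unit circle is no longer than its arc: the left side is 2 - 2 cos(b - a). *)
Lemma rotation_dist (a b : R) :
  (cos b - cos a) ^+ 2 + (sin b - sin a) ^+ 2 <= (b - a) ^+ 2.
Proof.
have := cos_ge_quadratic (b - a); rewrite cosB => h.
have h1 := cos2Dsin2 a; have h2 := cos2Dsin2 b.
move: h h1 h2; move: (cos a) (sin a) (cos b) (sin b) ((b - a) ^+ 2) => x y z w t.
by move=> h h1 h2; nra.
Qed.

End trigonometric_bounds.

(** * Rotation from the law of the statistic to a Gaussian *)

Section interpolation.
Context (R : realType) (E N : (R -> R) -> R) (v K K2 delta : R).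
Hypotheses (hE : expectation_on_quad E) (hN : expectation_on_quad N).
Hypotheses (EK : E (fun x => x ^+ 2) <= K) (NK : N (fun x => x ^+ 2) <= K2).
Hypothesis N_stein : forall B g g1, C11_pair B g g1 -> N (fun x => x * g x) = v * N g1.
Hypothesis E_stein : forall B g g1, C11_pair B g g1 ->
  `|E (fun x => x * g x) - v * E g1| <= B * delta.
Hypotheses (v0 : 0 <= v) (delta0 : 0 <= delta).
Variables (B : R) (h h1 h2 : R -> R).
Hypotheses (hh : C11_pair B h h1) (hh1 : C11_pair B h1 h2).

(** At angle 0 this is [h], at pi/2 the constant [N h], so E (H a) runs from E h to N h. *)
Let H (a x : R) : R := N (fun y => h (cos a * x + sin a * y)).

Let cos1 (a : R) : `|cos a| <= 1. Proof. exact: cos_max. Qed.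
Let sin1 (a : R) : `|sin a| <= 1. Proof. exact: sin_max. Qed.

(** To first order the change is dC E[x G] + dS N[y h1]. The two Stein identities turn this into v
    (dC C + dS S) E[G2] up to delta, and on the circle dC C + dS S is of second order. *)
Lemma interpolation_step (a b : R) :
  `|E (H b) - E (H a)| <= B * (`|b - a| * delta + (K + K2 + v) * (b - a) ^+ 2).
Proof.
have B0 := C11_ge0 hh; have [[mh mh1] hB h1B h1L hT] := hh.
have [[_ mh2] _ h2B h2L h1T] := hh1.
set C := cos a; set S := sin a; set dC := cos b - C; set dS := sin b - S; set d := b - a.
have dd : dC ^+ 2 + dS ^+ 2 <= d ^+ 2 by exact: rotation_dist.
have CS : C ^+ 2 + S ^+ 2 = 1 by exact: cos2Dsin2.
have CS' : (C + dC) ^+ 2 + (S + dS) ^+ 2 = 1 by rewrite /dC /dS !subrKC; exact: cos2Dsin2.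
pose G x := N (fun y => h1 (C * x + S * y)).
pose G2 x := N (fun y => h2 (C * x + S * y)).
have pH a' : C11_pair B (H a') (fun x => cos a' * N (fun y => h1 (cos a' * x + sin a' * y))).
  exact: (C11_average _ hN hh (cos1 a')).
have pG : C11_pair B G (fun x => C * G2 x) by exact: (C11_average _ hN hh1 (cos1 a)).
have [[mG mCG2] GB _ _ _] := pG.
have ma x : measurable_fun [set: R] (fun y => C * x + S * y).
  by apply: measurable_funD => //; exact: measurable_funM.
have ma' x : measurable_fun [set: R] (fun y => cos b * x + sin b * y).
  by apply: measurable_funD => //; exact: measurable_funM.
have G2B x : `|G2 x| <= B.
  apply: (eoq_norm_le_cst hN) => //.
  by apply: (quad_bnd (c := B)) => //; exact: (measurableT_comp mh2 (ma x)).
have mG2 : measurable_fun [set: R] G2.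
  apply: continuous_measurable_fun; apply: (lipschitz_continuous (B := B)) => x y.
  have q z : quad (fun y => h2 (C * z + S * y)).
    by apply: (quad_bnd (c := B)) => //; exact: (measurableT_comp mh2 (ma z)).
  rewrite -(eoqB hN)//; apply: (eoq_norm_le_cst hN); first exact: quadB.
  move=> z; rewrite (le_trans (h2L _ _))// opprD addrACA subrr addr0 -mulrBr normrM.
  by rewrite ler_wpM2l// ler_piMl//; exact: cos1.
have qG2 : quad G2 by exact: (quad_bnd (c := B)).
have qxG : quad (fun x => x * G x) by exact: (quad_idM (c := B)).
have qH a' : quad (H a') by have [[m _] hb _ _ _] := pH a'; exact: (quad_bnd (c := B)).
(* Taylor expansion of [h] along the rotation, Gaussian integration by parts in y, and (dC x + dS
   y)^2 <= d^2 (x^2 + y^2). *)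
have ptw x : `|H b x - H a x - (dC * (x * G x) + dS * (v * S * G2 x))| <= B * d ^+ 2 * (x ^+ 2 + K2).
  have ibp : N (fun y => y * h1 (C * x + S * y)) = v * S * G2 x.
    rewrite (N_stein (C11_affine (C * x) hh1 (sin1 a))) (eoqZ hN) ?mulrA//.
    by apply: (quad_bnd (c := B)) => //; exact: (measurableT_comp mh2 (ma x)).
  have q1 : quad (fun y => h1 (C * x + S * y)).
    by apply: (quad_bnd (c := B)) => //; exact: (measurableT_comp mh1 (ma x)).
  have q1y : quad (fun y => y * h1 (C * x + S * y)).
    by apply: (quad_idM (c := B)) => //; exact: (measurableT_comp mh1 (ma x)).
  have qa : quad (fun y => h (C * x + S * y)).
    by apply: (quad_bnd (c := B)) => //; exact: (measurableT_comp mh (ma x)).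
  have qb : quad (fun y => h (cos b * x + sin b * y)).
    by apply: (quad_bnd (c := B)) => //; exact: (measurableT_comp mh (ma' x)).
  have qc : quad (fun y => dC * x * h1 (C * x + S * y)) := quadZ (dC * x) q1.
  have qd : quad (fun y => dS * (y * h1 (C * x + S * y))) := quadZ dS q1y.
  rewrite -ibp /G mulrA -(eoqZ hN (dC * x) q1) -(eoqZ hN dS q1y) -(eoqD hN qc qd).
  rewrite -(eoqB hN qb qa) -(eoqB hN (quadB qb qa) (quadD qc qd)).
  apply: (@le_trans _ _ (N (fun y => B * d ^+ 2 * (x ^+ 2 + y ^+ 2)))).
    apply: (eoq_norm_le hN).
    - exact: (quadB (quadB qb qa) (quadD qc qd)).
    - by apply: quadZ; apply: quadD; [exact: quad_cst|exact: quad_sqr].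
    move=> y; have := hT (C * x + S * y) (cos b * x + sin b * y).
    have e : cos b * x + sin b * y - (C * x + S * y) = dC * x + dS * y by rewrite /dC /dS; ring.
    rewrite e (_ : dC * x * _ + _ = (dC * x + dS * y) * h1 (C * x + S * y)); last by ring.
    move=> /le_trans; apply; rewrite -mulrA ler_wpM2l//.
    apply: (@le_trans _ _ ((dC ^+ 2 + dS ^+ 2) * (x ^+ 2 + y ^+ 2))).
      rewrite -subr_ge0 (_ : _ - _ = (dC * y - dS * x) ^+ 2) ?sqr_ge0//; by ring.
    by rewrite ler_wpM2r// addr_ge0 ?sqr_ge0.
  rewrite (eoqZ hN); last by apply: quadD; [exact: quad_cst|exact: quad_sqr].
  have -> : N (fun y => x ^+ 2 + y ^+ 2) = x ^+ 2 + N (fun y => y ^+ 2).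
    by rewrite -[in RHS](eoq_cst hN (x ^+ 2)); exact: (eoqD hN (quad_cst _) (quad_sqr R)).
  by apply: ler_wpM2l; [rewrite mulr_ge0 ?sqr_ge0|rewrite lerD2l].
have qr : quad (fun x => dC * (x * G x) + dS * (v * S * G2 x)).
  by apply: quadD; apply: quadZ => //; exact: quadZ.
have main : `|E (H b) - E (H a) - (dC * E (fun x => x * G x) + dS * (v * S * E G2))|
    <= B * d ^+ 2 * (K + K2).
  rewrite -(eoqZ hE _ qG2) -!(eoqZ hE)//; last exact: quadZ.
  rewrite -(eoqD hE); [|exact: quadZ|by apply: quadZ; exact: quadZ].
  rewrite -(eoqB hE)// -(eoqB hE)//; last exact: quadB.
  apply: (@le_trans _ _ (E (fun x => B * d ^+ 2 * (x ^+ 2 + K2)))).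
    apply: (eoq_norm_le hE) => //; first by apply: quadB => //; exact: quadB.
    by apply: quadZ; apply: quadD; [exact: quad_sqr|exact: quad_cst].
  rewrite (eoqZ hE); last by apply: quadD; [exact: quad_sqr|exact: quad_cst].
  have -> : E (fun x => x ^+ 2 + K2) = E (fun x => x ^+ 2) + K2.
    by rewrite -[in RHS](eoq_cst hE K2); exact: (eoqD hE (quad_sqr R) (quad_cst _)).
  by apply: ler_wpM2l; [rewrite mulr_ge0 ?sqr_ge0|rewrite lerD2r].
have st := E_stein pG; rewrite (eoqZ hE)// in st.
have G2b : `|E G2| <= B by exact: (eoq_norm_le_cst hE).
have dCd : `|dC| <= `|d|.
  rewrite -(ler_pXn2r (_ : (0 < 2)%N))// ?nnegrE// !real_normK ?num_real//.
  by rewrite (le_trans _ dd)// lerDl sqr_ge0.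
(* Both endpoints lie on the unit circle, which makes dC C + dS S equal to minus half the squared
   chord. *)
have rot : `|dC * C + dS * S| <= d ^+ 2.
  have -> : dC * C + dS * S = - (dC ^+ 2 + dS ^+ 2) / 2.
    have lem (x y z t : R) : z ^+ 2 + t ^+ 2 = 1 -> (z + x) ^+ 2 + (t + y) ^+ 2 = 1 ->
      x * z + y * t = - (x ^+ 2 + y ^+ 2) / 2 by move=> e1 e2; lra.
    exact: lem.
  rewrite mulNr normrN ger0_norm; last by rewrite divr_ge0// addr_ge0 ?sqr_ge0.
  by rewrite ler_pdivrMr// (le_trans dd)// ler_peMr ?sqr_ge0// ler1n.
have e : E (H b) - E (H a) = (E (H b) - E (H a) - (dC * E (fun x => x * G x) + dS * (v * S * E G2)))
   + dC * (E (fun x => x * G x) - v * (C * E G2)) + v * (dC * C + dS * S) * E G2 by ring.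
rewrite e (le_trans (ler_normD _ _))// (le_trans (lerD (ler_normD _ _) (lexx _)))//.
have t2 : `|dC * (E (fun x => x * G x) - v * (C * E G2))| <= `|d| * (B * delta).
  by rewrite normrM ler_pM.
have t3 : `|v * (dC * C + dS * S) * E G2| <= v * d ^+ 2 * B.
  rewrite !normrM (ger0_norm v0) ler_pM// ?mulr_ge0// ler_wpM2l//.
rewrite (le_trans (lerD (lerD main t2) t3))// le_eqVlt; apply/orP; left; apply/eqP; ring.
Qed.

(** The quarter turn is cut into m + 1 equal steps: errors linear in the step add up to pi/2 times
    delta, quadratic ones vanish as m grows. No derivative in the angle is taken. *)
Lemma interpolation_bound : `|E h - N h| <= 2 * B * delta.
Proof.
have B0 := C11_ge0 hh.
have H0 : E (H 0) = E h.
  congr E; apply/funext => x; rewrite /H cos0 sin0.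
  rewrite -[RHS](eoq_cst hN (h x)); congr N; apply/funext => y.
  by rewrite mul1r mul0r addr0.
have H1 : E (H (pi / 2)) = N h.
  rewrite -[RHS](eoq_cst hE (N h)); congr E; apply/funext => x.
  rewrite /H cos_pihalf sin_pihalf; congr N; apply/funext => y.
  by rewrite mul1r mul0r add0r.
set M := K + K2 + v.
have bound (m : nat) : `|E h - N h| <= B * (pi / 2 * delta) + B * M * (pi / 2) ^+ 2 * m.+1%:R^-1.
  pose t (k : nat) : R := pi / 2 * (k%:R / m.+1%:R).
  have m0 : m.+1%:R != 0 :> R by rewrite pnatr_eq0.
  have t0 : t 0%N = 0 by rewrite /t !mul0r mulr0.
  have tm : t m.+1 = pi / 2 by rewrite /t divff// mulr1.
  have pi0 : 0 <= pi / 2 :> R by rewrite divr_ge0// pi_ge0.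
  have tS k : t k.+1 - t k = pi / 2 / m.+1%:R.
    by rewrite /t -mulrBr -mulrBl -natrB// subSnn mul1r.
  rewrite distrC -H1 -H0 -tm -t0.
  rewrite -(telescope_sumr (fun k => E (H (t k))) (leq0n m.+1)) (le_trans (ler_norm_sum _ _ _))//.
  apply: (@le_trans _ _ (\sum_(0 <= k < m.+1) B * (pi / 2 / m.+1%:R * delta + M * (pi / 2 / m.+1%:R) ^+ 2))).
    rewrite !big_mkord; apply: ler_sum => k _.
    have := interpolation_step (t k) (t k.+1); rewrite tS.
    by rewrite (ger0_norm (divr_ge0 pi0 (ler0n _ _))).
  rewrite sumr_const_nat subn0 -[leLHS]mulr_natl tm le_eqVlt; apply/orP; left; apply/eqP.
  by field; rewrite addrC natr1.
have lim : B * (pi / 2 * delta) + B * M * (pi / 2) ^+ 2 * m.+1%:R^-1 @[m --> \oo]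
    --> B * (pi / 2 * delta) + B * M * (pi / 2) ^+ 2 * 0.
  by apply: cvgD; [exact: cvg_cst|apply: cvgMr; exact: cvg_harmonic].
have : `|E h - N h| <= B * (pi / 2 * delta).
  move: lim; rewrite mulr0 addr0 => lim; rewrite -(cvg_lim _ lim)//.
  by apply: limr_ge; [apply/cvg_ex; eexists; exact: lim|near=> m; exact: bound].
have p2 : pi / 2 <= 2 :> R by rewrite ltW// pihalf_lt2.
by move=> /le_trans; apply; rewrite [2 * B]mulrC -[leRHS]mulrA ler_wpM2l// ler_wpM2r.
Unshelve. all: by end_near. Qed.

End interpolation.

(** * Gaussian expectations and their Stein identity *)

Section gaussian.
Context (R : realType) (s : R).
Hypothesis s0 : 0 < s.
Local Notation w := (normal_pdf 0 s).
Local Notation leb := (@lebesgue_measure R).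

Definition gaussE (f : R -> R) : R := \int[leb]_x (f x * w x).

Lemma centered_normal_pdfE x : w x = normal_peak s * expR (- (x ^+ 2 / (s ^+ 2 *+ 2))).
Proof. by rewrite normal_pdfE ?gt_eqF// /normal_fun subr0 mulNr. Qed.

(** Makes 1 + x^2 times the density of deviation s at most this constant times the density of
    deviation 2 s, so quadratic moments follow from the total mass of the wider Gaussian. With x^2 =
    2 s^2 t, the factor 1 + 3 s^2 is enough because exp(3t/4) >= 1 + 3t/4. *)
Definition wide_cst : R := (1 + 3 * s ^+ 2) * normal_peak s / normal_peak (2 * s).

Lemma wide_cst_ge0 : 0 <= wide_cst.
Proof.
by rewrite divr_ge0 ?normal_peak_ge0// mulr_ge0 ?normal_peak_ge0// addr_ge0// mulr_ge0// sqr_ge0.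
Qed.

Lemma normal_pdf_wide x : (1 + x ^+ 2) * w x <= wide_cst * normal_pdf 0 (2 * s) x.
Proof.
have s20 : 2 * s != 0 by rewrite gt_eqF// mulr_gt0.
rewrite centered_normal_pdfE normal_pdfE// /normal_fun subr0 mulNr.
rewrite /wide_cst -[_ / normal_peak (2 * s) * _]mulrA mulKf ?gt_eqF ?normal_peak_gt0//.
rewrite mulrCA [(1 + 3 * _) * _]mulrC -[leRHS]mulrA ler_wpM2l ?normal_peak_ge0//.
set t := x ^+ 2 / (s ^+ 2 *+ 2).
have xE : x ^+ 2 = 2 * s ^+ 2 * t.
  by rewrite /t -[_ *+ 2]mulr_natl; field; rewrite gt_eqF.
have -> : x ^+ 2 / ((2 * s) ^+ 2 *+ 2) = t / 4.
  have -> : (2 * s) ^+ 2 *+ 2 = s ^+ 2 *+ 2 * 4 by ring.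
  by rewrite invfM mulrA.
have t0 : 0 <= t by rewrite divr_ge0 ?sqr_ge0// mulrn_wge0// sqr_ge0.
have -> : - (t / 4) = 3 / 4 * t + - t by field.
rewrite expRD mulrA ler_wpM2r ?expR_ge0//.
have := expR_ge1Dx (3 / 4 * t); move: (expR _) => e te; rewrite xE.
have := sqr_ge0 s; move: (s ^+ 2) => q q0; nra.
Qed.

Lemma gaussE_integrable f : quad f -> leb.-integrable [set: R] (EFin \o (fun x => f x * w x)).
Proof.
move=> [mf [k fk]].
have i2 : leb.-integrable [set: R] (EFin \o (fun x => `|k| * wide_cst * normal_pdf 0 (2 * s) x)).
  exact: (integrableZl measurableT (`|k| * wide_cst) (integrable_normal_pdf 0 (2 * s))).
apply: (le_integrable _ _ _ i2) => //=.
  by apply/measurable_EFinP; apply: measurable_funM => //; exact: measurable_normal_pdf.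
move=> x _; rewrite lee_fin normrM (ger0_norm (normal_pdf_ge0 _ _ _)).
rewrite [leRHS]ger0_norm; last by rewrite mulr_ge0 ?normal_pdf_ge0// mulr_ge0 ?wide_cst_ge0.
rewrite -mulrA (le_trans _ (ler_wpM2l (normr_ge0 k) (normal_pdf_wide x)))//.
rewrite mulrA ler_wpM2r ?normal_pdf_ge0// (le_trans (fk x))// ler_wpM2r ?ler_norm//.
by rewrite addr_ge0 ?sqr_ge0.
Qed.

Lemma gaussE_expectation : expectation_on_quad gaussE.
Proof.
split=> [f g a qf qg|f g qf qg fg|r]; rewrite /gaussE.
- under eq_Rintegral do rewrite mulrDl -mulrA.
  rewrite RintegralD//; [|exact: gaussE_integrable|].
    by rewrite RintegralZl//; exact: gaussE_integrable.
  by have := gaussE_integrable (quadZ a qg); under eq_fun do rewrite -mulrA.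
- apply: le_Rintegral => //; [exact: gaussE_integrable..|].
  by move=> x _; rewrite ler_wpM2r// normal_pdf_ge0.
- rewrite RintegralZl//; last exact: integrable_normal_pdf.
  by rewrite /Rintegral integral_normal_pdf mulr1.
Qed.

Lemma gaussE_sqr_le : gaussE (fun x => x ^+ 2) <= wide_cst.
Proof.
have h := integral_normal_pdf 0 (2 * s); have i := integrable_normal_pdf 0 (2 * s).
rewrite -[leRHS]mulr1 (_ : 1 = \int[leb]_x normal_pdf 0 (2 * s) x); last by rewrite /Rintegral h.
rewrite -RintegralZl//; apply: le_Rintegral => //; first by apply: gaussE_integrable; exact: quad_sqr.
  exact: (integrableZl measurableT wide_cst i).
move=> x _; rewrite (le_trans _ (normal_pdf_wide x))// ler_wpM2r ?normal_pdf_ge0//.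
by rewrite lerDr.
Qed.

Lemma normal_pdf_is_derive (x : R) : is_derive x 1 w (- (x / s ^+ 2) * w x).
Proof.
rewrite (_ : w = fun x => normal_peak s * expR (- (2^-1 / s ^+ 2) * x ^+ 2)); last first.
  apply/funext => y; rewrite centered_normal_pdfE; congr (_ * expR _).
  by rewrite -[_ *+ 2]mulr_natl invfM; ring.
apply: is_derive_eq.
by rewrite /GRing.scale/= !mulr1; field; rewrite gt_eqF.
Qed.

(** The fundamental theorem on growing symmetric intervals, with dominated convergence for the
    integrals and vanishing boundary values. *)
Lemma Rintegral_derive_eq0 (F f : R -> R) : (forall x : R, is_derive x 1 F (f x)) ->
  continuous f -> leb.-integrable [set: R] (EFin \o f) ->
  F n.+1%:R @[n --> \oo] --> 0 -> F (- n.+1%:R) @[n --> \oo] --> 0 -> \int[leb]_x f x = 0.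
Proof.
move=> dF cf fi Fy FNy.
have mf : measurable_fun [set: R] f by exact: continuous_measurable_fun.
have cF := is_derive_continuous dF.
pose J n : set R := `[- n.+1%:R, n.+1%:R]%classic.
have ftc n : (\int[leb]_(x in J n) (f x)%:E = (F n.+1%:R)%:E - (F (- n.+1%:R))%:E)%E.
  apply: continuous_FTC2.
  - by rewrite gtrN.
  - exact: continuous_subspaceT.
  - split=> [x _||]; first by have [] := dF x.
    + by apply: cvg_at_right_filter; exact: cF.
    + by apply: cvg_at_left_filter; exact: cF.
  - by move=> x _; rewrite derive1E; have [_ ->] := dF x.
pose f_ n : R -> \bar R := (EFin \o f) \_ (J n).
have [] := @dominated_convergence _ _ _ leb setT measurableT f_ (EFin \o f) (EFin \o (fun x => `|f x|)).
- move=> n; apply/measurable_restrict => //.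
    exact: measurable_itv.
  by rewrite setTI; apply/measurable_EFinP; exact: measurable_funTS.
- exact/measurable_EFinP.
- apply: aeW => x _; apply: cvg_near_cst; near=> n.
  rewrite /f_ patchE mem_set//= /J /= in_itv/= -ler_norml.
  near: n; exists (Num.truncn `|x|) => // n /= xn.
  by rewrite (le_trans (ltW (truncnS_gt _)))// ler_nat.
- exact: (integrable_abse fi).
- apply: aeW => x n _; rewrite /f_ patchE; case: ifP => _ //=.
  by rewrite normr0 lee_fin.
move=> _ _ lim.
have e : [sequence (\int[leb]_x f_ n x)%E]_n = (fun n => (F n.+1%:R - F (- n.+1%:R))%:E).
  by apply/funext => n; rewrite /= /f_ -integral_mkcond ftc.
rewrite e in lim.
have lim0 : (F n.+1%:R - F (- n.+1%:R))%:E @[n --> \oo] --> 0%E.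
  by apply: cvg_EFin; [exact: nearW|rewrite -[X in _ --> X](subrr 0); exact: cvgB].
by rewrite /Rintegral (cvg_unique _ lim lim0).
Unshelve. all: by end_near. Qed.

(** The function -s^2 w g is a primitive of (x g - s^2 g1) w and vanishes at infinity. *)
Lemma gaussE_stein B g g1 : C11_pair B g g1 ->
  gaussE (fun x => x * g x) = s ^+ 2 * gaussE g1.
Proof.
move=> hg; have B0 := C11_ge0 hg; have [[mg mg1] gB g1B g1L gT] := hg.
have sn0 : s != 0 by rewrite gt_eqF.
have q1 : quad g1 by exact: (quad_bnd (c := B)).
have qx : quad (fun x => x * g x) by exact: (quad_idM (c := B)).
have cw := @continuous_normal_pdf R 0 s sn0.
have cg := C11_continuous hg; have cg1 := lipschitz_continuous g1L.
pose f x := x * g x * w x - s ^+ 2 * g1 x * w x.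
have fi1 := gaussE_integrable qx; have fi2 := gaussE_integrable (quadZ (s ^+ 2) q1).
have dF (x : R) : is_derive x 1 (fun x => - s ^+ 2 * (w x * g x)) (f x).
  have d1 := normal_pdf_is_derive x; have d2 := C11_is_derive x hg.
  have d3 := is_deriveM d1 d2; have d4 := is_deriveZ (- s ^+ 2) d3.
  apply: (@is_derive_eq _ _ _ _ _ _ _ _ d4); rewrite /f /GRing.scale/=; field; exact: sn0.
(* Domination by the wider density gives w(x) = O(1 / |x|), which suffices since g is bounded. *)
have lim (h : nat -> R) : (forall n, `|h n| = n.+1%:R) -> - s ^+ 2 * (w (h n) * g (h n)) @[n --> \oo] --> 0.
  move=> hn; apply/norm_cvg0P.
  apply: (@squeeze_cvgr _ _ _ _ (fun=> 0) (fun n => s ^+ 2 * (wide_cst * normal_peak (2 * s) * B * n.+1%:R^-1))).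
  - apply: nearW => n; rewrite normr_ge0/= normrM normrN (ger0_norm (sqr_ge0 s)).
    apply: (ler_wpM2l (sqr_ge0 s)); rewrite normrM (ger0_norm (normal_pdf_ge0 _ _ _)).
    rewrite [leRHS]mulrAC ler_pM ?normal_pdf_ge0// ler_pdivlMr//.
    have := normal_pdf_wide (h n); rewrite -[_ ^+ 2]real_normK ?num_real// hn => wide.
    apply: (@le_trans _ _ ((1 + n.+1%:R ^+ 2) * w (h n))).
      rewrite mulrC ler_wpM2r ?normal_pdf_ge0// -[leLHS]mul1r ler_wpDl// expr2 ler_wpM2r// ler1n.
    by [].
    rewrite (le_trans wide)// ler_wpM2l ?wide_cst_ge0// normal_pdf_ub// mulf_neq0//.
  - exact: cvg_cst.
  - set K := wide_cst * _ * B.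
    have h1 : K * n.+1%:R^-1 @[n --> \oo] --> K * 0 by apply: cvgMr; exact: cvg_harmonic.
    have : s ^+ 2 * (K * n.+1%:R^-1) @[n --> \oo] --> s ^+ 2 * (K * 0) by exact: cvgMr.
    by rewrite !mulr0.
have : \int[leb]_x f x = 0.
  apply: (Rintegral_derive_eq0 dF).
  - move=> x; apply: cvgB; apply: cvgM; try exact: cw.
      by apply: cvgM; [exact: cvg_id|exact: cg].
    by apply: cvgM; [exact: cvg_cst|exact: cg1].
  - exact: (integrableB measurableT fi1 fi2).
  - by apply: lim => n; rewrite ger0_norm.
  - by apply: lim => n; rewrite normrN ger0_norm.
rewrite RintegralB// => /eqP; rewrite subr_eq0 => /eqP e; rewrite [LHS]e.
exact: (eoqZ gaussE_expectation (s ^+ 2) q1).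
Qed.

Lemma normal_probE (A : set R) : measurable A -> 
  normal_prob 0 s A = (gaussE (\1_A))%:E.
Proof.
move=> mA; rewrite /gaussE /Rintegral.
have q : quad (\1_A) by apply: (quad_bnd (c := 1)) => // x; rewrite indicE; case: (_ \in _); rewrite ?normr1 ?normr0.
rewrite fineK; last by have := gaussE_integrable q; exact: integrable_fin_num.
rewrite /normal_prob [LHS]integral_mkcond; congr (integral _ _ _); apply/funext => x.
by rewrite patchE indicE; case: ifP; rewrite ?mul1r ?mul0r.
Qed.

Lemma normal_prob_itv_le (a b : R) : a <= b ->
  (normal_prob 0 s (`]a, b]%classic) <= (normal_peak s * (b - a))%:E)%E.
Proof.
move=> ab; apply: (@le_trans _ _ (\int[leb]_(x in `]a, b]%classic) (normal_peak s)%:E)%E).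
  apply: ge0_le_integral => //.
  - by move=> x _; rewrite lee_fin normal_pdf_ge0.
  - by apply/measurable_EFinP; apply: measurable_funTS; exact: measurable_normal_pdf.
  - by move=> x _; rewrite lee_fin normal_pdf_ub// gt_eqF.
rewrite integral_cst//= lebesgue_measure_itv/= lte_fin.
by case: ltP => // ba; rewrite mule0 lee_fin mulr_ge0 ?normal_peak_ge0// subr_ge0.
Qed.

Lemma normal_prob_ray_lipschitz (a b : R) : a <= b ->
  gaussE (\1_(`]-oo, b]%classic)) <= gaussE (\1_(`]-oo, a]%classic)) + normal_peak s * (b - a).
Proof.
move=> ab.
have q (A : set R) : measurable A -> quad (\1_A).
  move=> mA; apply: (quad_bnd (c := 1)) => // x.
  by rewrite indicE; case: (_ \in _); rewrite ?normr1 ?normr0.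
have -> : \1_(`]-oo, b]%classic) = (fun x => \1_(`]-oo, a]%classic) x + \1_(`]a, b]%classic) x) :> (R -> R).
  apply/funext => x; rewrite !indicE !mem_setE !in_itv/=.
  by case: (leP x a) => xa /=; rewrite ?(le_trans xa ab) ?addr0// add0r.
rewrite (eoqD gaussE_expectation); [|exact: q..].
by rewrite lerD2l -lee_fin -normal_probE// normal_prob_itv_le.
Qed.

End gaussian.

(** * Smooth cutoffs and comparison of distribution functions *)

Section logistic.
Context (R : realType).
Implicit Types x : R.

(** The decreasing variant, so that a steep rescaling approximates the indicator of a left
    half-line. *)
Definition logistic x : R := (1 + expR x)^-1.

Lemma logistic_gt0 x : 0 < logistic x.
Proof. by rewrite invr_gt0 addr_gt0 ?expR_gt0. Qed.

Lemma logistic_le1 x : logistic x <= 1.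
Proof. by rewrite invf_le1 ?lerDl ?expR_ge0// addr_gt0 ?expR_gt0. Qed.

Lemma logistic_le_inv x : 0 < x -> logistic x <= x^-1.
Proof.
move=> x0; rewrite lef_pV2 ?posrE ?addr_gt0 ?expR_gt0//.
by have := expR_ge1Dx x; lra.
Qed.

Lemma logisticN x : logistic (- x) = 1 - logistic x.
Proof.
rewrite /logistic expRN; have e0 := expR_gt0 x; have e1 : 1 + expR x != 0 by rewrite gt_eqF// addr_gt0.
by field; rewrite e1 gt_eqF.
Qed.

Lemma logistic_is_derive x : is_derive x 1 logistic (logistic x ^+ 2 - logistic x).
Proof.
have e1 (y : R) : 1 + expR y != 0 by rewrite gt_eqF// addr_gt0 ?expR_gt0.
have d1 : is_derive x 1 (fun y => 1 + expR y) (0 + expR x) by exact: is_deriveD.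
have d2 := @is_deriveV R (fun y => 1 + expR y) x (0 + expR x) 1 (e1 x) d1.
apply: (is_derive_eq d2); rewrite /GRing.scale/= add0r /logistic.
by field.
Qed.

(* The derivatives of the logistic function are polynomials in it. *)
Lemma poly_logistic_is_derive (p : {poly R}) (k t x : R) :
  is_derive x 1 (fun y => p.[logistic (k * (y - t))])
    (k * (p^`() * ('X^2 - 'X)).[logistic (k * (x - t))]).
Proof.
have d1 : is_derive x 1 (fun y => k * (y - t)) (k * (1 - 0)).
  by apply: is_deriveZ; exact: is_deriveB.
have d2 := @is_derive1_comp R logistic (fun y => k * (y - t)) x _ _ (logistic_is_derive (k * (x - t))) d1.
have d3 := @is_derive1_comp R (horner p) (fun y => logistic (k * (y - t))) x _ _ (is_derive_poly p _) d2.
apply: (is_derive_eq d3); rewrite hornerM hornerD hornerN hornerXn hornerX; ring.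
Qed.

Lemma C11_of_derive (B : R) (h h1 h2 : R -> R) : 
  (forall x, is_derive x 1 h (h1 x)) -> (forall x, is_derive x 1 h1 (h2 x)) ->
  (forall x, `|h x| <= B) -> (forall x, `|h1 x| <= B) -> (forall x, `|h2 x| <= B) ->
  C11_pair B h h1.
Proof.
move=> d1 d2 hB h1B h2B; have h1L x y : `|h1 y - h1 x| <= B * `|y - x| by exact: is_derive_lipschitz.
split=> //; last by move=> x y; by rewrite [(y - x) * _]mulrC; exact: (is_derive_taylor _ _ d1).
by split; apply: continuous_measurable_fun; apply: is_derive_continuous.
Qed.

Definition cutoff (k t x : R) : R := logistic (k * (x - t)).

(** Two nested C11 pairs involve three derivatives. Each brings a factor k and the map p -> p' (X^2
    - X) on polynomials in the logistic value; the polynomials reached from X are bounded by 1 on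
    [0, 1]. *)
Lemma cutoff_C11 (k t : R) : 1 <= k -> exists h1 h2,
  C11_pair (k ^+ 3) (cutoff k t) h1 /\ C11_pair (k ^+ 3) h1 h2.
Proof.
move=> k1; have k0 : 0 <= k := le_trans ler01 k1.
pose P := ('X^2 - 'X : {poly R}); pose D (p : {poly R}) := p^`() * P.
pose g (p : {poly R}) (j : nat) x := k ^+ j * p.[logistic (k * (x - t))].
have dg p j x : is_derive x 1 (g p j) (g (D p) j.+1 x).
  have d := is_deriveZ (k ^+ j) (poly_logistic_is_derive p k t x).
  have -> : g (D p) j.+1 x = k ^+ j * (k * (D p).[logistic (k * (x - t))]).
    by rewrite [RHS]mulrA -exprSr.
  rewrite /g /D; exact: d.
have e1 : D 'X = P by rewrite /D derivX mul1r.
have e2 : D P = ('X *+ 2 - 1) * P by rewrite {1}/D /P derivB derivX derivXn.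
have gB p j x : (j <= 3)%N -> (forall y, 0 <= y <= 1 -> `|p.[y]| <= 1) -> `|g p j x| <= k ^+ 3.
  move=> j3 pb; rewrite normrM -[leRHS]mulr1 ler_pM//.
    by rewrite ger0_norm ?exprn_ge0// ler_weXn2l.
  by apply: pb; rewrite ltW ?logistic_gt0// logistic_le1.
have b0 (y : R) : 0 <= y <= 1 -> `|'X.[y]| <= 1 by move=> /andP[y0 y1]; rewrite hornerX ger0_norm.
have b1 (y : R) : 0 <= y <= 1 -> `|P.[y]| <= 1.
  by move=> /andP[y0 y1]; rewrite !hornerE ler_norml; apply/andP; split; nra.
have b2 (y : R) : 0 <= y <= 1 -> `|(D P).[y]| <= 1.
  move=> /[dup] y01 /andP[y0 y1]; rewrite e2 hornerM normrM -[leRHS]mulr1 ler_pM ?b1//.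
  by rewrite !hornerE ler_norml; apply/andP; split; lra.
have b3 (y : R) : 0 <= y <= 1 -> `|(D (D P)).[y]| <= 1.
  move=> /[dup] y01 /andP[y0 y1]; rewrite {1}/D hornerM normrM -[leRHS]mulr1 ler_pM ?b1//.
  rewrite e2 derivM derivB derivMn derivX derivC subr0 /P derivB derivX derivXn.
  rewrite expr1 !(hornerM, hornerD, hornerN, hornerMn, hornerX, hornerXn, hornerC).
  by rewrite ler_norml; apply/andP; split; nra.
exists (g P 1), (g (D P) 2).
have e0 : cutoff k t = g 'X 0.
  by apply/funext => x; rewrite /g expr0 mul1r hornerX.
have d1 x : is_derive x 1 (g 'X 0) (g P 1 x) by rewrite -e1; exact: dg.
split; [rewrite e0; apply: (C11_of_derive d1 (dg P 1%N))|apply: (C11_of_derive (dg P 1%N) (dg (D P) 2%N))];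
  by move=> x; apply: gB.
Qed.

Lemma cutoff_quad k t : 1 <= k -> quad (cutoff k t).
Proof.
move=> /(cutoff_C11 t)[h1 [h2 [[[m _] hB _ _ _] _]]].
exact: (quad_bnd (c := k ^+ 3)).
Qed.

Section cutoff_bounds.
Variables (e : R).
Hypotheses (e0 : 0 < e) (e1 : e <= 1).
(** At distance e from the threshold the argument is then at least 1/e, where the logistic value is
    at most e. *)
Let k := e^-1 ^+ 2.

Lemma cutoff_small (t x : R) : t + e <= x -> cutoff k t x <= e.
Proof.
move=> tx; have xt : e <= x - t by rewrite lerBrDl.
have k0 : 0 < k by rewrite exprn_gt0// invr_gt0.
have h : e^-1 <= k * (x - t).
  by rewrite (le_trans _ (ler_wpM2l (ltW k0) xt))// /k expr2 -mulrA mulVf ?mulr1// gt_eqF.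
have p : 0 < k * (x - t) by rewrite (lt_le_trans _ h)// invr_gt0.
rewrite (le_trans (logistic_le_inv p))// -[leRHS]invrK lef_pV2 ?posrE// invr_gt0//.
Qed.

Lemma cutoff_large (t x : R) : x <= t - e -> 1 - e <= cutoff k t x.
Proof.
move=> xt; have := @cutoff_small x t; rewrite /cutoff -opprB mulrN logisticN => h.
by rewrite lerBlDr -lerBlDl h// -lerBrDr.
Qed.

Let ray (t x : R) : R := \1_(`]-oo, t]%classic) x.

Lemma cutoff_ge_ray t x : ray t x - e <= cutoff k (t + e) x.
Proof.
rewrite /ray indicE mem_setE in_itv/=; have [xt|xt] := leP x t; rewrite [_%:R]/=.
  by apply: cutoff_large; rewrite addrK.
by rewrite sub0r (le_trans _ (ltW (logistic_gt0 _)))// oppr_le0 ltW.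
Qed.

Lemma cutoff_le_ray t x : cutoff k (t - e) x <= ray t x + e.
Proof.
rewrite /ray indicE mem_setE in_itv/=; have [xt|xt] := leP x t; rewrite [_%:R]/=.
  by rewrite (le_trans (logistic_le1 _))// lerDl ltW.
by rewrite add0r cutoff_small// subrK ltW.
Qed.

Variables (E N : (R -> R) -> R) (M delta : R).
Hypotheses (hE : expectation_on_quad E) (hN : expectation_on_quad N).
Hypothesis N_ray : forall a b, a <= b -> N (ray b) <= N (ray a) + M * (b - a).
Hypothesis EN : forall B h h1 h2, C11_pair B h h1 -> C11_pair B h1 h2 ->
  `|E h - N h| <= 2 * B * delta.

Lemma quad_indic (A : set R) : measurable A -> quad (\1_A).
Proof.
move=> mA; apply: (quad_bnd (c := 1)) => // x.
by rewrite indicE; case: (_ \in _); rewrite ?normr1 ?normr0.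
Qed.

(** The indicator lies between cutoffs shifted by e, up to e; [N] absorbs the total shift 2e by its
    Lipschitz constant M. The sixth power of 1/e is k^3. *)
Lemma ray_distance t : `|E (ray t) - N (ray t)| <= 2 * e * (1 + M) + 2 * (e^-1 ^+ 6) * delta.
Proof.
have k1 : 1 <= k by rewrite exprn_ege1// invf_ge1.
have qr u : quad (ray u) by exact: quad_indic.
have qc u : quad (cutoff k u) by exact: cutoff_quad.
have ke : k ^+ 3 = e^-1 ^+ 6 by rewrite -exprM.
have Ec u : `|E (cutoff k u) - N (cutoff k u)| <= 2 * e^-1 ^+ 6 * delta.
  by have [h1 [h2 [c1 c2]]] := cutoff_C11 u k1; rewrite -ke; exact: (EN c1 c2).
have lo L (hL : expectation_on_quad L) u : L (ray u) - e <= L (cutoff k (u + e)).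
  rewrite -(eoq_cst hL e) -(eoqB hL)//; last exact: quad_cst.
  apply: (eoq_le hL) => //; first by apply: quadB => //; exact: quad_cst.
  by move=> x; rewrite (eoq_cst hL); exact: cutoff_ge_ray.
have up L (hL : expectation_on_quad L) u : L (cutoff k (u - e)) <= L (ray u) + e.
  rewrite -[X in _ <= _ + X](eoq_cst hL e) -(eoqD hL)//; last exact: quad_cst.
  apply: (eoq_le hL) => //; first by apply: quadD => //; exact: quad_cst.
  exact: cutoff_le_ray.
have e20 : 0 <= 2 * e by rewrite mulr_ge0// ltW.
have a1 := lo E hE t; have a2 := Ec (t + e); have a3 := up N hN (t + 2 * e).
have a4 := @N_ray t (t + 2 * e); rewrite lerDl e20 (_ : t + 2 * e - t = 2 * e) in a4; last by ring.
rewrite (_ : t + 2 * e - e = t + e) in a3; last by ring.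
have b1 := up E hE t; have b2 := Ec (t - e); have b3 := lo N hN (t - 2 * e).
have b4 := @N_ray (t - 2 * e) t; rewrite gerBl e20 (_ : t - (t - 2 * e) = 2 * e) in b4; last by ring.
rewrite (_ : t - 2 * e + e = t - e) in b3; last by ring.
have {}a4 := a4 isT; have {}b4 := b4 isT.
rewrite ler_norml; move: a2 b2; rewrite !ler_norml => /andP[_ a2] /andP[b2 _].
by apply/andP; split; lra.
Qed.

End cutoff_bounds.
End logistic.

Section central_limit.
Context (R : realType).

(** The level e is free: it is fixed first, to make the smoothing error small, and delta is then
    made small relative to e^6. *)
Lemma clt_of_stein (E : (R -> R) -> R) (v K delta e t : R) :
  expectation_on_quad E -> E (fun x => x ^+ 2) <= K -> 0 < v -> 0 <= delta ->
  (forall B g g1, C11_pair B g g1 -> `|E (fun x => x * g x) - v * E g1| <= B * delta) ->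
  0 < e -> e <= 1 ->
  `|E (\1_(`]-oo, t]%classic)) - gaussE (Num.sqrt v) (\1_(`]-oo, t]%classic))|
    <= 2 * e * (1 + normal_peak (Num.sqrt v)) + 2 * (e^-1 ^+ 6) * delta.
Proof.
move=> hE EK v0 delta0 stein e0 e1.
have s0 : 0 < Num.sqrt v by rewrite sqrtr_gt0.
have hN := gaussE_expectation s0.
apply: (ray_distance e0 e1 hE hN) => [a b ab|B h h1 h2 hh hh1].
  exact: normal_prob_ray_lipschitz.
apply: (interpolation_bound hE hN EK (gaussE_sqr_le s0) _ stein (ltW v0) delta0 hh hh1).
by move=> B' g g1 hg; rewrite (gaussE_stein s0 hg) sqr_sqrtr// ltW.
Qed.

Lemma KS_dist_le (nu1 nu2 : set R -> \bar R) (r : R) :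
  (forall t, `|fine (nu1 `]-oo, t]%classic) - fine (nu2 `]-oo, t]%classic)| <= r) ->
  `|KS_dist nu1 nu2| <= r.
Proof.
move=> h; rewrite /KS_dist; set S := [set _ | _ in _].
have S0 : S !=set0 by exists `|fine (nu1 `]-oo, 0]%classic) - fine (nu2 `]-oo, 0]%classic)|, 0.
have Sub : ubound S r by move=> _ [t _ <-].
rewrite ger0_norm; first exact: ge_sup.
apply: (@le_trans _ _ `|fine (nu1 `]-oo, 0]%classic) - fine (nu2 `]-oo, 0]%classic)|) => //.
by apply: ub_le_sup; [exists r|exists 0].
Qed.

End central_limit.

Lemma bnd_quad d (T : measurableType d) (R : realType) (D : set T) (X : T -> R) f :
  bounded_on D X -> quad f -> bounded_on D (fun s => f (X s)).
Proof.
move=> [mX [M XM]] [mf [c fc]]; apply: (bnd_comp (M := `|c| * (1 + M ^+ 2))) => // s Ds.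
rewrite (le_trans (fc _))// (le_trans (ler_wpM2r _ (ler_norm c)))//; first by rewrite addr_ge0 ?sqr_ge0.
rewrite ler_wpM2l// lerD2l -[leLHS]real_normK ?num_real// lerXn2r ?nnegrE ?XM//.
exact: le_trans (XM _ Ds).
Qed.

Section gibbs_law.
Context (R : realType) (mu : probability (Borel R) R).
Hypothesis muI : mu `[-1, 1]%classic = 1%E.
Context (n : nat) (A : 'M[R]_n) (b : n.-tuple (Borel R)).
Local Notation D := (@box _ (Borel R) (I11 R) n).
Local Notation gexp := (gexp mu A b).

Lemma gibbsE (B : set (n.-tuple (Borel R))) : measurable B ->
  gibbs mu A b B = (gexp (\1_B))%:E.
Proof.
move=> mB.
have mD : measurable D by exact: measurable_box.
have PD : prob_pow mu n D = 1%E by exact: prob_pow_box.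
have bB := bnd_indic R D mB.
rewrite gexpE /gibbs (partition_functionE muI) EFinM muleC; congr (_ * _)%E.
rewrite -(integral_fullE mD PD (bndW A b bB)) integral_mkcond.
apply: eq_integral => s _; rewrite patchE indicE.
by case: (s \in B); rewrite ?mul1r ?mul0r.
Qed.

Lemma measurable_gexp_ray (X : n.-tuple (Borel R) -> R) (t : R) : bounded_on D X ->
  bounded_on D (fun s => \1_(`]-oo, t]%classic) (X s) : R).
Proof.
move=> [mX _]; apply: (bnd_comp (M := 1)) => // s _.
by rewrite indicE; case: (_ \in _); rewrite ?normr1 ?normr0.
Qed.

Lemma gexp_expectation (X : n.-tuple (Borel R) -> R) : bounded_on D X ->
  expectation_on_quad (fun f => gexp (fun s => f (X s))).
Proof.
move=> bX; split=> [f g a qf qg|f g qf qg fg|r].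
- have bf := bnd_quad bX qf; have bg := bnd_quad bX qg.
  by rewrite (gexpD muI)// ?(gexpZ muI)//; apply: bndM => //; exact: bnd_cst.
- by apply: (gexp_le muI); [exact: bnd_quad bX qf|exact: bnd_quad bX qg|move=> s _; exact: fg].
- exact: (gexp_cst muI).
Qed.

Lemma bnd_lin_stat Q (v m : n.-tuple (Borel R)) : bounded_on D (fun s => lin_stat Q v s m).
Proof.
rewrite /lin_stat; apply: bndM; first exact: bnd_cst.
apply: bnd_sum => i _; apply: bndM; first exact: bnd_cst.
by apply: bndB; [exact: bnd_coord|exact: bnd_cst].
Qed.

Lemma stat_law_rayE Q (v m : n.-tuple (Borel R)) (t : R) :
  stat_law mu Q v A b m (`]-oo, t]%classic)
  = (gexp (fun s => \1_(`]-oo, t]%classic) (lin_stat Q v s m)))%:E.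
Proof.
have [mX _] := bnd_lin_stat Q v m.
rewrite /stat_law /pushforward gibbsE//; rewrite -[X in measurable X]setTI; exact: mX.
Qed.

End gibbs_law.

Section gibbs_clt.
Context (R : realType) (mu : probability (Borel R) R).
Hypothesis hmu : base_measure mu.
Context (n : nat) (A : 'M[R]_n) (b u : n.-tuple (Borel R)) (rho alpha : R).
Hypothesis hA : coupling_matrix A.
Hypotheses (rho0 : 0 <= rho) (rho1 : rho < 1) (Arho : forall i, \sum_j `|A i j| <= rho).
Hypotheses (Aalpha : forall i, \sum_j A i j ^+ 2 <= alpha).
Hypothesis u_fix : forall i, tnth u i = psi1 mu (local_field A u i + tnth b i).
Hypothesis nalpha : n%:R * alpha ^+ 2 <= 1.
Variables (q : 'I_n -> R) (kappa v tau : R).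
Hypotheses (kappa0 : 0 <= kappa) (tau0 : 0 <= tau) (alpha_tau : alpha <= tau ^+ 2).
Hypotheses (q_tau : forall i, `|q i| <= tau) (q2 : \sum_i q i ^+ 2 <= 2).
Hypothesis q_alpha : alpha * \sum_i `|q i| <= tau.
Let dd i := psi2 mu (local_field A u i + tnth b i).
Let eta i := kappa * q i - kappa * (\sum_j A i j * (dd j * q j)) - q i.
Hypotheses (eta_tau : \sum_i eta i ^+ 2 <= tau ^+ 2).
Hypotheses (v0 : 0 < v) (v_tau : `|kappa * (\sum_i q i ^+ 2 * dd i) - v| <= tau).

Lemma stein_cst_ge0 : 0 <= stein_cst rho kappa.
Proof.
have C0 : 0 <= dev_cst rho := le_trans ler01 (dev_cst_ge1 rho0 rho1).
by rewrite /stein_cst addr_ge0// addr_ge0// mulr_ge0// addr_ge0// mulr_ge0.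
Qed.

Lemma gibbs_clt (e t : R) : 0 < e -> e <= 1 ->
  `|gexp mu A b (fun s => \1_(`]-oo, t]%classic) (\sum_i q i * (tnth s i - tnth u i)))
    - gaussE (Num.sqrt v) (\1_(`]-oo, t]%classic))|
  <= 2 * e * (1 + normal_peak (Num.sqrt v)) + 2 * (e^-1 ^+ 6) * (stein_cst rho kappa * tau).
Proof.
move=> e0 e1; have muI := base_measureI hmu.
have bX := bnd_dev u q.
apply: (@clt_of_stein R (fun f => gexp mu A b (fun s => f (\sum_i q i * (tnth s i - tnth u i)))) v
  (2 * dev_cst rho) _ e t (gexp_expectation muI A b bX)) => //.
- exact: (gexp_stat_sqr hmu hA rho0 rho1 Arho Aalpha u_fix nalpha q2).
- by apply: mulr_ge0 => //; exact: stein_cst_ge0.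
- move=> B g g1 hg.
  exact: (gibbs_stein hmu hA rho0 rho1 Arho Aalpha u_fix nalpha kappa0 tau0 alpha_tau q_tau q2 q_alpha eta_tau v_tau hg).
Qed.

End gibbs_clt.

(** * Typical external fields *)

Section product_moments.
Context d (T : measurableType d) (R : realType) (nu : probability T R) (D : set T).
Hypotheses (mD : measurable D) (nuD : nu D = 1%E).
Variable n : nat.
Implicit Types (k : T -> R) (F : n.-tuple T -> R) (i j : 'I_n).
Local Notation Dn := (@box _ T D n).
Local Notation E f := (\int[prob_pow nu n]_(s in Dn) f s).
Local Notation E1 k := (\int[nu]_(z in D) k z).

Let mDn : measurable Dn. Proof. exact: measurable_box. Qed.
Let PDn : prob_pow nu n Dn = 1%E. Proof. exact: prob_pow_box. Qed.

Lemma bnd_tnth k j : bounded_on D k -> bounded_on Dn (fun s => k (tnth s j)).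
Proof.
move=> [mk [M kM]]; split; first by apply: (measurableT_comp mk); exact: measurable_tnth.
by exists M => s Ds; apply: kM; exact: Ds.
Qed.

Lemma expect_indep k F j : bounded_on D k -> bounded_on Dn F ->
  (forall s z, F (upd s j z) = F s) ->
  E (fun s => k (tnth s j) * F s) = E1 k * E F.
Proof.
move=> bk bF hF; rewrite (expect_resample mD nuD j); last by apply: bndM => //; exact: bnd_tnth.
rewrite -(expectZl mDn PDn)//; apply: expect_eq => s Ds.
transitivity (E1 (fun z => k z * F s)); last exact: (expectZr mD nuD).
by apply: expect_eq => z _; rewrite tnth_upd eqxx hF.
Qed.

Lemma expect_indep0 k F j : bounded_on D k -> bounded_on Dn F ->
  (forall s z, F (upd s j z) = F s) -> E1 k = 0 ->
  E (fun s => k (tnth s j) * F s) = 0.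
Proof. by move=> bk bF hF k0; rewrite expect_indep// k0 mul0r. Qed.

Section centered_sum.
Variables (k : T -> R) (a : 'I_n -> R).
Hypotheses (bk : bounded_on D k) (k0 : E1 k = 0).
(** Partial sums over a duplicate-free list, so that moments are computed by adding one index at a
    time. *)
Let S r s : R := \sum_(i <- r) a i * k (tnth s i).

Let bS r : bounded_on Dn (S r).
Proof. by apply: bnd_sum => i _; apply: bndM; [exact: bnd_cst|exact: bnd_tnth]. Qed.

Let S_upd r j s z : j \notin r -> S r (upd s j z) = S r s.
Proof.
move=> jr; rewrite /S big_seq [RHS]big_seq; apply: eq_bigr => i ir.
by rewrite tnth_upd; case: eqP => // ij; move: jr; rewrite -ij ir.
Qed.

Let S_mean r : uniq r -> E (S r) = 0.
Proof.
move=> _; rewrite (expect_sum mDn PDn); last first.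
  by move=> i _; apply: bndM; [exact: bnd_cst|exact: bnd_tnth].
rewrite big1// => i _; rewrite (expectZl mDn PDn); last exact: bnd_tnth.
by rewrite (expect_coord mD nuD)// k0 mulr0.
Qed.

Let S_sqr r : uniq r -> E (fun s => S r s ^+ 2) = E1 (fun z => k z ^+ 2) * \sum_(i <- r) a i ^+ 2.
Proof.
elim: r => [_|j r IH /= /andP[jr ur]].
  rewrite big_nil mulr0 -[RHS](expect_cst mDn PDn 0).
  by apply: expect_eq => s _; rewrite /S big_nil expr0n.
have b1 : bounded_on Dn (fun s => a j ^+ 2 * k (tnth s j) ^+ 2).
  by apply: bndM; [exact: bnd_cst|apply: bndX; exact: bnd_tnth].
have b2 : bounded_on Dn (fun s => 2 * a j * (k (tnth s j) * S r s)).
  by apply: bndM; [exact: bnd_cst|apply: bndM => //; exact: bnd_tnth].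
have b3 : bounded_on Dn (fun s => S r s ^+ 2) by exact: bndX.
transitivity (E (fun s => a j ^+ 2 * k (tnth s j) ^+ 2 + 2 * a j * (k (tnth s j) * S r s) + S r s ^+ 2)).
  by apply: expect_eq => s _; rewrite {1}/S big_cons -/(S r s); ring.
rewrite (expectD mDn PDn (bndD b1 b2) b3) (expectD mDn PDn b1 b2) IH//.
rewrite !(expectZl mDn PDn); [|by apply: bndM => //; exact: bnd_tnth|by apply: bndX; exact: bnd_tnth].
rewrite (expect_indep0 bk (bS r) _ k0); last by move=> s z; exact: S_upd.
rewrite (expect_coord mD nuD j (bndX 2 bk)) big_cons; ring.
Qed.

(** Expanding (a_j k_j + S)^4, the terms in S^3 and in S have mean zero, one by the centering of k_j
    and one by that of S. There remain 6 a^2 A + a^4 on top of 3 A^2, A being the sum of squares so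
    far, and this is at most 3 (A + a^2)^2. *)
Let S_four r : (forall z, D z -> `|k z| <= 1) -> uniq r ->
  E (fun s => S r s ^+ 4) <= 3 * (\sum_(i <- r) a i ^+ 2) ^+ 2.
Proof.
move=> k1; elim: r => [_|j r IH /= /andP[jr ur]].
  have -> : E (fun s => S [::] s ^+ 4) = 0; last by rewrite mulr_ge0 ?sqr_ge0.
  rewrite -[RHS](expect_cst mDn PDn 0).
  by apply: expect_eq => s _; rewrite /S big_nil expr0n.
have bj := bnd_tnth j bk.
have hu m s z : S r (upd s j z) ^+ m = S r s ^+ m by rewrite S_upd.
have b1 : bounded_on Dn (fun s => 4 * a j * (k (tnth s j) * S r s ^+ 3)).
  by apply: bndM; [exact: bnd_cst|exact: (bndM bj (bndX 3 (bS r)))].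
have b2 : bounded_on Dn (fun s => 6 * a j ^+ 2 * (k (tnth s j) ^+ 2 * S r s ^+ 2)).
  by apply: bndM; [exact: bnd_cst|exact: (bndM (bndX 2 bj) (bndX 2 (bS r)))].
have b3 : bounded_on Dn (fun s => 4 * a j ^+ 3 * (k (tnth s j) ^+ 3 * S r s)).
  by apply: bndM; [exact: bnd_cst|exact: (bndM (bndX 3 bj) (bS r))].
have b4 : bounded_on Dn (fun s => a j ^+ 4 * k (tnth s j) ^+ 4).
  by apply: bndM; [exact: bnd_cst|exact: (bndX 4 bj)].
have b0 := bndX 4 (bS r).
have -> : E (fun s => S (j :: r) s ^+ 4) = E (fun s => S r s ^+ 4 + 4 * a j * (k (tnth s j) * S r s ^+ 3)
   + 6 * a j ^+ 2 * (k (tnth s j) ^+ 2 * S r s ^+ 2) + 4 * a j ^+ 3 * (k (tnth s j) ^+ 3 * S r s)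
   + a j ^+ 4 * k (tnth s j) ^+ 4).
  by apply: expect_eq => s _; rewrite {1}/S big_cons -/(S r s); ring.
rewrite (expectD mDn PDn (bndD (bndD (bndD b0 b1) b2) b3) b4).
rewrite (expectD mDn PDn (bndD (bndD b0 b1) b2) b3) (expectD mDn PDn (bndD b0 b1) b2) (expectD mDn PDn b0 b1).
rewrite (expectZl mDn PDn _ (bndM bj (bndX 3 (bS r)))) (expect_indep0 bk (bndX 3 (bS r)) (hu 3%N) k0).
rewrite (expectZl mDn PDn _ (bndM (bndX 2 bj) (bndX 2 (bS r)))) (expect_indep (bndX 2 bk) (bndX 2 (bS r)) (hu 2%N)).
rewrite (expectZl mDn PDn _ (bndM (bndX 3 bj) (bS r))) (expect_indep (bndX 3 bk) (bS r)) ?S_mean//; last first.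
  by move=> s z; exact: S_upd.
rewrite (expectZl mDn PDn _ (bndX 4 bj)) S_sqr// big_cons.
have e2 : E1 (fun z => k z ^+ 2) <= 1.
  apply: (expect_le_cst mD nuD (bndX 2 bk)) => z Dz.
  by rewrite -real_normK ?num_real// exprn_ile1// k1.
have e4 : E (fun s => k (tnth s j) ^+ 4) <= 1.
  apply: (expect_le_cst mDn PDn (bndX 4 bj)) => z Dz.
  by rewrite (_ : 4 = 2 * 2)%N// exprM exprn_ile1 ?sqr_ge0// -real_normK ?num_real// exprn_ile1// k1.
have e20 : 0 <= E1 (fun z => k z ^+ 2) by apply: Rintegral_ge0 => z _; exact: sqr_ge0.
have {IH}IH := IH ur.
have A0 : 0 <= \sum_(i <- r) a i ^+ 2 by apply: sumr_ge0 => i _; exact: sqr_ge0.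
have a0 := sqr_ge0 (a j).
rewrite !mulr0 addr0 addr0 (_ : a j ^+ 4 = (a j ^+ 2) ^+ 2); last by rewrite -exprM.
move: e2 e20 e4 IH A0 a0; move: (E1 (fun z => k z ^+ 2)) (E (fun s => k (tnth s j) ^+ 4)) (E (fun s => S r s ^+ 4)).
move: (\sum_(i <- r) _) (a j ^+ 2) => A x e f g e2 e20 e4 IH A0 x0.
have h1 : 6 * x * (e * (e * A)) <= 6 * x * A.
  rewrite -!mulrA !ler_wpM2l// mulrA ler_piMl// mulr_ile1//.
have h2 : x ^+ 2 * f <= x ^+ 2 by rewrite ler_piMr ?sqr_ge0.
have := sqr_ge0 x; lra.
Qed.

Lemma centered_sum_sqr : E (fun s => (\sum_i a i * k (tnth s i)) ^+ 2)
  = E1 (fun z => k z ^+ 2) * \sum_i a i ^+ 2.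
Proof. exact: (S_sqr (index_enum_uniq _)). Qed.

Lemma centered_sum_four : (forall z, D z -> `|k z| <= 1) ->
  E (fun s => (\sum_i a i * k (tnth s i)) ^+ 4) <= 3 * (\sum_i a i ^+ 2) ^+ 2.
Proof. by move=> k1; exact: (S_four k1 (index_enum_uniq _)). Qed.

Lemma centered_sum_sqr_le : (forall z, D z -> `|k z| <= 1) ->
  E (fun s => (\sum_i a i * k (tnth s i)) ^+ 2) <= \sum_i a i ^+ 2.
Proof.
move=> k1; rewrite centered_sum_sqr ler_piMl ?sumr_ge0// => [i _|]; first exact: sqr_ge0.
apply: (expect_le_cst mD nuD (bndX 2 bk)) => z Dz.
by rewrite -real_normK ?num_real// exprn_ile1// k1.
Qed.

End centered_sum.

Section bilinear.
Variables (x y : T -> R) (B : 'I_n -> 'I_n -> R).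
Hypotheses (bx : bounded_on D x) (by_ : bounded_on D y) (x0 : E1 x = 0) (y0 : E1 y = 0).
Hypotheses (x1 : forall z, D z -> `|x z| <= 1) (y1 : forall z, D z -> `|y z| <= 1).
Hypothesis B0 : forall i, B i i = 0.

Let m (p q : 'I_n * 'I_n) s : R :=
  x (tnth s p.1) * y (tnth s p.2) * (x (tnth s q.1) * y (tnth s q.2)).

Let bm p q : bounded_on Dn (m p q).
Proof. by apply: bndM; apply: bndM; exact: bnd_tnth. Qed.

Let m_le1 p q : `|E (m p q)| <= 1.
Proof.
apply: (expect_norm_le mDn PDn (bm p q)) => s Ds; rewrite !normrM.
by rewrite mulr_ile1 ?mulr_ge0// mulr_ile1 ?x1 ?y1.
Qed.

(** If an index of p is absent from q, its factor is centered and independent of the rest. When both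
    indices of p occur in q, q is p or p swapped. *)
Let m_eq0 p q : p.1 != p.2 -> q.1 != q.2 -> q != p -> q != (p.2, p.1) -> E (m p q) = 0.
Proof.
move: p q => [i j] [k l] /= ij kl n1 n2.
have vanish (u : 'I_n) F (f : T -> R) : bounded_on Dn F -> bounded_on D f -> E1 f = 0 ->
    (forall s z', F (upd s u z') = F s) -> (forall s, m (i, j) (k, l) s = f (tnth s u) * F s) ->
    E (m (i, j) (k, l)) = 0.
  move=> hF bf f0 hu e; transitivity (E (fun s => f (tnth s u) * F s)); last exact: expect_indep0.
  by apply: expect_eq => s _.
have ne (u v : 'I_n) s z : v != u -> tnth (upd s u z) v = tnth s v.
  by rewrite tnth_upd => /negbTE ->.
have bxi v : bounded_on Dn (fun s => x (tnth s v)) by exact: bnd_tnth.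
have byi v : bounded_on Dn (fun s => y (tnth s v)) by exact: bnd_tnth.
have [/andP[ki li]|ikl] := boolP ((k != i) && (l != i)).
  apply: (vanish i (fun s => y (tnth s j) * (x (tnth s k) * y (tnth s l))) x) => //.
  - by apply: bndM => //; exact: bndM.
  - by move=> s z; rewrite !ne// eq_sym.
  - by move=> s; rewrite /m/= -mulrA.
have [/andP[kj lj]|jkl] := boolP ((k != j) && (l != j)).
  apply: (vanish j (fun s => x (tnth s i) * (x (tnth s k) * y (tnth s l))) y) => //.
  - by apply: bndM => //; exact: bndM.
  - by move=> s z; rewrite !ne.
  - by move=> s; rewrite /m/= -mulrA mulrCA.
exfalso; move: n1 n2 ikl jkl; rewrite !xpair_eqE !negb_and !negbK.
move=> n1 n2 /orP[/eqP ki|/eqP li] /orP[/eqP kj|/eqP lj].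
- by move: ij; rewrite -ki -kj eqxx.
- by move: n1; rewrite ki lj !eqxx.
- by move: n2; rewrite kj li !eqxx.
- by move: ij; rewrite -li -lj eqxx.
Qed.

(** Only the pairings of p with itself and with its swap survive; each contributes at most the sum
    of the squared coefficients, whence the 2. *)
Lemma bilinear_sqr_le : E (fun s => (\sum_i \sum_j B i j * (x (tnth s i) * y (tnth s j))) ^+ 2)
  <= 2 * \sum_i \sum_j B i j ^+ 2.
Proof.
pose b (p : 'I_n * 'I_n) := B p.1 p.2.
have -> : E (fun s => (\sum_i \sum_j B i j * (x (tnth s i) * y (tnth s j))) ^+ 2)
   = E (fun s => \sum_p \sum_q b p * b q * m p q s).
  apply: expect_eq => s _; rewrite pair_big/= expr2 big_distrlr/=.
  by apply: eq_bigr => p _; apply: eq_bigr => q _; rewrite /b /m; ring.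
have bmm p q : bounded_on Dn (fun s => b p * b q * m p q s) by apply: bndM => //; exact: bnd_cst.
rewrite (expect_sum mDn PDn); last by move=> p _; exact: bnd_sum.
pose sw (p : 'I_n * 'I_n) := (p.2, p.1).
apply: (@le_trans _ _ (\sum_p \sum_q ((if q == p then b p ^+ 2 else 0)
     + (if q == sw p then (b p ^+ 2 + b q ^+ 2) / 2 else 0)))).
  apply: ler_sum => p _; rewrite (expect_sum mDn PDn) => [|q _]; last exact: bmm.
  apply: ler_sum => q _; rewrite (expectZl mDn PDn)//.
  have b0 (r : 'I_n * 'I_n) : r.1 = r.2 -> b r = 0 by rewrite /b => ->.
  have r0 : 0 <= (if q == p then b p ^+ 2 else 0) + (if q == sw p then (b p ^+ 2 + b q ^+ 2) / 2 else 0).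
    by apply: addr_ge0; case: ifP => _ //; rewrite ?sqr_ge0// divr_ge0// addr_ge0 ?sqr_ge0.
  have [/b0 p0|p12] := eqVneq p.1 p.2; first by rewrite {1}p0 !mul0r.
  have [/b0 q0|q12] := eqVneq q.1 q.2; first by rewrite {1}q0 mulr0 mul0r.
  have [qp|qp] := eqVneq q p.
    rewrite qp -expr2; apply: (@le_trans _ _ (b p ^+ 2)).
      by rewrite ler_piMr ?sqr_ge0// (le_trans (ler_norm _)).
    by rewrite lerDl; case: ifP => // _; rewrite divr_ge0// addr_ge0 ?sqr_ge0.
  rewrite add0r; have [qs|qs] := eqVneq q (sw p); last by rewrite m_eq0// mulr0.
  apply: (@le_trans _ _ `|b p * b q|).
    by rewrite (le_trans (ler_norm _))// normrM ler_piMr.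
  have := sqr_ge0 (`|b p| - `|b q|); rewrite normrM sqrrB !real_normK ?num_real//.
  by rewrite mulr2n; lra.
rewrite (eq_bigr (fun p => b p ^+ 2 + (b p ^+ 2 + b (sw p) ^+ 2) / 2)); last first.
  by move=> p _; rewrite big_split/= -!big_mkcond/= !big_pred1_eq.
have sym : \sum_p b (sw p) ^+ 2 = \sum_p b p ^+ 2.
  by rewrite [RHS](reindex_inj (h := sw))// => -[i j] [k l] [-> ->].
rewrite big_split/= -mulr_suml big_split/= sym pair_big/= le_eqVlt; apply/orP; left; apply/eqP.
by rewrite -/b; set Y := \sum_p _; field.
Qed.

End bilinear.
End product_moments.

Section convex_split.
Context (R : realType) (rho : R).
Hypotheses (rho0 : 0 < rho) (rho1 : rho < 1).

(** Convexity with weights 1 - rho and rho. The weight rho on b is chosen so that a term contracted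
    by rho^2 keeps a factor rho < 1 and can be absorbed. *)
Lemma sqr_convex_split (a b : R) : (a + b) ^+ 2 <= a ^+ 2 / (1 - rho) + b ^+ 2 / rho.
Proof.
have r1 : 0 < 1 - rho by rewrite subr_gt0.
rewrite -subr_ge0 (_ : _ - _ = (rho * a - (1 - rho) * b) ^+ 2 / (rho * (1 - rho))).
  by rewrite divr_ge0 ?sqr_ge0// mulr_ge0// ltW.
by field; rewrite !gt_eqF.
Qed.

Lemma four_convex_split (a b : R) : (a + b) ^+ 4 <= a ^+ 4 / (1 - rho) ^+ 3 + b ^+ 4 / rho ^+ 3.
Proof.
have r1 : 0 < 1 - rho by rewrite subr_gt0.
rewrite (_ : 4 = 2 * 2)%N// exprM.
apply: (@le_trans _ _ ((a ^+ 2 / (1 - rho) + b ^+ 2 / rho) ^+ 2)).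
  rewrite lerXn2r ?nnegrE ?sqr_ge0 ?sqr_convex_split//.
  by rewrite addr_ge0// divr_ge0 ?sqr_ge0// ltW.
apply: (le_trans (sqr_convex_split _ _)).
rewrite le_eqVlt; apply/orP; left; apply/eqP.
by rewrite [(2 * 2)%N]/=; field; rewrite !gt_eqF.
Qed.

End convex_split.

(** * The mean-field equation for a typical field *)

Section good_field.
Context (R : realType) (mu : probability (Borel R) R).
Hypothesis hmu : base_measure mu.
Context (n : nat) (A : 'M[R]_n) (c u : n.-tuple (Borel R)) (rho : R).
Hypotheses (rho0 : 0 < rho) (rho1 : rho < 1) (Arho : forall i, \sum_j `|A i j| <= rho).
Hypothesis hA : coupling_matrix A.
Local Notation psi1 := (psi1 mu).
Local Notation psi2 := (psi2 mu).
Hypothesis u_fix : forall i, tnth u i = psi1 (local_field A u i + tnth c i).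
Implicit Types i j : 'I_n.

Let xi i : R := psi1 (tnth c i).
Let s i : R := local_field A u i.
Let g i : R := \sum_j A i j * xi j.
Let L : R := (1 - rho)^-1.

Let B i j : R := `|A i j|.
Let B0 i j : 0 <= B i j. Proof. exact: normr_ge0. Qed.
Let Bs i j : B i j = B j i. Proof. by rewrite /B (coupling_sym hA). Qed.

Let u_xi i : `|tnth u i - xi i| <= `|s i|.
Proof.
by rewrite u_fix (le_trans (psi1_lipschitz hmu _ _))// addrK.
Qed.

Let s_g i : `|s i - g i| <= \sum_j B i j * `|s j|.
Proof.
rewrite /s local_fieldE /g -sumrB (le_trans (ler_norm_sum _ _ _))//.
by apply: ler_sum => j _; rewrite -mulrBr normrM ler_wpM2l.
Qed.

(** With s = A u, g = A xi and |u - xi| <= |s|, the difference s - g is a contraction of |s|. One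
    factor L comes from the convex split, the other from absorbing rho times the left side. *)
Lemma field_sqr_le : \sum_i s i ^+ 2 <= L ^+ 2 * \sum_i g i ^+ 2.
Proof.
have r1 : 0 < 1 - rho by rewrite subr_gt0.
have h : \sum_i s i ^+ 2 <= L * (\sum_i g i ^+ 2) + rho * \sum_i s i ^+ 2.
  apply: (@le_trans _ _ (\sum_i (g i ^+ 2 / (1 - rho) + (\sum_j B i j * `|s j|) ^+ 2 / rho))).
    apply: ler_sum => i _; rewrite -[in leLHS](subrKC (g i) (s i)).
    rewrite (le_trans (sqr_convex_split rho0 rho1 _ _))// lerD2l ler_wpM2r ?invr_ge0 ?(ltW rho0)//.
    by rewrite -[leLHS]real_normK ?num_real// lerXn2r ?nnegrE// (le_trans _ (s_g i)).
  rewrite big_split/= -!mulr_suml [L * _]mulrC lerD2l ler_pdivrMr//.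
  have := l2_contraction B0 Bs (ltW rho0) Arho (fun j => `|s j|).
  have eS S : rho * S * rho = rho ^+ 2 * S by ring.
  move=> /le_trans; apply; rewrite eS ler_wpM2l ?sqr_ge0//.
  by apply: ler_sum => j _; rewrite real_normK ?num_real.
rewrite expr2 -mulrA /L ler_pdivlMl//; move: h; rewrite /L; lra.
Qed.

Lemma field_four_le : \sum_i s i ^+ 4 <= L ^+ 4 * \sum_i g i ^+ 4.
Proof.
have r1 : 0 < 1 - rho by rewrite subr_gt0.
have h : \sum_i s i ^+ 4 <= L ^+ 3 * (\sum_i g i ^+ 4) + rho * \sum_i s i ^+ 4.
  apply: (@le_trans _ _ (\sum_i (g i ^+ 4 / (1 - rho) ^+ 3 + (\sum_j B i j * `|s j|) ^+ 4 / rho ^+ 3))).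
    apply: ler_sum => i _; rewrite -[in leLHS](subrKC (g i) (s i)).
    rewrite (le_trans (four_convex_split rho0 rho1 _ _))// lerD2l ler_wpM2r ?invr_ge0 ?exprn_ge0 ?(ltW rho0)//.
    rewrite (_ : 4 = 2 * 2)%N// 2!exprM lerXn2r ?nnegrE ?sqr_ge0//.
    by rewrite -[leLHS]real_normK ?num_real// lerXn2r ?nnegrE// (le_trans _ (s_g i)).
  rewrite big_split/= -!mulr_suml /L exprVn [_^-1 * _]mulrC lerD2l ler_pdivrMr ?exprn_gt0//.
  have := l4_contraction B0 Bs (ltW rho0) Arho (fun j => `|s j|).
  have eS S : rho * S * rho ^+ 3 = rho ^+ 4 * S by ring.
  move=> /le_trans; apply; rewrite eS ler_wpM2l ?exprn_ge0 ?(ltW rho0)//.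
  by apply: ler_sum => j _; rewrite (_ : 4 = 2 * 2)%N// 2!exprM real_normK ?num_real.
rewrite exprS -mulrA /L ler_pdivlMl//; move: h; rewrite /L; lra.
Qed.

(** [tl] stands for theta lambda, [N] for n^gamma, [kappa] for 1 / (1 - tl ups), [K] for a bound on
    it of at least 1, and [y] for the common smallness parameter. *)
Variables (q : 'I_n -> R) (tl ups kappa K y N : R).
Hypotheses (ups0 : 0 <= ups) (ups1 : ups <= 1).
Hypotheses (kappaE : kappa * (1 - tl * ups) = 1) (kappa0 : 0 <= kappa) (kappaK : kappa <= K) (K1 : 1 <= K).
Hypotheses (y0 : 0 < y) (y1 : y <= 1) (N1 : 1 <= N).
Hypotheses (q_sum : `|\sum_i q i ^+ 2 - 1| <= y ^+ 6) (q_max : forall i, `|q i| <= y ^+ 6).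
(** Residual of the eigenvector equation, and below it the fluctuation of psi''(c_i) about its
    mean. *)
Let w i : R := tl * q i - \sum_j A i j * q j.
Let d0 i : R := psi2 (tnth c i) - ups.
Hypothesis w_small : N * \sum_i w i ^+ 2 <= y ^+ 6.
Hypothesis Y1 : \sum_i g i ^+ 4 <= y ^+ 4.
Hypothesis Y2 : N * \sum_i (\sum_j A i j * (d0 j * q j)) ^+ 2 <= y ^+ 4.
Hypothesis Y3 : (\sum_i q i ^+ 2 * d0 i) ^+ 2 <= y ^+ 4.
Hypothesis Y4 : (\sum_i w i * xi i) ^+ 2 <= y ^+ 4.
Hypothesis Y5 : (\sum_i \sum_j A i j * q j * (xi i * d0 j)) ^+ 2 <= y ^+ 4.
Hypothesis Y6 : y ^+ 2 * \sum_i g i ^+ 2 <= N.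
Let dd i : R := psi2 (local_field A u i + tnth c i).
Let eta i : R := kappa * q i - kappa * (\sum_j A i j * (dd j * q j)) - q i.
Let e i : R := dd i - psi2 (tnth c i).

Let abs_le_sqr (a b : R) : 0 <= b -> a ^+ 2 <= b ^+ 2 -> `|a| <= b.
Proof. by move=> b0 ab; rewrite -(ler_pXn2r (_ : (0 < 2)%N)) ?nnegrE// real_normK ?num_real. Qed.

Let L1 : 1 <= L.
Proof. by rewrite /L invf_ge1 ?subr_gt0// gerBl ltW. Qed.

Let y_le m m' : (m <= m')%N -> y ^+ m' <= y ^+ m.
Proof. by move=> mm; rewrite ler_wiXn2l// ltW. Qed.

Let q_sum2 : \sum_i q i ^+ 2 <= 2.
Proof.
have : y ^+ 6 <= 1 by exact: (y_le (leq0n 6)).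
by move: q_sum; rewrite ler_norml => /andP[_]; lra.
Qed.

Let q_four : \sum_i q i ^+ 4 <= 2.
Proof.
apply: le_trans q_sum2; apply: ler_sum => i _.
rewrite (_ : 4 = 2 + 2)%N// exprD ler_piMr ?sqr_ge0// -real_normK ?num_real// exprn_ile1//.
by rewrite (le_trans (q_max i))// (y_le (leq0n 6)).
Qed.

Let s_four : \sum_i s i ^+ 4 <= L ^+ 4 * y ^+ 4.
Proof. by rewrite (le_trans field_four_le)// ler_wpM2l ?exprn_ge0// (le_trans ler01). Qed.

Let s_four_ge0 : 0 <= \sum_i s i ^+ 4.
Proof. by apply: sumr_ge0 => i _; rewrite (_ : 4 = 2 * 2)%N// exprM sqr_ge0. Qed.

Let Ly0 : 0 <= L * y. Proof. by rewrite mulr_ge0 ?(ltW y0)// (le_trans ler01). Qed.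

(** Cauchy-Schwarz into fourth moments: the l2 norm of [s] may be of order sqrt N, and only its l4
    norm is small. *)
Let weighted_sqr : \sum_i s i ^+ 2 * q i ^+ 2 <= 2 * (L * y) ^+ 2.
Proof.
apply: (le_trans (ler_norm _)); apply: abs_le_sqr; first by rewrite mulr_ge0 ?sqr_ge0.
apply: (le_trans (cauchy_schwarz_sum _ _)).
rewrite (eq_bigr (fun i => s i ^+ 4)); last by move=> i _; rewrite -exprM.
rewrite [X in _ * X](eq_bigr (fun i => q i ^+ 4)); last by move=> i _; rewrite -exprM.
apply: (le_trans (ler_wpM2l s_four_ge0 q_four)).
have e4 : (2 * (L * y) ^+ 2) ^+ 2 = 4 * (L * y) ^+ 4 by ring.
have := s_four; rewrite -exprMn e4; have := exprn_ge0 4 Ly0.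
by move: (\sum_i _) ((L * y) ^+ 4) => a b; lra.
Qed.

Let weighted_field : \sum_i `|q i| * s i ^+ 2 <= 2 * (L * y) ^+ 2.
Proof.
apply: (le_trans (ler_norm _)); apply: abs_le_sqr; first by rewrite mulr_ge0 ?sqr_ge0.
apply: (le_trans (cauchy_schwarz_sum _ _)).
rewrite [X in _ * X](eq_bigr (fun i => s i ^+ 4)); last by move=> i _; rewrite -exprM.
rewrite [X in X * _](eq_bigr (fun i => q i ^+ 2)); last by move=> i _; rewrite real_normK ?num_real.
apply: (le_trans (ler_wpM2r s_four_ge0 q_sum2)).
have e4 : (2 * (L * y) ^+ 2) ^+ 2 = 4 * (L * y) ^+ 4 by ring.
have := s_four; rewrite -exprMn e4; have := exprn_ge0 4 Ly0.
by move: (\sum_i _) ((L * y) ^+ 4) => a b; lra.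
Qed.

Let weighted_abs : \sum_i q i ^+ 2 * `|s i| <= 2 * (L * y).
Proof.
apply: (le_trans (ler_norm _)); apply: abs_le_sqr; first by rewrite mulr_ge0.
rewrite (eq_bigr (fun i => `|q i| * (`|s i| * `|q i|))); last first.
  by move=> i _; rewrite mulrCA -expr2 real_normK ?num_real// mulrC.
apply: (le_trans (cauchy_schwarz_sum _ _)).
rewrite [X in X * _](eq_bigr (fun i => q i ^+ 2)); last by move=> i _; rewrite real_normK ?num_real.
rewrite [X in _ * X](eq_bigr (fun i => s i ^+ 2 * q i ^+ 2)); last first.
  by move=> i _; rewrite exprMn !real_normK ?num_real.
rewrite (_ : (2 * (L * y)) ^+ 2 = 2 * (2 * (L * y) ^+ 2)); last by ring.
apply: ler_pM; [| |exact: q_sum2|exact: weighted_sqr]; apply: sumr_ge0 => i _; first exact: sqr_ge0.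
by rewrite mulr_ge0 ?sqr_ge0.
Qed.

Let e_le i : `|e i| <= 4 * `|s i|.
Proof. by rewrite (le_trans (psi2_lipschitz hmu _ _))// addrK. Qed.

Let K0 : 0 <= K. Proof. exact: le_trans K1. Qed.

Let yL m : (0 < m)%N -> y ^+ m <= L * y.
Proof. by move=> m0; rewrite (le_trans (y_le m0))// expr1 ler_peMl// ltW. Qed.

(** The discrepancy has three sources: the effect of the field [s] on psi'', the fluctuation [d0] of
    psi''(c_i), and the normalization of [q]. *)
Lemma good_variance : `|kappa * (\sum_i q i ^+ 2 * dd i) - kappa * ups| <= 11 * K * (L * y).
Proof.
have -> : kappa * (\sum_i q i ^+ 2 * dd i) - kappa * ups = kappa * (\sum_i q i ^+ 2 * e i
    + \sum_i q i ^+ 2 * d0 i + ups * (\sum_i q i ^+ 2 - 1)).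
  rewrite -mulrBr; congr (_ * _).
  rewrite mulrBr mulr1 mulr_sumr addrA -!big_split/=; congr (_ - _).
  by apply: eq_bigr => i _; rewrite /e /d0; ring.
have h1 : `|\sum_i q i ^+ 2 * e i| <= 8 * (L * y).
  rewrite (le_trans (ler_norm_sum _ _ _))//; apply: (@le_trans _ _ (4 * \sum_i q i ^+ 2 * `|s i|)).
    rewrite mulr_sumr; apply: ler_sum => i _.
    by rewrite normrM (ger0_norm (sqr_ge0 _)) mulrCA ler_wpM2l ?sqr_ge0.
  by have := weighted_abs; lra.
have h2 : `|\sum_i q i ^+ 2 * d0 i| <= L * y.
  apply: le_trans (yL (isT : (0 < 2)%N)); apply: abs_le_sqr; first exact: sqr_ge0.
  by rewrite -exprM.
have h3 : `|ups * (\sum_i q i ^+ 2 - 1)| <= L * y.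
  rewrite normrM (ger0_norm ups0) (le_trans _ (yL (isT : (0 < 6)%N)))//.
  by rewrite (le_trans _ q_sum)// ler_piMl.
rewrite normrM (ger0_norm kappa0) [11 * K]mulrC -mulrA ler_pM//.
rewrite (le_trans (ler_normD _ _))// (le_trans (lerD (ler_normD _ _) (lexx _)))//.
by move: h1 h2 h3 Ly0; lra.
Qed.

Lemma three_sqr_le (a b c' : R) : (a - b - c') ^+ 2 <= 3 * (a ^+ 2 + b ^+ 2 + c' ^+ 2).
Proof.
have := sqr_ge0 (a + b); have := sqr_ge0 (a + c'); have := sqr_ge0 (b - c'); lra.
Qed.

Let w_sum : \sum_i w i ^+ 2 <= y ^+ 2.
Proof.
rewrite (le_trans _ (y_le (isT : (2 <= 6)%N)))// (le_trans _ w_small)// ler_peMl//.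
by apply: sumr_ge0 => i _; exact: sqr_ge0.
Qed.

Let v i : R := \sum_j A i j * (d0 j * q j).

Let v_sum : \sum_i v i ^+ 2 <= y ^+ 2.
Proof.
rewrite (le_trans _ (y_le (isT : (2 <= 4)%N)))// (le_trans _ Y2)// ler_peMl//.
by apply: sumr_ge0 => i _; exact: sqr_ge0.
Qed.

Lemma good_residual : \sum_i eta i ^+ 2 <= (11 * K * (L * y)) ^+ 2.
Proof.
have h3 : \sum_i (\sum_j A i j * (e j * q j)) ^+ 2 <= 32 * (L * y) ^+ 2.
  apply: (@le_trans _ _ (\sum_i (\sum_j B i j * `|e j * q j|) ^+ 2)).
    apply: ler_sum => i _; rewrite -[leLHS]real_normK ?num_real// lerXn2r ?nnegrE//.
      by apply: sumr_ge0 => j _; exact: mulr_ge0.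
    rewrite (le_trans (ler_norm_sum _ _ _))//; apply: ler_sum => j _.
    by rewrite normrM.
  apply: (le_trans (l2_contraction B0 Bs (ltW rho0) Arho _)).
  apply: (@le_trans _ _ (\sum_j `|e j * q j| ^+ 2)).
    by rewrite ler_piMl ?exprn_ile1 ?(ltW rho0) ?(ltW rho1)// sumr_ge0.
  have -> : 32 * (L * y) ^+ 2 = 16 * (2 * (L * y) ^+ 2) by ring.
  rewrite (le_trans _ (ler_wpM2l _ weighted_sqr))// mulr_sumr; apply: ler_sum => j _.
  rewrite real_normK ?num_real// exprMn [leRHS]mulrA; apply: ler_wpM2r; first exact: sqr_ge0.
  have h := e_le j; rewrite -[leLHS]real_normK ?num_real// -[s j ^+ 2]real_normK ?num_real//.
  rewrite (_ : 16 * `|s j| ^+ 2 = (4 * `|s j|) ^+ 2); last by ring.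
  by rewrite lerXn2r ?nnegrE ?mulr_ge0.
(* Inserting 1 = kappa (1 - tl ups) before the last q_i makes the eigenvector residual appear. *)
have etaE i : eta i = kappa * (ups * w i - v i - \sum_j A i j * (e j * q j)).
  rewrite /eta -[in X in _ - X](mul1r (q i)) -kappaE.
  have -> : \sum_j A i j * (dd j * q j) = v i + \sum_j A i j * (e j * q j) + ups * \sum_j A i j * q j.
    rewrite mulr_sumr -!big_split/=; apply: eq_bigr => j _; rewrite /e /d0; ring.
  rewrite /w; ring.
rewrite (eq_bigr (fun i => kappa ^+ 2 * (ups * w i - v i - \sum_j A i j * (e j * q j)) ^+ 2)); last first.
  by move=> i _; rewrite etaE exprMn.
rewrite -mulr_sumr; apply: (@le_trans _ _ (K ^+ 2 * \sum_i 3 * (w i ^+ 2 + v i ^+ 2 + (\sum_j A i j * (e j * q j)) ^+ 2))).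
  apply: ler_pM; rewrite ?sqr_ge0//.
  - by apply: sumr_ge0 => i _; exact: sqr_ge0.
  - by rewrite lerXn2r ?nnegrE.
  apply: ler_sum => i _; rewrite (le_trans (three_sqr_le _ _ _))// ler_wpM2l// !lerD2r.
  by rewrite exprMn ler_piMl ?sqr_ge0// exprn_ile1.
rewrite (_ : (11 * K * (L * y)) ^+ 2 = K ^+ 2 * (121 * (L * y) ^+ 2)); last by ring.
rewrite ler_wpM2l ?sqr_ge0// -mulr_sumr !big_split/=.
have yy : y ^+ 2 <= (L * y) ^+ 2 by rewrite lerXn2r ?nnegrE ?(ltW y0)// ler_peMl// ltW.
move: h3 w_sum v_sum yy (sqr_ge0 (L * y)).
move: (\sum_i w i ^+ 2) (\sum_i v i ^+ 2) (\sum_i (\sum_j _) ^+ 2) (y ^+ 2) ((L * y) ^+ 2) => x1 x2 x3 x4 x5; lra.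
Qed.

(** Linear response. [eta0] is the residual with psi''(c) in place of psi'' at the full field, so it
    involves the field but not the optimizer. The difference splits into a Taylor remainder, the
    pairing of [eta0] with xi, which is small by the second moments of sums over the field, and its
    pairing with u - xi. *)
Lemma good_shift : `|\sum_i q i * tnth u i - kappa * \sum_i q i * xi i| <= 12 * K * L * (L * y).
Proof.
pose eta0 i := kappa * (ups * w i - v i).
have decomp : \sum_i q i * tnth u i - kappa * \sum_i q i * xi i =
    kappa * (\sum_i q i * (tnth u i - xi i - psi2 (tnth c i) * s i))
    - \sum_i eta0 i * xi i - \sum_i eta0 i * (tnth u i - xi i).
  have adj (x z : 'I_n -> R) : \sum_i z i * (\sum_j A i j * x j) = \sum_i (\sum_j A i j * z j) * x i.
    have [At _] := hA.
    under eq_bigr do rewrite mulr_sumr; rewrite exchange_big/=; apply: eq_bigr => i _.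
    rewrite mulr_suml; apply: eq_bigr => j _; rewrite -[in LHS]At mxE; ring.
  (* Symmetry of A carries psi''(c) A u over to q, and kappa (1 - tl ups) = 1 identifies the
     remaining coefficient. *)
  have key : \sum_i eta0 i * tnth u i = kappa * (\sum_i q i * tnth u i)
     - kappa * (\sum_i q i * psi2 (tnth c i) * s i) - \sum_i q i * tnth u i.
    have -> : \sum_i q i * psi2 (tnth c i) * s i = \sum_i (\sum_j A i j * (q j * psi2 (tnth c j))) * tnth u i.
      by rewrite -adj; apply: eq_bigr => i _; rewrite /s local_fieldE.
    rewrite !mulr_sumr -!sumrB; apply: eq_bigr => i _.
    rewrite !mulrA -!mulrBl; congr (_ * _).
    rewrite -[in X in _ = _ - X](mul1r (q i)) -kappaE /eta0 /v /w.
    have -> : \sum_j A i j * (q j * psi2 (tnth c j)) = \sum_j A i j * (d0 j * q j) + ups * \sum_j A i j * q j.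
      rewrite mulr_sumr -!big_split/=; apply: eq_bigr => j _; rewrite /d0; ring.
    ring.
  have -> : \sum_i eta0 i * (tnth u i - xi i) = \sum_i eta0 i * tnth u i - \sum_i eta0 i * xi i.
    by rewrite -sumrB; apply: eq_bigr => i _; rewrite mulrBr.
  rewrite key.
  have -> : \sum_i q i * (tnth u i - xi i - psi2 (tnth c i) * s i) = \sum_i q i * tnth u i
      - \sum_i q i * xi i - \sum_i q i * psi2 (tnth c i) * s i.
    by rewrite -!sumrB; apply: eq_bigr => i _; ring.
  ring.
have t1 : `|kappa * (\sum_i q i * (tnth u i - xi i - psi2 (tnth c i) * s i))| <= K * (8 * (L * y) ^+ 2).
  rewrite normrM (ger0_norm kappa0) ler_pM// (le_trans (ler_norm_sum _ _ _))//.
  apply: (@le_trans _ _ (4 * \sum_i `|q i| * s i ^+ 2)); last by have := weighted_field; lra.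
  rewrite mulr_sumr; apply: ler_sum => i _; rewrite normrM mulrCA ler_wpM2l//.
  have := psi1_taylor hmu (tnth c i) (local_field A u i + tnth c i).
  by rewrite -u_fix addrK mulrC.
have t2 : `|\sum_i eta0 i * xi i| <= K * (2 * y ^+ 2).
  have -> : \sum_i eta0 i * xi i = kappa * (ups * (\sum_i w i * xi i) - \sum_i \sum_j A i j * q j * (xi i * d0 j)).
    rewrite mulrBr !mulr_sumr -sumrB; apply: eq_bigr => i _.
    rewrite /eta0 /v mulr_sumr [kappa * (_ - _)]mulrBr mulrBl -!mulrA; congr (_ - _).
    rewrite mulr_suml -mulr_sumr; congr (_ * _); apply: eq_bigr => j _; ring.
  rewrite normrM (ger0_norm kappa0) ler_pM//.
  have a1 : `|\sum_i w i * xi i| <= y ^+ 2 by apply: abs_le_sqr; rewrite ?sqr_ge0// -exprM.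
  have a2 : `|\sum_i \sum_j A i j * q j * (xi i * d0 j)| <= y ^+ 2.
    by apply: abs_le_sqr; rewrite ?sqr_ge0// -exprM.
  rewrite (le_trans (ler_normB _ _))// (_ : 2 * y ^+ 2 = y ^+ 2 + y ^+ 2); last by ring.
  rewrite lerD// normrM (ger0_norm ups0) (le_trans _ a1)// ler_piMl//.
(* The squared norm of u - xi may be as large as N / y^2. Cauchy-Schwarz therefore needs [eta0]
   small after multiplication by N, which is why N stands in front of the bounds on [w] and [Y2]. *)
have t3 : `|\sum_i eta0 i * (tnth u i - xi i)| <= K * (2 * (L * y)).
  apply: abs_le_sqr; first by apply: mulr_ge0 => //; exact: mulr_ge0.
  apply: (le_trans (cauchy_schwarz_sum _ _)).
  have b1 : N * \sum_i eta0 i ^+ 2 <= K ^+ 2 * (4 * y ^+ 4).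
    rewrite (eq_bigr (fun i => kappa ^+ 2 * (ups * w i - v i) ^+ 2)); last by move=> i _; rewrite exprMn.
    rewrite -mulr_sumr mulrCA; apply: ler_pM; rewrite ?sqr_ge0//.
    - by rewrite mulr_ge0 ?(le_trans ler01 N1)// sumr_ge0// => i _; exact: sqr_ge0.
    - by rewrite lerXn2r ?nnegrE.
    apply: (@le_trans _ _ (2 * (N * \sum_i w i ^+ 2) + 2 * (N * \sum_i v i ^+ 2))).
      rewrite ![2 * _]mulrCA -mulrDr ler_wpM2l ?(le_trans ler01 N1)//.
      rewrite !mulr_sumr -big_split/=; apply: ler_sum => i _.
      have u2 : ups ^+ 2 <= 1 by rewrite exprn_ile1.
      have := sqr_ge0 (ups * w i + v i); have := ler_wpM2r (sqr_ge0 (w i)) u2; rewrite mul1r; lra.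
    have := w_small; have := Y2; have := y_le (isT : (4 <= 6)%N); rewrite /v; lra.
  have b2 : y ^+ 2 * \sum_i (tnth u i - xi i) ^+ 2 <= L ^+ 2 * N.
    apply: (@le_trans _ _ (y ^+ 2 * (L ^+ 2 * \sum_i g i ^+ 2))).
      rewrite ler_wpM2l ?sqr_ge0// (le_trans _ field_sqr_le)//; apply: ler_sum => i _.
      by rewrite -[leLHS]real_normK ?num_real// -[leRHS]real_normK ?num_real// lerXn2r ?nnegrE.
    by rewrite mulrCA ler_wpM2l ?sqr_ge0.
  have e0s : 0 <= \sum_i eta0 i ^+ 2 by apply: sumr_ge0 => i _; exact: sqr_ge0.
  have N0 : 0 < N := lt_le_trans ltr01 N1.
  rewrite -(ler_pM2l (mulr_gt0 N0 (exprn_gt0 2 y0))).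
  rewrite (_ : N * y ^+ 2 * _ = (N * \sum_i eta0 i ^+ 2) * (y ^+ 2 * \sum_i (tnth u i - xi i) ^+ 2)); last by ring.
  rewrite (_ : N * y ^+ 2 * _ = (K ^+ 2 * (4 * y ^+ 4)) * (L ^+ 2 * N)); last by ring.
  apply: ler_pM => //; first by rewrite mulr_ge0// ltW.
  by rewrite mulr_ge0 ?sqr_ge0// sumr_ge0// => i _; exact: sqr_ge0.
have yLL : y ^+ 2 <= L * y by exact: yL.
have LyL : (L * y) ^+ 2 <= L * (L * y).
  by rewrite expr2 ler_wpM2r// ler_piMr// (le_trans ler01).
have LyL2 : L * y <= L * (L * y) by rewrite ler_peMl.
rewrite decomp (le_trans (ler_normB _ _))// (le_trans (lerD (ler_normB _ _) (lexx _)))//.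
rewrite (le_trans (lerD (lerD t1 t2) t3))// -!mulrDr [12 * K]mulrC -!mulrA ler_wpM2l//.
by move: yLL LyL LyL2; move: (y ^+ 2) (L * y) => a b; lra.
Qed.

End good_field.

(** * Moments of the field-dependent errors *)

Section field_moments.
Context (R : realType) (mu F : probability (Borel R) R).
Hypothesis hmu : base_measure mu.
Local Notation psi1 := (psi1 mu).
Local Notation psi2 := (psi2 mu).
Context (n : nat) (A : 'M[R]_n).
Implicit Types (c : n.-tuple (Borel R)) (i j : 'I_n).
Local Notation D1 := ([set: Borel R]).
Local Notation D := (@box _ (Borel R) D1 n).
Local Notation E f := (\int[prob_pow F n]_(c in D) f c).

Let mD1 : measurable D1. Proof. exact: measurableT. Qed.
Let FD1 : F D1 = 1%E. Proof. exact: probability_setT. Qed.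
Let mD : measurable D. Proof. exact: measurable_box. Qed.
Let PD : prob_pow F n D = 1%E. Proof. exact: prob_pow_box. Qed.

Definition mean_var : R := \int[F]_x psi2 x.
Definition var_mean : R := \int[F]_x (psi1 x) ^+ 2.
Local Notation ups := mean_var.
Definition centered_var (x : R) : R := psi2 x - ups.

Lemma bnd_psi1 : bounded_on D1 (psi1 : Borel R -> R).
Proof. by apply: (bnd_le (M := 1)) => [|x _]; [exact: measurable_psi1|exact: psi1_le1]. Qed.

Lemma bnd_psi2 : bounded_on D1 (psi2 : Borel R -> R).
Proof. by apply: (bnd_le (M := 1)) => [|x _]; [exact: measurable_psi2|exact: psi2_norm_le1]. Qed.

Lemma mean_var_gt0 : 0 < ups.
Proof. by apply: (expect_gt0 mD1 FD1 bnd_psi2) => x _; exact: psi2_gt0. Qed.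

Lemma mean_var_le1 : ups <= 1.
Proof. by apply: (expect_le_cst mD1 FD1 bnd_psi2) => x _; exact: psi2_le1. Qed.

Lemma var_mean_ge0 : 0 <= var_mean.
Proof. by apply: Rintegral_ge0 => x _; exact: sqr_ge0. Qed.

Lemma var_mean_le1 : var_mean <= 1.
Proof.
apply: (expect_le_cst mD1 FD1 (bndX 2 bnd_psi1)) => x _.
by rewrite -real_normK ?num_real// exprn_ile1// psi1_le1.
Qed.

Lemma bnd_centered_var : bounded_on D1 (centered_var : Borel R -> R).
Proof. by apply: bndB; [exact: bnd_psi2|exact: bnd_cst]. Qed.

Lemma centered_var0 : \int[F]_x centered_var x = 0.
Proof.
rewrite /centered_var (expectB mD1 FD1 bnd_psi2 (bnd_cst _ _)).
by rewrite (expect_cst mD1 FD1) subrr.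
Qed.

Lemma centered_var_le1 x : `|centered_var x| <= 1.
Proof.
rewrite ler_norml /centered_var; have := psi2_gt0 hmu x; have := psi2_le1 hmu x.
have := mean_var_gt0; have := mean_var_le1; move: (psi2 x) => a h1 h2 h3 h4.
by apply/andP; split; lra.
Qed.

Hypothesis F0 : \int[F]_x psi1 x = 0.
Variables (q w : 'I_n -> R) (alpha N y : R).
Hypotheses (hA : coupling_matrix A) (Aalpha : forall i, \sum_j A i j ^+ 2 <= alpha).
Hypotheses (y0 : 0 < y) (y1 : y <= 1) (NE : N = n%:R * alpha) (N1 : 1 <= N).
Hypotheses (alpha_y : alpha <= y ^+ 6) (Nalpha : N * alpha <= y ^+ 6).
Hypotheses (q_sum : \sum_i q i ^+ 2 <= 2) (q_max : forall i, `|q i| <= y ^+ 6).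
Hypothesis w_small : N * \sum_i w i ^+ 2 <= y ^+ 6.

Let Y1 c := \sum_i (\sum_j A i j * psi1 (tnth c j)) ^+ 4.
Let Y2 c := \sum_i (\sum_j A i j * (centered_var (tnth c j) * q j)) ^+ 2.
Let Y3 c := (\sum_i q i ^+ 2 * centered_var (tnth c i)) ^+ 2.
Let Y4 c := (\sum_i w i * psi1 (tnth c i)) ^+ 2.
Let Y5 c := (\sum_i \sum_j A i j * q j * (psi1 (tnth c i) * centered_var (tnth c j))) ^+ 2.
Let Y6 c := \sum_i (\sum_j A i j * psi1 (tnth c j)) ^+ 2.

(* Collects all field-dependent error terms, so that a single Markov inequality makes them small at once. *)
Definition field_defect c : R :=
  Y1 c + N * Y2 c + Y3 c + Y4 c + Y5 c + y ^+ 6 / N * Y6 c.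

Let b1 j : bounded_on D (fun c => psi1 (tnth c j)). Proof. by apply: bnd_tnth; exact: bnd_psi1. Qed.
Let b2 j : bounded_on D (fun c => centered_var (tnth c j)).
Proof. by apply: bnd_tnth; exact: bnd_centered_var. Qed.

Let bg i : bounded_on D (fun c => \sum_j A i j * psi1 (tnth c j)).
Proof. by apply: bnd_sum => j _; apply: bndM; [exact: bnd_cst|exact: b1]. Qed.

Let bY1 : bounded_on D Y1.
Proof. by apply: bnd_sum => i _; exact: (bndX 4 (bg i)). Qed.
Let bY6 : bounded_on D Y6.
Proof. by apply: bnd_sum => i _; exact: (bndX 2 (bg i)). Qed.
Let bv i : bounded_on D (fun c => \sum_j A i j * (centered_var (tnth c j) * q j)).
Proof.
apply: bnd_sum => j _; apply: bndM; first exact: bnd_cst.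
by apply: bndM; [exact: b2|exact: bnd_cst].
Qed.
Let bY2 : bounded_on D Y2.
Proof. by apply: bnd_sum => i _; exact: (bndX 2 (bv i)). Qed.
Let bY3 : bounded_on D Y3.
Proof. by apply: (bndX 2); apply: bnd_sum => j _; apply: bndM; [exact: bnd_cst|exact: b2]. Qed.
Let bY4 : bounded_on D Y4.
Proof. by apply: (bndX 2); apply: bnd_sum => j _; apply: bndM; [exact: bnd_cst|exact: b1]. Qed.
Let bY5 : bounded_on D Y5.
Proof.
apply: (bndX 2); apply: bnd_sum => i _; apply: bnd_sum => j _.
by apply: bndM; [exact: bnd_cst|apply: bndM; [exact: b1|exact: b2]].
Qed.

Lemma bnd_field_defect : bounded_on D field_defect.
Proof.
apply: bndD; last by apply: bndM; [exact: bnd_cst|exact: bY6].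
apply: bndD; last exact: bY5; apply: bndD; last exact: bY4; apply: bndD; last exact: bY3.
by apply: bndD; [exact: bY1|apply: bndM; [exact: bnd_cst|exact: bY2]].
Qed.

Let Y_ge0 c : [/\ 0 <= Y1 c, 0 <= Y2 c, 0 <= Y3 c, 0 <= Y4 c & 0 <= Y5 c] /\ 0 <= Y6 c.
Proof.
split; [split|]; rewrite ?sqr_ge0//; apply: sumr_ge0 => i _; rewrite ?sqr_ge0//.
by rewrite (_ : 4 = 2 * 2)%N// exprM sqr_ge0.
Qed.

Let N0 : 0 < N. Proof. exact: lt_le_trans N1. Qed.

Lemma field_defect_ge0 c : 0 <= field_defect c.
Proof.
have [[h1 h2 h3 h4 h5] h6] := Y_ge0 c.
have h7 : 0 <= y ^+ 6 / N by rewrite divr_ge0 ?exprn_ge0// ltW.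
by rewrite !addr_ge0// mulr_ge0// ltW.
Qed.

(** All summands are nonnegative, so each inherits the bound; the weight y^6 / N on the last one is
    what leaves y^2 Y6 <= N. *)
Lemma field_defect_small c : field_defect c <= y ^+ 4 ->
  [/\ Y1 c <= y ^+ 4, N * Y2 c <= y ^+ 4, Y3 c <= y ^+ 4, Y4 c <= y ^+ 4 & Y5 c <= y ^+ 4]
  /\ y ^+ 2 * Y6 c <= N.
Proof.
have [[h1 h2 h3 h4 h5] h6] := Y_ge0 c; rewrite /field_defect => h.
have h2' : 0 <= N * Y2 c by rewrite mulr_ge0// ltW.
have h6' : 0 <= y ^+ 6 / N * Y6 c by rewrite mulr_ge0// divr_ge0 ?exprn_ge0// ltW.
split; first by split; lra.
have : y ^+ 6 / N * Y6 c <= y ^+ 4 by lra.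
rewrite mulrAC ler_pdivrMr// (_ : y ^+ 6 = y ^+ 4 * y ^+ 2); last by ring.
by rewrite -mulrA ler_pM2l ?exprn_gt0.
Qed.

Let a0 : 0 <= alpha.
Proof. by rewrite leNgt; apply/negP => a0; move: N0; rewrite NE ltNge mulr_ge0_le0 ?ler0n// ltW. Qed.

Let A2_sum : \sum_i \sum_j A i j ^+ 2 <= N.
Proof.
rewrite NE (le_trans (ler_sum _ (fun i _ => Aalpha i)))//.
by rewrite sumr_const card_ord mulr_natl.
Qed.

Let Aq2_sum : \sum_i \sum_j (A i j * q j) ^+ 2 <= 2 * alpha.
Proof.
rewrite exchange_big/=; apply: (@le_trans _ _ (\sum_j alpha * q j ^+ 2)).
  apply: ler_sum => j _; under eq_bigr do rewrite exprMn.
  rewrite -mulr_suml ler_wpM2r ?sqr_ge0// (le_trans _ (Aalpha j))//.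
  have [At _] := hA; rewrite le_eqVlt; apply/orP; left; apply/eqP; apply: eq_bigr => i _.
  by rewrite -[in LHS]At mxE.
by rewrite -mulr_sumr mulrC ler_wpM2r.
Qed.

(** 13 = 3 + 2 + 2 + 1 + 4 + 1. The 3 comes from fourth moments of the rows of A, whose sum is at
    most 3 n alpha^2, and the 4 from the bilinear form, which doubles a sum of squares bounded by 2
    alpha. *)
Lemma expect_field_defect : E field_defect <= 13 * y ^+ 6.
Proof.
have bD4 := bndD (bndD (bndD (bndD bY1 (bndM (bnd_cst D N) bY2)) bY3) bY4) bY5.
have bD3 := bndD (bndD (bndD bY1 (bndM (bnd_cst D N) bY2)) bY3) bY4.
have bD2 := bndD (bndD bY1 (bndM (bnd_cst D N) bY2)) bY3.
have bD1 := bndD bY1 (bndM (bnd_cst D N) bY2).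
rewrite (expectD mD PD bD4 (bndM (bnd_cst D _) bY6)) (expectD mD PD bD3 bY5) (expectD mD PD bD2 bY4).
rewrite (expectD mD PD bD1 bY3) (expectD mD PD bY1 (bndM (bnd_cst D N) bY2)).
rewrite (expectZl mD PD _ bY2) (expectZl mD PD _ bY6).
have e1 : E Y1 <= 3 * y ^+ 6.
  rewrite (expect_sum mD PD) => [|i _]; last exact: (bndX 4 (bg i)).
  apply: (@le_trans _ _ (\sum_(i < n) 3 * alpha ^+ 2)).
    apply: ler_sum => i _.
    rewrite (le_trans (centered_sum_four mD1 FD1 (fun j => A i j) bnd_psi1 F0 _))// => [z _|]; first exact: psi1_le1.
    by rewrite ler_wpM2l// lerXn2r ?nnegrE// sumr_ge0// => j _; exact: sqr_ge0.
  rewrite sumr_const card_ord -[leLHS]mulr_natl mulrCA ler_wpM2l//.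
  by rewrite expr2 mulrA -NE.
have e2 : N * E Y2 <= 2 * y ^+ 6.
  rewrite (expect_sum mD PD) => [|i _]; last exact: (bndX 2 (bv i)).
  apply: (@le_trans _ _ (N * (2 * alpha))); last by rewrite mulrCA ler_wpM2l.
  rewrite ler_wpM2l ?(ltW N0)// (le_trans _ Aq2_sum)//; apply: ler_sum => i _.
  have := centered_sum_sqr_le mD1 FD1 (fun j => A i j * q j) bnd_centered_var centered_var0 (fun z _ => centered_var_le1 z).
  apply: le_trans; rewrite le_eqVlt; apply/orP; left; apply/eqP.
  by apply: eq_Rintegral => c _; congr (_ ^+ 2); apply: eq_bigr => j _; rewrite mulrAC mulrA.
have e3 : E Y3 <= 2 * y ^+ 6.
  have := centered_sum_sqr_le mD1 FD1 (fun j => q j ^+ 2) bnd_centered_var centered_var0 (fun z _ => centered_var_le1 z).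
  move=> /le_trans; apply; rewrite (le_trans _ (ler_wpM2r _ q_sum)) ?exprn_ge0 ?(ltW y0)// mulr_suml.
  apply: ler_sum => i _; rewrite expr2 ler_wpM2l ?sqr_ge0//.
  rewrite -real_normK ?num_real// expr2 (le_trans _ (q_max i))// ler_piMl//.
  by rewrite (le_trans (q_max i))// exprn_ile1// ltW.
have e4 : E Y4 <= y ^+ 6.
  have := centered_sum_sqr_le mD1 FD1 w bnd_psi1 F0 (fun z _ => psi1_le1 hmu z).
  move=> /le_trans; apply; rewrite (le_trans _ w_small)// ler_peMl//.
  by apply: sumr_ge0 => i _; exact: sqr_ge0.
have e5 : E Y5 <= 4 * y ^+ 6.
  have h0 i : A i i * q i = 0 by have [_ Ad] := hA; rewrite Ad mul0r.
  have := bilinear_sqr_le (B := fun i j => A i j * q j) mD1 FD1 bnd_psi1 bnd_centered_var F0 centered_var0 (fun z _ => psi1_le1 hmu z) (fun z _ => centered_var_le1 z) h0.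
  move=> /le_trans; apply; apply: (le_trans (ler_wpM2l (ler0n _ 2) Aq2_sum)).
  by rewrite mulrA -natrM ler_wpM2l.
have e6 : y ^+ 6 / N * E Y6 <= y ^+ 6.
  rewrite mulrAC ler_pdivrMr// ler_wpM2l ?exprn_ge0 ?(ltW y0)//.
  rewrite (expect_sum mD PD) => [|i _]; last exact: (bndX 2 (bg i)).
  rewrite (le_trans _ A2_sum)//; apply: ler_sum => i _.
  exact: (centered_sum_sqr_le mD1 FD1 (fun j => A i j) bnd_psi1 F0 (fun z _ => psi1_le1 hmu z)).
lra.
Qed.

End field_moments.

Section good_event.
Context d (T : measurableType d) (R : realType) (P : probability T R) (D : set T).
Hypotheses (mD : measurable D) (PD : P D = 1%E).

Lemma measurable_gt (W : T -> R) (r : R) : measurable_fun [set: T] W ->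
  measurable [set x | r < W x].
Proof.
move=> mW; rewrite (_ : [set _ | _] = W @^-1` `]r, +oo[%classic).
  by rewrite -[X in measurable X]setTI; exact: mW.
by apply/seteqP; split => x /=; rewrite in_itv/= andbT.
Qed.

Lemma expect_markov (W : T -> R) (r m : R) : bounded_on D W -> (forall x, 0 <= W x) ->
  0 < r -> \int[P]_(x in D) W x <= m * r ->
  \int[P]_(x in D) (\1_[set x | r < W x] x) <= m.
Proof.
move=> bW W0 r0 Wm; have mS := measurable_gt r (bnd_meas bW).
rewrite -(ler_pM2r r0) (le_trans _ Wm)// -(expectZr mD PD); last exact: bnd_indic.
apply: (expect_le mD PD) => //; first by apply: bndM; [exact: bnd_indic|exact: bnd_cst].
move=> x _; rewrite indicE; have [xS|_] := boolP (x \in _); last by rewrite mul0r.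
by rewrite mul1r ltW//; exact: (set_mem xS).
Qed.

Lemma expect_split (S : set T) (f h : T -> R) (r m : R) : measurable S ->
  bounded_on D f -> bounded_on D h -> 0 <= r ->
  (forall x, D x -> ~ S x -> `|f x - h x| <= r) ->
  (forall x, D x -> `|f x - h x| <= 1) ->
  \int[P]_(x in D) (\1_S x) <= m ->
  `|\int[P]_(x in D) f x - \int[P]_(x in D) h x| <= r + m.
Proof.
move=> mS bf bh r0 fr f1 Sm; rewrite -(expectB mD PD)//.
rewrite (le_trans (expect_norm mD PD (bndB bf bh)))//.
apply: (@le_trans _ _ (\int[P]_(x in D) (r + \1_S x))).
  apply: (expect_le mD PD); first exact: (bnd_norm (bndB bf bh)).
    by apply: bndD; [exact: bnd_cst|exact: bnd_indic].
  move=> x Dx; rewrite indicE; have [xS|xS] := boolP (x \in S).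
    by rewrite (le_trans (f1 x Dx))// lerDr.
  by rewrite addr0 fr// => Sx; move: xS; rewrite (mem_set Sx).
rewrite (expectD mD PD); [|exact: bnd_cst|exact: bnd_indic].
by rewrite (expect_cst mD PD) lerD2l.
Qed.

End good_event.

(** * Averaging over the external field *)

Section averaged_functional.
Context (R : realType) (mu F : probability (Borel R) R).
Hypothesis hmu : base_measure mu.
Hypothesis F0 : \int[F]_x psi1 mu x = 0.
Context (n : nat) (q : 'I_n -> R) (kappa v : R).
Hypotheses (kappa0 : 0 <= kappa) (v0 : 0 < v).
Implicit Types (c : n.-tuple (Borel R)) (i j : 'I_n).
Local Notation psi1 := (psi1 mu).
Local Notation D1 := ([set: Borel R]).
Local Notation D := (@box _ (Borel R) D1 n).
Local Notation E f := (\int[prob_pow F n]_(c in D) f c).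
Local Notation N := (gaussE (Num.sqrt v)).

Let mD1 : measurable D1. Proof. exact: measurableT. Qed.
Let FD1 : F D1 = 1%E. Proof. exact: probability_setT. Qed.
Let mD : measurable D. Proof. exact: measurable_box. Qed.
Let PD : prob_pow F n D = 1%E. Proof. exact: prob_pow_box. Qed.
Let s0 : 0 < Num.sqrt v. Proof. by rewrite sqrtr_gt0. Qed.
Let hN := gaussE_expectation s0.

Definition field_stat c : R := kappa * \sum_i q i * psi1 (tnth c i).
Local Notation S := field_stat.

(** Law of a centered Gaussian of variance [v] plus an independent copy of the field statistic. It
    is not Gaussian, but it satisfies an approximate Stein identity with the sum of the two
    variances. *)
Definition averaged (f : R -> R) : R := E (fun c => N (fun z => f (z + S c))).

Let bxi i : bounded_on D (fun c => psi1 (tnth c i)).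
Proof. by apply: bnd_tnth; exact: bnd_psi1. Qed.

Lemma bnd_field_stat : bounded_on D S.
Proof.
apply: bndM; first exact: bnd_cst.
by apply: bnd_sum => i _; apply: bndM; [exact: bnd_cst|exact: bxi].
Qed.

Lemma quad_shift (f : R -> R) x : quad f -> quad (fun z => f (z + x)).
Proof.
move=> [mf [k fk]]; apply: (quad_le (c := `|k| * (2 + 2 * x ^+ 2))) => [|z].
  by apply: measurableT_comp => //; exact: measurable_funD.
rewrite (le_trans (fk _))// -mulrA (le_trans (ler_wpM2r _ (ler_norm k)))//.
  by rewrite addr_ge0 ?sqr_ge0.
rewrite ler_wpM2l//; have := sqr_ge0 (z - x); have := mulr_ge0 (sqr_ge0 z) (sqr_ge0 x); lra.
Qed.

Lemma quad_gauss_shift (f : R -> R) : quad f -> quad (fun x => N (fun z => f (z + x))).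
Proof.
move=> qf; have [mf [k fk]] := qf; split.
  pose H (p : Borel R * Borel R) : R := f (p.2 + p.1) * normal_pdf 0 (Num.sqrt v) p.2.
  have mH : measurable_fun [set: Borel R * Borel R] H.
    apply: measurable_funM; last by apply: (measurableT_comp (measurable_normal_pdf _ _)).
    by apply: (measurableT_comp mf); exact: measurable_funD.
  exact: (measurable_Rintegral_param (@lebesgue_measure R) measurableT mH).
exists (`|k| * (2 + 2 * N (fun z => z ^+ 2))) => x.
have K0 : 0 <= N (fun z => z ^+ 2).
  by rewrite -(eoq_cst hN 0); apply: (eoq_le hN) => [||z]; [exact: quad_cst|exact: quad_sqr|exact: sqr_ge0].
apply: (@le_trans _ _ (N (fun z => `|k| * ((1 + 2 * x ^+ 2) + 2 * z ^+ 2)))).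
  apply: (eoq_norm_le hN); first exact: quad_shift.
    by apply: quadZ; apply: quadD; [exact: quad_cst|apply: quadZ; exact: quad_sqr].
  move=> z; rewrite (le_trans (fk _))// (le_trans (ler_wpM2r _ (ler_norm k)))//.
    by rewrite addr_ge0 ?sqr_ge0.
  by rewrite ler_wpM2l//; have := sqr_ge0 (z - x); lra.
rewrite (eoqZ hN); last by apply: quadD; [exact: quad_cst|apply: quadZ; exact: quad_sqr].
rewrite -mulrA ler_wpM2l// (eoqD hN); [|exact: quad_cst|by apply: quadZ; exact: quad_sqr].
rewrite (eoq_cst hN) (eoqZ hN); last exact: quad_sqr.
by have := mulr_ge0 K0 (sqr_ge0 x); have := sqr_ge0 x; lra.
Qed.

Lemma bnd_averaged (f : R -> R) : quad f -> bounded_on D (fun c => N (fun z => f (z + S c))).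
Proof. by move=> qf; apply: (bnd_quad bnd_field_stat (quad_gauss_shift qf)). Qed.

Lemma averaged_expectation : expectation_on_quad averaged.
Proof.
split=> [f g a qf qg|f g qf qg fg|r]; rewrite /averaged.
- rewrite -(expectZl mD PD); last exact: bnd_averaged.
  rewrite -(expectD mD PD); [|exact: bnd_averaged|by apply: bndM; [exact: bnd_cst|exact: bnd_averaged]].
  apply: expect_eq => c _; have [h _ _] := hN; apply: h; exact: quad_shift.
- apply: (expect_le mD PD); [exact: bnd_averaged..|move=> c _].
  by apply: (eoq_le hN) => [||z]; [exact: quad_shift..|exact: fg].
- rewrite -[RHS](expect_cst mD PD r); apply: expect_eq => c _; exact: (eoq_cst hN).
Qed.

Section stein.
Variables (K y : R).
Hypotheses (kappaK : kappa <= K) (K1 : 1 <= K) (y0 : 0 <= y).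
Hypotheses (q_sum : `|\sum_i q i ^+ 2 - 1| <= y) (q_sum2 : \sum_i q i ^+ 2 <= 2) (q_max : forall i, `|q i| <= y).
Section coordinate.
Variables (B : R) (G G1 : R -> R).
Hypothesis hG : C11_pair B G G1.

Let bG : bounded_on D (fun c => G (S c)).
Proof.
have [[mG _] GB _ _ _] := hG.
by apply: (bnd_comp (M := B)) => //; have [] := bnd_field_stat.
Qed.

Let bG1 : bounded_on D (fun c => G1 (S c)).
Proof.
have [[_ mG1] _ G1B _ _] := hG.
by apply: (bnd_comp (M := B)) => //; have [] := bnd_field_stat.
Qed.

(** Leave-one-out: [Si] omits coordinate i, so centering kills the zeroth order of G at [Si] and the
    first order yields the variance of psi'(c_i). The 2 counts the Taylor remainder and the return
    of G1 from [Si] to S. *)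
Lemma coordinate_stein i : `|E (fun c => psi1 (tnth c i) * G (S c))
   - kappa * q i * (var_mean mu F * E (fun c => G1 (S c)))| <= 2 * B * (kappa ^+ 2 * q i ^+ 2).
Proof.
have B0 := C11_ge0 hG; have [[mG mG1] GB G1B G1L GT] := hG.
pose Si c : R := kappa * \sum_(j | j != i) q j * psi1 (tnth c j).
have bSi : bounded_on D Si.
  apply: bndM; first exact: bnd_cst.
  by apply: bnd_sum => j _; apply: bndM; [exact: bnd_cst|exact: bxi].
have SE c : S c = Si c + kappa * q i * psi1 (tnth c i).
  by rewrite /S (bigD1 i)//= mulrDr addrC mulrA.
have Siu c z : Si (upd c i z) = Si c.
  rewrite /Si; congr (kappa * _); apply: eq_bigr => j ji.
  by rewrite tnth_upd (negbTE ji).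
have bGi : bounded_on D (fun c => G (Si c)).
  by apply: (bnd_comp (M := B)) => //; have [] := bSi.
have bG1i : bounded_on D (fun c => G1 (Si c)).
  by apply: (bnd_comp (M := B)) => //; have [] := bSi.
have e1 : E (fun c => psi1 (tnth c i) * G (Si c)) = 0.
  have hu c z : G (Si (upd c i z)) = G (Si c) by rewrite Siu.
  exact: (expect_indep0 mD1 FD1 (bnd_psi1 hmu) bGi hu F0).
have e2 : E (fun c => psi1 (tnth c i) ^+ 2 * G1 (Si c)) = var_mean mu F * E (fun c => G1 (Si c)).
  have hu c z : G1 (Si (upd c i z)) = G1 (Si c) by rewrite Siu.
  exact: (expect_indep mD1 FD1 (bndX 2 (bnd_psi1 hmu)) bG1i hu).
have d1 : `|E (fun c => psi1 (tnth c i) * G (S c)) - E (fun c => psi1 (tnth c i) * G (Si c))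
    - kappa * q i * E (fun c => psi1 (tnth c i) ^+ 2 * G1 (Si c))| <= B * (kappa ^+ 2 * q i ^+ 2).
  have c1 := bndM (bxi i) bG; have c2 := bndM (bxi i) bGi; have c3 := bndM (bndX 2 (bxi i)) bG1i.
  have c4 := bndM (bnd_cst D (kappa * q i)) c3.
  rewrite -(expectB mD PD c1 c2) -(expectZl mD PD _ c3) -(expectB mD PD (bndB c1 c2) c4).
  apply: (expect_norm_le mD PD (bndB (bndB c1 c2) c4)) => c _.
  rewrite (_ : _ - _ = psi1 (tnth c i) * (G (S c) - G (Si c) - (S c - Si c) * G1 (Si c))); last first.
    have -> : S c - Si c = kappa * q i * psi1 (tnth c i) by rewrite SE addrAC subrr add0r.
    ring.
  rewrite normrM -[leRHS]mul1r ler_pM ?psi1_le1// (le_trans (GT _ _))//.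
  rewrite SE addrAC subrr add0r exprMn; apply: ler_wpM2l => //.
  rewrite exprMn; apply: ler_piMr; first by apply: mulr_ge0; exact: sqr_ge0.
  by rewrite -real_normK ?num_real// exprn_ile1// psi1_le1.
have d2 : `|E (fun c => G1 (Si c)) - E (fun c => G1 (S c))| <= B * (kappa * `|q i|).
  rewrite -(expectB mD PD bG1i bG1); apply: (expect_norm_le mD PD (bndB bG1i bG1)) => c _.
  rewrite (le_trans (G1L _ _))// SE opprD addrA subrr add0r normrN !normrM (ger0_norm kappa0).
  by rewrite ler_wpM2l// ler_piMr ?mulr_ge0// psi1_le1.
rewrite e1 subr0 e2 in d1.
rewrite (_ : _ - _ = (E (fun c => psi1 (tnth c i) * G (S c)) - kappa * q i * (var_mean mu F * E (fun c => G1 (Si c))))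
   + kappa * q i * (var_mean mu F * (E (fun c => G1 (Si c)) - E (fun c => G1 (S c))))); last by ring.
rewrite (le_trans (ler_normD _ _))// (_ : 2 * B * _ = B * (kappa ^+ 2 * q i ^+ 2) + B * (kappa ^+ 2 * q i ^+ 2)); last by ring.
rewrite lerD// !normrM (ger0_norm kappa0) (ger0_norm (var_mean_ge0 _ _)).
rewrite (_ : B * _ = kappa * `|q i| * (1 * (B * (kappa * `|q i|)))); last first.
  by rewrite -[q i ^+ 2]real_normK ?num_real//; ring.
by rewrite ler_wpM2l ?mulr_ge0// ler_pM ?var_mean_ge0// var_mean_le1.
Qed.

End coordinate.

Variables (B : R) (g g1 : R -> R).
Hypothesis hg : C11_pair B g g1.

Let G x := N (fun z => g (z + x)).
Let G1 x := N (fun z => g1 (z + x)).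

Let hG : C11_pair B G G1.
Proof.
have n1 : `|1 : R| <= 1 by rewrite normr1.
have := C11_average 1 hN hg n1.
congr (C11_pair _ _ _); apply/funext => x.
  by rewrite /G; congr N; apply/funext => z; rewrite !mul1r addrC.
by rewrite mul1r /G1; congr N; apply/funext => z; rewrite !mul1r addrC.
Qed.

(** The factor x is split as z + S. The Gaussian part z integrates by parts exactly and gives [v];
    the part S is expanded coordinate by coordinate with [g] smoothed by the Gaussian. *)
Lemma averaged_stein : `|averaged (fun x => x * g x) - (v + kappa ^+ 2 * var_mean mu F) * averaged g1|
  <= B * (5 * K ^+ 3 * y).
Proof.
have B0 := C11_ge0 hG; have [[mG mG1] GB G1B G1L GT] := hG.
have [[mg mg1] gB g1B _ _] := hg.
have qg : quad g by exact: (quad_bnd (c := B)).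
have qg1 : quad g1 by exact: (quad_bnd (c := B)).
have bG : bounded_on D (fun c => G (S c)) by exact: bnd_averaged.
have bG1 : bounded_on D (fun c => G1 (S c)) by exact: bnd_averaged.
have bSG : bounded_on D (fun c => S c * G (S c)) by apply: bndM; [exact: bnd_field_stat|exact: bG].
have e1 : averaged (fun x => x * g x) = v * averaged g1 + E (fun c => S c * G (S c)).
  rewrite /averaged -(expectZl mD PD _ (bnd_averaged qg1)).
  rewrite -(expectD mD PD (bndM (bnd_cst D v) (bnd_averaged qg1)) bSG); apply: expect_eq => c _.
  transitivity (N (fun z => z * g (z + S c)) + S c * N (fun z => g (z + S c))).
    have mgS : measurable_fun [set: R] (fun z => g (z + S c)) by have [] := quad_shift (S c) qg.
    have q1 : quad (fun z => z * g (z + S c)) by exact: (quad_idM (c := B)).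
    rewrite -(eoqZ hN); last exact: quad_shift.
    rewrite -(eoqD hN) //; last by apply: quadZ; exact: quad_shift.
    by congr N; apply/funext => z; rewrite mulrDl.
  congr (_ + _).
  have hgS : C11_pair B (fun z => g (S c + 1 * z)) (fun z => 1 * g1 (S c + 1 * z)).
    by apply: C11_affine => //; rewrite normr1.
  have := gaussE_stein s0 hgS; rewrite sqr_sqrtr ?ltW//.
  have -> : (fun z => 1 * g1 (S c + 1 * z)) = (fun z => g1 (z + S c)).
    by apply/funext => z; rewrite !mul1r addrC.
  by have -> : (fun z => z * g (S c + 1 * z)) = (fun z => z * g (z + S c));
    [apply/funext => z; rewrite mul1r addrC|].
have e2 : E (fun c => S c * G (S c)) = \sum_i kappa * q i * E (fun c => psi1 (tnth c i) * G (S c)).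
  have bb i : bounded_on D (fun c => kappa * q i * (psi1 (tnth c i) * G (S c))).
    by apply: bndM; [exact: bnd_cst|apply: bndM; [exact: bxi|exact: bG]].
  transitivity (E (fun c => \sum_i kappa * q i * (psi1 (tnth c i) * G (S c)))).
    apply: expect_eq => c _; rewrite {1}/S mulr_sumr mulr_suml; apply: eq_bigr => i _; ring.
  rewrite (expect_sum mD PD); last by move=> i _; exact: bb.
  by apply: eq_bigr => i _; rewrite (expectZl mD PD)//; apply: bndM; [exact: bxi|exact: bG].
have aE : averaged g1 = E (fun c => G1 (S c)) by [].
rewrite e1 e2 aE; set e := E (fun c => G1 (S c)).
have eB : `|e| <= B by exact: (expect_norm_le mD PD bG1).
rewrite (_ : _ - _ = \sum_i kappa * q i * (E (fun c => psi1 (tnth c i) * G (S c)) - kappa * q i * (var_mean mu F * e))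
   + kappa ^+ 2 * var_mean mu F * e * (\sum_i q i ^+ 2 - 1)); last first.
  under [in RHS]eq_bigr do rewrite mulrBr; rewrite sumrB.
  have -> : \sum_i kappa * q i * (kappa * q i * (var_mean mu F * e)) = kappa ^+ 2 * var_mean mu F * e * \sum_i q i ^+ 2.
    by rewrite mulr_sumr; apply: eq_bigr => i _; ring.
  ring.
have K0 : 0 <= K := le_trans ler01 K1.
have t1 : `|\sum_i kappa * q i * (E (fun c => psi1 (tnth c i) * G (S c)) - kappa * q i * (var_mean mu F * e))|
    <= 4 * K ^+ 3 * y * B.
  rewrite (le_trans (ler_norm_sum _ _ _))//.
  apply: (@le_trans _ _ (\sum_i (2 * K ^+ 3 * y * B) * q i ^+ 2)).
    apply: ler_sum => i _; rewrite !normrM (ger0_norm kappa0).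
    rewrite (_ : 2 * K ^+ 3 * y * B * q i ^+ 2 = K * y * (2 * B * (K ^+ 2 * q i ^+ 2))); last by ring.
    apply: ler_pM => //; first by rewrite mulr_ge0.
      by rewrite ler_pM.
    rewrite (le_trans (coordinate_stein hG i))// !ler_wpM2l ?mulr_ge0// ler_wpM2r ?sqr_ge0//.
    by rewrite lerXn2r ?nnegrE.
  rewrite -mulr_sumr (_ : 4 * K ^+ 3 * y * B = 2 * K ^+ 3 * y * B * 2); last by ring.
  by rewrite ler_wpM2l// !mulr_ge0// exprn_ge0.
have t2 : `|kappa ^+ 2 * var_mean mu F * e * (\sum_i q i ^+ 2 - 1)| <= K ^+ 2 * 1 * B * y.
  rewrite normrM ler_pM// normrM ler_pM// ger0_norm ?mulr_ge0 ?sqr_ge0 ?var_mean_ge0//.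
  by rewrite ler_pM ?sqr_ge0 ?var_mean_ge0 ?var_mean_le1// lerXn2r ?nnegrE.
rewrite (le_trans (ler_normD _ _))// (le_trans (lerD t1 t2))//.
rewrite (_ : B * _ = 4 * K ^+ 3 * y * B + K ^+ 3 * 1 * B * y); last by ring.
by rewrite lerD2l !ler_wpM2r// ler_weXn2l.
Qed.

End stein.
End averaged_functional.

(** The deterministic properties of graph and types on which the limits rest: a contraction bound,
    small squared row sums, a normalized and delocalized [q], and [q] an approximate eigenvector
    with an error that survives the factor n alpha. *)
Definition well_spread (R : realType) (n : nat) (rho tl alpha y : R) (A : 'M[R]_n) (q : 'I_n -> R) : Prop :=
  [/\ forall i, \sum_j `|A i j| <= rho, forall i, \sum_j A i j ^+ 2 <= alpha,
      `|\sum_i q i ^+ 2 - 1| <= y ^+ 6, forall i, `|q i| <= y ^+ 6 &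
      n%:R * alpha * (\sum_i (tl * q i - \sum_j A i j * q j) ^+ 2) <= y ^+ 6].

Section quenched_average.
Context (R : realType) (mu F : probability (Borel R) R).
Hypothesis hmu : base_measure mu.
Hypothesis F0 : \int[F]_x psi1 mu x = 0.
Local Notation ups := (mean_var mu F).
Variables (rho tl kappa K : R).
Hypotheses (rho0 : 0 < rho) (rho1 : rho < 1).
Hypotheses (kappaE : kappa * (1 - tl * ups) = 1) (kappa0 : 0 < kappa) (kappaK : kappa <= K) (K1 : 1 <= K).
Local Notation v1 := (kappa * ups).
Local Notation v2 := (kappa * ups + kappa ^+ 2 * var_mean mu F).
Local Notation L := ((1 - rho)^-1).

Let v1_gt0 : 0 < v1. Proof. by rewrite mulr_gt0// mean_var_gt0. Qed.

Lemma limit_variance_gt0 : 0 < v2.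
Proof. by rewrite ltr_pwDl// mulr_ge0 ?sqr_ge0 ?var_mean_ge0. Qed.

Definition quenched_error (e y : R) : R :=
  2 * e * (1 + normal_peak (Num.sqrt v1)) + 2 * (e^-1 ^+ 6) * (stein_cst rho kappa * (11 * K * (L * y))).

(** In order: the Gaussian approximation at a good field, the recentering from the optimizer to the
    field statistic at the cost of the peak density, the probability of a bad field, and the Stein
    comparison of the mixture with the limit. *)
Definition averaged_error (e y : R) : R :=
  quenched_error e y + normal_peak (Num.sqrt v1) * (12 * K * L * (L * y)) + 13 * y ^+ 2
  + (2 * e * (1 + normal_peak (Num.sqrt v2)) + 2 * (e^-1 ^+ 6) * (5 * K ^+ 3 * y ^+ 6)).

Context (n : nat) (A : 'M[R]_n) (q : 'I_n -> R) (alpha y : R).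
Hypotheses (hA : coupling_matrix A) (hq : well_spread rho tl alpha y A q).
Hypotheses (y0 : 0 < y) (y1 : y <= 1) (N1 : 1 <= n%:R * alpha).
Hypotheses (alpha_y : alpha <= y ^+ 6) (Nalpha : n%:R * alpha * alpha <= y ^+ 6).
Implicit Types (c s : n.-tuple (Borel R)) (i j : 'I_n).
Local Notation D := (@box _ (Borel R) [set: Borel R] n).
Local Notation E f := (\int[prob_pow F n]_(c in D) f c).
Let w i : R := tl * q i - \sum_j A i j * q j.
Local Notation W := (field_defect mu F A q w (n%:R * alpha) y).

Let K0 : 0 <= K. Proof. exact: le_trans K1. Qed.
Let L1 : 1 <= L. Proof. by rewrite invf_ge1 ?subr_gt0// gerBl ltW. Qed.
Let y_le m m' : (m <= m')%N -> y ^+ m' <= y ^+ m.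
Proof. by move=> mm; rewrite ler_wiXn2l// ltW. Qed.
Let yKL : y <= 11 * K * (L * y).
Proof.
have h : 1 * (1 * y) <= 11 * K * (L * y).
  apply: ler_pM => //; first by rewrite mul1r ltW.
    by rewrite -[leLHS]mulr1 ler_pM// ler1n.
  by rewrite ler_wpM2r// ltW.
by rewrite !mul1r in h.
Qed.

Let q_sum2 : \sum_i q i ^+ 2 <= 2.
Proof.
have [_ _ h _ _] := hq; have : y ^+ 6 <= 1 by exact: (y_le (leq0n 6)).
by move: h; rewrite ler_norml => /andP[_]; lra.
Qed.

Lemma expect_bad_field : E (fun c => \1_[set c | y ^+ 4 < W c] c) <= 13 * y ^+ 2.
Proof.
have [_ Aalpha q1 q_max w_small] := hq.
have mD : measurable D by exact: measurable_box.
have PD : prob_pow F n D = 1%E by apply: prob_pow_box => //; exact: probability_setT.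
apply: (expect_markov mD PD).
- exact: (bnd_field_defect F hmu).
- by move=> c; exact: field_defect_ge0.
- by rewrite exprn_gt0.
- rewrite (le_trans (expect_field_defect hmu F0 hA Aalpha y0 y1 erefl N1 alpha_y Nalpha q_sum2 q_max w_small))//.
  by rewrite -mulrA -exprD.
Qed.

Section good.
Variables (c u : n.-tuple (Borel R)).
Hypothesis u_fix : forall i, tnth u i = psi1 mu (local_field A u i + tnth c i).
Hypothesis c_good : W c <= y ^+ 4.

Lemma quenched_clt (e t : R) : 0 < e -> e <= 1 ->
  `|gexp mu A c (fun s => \1_(`]-oo, t]%classic) (\sum_i q i * (tnth s i - tnth u i)))
    - gaussE (Num.sqrt v1) (\1_(`]-oo, t]%classic))| <= quenched_error e y.
Proof.
move=> e0 e1; have [Arho Aalpha q1 q_max w_small] := hq.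
have [[hY1 hY2 hY3 hY4 hY5] hY6] := field_defect_small y0 N1 c_good.
have a0 : 0 <= alpha.
  by rewrite leNgt; apply/negP => a0; have := lt_le_trans ltr01 N1; rewrite ltNge mulr_ge0_le0// ltW.
have tau0 : 0 <= 11 * K * (L * y) := le_trans (ltW y0) yKL.
have ytau m m' : (m <= m')%N -> y ^+ m' <= (11 * K * (L * y)) ^+ m.
  move=> mm; rewrite (le_trans (y_le mm))//.
  by case: m mm => [|m] _; rewrite ?expr0// lerXn2r ?nnegrE// ltW.
have res := good_residual hmu rho0 rho1 Arho hA u_fix (ltW (mean_var_gt0 F hmu)) (mean_var_le1 F hmu)
  kappaE (ltW kappa0) kappaK K1 y0 y1 N1 q1 q_max w_small hY1 hY2.
have var := good_variance hmu rho0 rho1 Arho hA u_fix (ltW (mean_var_gt0 F hmu)) (mean_var_le1 F hmu)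
  (ltW kappa0) kappaK y0 y1 q1 q_max hY1 hY3.
apply: (gibbs_clt hmu hA (ltW rho0) rho1 Arho Aalpha u_fix _ (ltW kappa0) tau0 _ _ q_sum2 _ res v1_gt0 var) => //.
- by rewrite expr2 mulrA (le_trans Nalpha)// (y_le (leq0n 6)).
- by rewrite (le_trans alpha_y)// ytau.
- by move=> i; rewrite (le_trans (q_max i))// (le_trans (ytau 1 6 _))// expr1.
(* By Cauchy-Schwarz the square of alpha times the l1 norm of q is at most 2 n alpha^2. *)
- have s0 : 0 <= \sum_i `|q i| by exact: sumr_ge0.
  rewrite -ler_sqr ?nnegrE//; last exact: mulr_ge0.
  rewrite exprMn.
  apply: (@le_trans _ _ (alpha ^+ 2 * (n%:R * 2))).
    rewrite ler_wpM2l ?sqr_ge0// (le_trans (sum_sqr_le1 _))// ler_wpM2l//.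
    by rewrite (eq_bigr (fun i => q i ^+ 2))// => i _; rewrite real_normK ?num_real.
  rewrite (_ : alpha ^+ 2 * _ = 2 * (n%:R * alpha * alpha)); last by ring.
  apply: (@le_trans _ _ (2 * y ^+ 2)).
    by rewrite ler_wpM2l// (le_trans Nalpha)// y_le.
  rewrite (_ : (11 * K * (L * y)) ^+ 2 = (11 * K * L) ^+ 2 * y ^+ 2); last by ring.
  rewrite ler_wpM2r ?sqr_ge0// (_ : (11 * K * L) ^+ 2 = 121 * (K * L) ^+ 2); last by ring.
  apply: (@le_trans _ _ (2 * 1)); first by rewrite mulr1.
  by rewrite ler_pM// ?ler_nat// expr_ge1// ?mulr_ege1// mulr_ge0// (le_trans ler01).
Qed.

Lemma quenched_shift : `|\sum_i q i * tnth u i - field_stat mu q kappa c| <= 12 * K * L * (L * y).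
Proof.
have [Arho Aalpha q1 q_max w_small] := hq.
have [[hY1 hY2 hY3 hY4 hY5] hY6] := field_defect_small y0 N1 c_good.
exact: (good_shift hmu rho0 rho1 Arho hA u_fix (ltW (mean_var_gt0 F hmu)) (mean_var_le1 F hmu)
  kappaE (ltW kappa0) kappaK K1 y0 y1 N1 q1 w_small hY1 hY2 hY4 hY5 hY6).
Qed.

End good.
(** Numerator and normalization are parameter integrals of a weight jointly measurable in field and
    spins. This is the quantity integrated over the field, whatever the selection of optimizers. *)
Lemma bnd_gexp_field (f : R -> R) : measurable_fun [set: R] f -> (forall x, `|f x| <= 1) ->
  bounded_on D (fun c => gexp mu A c (fun s => f (\sum_i q i * tnth s i))).
Proof.
move=> mf f1; have muI := base_measureI hmu.
have bf : bounded_on (@box _ (Borel R) (I11 R) n) (fun s => f (\sum_i q i * tnth s i)).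
  by apply: (bnd_comp (M := 1)) => //; have [] := bnd_lin q.
split; last first.
  by exists 1 => c _; apply: (gexp_norm_le muI A c bf) => s _; exact: f1.
have mB : measurable (@box _ (Borel R) (I11 R) n) by apply: measurable_box; exact: measurable_itv.
have mW : measurable_fun [set: n.-tuple (Borel R) * n.-tuple (Borel R)] (fun p => weight A p.1 p.2).
  apply: measurableT_comp => //; apply: measurable_funD.
    have [m _] := bnd_energy A [tuple 0 | i < n].
    have e : (fun p : n.-tuple (Borel R) * n.-tuple (Borel R) => 2^-1 * (\sum_i \sum_j tnth p.2 i * A i j * tnth p.2 j))
      = (fun p => energy A [tuple 0 | i < n] p.2).
      apply/funext => p; rewrite /energy [X in _ = _ + X]big1 ?addr0// => i _.
      by rewrite tnth_mktuple mul0r.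
    by rewrite e; apply: measurableT_comp.
  apply: measurable_sum => i; apply: measurable_funM.
    by apply: (measurableT_comp (@measurable_tnth _ _ _ i)).
  by apply: (measurableT_comp (@measurable_tnth _ _ _ i)).
have e : (fun c => gexp mu A c (fun s => f (\sum_i q i * tnth s i))) =
   (fun c => (\int[prob_pow mu n]_(s in @box _ (Borel R) (I11 R) n) (f (\sum_i q i * tnth s i) * weight A c s))
     * (\int[prob_pow mu n]_(s in @box _ (Borel R) (I11 R) n) weight A c s)^-1).
  by apply/funext => c; rewrite gexpE.
rewrite e; apply: measurable_funM.
  apply: (@measurable_Rintegral_param _ _ _ _ _ (prob_pow mu n) _
     (fun p => f (\sum_i q i * tnth p.2 i) * weight A p.1 p.2) mB).
  apply: measurable_funM => //.
  by have [m _] := bf; apply: (measurableT_comp m).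
apply: (measurableT_comp (@measurable_invr R)).
exact: (@measurable_Rintegral_param _ _ _ _ _ (prob_pow mu n) _ (fun p => weight A p.1 p.2) mB).
Qed.

Variable u : n.-tuple (Borel R) -> n.-tuple (Borel R).
Hypothesis u_fix : forall c i, tnth (u c) i = psi1 mu (local_field A (u c) i + tnth c i).

(** At a good field the Gibbs probability is close to that of a Gaussian centered at the sum of the
    q_i u_i, then at the field statistic; at a bad field the two differ by at most 1. Averaging
    leaves the Gaussian mixture, handled by its Stein identity. *)
Lemma averaged_clt (e t : R) : 0 < e -> e <= 1 ->
  `|E (fun c => gexp mu A c (fun s => \1_(`]-oo, t]%classic) (\sum_i q i * tnth s i)))
    - gaussE (Num.sqrt v2) (\1_(`]-oo, t]%classic))| <= averaged_error e y.
Proof.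
move=> e0 e1; have [Arho Aalpha q1 q_max w_small] := hq; have muI := base_measureI hmu.
have mD : measurable D by exact: measurable_box.
have PD : prob_pow F n D = 1%E by apply: prob_pow_box => //; exact: probability_setT.
have qray t' : quad (\1_(`]-oo, t']%classic) : R -> R) by exact: quad_indic.
have s0 : 0 < Num.sqrt v1 by rewrite sqrtr_gt0.
have hN := gaussE_expectation s0.
have hE := averaged_expectation F hmu q kappa v1_gt0.
have step2 : `|averaged mu F q kappa v1 (\1_(`]-oo, t]%classic)) - gaussE (Num.sqrt v2) (\1_(`]-oo, t]%classic))|
    <= 2 * e * (1 + normal_peak (Num.sqrt v2)) + 2 * (e^-1 ^+ 6) * (5 * K ^+ 3 * y ^+ 6).
  apply: (clt_of_stein t hE (lexx _) limit_variance_gt0) => //.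
    by rewrite !mulr_ge0 ?exprn_ge0// ltW.
  move=> B g g1 hg.
  exact: (averaged_stein hmu F0 (ltW kappa0) v1_gt0 kappaK K1 (exprn_ge0 6 (ltW y0)) q1 q_sum2 q_max hg).
pose bad := [set c : n.-tuple (Borel R) | y ^+ 4 < W c].
have mbad : measurable bad by apply: measurable_gt; have [] := bnd_field_defect F hmu A q w (n%:R * alpha) y.
have bg : bounded_on D (fun c => gexp mu A c (fun s => \1_(`]-oo, t]%classic) (\sum_i q i * tnth s i))).
  apply: bnd_gexp_field => // x.
  by rewrite indicE; case: (_ \in _); rewrite ?normr1 ?normr0.
have bN := bnd_averaged hmu q kappa v1_gt0 (qray t).
have shiftE c : gaussE (Num.sqrt v1) (fun z => \1_(`]-oo, t]%classic) (z + field_stat mu q kappa c))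
    = gaussE (Num.sqrt v1) (\1_(`]-oo, t - field_stat mu q kappa c]%classic)).
  by congr gaussE; apply/funext => z; rewrite !indicE !mem_setE !in_itv/= lerBrDr.
have peak0 := normal_peak_ge0 (Num.sqrt v1).
have near c : D c -> ~ bad c ->
  `|gexp mu A c (fun s => \1_(`]-oo, t]%classic) (\sum_i q i * tnth s i))
   - gaussE (Num.sqrt v1) (fun z => \1_(`]-oo, t]%classic) (z + field_stat mu q kappa c))|
  <= quenched_error e y + normal_peak (Num.sqrt v1) * (12 * K * L * (L * y)).
  move=> _ /negP; rewrite -leNgt => cgood; rewrite shiftE//.
  set m := \sum_i q i * tnth (u c) i.
  have -> : gexp mu A c (fun s => \1_(`]-oo, t]%classic) (\sum_i q i * tnth s i))
     = gexp mu A c (fun s => \1_(`]-oo, t - m]%classic) (\sum_i q i * (tnth s i - tnth (u c) i))).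
    apply: eq_gexp => s _; rewrite !indicE !mem_setE !in_itv/= lerBrDr /m -big_split/=.
    by congr ((_ <= _)%R%:R); apply: eq_bigr => i _; rewrite mulrBr subrK.
  have h1 := quenched_clt (u_fix c) cgood (t - m) e0 e1.
  have h2 := quenched_shift (u_fix c) cgood.
  have h3 a b : `|gaussE (Num.sqrt v1) (\1_(`]-oo, a]%classic)) - gaussE (Num.sqrt v1) (\1_(`]-oo, b]%classic))|
      <= normal_peak (Num.sqrt v1) * `|a - b|.
    wlog ab : a b / a <= b => [h|].
      by have [/h//|/ltW /h] := leP a b; rewrite distrC [`|b - a|]distrC.
    have := normal_prob_ray_lipschitz s0 ab.
    have : gaussE (Num.sqrt v1) (\1_(`]-oo, a]%classic)) <= gaussE (Num.sqrt v1) (\1_(`]-oo, b]%classic)).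
      apply: (eoq_le hN) => // x; rewrite !indicE !mem_setE !in_itv/=.
      by case: (leP x a) => // xa; rewrite (le_trans xa ab).
    move=> h4 h5; rewrite distrC ger0_norm ?subr_ge0// distrC ger0_norm ?subr_ge0//.
    by rewrite lerBlDl.
  rewrite -(subrKA (gaussE (Num.sqrt v1) (\1_(`]-oo, t - m]%classic)))) (le_trans (ler_normD _ _))// lerD//.
  rewrite (le_trans (h3 _ _))// ler_wpM2l// (_ : t - m - _ = field_stat mu q kappa c - m); last by ring.
  by rewrite distrC.
have far c : D c ->
  `|gexp mu A c (fun s => \1_(`]-oo, t]%classic) (\sum_i q i * tnth s i))
   - gaussE (Num.sqrt v1) (fun z => \1_(`]-oo, t]%classic) (z + field_stat mu q kappa c))| <= 1.
  move=> _.
  have bf : bounded_on (@box _ (Borel R) (I11 R) n) (fun s => \1_(`]-oo, t]%classic) (\sum_i q i * tnth s i) : R).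
    by apply: (measurable_gexp_ray t); exact: bnd_lin.
  have g0 : 0 <= gexp mu A c (fun s => \1_(`]-oo, t]%classic) (\sum_i q i * tnth s i)).
    by apply: (gexp_ge0 muI) => // s _; rewrite indicE; case: (_ \in _).
  have g1 : gexp mu A c (fun s => \1_(`]-oo, t]%classic) (\sum_i q i * tnth s i)) <= 1.
    rewrite -[leRHS](gexp_cst muI A c); apply: (gexp_le muI) => [||s _]; [exact: bf|exact: bnd_cst|].
    by rewrite indicE; case: (_ \in _).
  have q' := quad_shift (field_stat mu q kappa c) (qray t).
  have n0 : 0 <= gaussE (Num.sqrt v1) (fun z => \1_(`]-oo, t]%classic) (z + field_stat mu q kappa c)).
    rewrite -[leLHS](eoq_cst hN 0); apply: (eoq_le hN) => [||x]; [exact: quad_cst|exact: q'|].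
    by rewrite indicE; case: (_ \in _).
  have n1 : gaussE (Num.sqrt v1) (fun z => \1_(`]-oo, t]%classic) (z + field_stat mu q kappa c)) <= 1.
    rewrite -[leRHS](eoq_cst hN 1); apply: (eoq_le hN) => [||x]; [exact: q'|exact: quad_cst|].
    by rewrite indicE; case: (_ \in _).
  move: g0 g1 n0 n1; move: (gexp _ _ _ _) (gaussE _ _) => a b a0 a1 b0 b1.
  by rewrite ler_norml; apply/andP; split; lra.
have tau0 : 0 <= 11 * K * (L * y) := le_trans (ltW y0) yKL.
have err0 : 0 <= quenched_error e y + normal_peak (Num.sqrt v1) * (12 * K * L * (L * y)).
  have L0 : 0 <= L := le_trans ler01 L1.
  rewrite addr_ge0//; last by rewrite mulr_ge0// !mulr_ge0// ltW.
  rewrite /quenched_error addr_ge0//; first by rewrite !mulr_ge0 ?addr_ge0 ?(ltW e0).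
  apply: mulr_ge0; first by rewrite mulr_ge0// exprn_ge0// invr_ge0 ltW.
  by apply: mulr_ge0 => //; apply: stein_cst_ge0 => //; exact: ltW.
have step1 := expect_split mD PD mbad bg bN err0 near far expect_bad_field.
rewrite -(subrKA (averaged mu F q kappa v1 (\1_(`]-oo, t]%classic)))) (le_trans (ler_normD _ _))//.
by rewrite /averaged_error lerD.
Qed.

End quenched_average.

(** * Random graphs with given types *)

Section random_adjacency.
Context (R : realType) (n : nat).
Implicit Types (g : 'M[bool]_n) (i j : 'I_n) (e : 'I_n * 'I_n).

Definition adjb g : bool := (g^T == g) && [forall i, ~~ g i i].

Lemma adjP g : reflect (adjacency g) (adjb g).
Proof.
apply: (iffP andP) => [[/eqP gt /forallP gd]|[gt gd]].
  by split=> // i; apply/negbTE; exact: gd.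
by split; [exact/eqP|apply/forallP => i; rewrite gd].
Qed.

Definition lt_edge e : bool := (e.1 < e.2)%N.

(** Symmetric loopless matrices correspond to Boolean functions on the pairs i < j, set to false on
    all other pairs; through this bijection the sum is an expanded product. *)
Lemma adjacency_big_distr (phi : 'I_n * 'I_n -> bool -> R) :
  \sum_(g | adjb g) \prod_(e | lt_edge e) phi e (g e.1 e.2)
  = \prod_(e | lt_edge e) (phi e true + phi e false).
Proof.
transitivity (\prod_(e | lt_edge e) \sum_(b : bool) phi e b); last first.
  by apply: eq_bigr => e _; rewrite big_bool.
rewrite (big_distr_big false).
pose h (f : {ffun 'I_n * 'I_n -> bool}) : 'M[bool]_n := \matrix_(i, j) (f (i, j) || f (j, i)).
pose h' g : {ffun 'I_n * 'I_n -> bool} := [ffun e => lt_edge e && g e.1 e.2].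
rewrite (reindex_onto h h') => [|g /andP[/eqP gt /forallP gd]]; last first.
  apply/matrixP => i j; rewrite mxE !ffunE /lt_edge/=.
  have gij : g j i = g i j by rewrite -[in LHS]gt mxE.
  case: (ltngtP i j) => [_|_|/ord_inj ij] /=; rewrite ?orbF ?gij//.
  by rewrite ij (negbTE (gd j)).
apply: eq_big => [f|f /andP[fa /eqP fh]].
  apply/idP/idP.
    move=> /andP[_ /eqP fh]; apply/familyP => e; rewrite unfold_in -/(lt_edge e).
    by case: ifP => le //; rewrite -fh ffunE le.
  move=> /familyP ff.
  have f0 e : ~~ lt_edge e -> f e = false.
    by move=> le; have := ff e; rewrite unfold_in -/(lt_edge e) (negbTE le) => /eqP.
  apply/andP; split.
    apply/andP; split; first by apply/eqP/matrixP => i j; rewrite !mxE orbC.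
    by apply/forallP => i; rewrite mxE f0 // /lt_edge ltnn.
  apply/eqP/ffunP => e; rewrite ffunE mxE.
  have [le|le] := boolP (lt_edge e); last by rewrite f0.
  rewrite -surjective_pairing (f0 (e.2, e.1)) ?orbF//.
  by rewrite /lt_edge/= -leqNgt ltnW.
apply: eq_bigr => e le; congr (phi e _).
by rewrite -{2}fh ffunE le.
Qed.

Variable p : 'I_n -> 'I_n -> R.
Hypotheses (p0 : forall i j, 0 <= p i j) (p1 : forall i j, p i j <= 1) (ps : forall i j, p i j = p j i).

Definition adj_pmf g : R := \prod_(e | lt_edge e) bernoulli_pmf (p e.1 e.2) (g e.1 e.2).
Local Notation "'EG' f" := (\sum_(g | adjb g) adj_pmf g * f g) (at level 10).

Lemma adj_pmf_ge0 g : 0 <= adj_pmf g.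
Proof. by apply: prodr_ge0 => e _; rewrite bernoulli_pmf_ge0// p0 p1. Qed.

Lemma adj_expect_prod (phi : 'I_n * 'I_n -> bool -> R) :
  EG (fun g => \prod_(e | lt_edge e) phi e (g e.1 e.2))
  = \prod_(e | lt_edge e) (p e.1 e.2 * phi e true + (1 - p e.1 e.2) * phi e false).
Proof.
rewrite -(adjacency_big_distr (fun e b => bernoulli_pmf (p e.1 e.2) b * phi e b)).
by apply: eq_bigr => g _; rewrite big_split.
Qed.

Lemma adj_pmf_sum : \sum_(g | adjb g) adj_pmf g = 1.
Proof.
have h := adj_expect_prod (fun _ _ => 1).
rewrite [X in _ = X]big1 in h => [|e _]; last by rewrite !mulr1 subrKC.
by rewrite -[RHS]h; apply: eq_bigr => g _; rewrite big1 ?mulr1.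
Qed.

Definition edge i j : 'I_n * 'I_n := if (i < j)%N then (i, j) else (j, i).

Lemma edgeP i j : i != j -> lt_edge (edge i j).
Proof.
rewrite /edge; case: ltnP => // ji ij; rewrite /lt_edge/= ltn_neqAle ji andbT eq_sym.
by apply: contra ij => /eqP /val_inj ->.
Qed.

Lemma edge_inj i j k : edge i j = edge i k -> j = k.
Proof. by rewrite /edge; case: ltnP => _; case: ltnP => _ [] // *; subst. Qed.

Lemma edge_adj g i j : adjb g -> g (edge i j).1 (edge i j).2 = g i j.
Proof.
move=> /adjP[gt _]; rewrite /edge; case: ifP => _ //=.
by rewrite -[in LHS]gt mxE.
Qed.

Lemma edge_prob i j : p (edge i j).1 (edge i j).2 = p i j.
Proof. by rewrite /edge; case: ifP. Qed.

Let c g e : R := (g e.1 e.2)%:R - p e.1 e.2.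
Let t1 : true%:R = 1 :> R. Proof. by []. Qed.
Let f0 : false%:R = 0 :> R. Proof. by []. Qed.

(** The product of two centered entries is written as a product over all edges with factor 1
    elsewhere, so that [adj_expect_prod] factorizes the mean. *)
Lemma adj_cov e e' : lt_edge e -> lt_edge e' ->
  EG (fun g => c g e * c g e') = if e == e' then p e.1 e.2 * (1 - p e.1 e.2) else 0.
Proof.
move=> le le'.
pose k (a : 'I_n * 'I_n) (x : 'I_n * 'I_n) (b : bool) : R := if x == a then b%:R - p x.1 x.2 else 1.
have kE a g : lt_edge a -> \prod_(x | lt_edge x) k a x (g x.1 x.2) = c g a.
  move=> la; rewrite (bigD1 a)//= /k eqxx big1 ?mulr1// => x /andP[_ /negbTE ->] //.
under eq_bigr => g _ do rewrite -(kE e)// -(kE e')// -big_split/=.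
rewrite (adj_expect_prod (fun x b => k e x b * k e' x b)) (bigD1 e)//= /k eqxx.
case: eqVneq => [ee|ee].
  rewrite big1 => [|x /andP[_ xe]]; first by rewrite t1 f0; ring.
  by rewrite -ee (negbTE xe); ring.
have z (x : R) : x * ((true%:R - x) * 1) + (1 - x) * ((false%:R - x) * 1) = 0.
  by rewrite t1 f0; ring.
by rewrite z mul0r.
Qed.

Lemma adj_row_variance (a : 'I_n -> R) i :
  EG (fun g => (\sum_(j | j != i) a j * ((g i j)%:R - p i j)) ^+ 2)
  <= \sum_(j | j != i) a j ^+ 2 * p i j.
Proof.
have -> : EG (fun g => (\sum_(j | j != i) a j * ((g i j)%:R - p i j)) ^+ 2)
   = \sum_(j | j != i) \sum_(k | k != i) a j * a k * EG (fun g => c g (edge i j) * c g (edge i k)).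
  transitivity (EG (fun g => \sum_(j | j != i) \sum_(k | k != i) a j * a k * (c g (edge i j) * c g (edge i k)))).
    apply: eq_bigr => g ga; congr (_ * _); rewrite expr2 big_distrlr/=.
    apply: eq_bigr => j _; apply: eq_bigr => k _; rewrite /c !edge_adj// !edge_prob; ring.
  under eq_bigr do rewrite mulr_sumr; rewrite exchange_big/=; apply: eq_bigr => j _.
  under eq_bigr do rewrite mulr_sumr; rewrite exchange_big/=; apply: eq_bigr => k _.
  by rewrite mulr_sumr; apply: eq_bigr => g _; rewrite mulrCA.
apply: ler_sum => j ji; rewrite (bigD1 j)//=.
have -> : \sum_(k | (k != i) && (k != j)) a j * a k * EG (fun g => c g (edge i j) * c g (edge i k)) = 0.
  apply: big1 => k /andP[ki kj]; rewrite adj_cov ?edgeP// 1?eq_sym//.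
  by case: eqP => [/edge_inj jk|_]; rewrite ?mulr0//; move: kj; rewrite jk eqxx.
rewrite addr0 adj_cov ?edgeP// 1?eq_sym// eqxx edge_prob expr2 ler_wpM2l ?sqr_ge0 -?expr2 ?sqr_ge0//.
by rewrite ler_piMr// gerBl.
Qed.

Lemma adj_row_mean (a : 'I_n -> R) i :
  EG (fun g => \sum_(j | j != i) a j * ((g i j)%:R - p i j)) = 0.
Proof.
transitivity (\sum_(j | j != i) a j * EG (fun g => c g (edge i j))).
  under eq_bigr do rewrite mulr_sumr; rewrite exchange_big/=; apply: eq_bigr => j ji.
  rewrite mulr_sumr; apply: eq_bigr => g ga.
  by rewrite /c !edge_adj// !edge_prob mulrCA.
rewrite big1// => j ji; apply/eqP; rewrite mulf_eq0; apply/orP; right; apply/eqP.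
pose k (x : 'I_n * 'I_n) (b : bool) : R := if x == edge i j then b%:R - p x.1 x.2 else 1.
have le : lt_edge (edge i j) by rewrite edgeP// eq_sym.
have kE g : \prod_(x | lt_edge x) k x (g x.1 x.2) = c g (edge i j).
  by rewrite (bigD1 (edge i j))//= /k eqxx big1 ?mulr1// => x /andP[_ /negbTE ->].
under eq_bigr => g _ do rewrite -kE.
have z (x : R) : x * (true%:R - x) + (1 - x) * (false%:R - x) = 0.
  by rewrite t1 f0; ring.
by rewrite (adj_expect_prod k) (bigD1 (edge i j))//= /k eqxx z mul0r.
Qed.

Lemma adj_row_sqr (b : R) (a : 'I_n -> R) i :
  EG (fun g => (b - \sum_(j | j != i) a j * ((g i j)%:R - p i j)) ^+ 2)
  <= b ^+ 2 + \sum_(j | j != i) a j ^+ 2 * p i j.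
Proof.
apply: (le_trans _ (lerD (lexx _) (adj_row_variance a i))).
set X := fun g => \sum_(j | j != i) a j * ((g i j)%:R - p i j).
have -> : EG (fun g => (b - X g) ^+ 2) = b ^+ 2 - 2 * b * EG X + EG (fun g => X g ^+ 2).
  have e1 : b ^+ 2 = \sum_(g | adjb g) b ^+ 2 * adj_pmf g by rewrite -mulr_sumr adj_pmf_sum mulr1.
  rewrite [X in _ = X - _ + _]e1 mulr_sumr -sumrB -big_split/=.
  by apply: eq_bigr => g _; ring.
by rewrite adj_row_mean mulr0 subr0.
Qed.

(** Independence over edges and 1 + p (exp t - 1) <= exp(p (exp t - 1)). The neighbours of i are
    grouped by edge, at most one to each, to fit a product over all pairs. *)
Lemma adj_exp_degree (t : R) i : 0 <= t ->
  EG (fun g => expR (t * \sum_j (g i j)%:R)) <= expR ((expR t - 1) * \sum_j p i j).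
Proof.
move=> t0; pose k (x : 'I_n * 'I_n) (b : bool) : R :=
  \prod_(j | (j != i) && (edge i j == x)) expR (t * b%:R).
have kE g : adjb g -> expR (t * \sum_j (g i j)%:R) = \prod_(x | lt_edge x) k x (g x.1 x.2).
  move=> ga; rewrite mulr_sumr expR_sum (bigID (fun j => j != i))/= [X in _ * X]big1 ?mulr1; last first.
    by move=> j /negPn/eqP ->; have /adjP[_ ->] := ga; rewrite mulr0 expR0.
  rewrite (partition_big (edge i) lt_edge)/= => [|j ji]; last by rewrite edgeP// eq_sym.
  apply: eq_bigr => x lx; apply: eq_bigr => j /andP[ji /eqP <-].
  by rewrite edge_adj.
under eq_bigr => g ga do rewrite kE//.
rewrite (adj_expect_prod k).
have et : 0 <= expR t - 1 by rewrite subr_ge0 -[leLHS]expR0 ler_expR.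
apply: (@le_trans _ _ (\prod_(j | j != i) expR ((expR t - 1) * p i j))); last first.
  by rewrite -expR_sum ler_expR -mulr_sumr ler_wpM2l// [leRHS](bigD1 i)//= lerDr.
rewrite [leRHS](partition_big (edge i) lt_edge)/= => [|j ji]; last by rewrite edgeP// eq_sym.
apply: ler_prod => x lx; apply/andP; split.
  have k0 b : 0 <= k x b by apply: prodr_ge0 => j _; exact: expR_ge0.
  by rewrite addr_ge0// mulr_ge0// subr_ge0.
have [/existsP[j /andP[ji /eqP jx]]|] := boolP [exists j, (j != i) && (edge i j == x)]; last first.
  rewrite negb_exists => /forallP no.
  rewrite /k !big_pred0 ?mulr1 ?subrKC// => j; exact/negbTE/no.
have only l : (l != i) && (edge i l == x) = (l == j).
  apply/idP/eqP => [/andP[_ /eqP lx']|->]; last by rewrite ji jx eqxx.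
  by apply: (@edge_inj i); rewrite jx.
rewrite /k !(eq_bigl _ _ only) !big_pred1_eq mulr0 expR0 -jx edge_prob ?t1 !mulr1.
by rewrite (le_trans _ (expR_ge1Dx _))// le_eqVlt; apply/orP; left; apply/eqP; ring.
Qed.

End random_adjacency.

(** * Sampling the types *)

Section truncation.
Context d (T : measurableType d) (R : realType) (nu : probability T R) (D : set T).
Hypotheses (mD : measurable D) (nuD : nu D = 1%E).
Variable Q : T -> R.
Hypotheses (mQ : measurable_fun [set: T] Q) (Q2 : \int[nu]_(x in D) (Q x ^+ 2) = 1).
Local Notation E f := (\int[nu]_(x in D) f x).

Let mQ2 : measurable_fun [set: T] (fun x => Q x ^+ 2). Proof. exact: measurable_funX. Qed.

(** The real-valued integral sends infinity to 0, so the value 1 already forces finiteness. *)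
Lemma integrable_sqr : nu.-integrable D (EFin \o (fun x => Q x ^+ 2)).
Proof.
have e : (\int[nu]_(x in D) (Q x ^+ 2)%:E = 1)%E.
  move: Q2; rewrite /Rintegral; set I := (\int[nu]_(x in D) _)%E.
  have I0 : (0 <= I)%E by apply: integral_ge0 => x _; rewrite lee_fin sqr_ge0.
  by case: I I0 => [r _ /= -> //|_ /= /eqP|//]; rewrite eq_sym oner_eq0.
apply/integrableP; split; first by apply/measurable_EFinP; exact: measurable_funTS.
rewrite (_ : \int[_]_(_ in _) _ = 1)%E ?ltry// -e; apply: eq_integral => x _ /=.
by rewrite ger0_norm ?sqr_ge0.
Qed.

Let bnd_int f : bounded_on D f -> nu.-integrable D (EFin \o f).
Proof. exact: bnd_integrable. Qed.

Lemma integrable_le_sqr (f : T -> R) (c : R) : measurable_fun [set: T] f ->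
  (forall x, D x -> `|f x| <= c * (1 + Q x ^+ 2)) -> nu.-integrable D (EFin \o f).
Proof.
move=> mf fc; have i1 := bnd_int (bnd_cst D (1 : R)); have i2 := integrable_sqr.
have i3 := integrableZl mD c (integrableD mD i1 i2).
apply: (le_integrable mD _ _ i3); first by apply/measurable_EFinP; exact: measurable_funTS.
move=> x Dx; rewrite /= lee_fin (le_trans (fc x Dx))//.
exact: ler_norm.
Qed.

Definition trunc (M x : R) : R := if `|x| <= M then x else 0.

Lemma trunc_le M x : 0 <= M -> `|trunc M x| <= M.
Proof. by move=> M0; rewrite /trunc; case: ifP; rewrite ?normr0. Qed.

Lemma measurable_trunc M : measurable_fun [set: R] (trunc M).
Proof.
apply: measurable_fun_if => //.
by apply: (@measurable_fun_ler _ _ _ _ (fun x : R => `|x|) (fun=> M)).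
Qed.

Lemma bnd_trunc M : 0 <= M -> bounded_on D (fun x => trunc M (Q x)).
Proof.
move=> M0; apply: (bnd_comp (M := M)) => // [x _|]; first exact: trunc_le.
exact: measurable_trunc.
Qed.

Lemma trunc_sqr_le M x : trunc M x ^+ 2 <= x ^+ 2.
Proof. by rewrite /trunc; case: ifP => // _; rewrite expr0n sqr_ge0. Qed.

(** The part of the unit mass of Q^2 carried by values of size above M. *)
Definition tail M : R := 1 - E (fun x => trunc M (Q x) ^+ 2).

Lemma tailE M : 0 <= M -> tail M = E (fun x => Q x ^+ 2 - trunc M (Q x) ^+ 2).
Proof.
move=> M0; rewrite RintegralB//; first by rewrite /tail Q2.
  exact: integrable_sqr.
exact: (bnd_int (bndX 2 (bnd_trunc M0))).
Qed.

Let integrable_tail M : 0 <= M -> nu.-integrable D (EFin \o (fun x => Q x ^+ 2 - trunc M (Q x) ^+ 2)).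
Proof.
move=> M0; exact: (integrableB mD integrable_sqr (bnd_int (bndX 2 (bnd_trunc M0)))).
Qed.

Lemma tail_ge0 M : 0 <= M -> 0 <= tail M.
Proof. by move=> M0; rewrite tailE//; apply: Rintegral_ge0 => x _; rewrite subr_ge0 trunc_sqr_le. Qed.

Lemma trunc_sqr_le1 M : 0 <= M -> E (fun x => trunc M (Q x) ^+ 2) <= 1.
Proof. by move=> /tail_ge0; rewrite subr_ge0. Qed.

Lemma tail_le M M' : 0 <= M -> M <= M' -> tail M' <= tail M.
Proof.
move=> M0 MM; have M'0 := le_trans M0 MM; rewrite !tailE//.
apply: le_Rintegral => //; [exact: integrable_tail..|move=> x _].
rewrite lerD2l lerN2 /trunc; case: ifP => [h|_]; last by rewrite expr0n sqr_ge0.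
by rewrite (le_trans h MM).
Qed.

(** Chebyshev restricted to the tail. At M = delta sqrt n it gives n P(|Q| > M) <= tail M / delta^2,
    which tends to 0 although Q need only be square integrable. *)
Lemma tail_prob M : 0 < M -> E (fun x => \1_[set x | M < `|Q x|] x) * M ^+ 2 <= tail M.
Proof.
move=> M0; have mn : measurable_fun [set: T] (fun x => `|Q x|) by exact: measurableT_comp.
have mS := measurable_gt M mn.
rewrite -(expectZr mD nuD); last exact: bnd_indic.
rewrite tailE ?(ltW M0)//; apply: le_Rintegral => //; last 2 first.
- exact: (integrable_tail (ltW M0)).
- move=> x _; rewrite indicE; have [xS|_] := boolP (x \in _).
    have /= MQ := set_mem xS.
    rewrite mul1r /trunc [`|Q x| <= M]leNgt MQ /= expr0n subr0 -[leRHS]real_normK ?num_real// lerXn2r ?nnegrE ?(ltW M0)//.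
    exact: ltW.
  by rewrite mul0r subr_ge0 trunc_sqr_le.
- by apply: bnd_int; apply: bndM; [exact: bnd_indic|exact: bnd_cst].
Qed.

Lemma tail_cvg0 (e : R) : 0 < e -> exists2 M0, 0 < M0 & forall M, M0 <= M -> tail M <= e.
Proof.
move=> e0; pose g k : T -> R := fun x => Q x ^+ 2 - trunc k%:R (Q x) ^+ 2.
have mg k : measurable_fun [set: T] (g k).
  apply: measurable_funB => //; apply: measurable_funX.
  by apply: measurableT_comp => //; exact: measurable_trunc.
have [] := @dominated_convergence _ _ _ nu D mD (fun k => EFin \o g k) (fun=> 0%E) (EFin \o (fun x => Q x ^+ 2)).
- by move=> k; apply/measurable_EFinP; exact: measurable_funTS.
- exact: measurable_cst.
- apply: aeW => x _; apply: cvg_near_cst; near=> k.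
  rewrite /= /g /trunc (_ : `|Q x| <= k%:R) ?subrr//.
  near: k; exists (Num.truncn `|Q x|).+1 => // k /= xk.
  by rewrite (le_trans (ltW (truncnS_gt _)))// ler_nat.
- exact: integrable_sqr.
- apply: aeW => x k _ /=; rewrite lee_fin ger0_norm ?subr_ge0 ?trunc_sqr_le//.
  by rewrite gerBl sqr_ge0.
move=> _ _; rewrite integral0 => lim.
have tE k : (\int[nu]_(x in D) (EFin \o g k) x = (tail k%:R)%:E)%E.
  rewrite tailE// /Rintegral fineK//.
  by apply: integrable_fin_num => //; exact: (integrable_tail (ler0n _ k)).
have {}lim : tail k%:R @[k --> \oo] --> 0.
  have : (tail k%:R)%:E @[k --> \oo] --> 0%:E.
    by rewrite (_ : (fun k => _) = [sequence (\int[nu]_(x in D) (EFin \o g k) x)%E]_k)//; apply/funext => k; rewrite /= tE.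
  by move/fine_cvg.
move/cvgrPdist_le : lim => /(_ e e0)[k _ hk].
exists k.+1%:R => // M kM; have := hk k.+1 (leqnSn k).
rewrite /= sub0r normrN ger0_norm ?tail_ge0// => /(le_trans _); apply.
by apply: tail_le.
Unshelve. all: by end_near. Qed.

Section kernel.
Variable k : T -> R.
Hypotheses (mk : measurable_fun [set: T] k) (k1 : forall x, D x -> `|k x| <= 1).

Let ikQ : nu.-integrable D (EFin \o (fun x => k x * Q x)).
Proof.
apply: (@integrable_le_sqr _ 1) => [|x Dx]; first exact: measurable_funM.
rewrite mul1r normrM (le_trans (ler_wpM2r (normr_ge0 _) (k1 Dx)))// mul1r.
rewrite -[Q x ^+ 2]real_normK ?num_real//; have := sqr_ge0 (`|Q x| - 1); have := normr_ge0 (Q x).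
by move: `|Q x| => y; nra.
Qed.

(** Above the level M, |Q| <= Q^2 / M. *)
Lemma kernel_trunc M : 0 < M ->
  `|E (fun x => k x * trunc M (Q x)) - E (fun x => k x * Q x)| <= M^-1.
Proof.
move=> M0; have bk : bounded_on D k by exact: (bnd_le mk k1).
have ikt := bnd_int (bndM bk (bnd_trunc (ltW M0))).
rewrite -RintegralB// (le_trans (le_normr_Rintegral _ _))//; first exact: (integrableB mD ikt ikQ).
rewrite -[leRHS]mulr1 -Q2 -RintegralZl//; last exact: integrable_sqr.
apply: le_Rintegral => //.
- exact: (integrable_abse (integrableB mD ikt ikQ)).
- exact: (integrableZl mD M^-1 integrable_sqr).
move=> x Dx; rewrite -mulrBr normrM (le_trans (ler_wpM2r (normr_ge0 _) (k1 Dx)))// mul1r.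
rewrite /trunc; have [h|h] := leP `|Q x| M; first by rewrite subrr normr0 mulr_ge0 ?sqr_ge0// invr_ge0 ltW.
rewrite sub0r normrN ler_pdivlMl// -[leRHS]real_normK ?num_real// expr2 ler_wpM2r//.
exact: ltW.
Qed.

(** |Q| <= (1 + Q^2) / 2. Applied to an eigenfunction it bounds lambda Q pointwise. *)
Lemma kernel_le1 : `|E (fun x => k x * Q x)| <= 1.
Proof.
have i2 := integrableD mD (bnd_int (bnd_cst D (1 : R))) integrable_sqr.
have e : 1 = E (fun x => 2^-1 * (1 + Q x ^+ 2)).
  rewrite RintegralZl// RintegralD//; [|exact: (bnd_int (bnd_cst D (1 : R)))|exact: integrable_sqr].
  by rewrite Q2 (expect_cst mD nuD); lra.
rewrite [leRHS]e (le_trans (le_normr_Rintegral _ _))//; apply: le_Rintegral => //.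
- exact: (integrable_abse ikQ).
- exact: (integrableZl mD 2^-1 i2).
move=> x Dx; rewrite normrM (le_trans (ler_wpM2r (normr_ge0 _) (k1 Dx)))// mul1r.
rewrite -[Q x ^+ 2]real_normK ?num_real//; have := sqr_ge0 (`|Q x| - 1).
by move: `|Q x| => y; lra.
Qed.

End kernel.
End truncation.

(** * The kernel operator on a random sample *)

Section sampled_kernel.
Context d (T : measurableType d) (R : realType) (nu : probability T R) (D : set T).
Hypotheses (mD : measurable D) (nuD : nu D = 1%E).
Variables (f : T -> T -> R) (t Lam : T -> R) (M : R) (n : nat).
Hypothesis mf : measurable_fun [set: T * T] (fun x => f x.1 x.2).
Hypothesis f01 : forall x z, D x -> D z -> 0 <= f x z <= 1.
Hypothesis fs : forall x z, D x -> D z -> f x z = f z x.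
Hypotheses (bt : bounded_on D t) (M0 : 0 < M) (tM : forall x, D x -> `|t x| <= M).
Hypothesis t2 : \int[nu]_(x in D) (t x ^+ 2) <= 1.
Hypotheses (mLam : measurable_fun [set: T] Lam) (Lam1 : forall x, D x -> `|Lam x| <= 1).
Hypothesis Lam_f : forall x, D x -> `|\int[nu]_(z in D) (f x z * t z) - Lam x| <= M^-1.
Hypothesis n0 : (0 < n)%N.
Implicit Types (u : n.-tuple T) (i j : 'I_n).
Local Notation Dn := (@box _ T D n).
Local Notation E f := (\int[prob_pow nu n]_(u in Dn) f u).
Local Notation E1 k := (\int[nu]_(z in D) k z).

Let mDn : measurable Dn. Proof. exact: measurable_box. Qed.
Let PDn : prob_pow nu n Dn = 1%E. Proof. exact: prob_pow_box. Qed.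
Let nR : 0 < n%:R :> R. Proof. by rewrite ltr0n. Qed.
Let n1 : 1 <= n%:R :> R. Proof. by rewrite ler1n. Qed.

(** Truncation supplies the fourth moment: t^4 <= M^2 t^2. *)
Lemma sum_sqr_variance :
  E (fun u => (\sum_i n%:R^-1 * t (tnth u i) ^+ 2 - E1 (fun z => t z ^+ 2)) ^+ 2) <= M ^+ 2 / n%:R.
Proof.
set m := E1 _.
have bk : bounded_on D (fun z => t z ^+ 2 - m) by apply: bndB; [exact: (bndX 2 bt)|exact: bnd_cst].
have k0 : E1 (fun z => t z ^+ 2 - m) = 0.
  by rewrite (expectB mD nuD (bndX 2 bt) (bnd_cst D m)) (expect_cst mD nuD) subrr.
have := centered_sum_sqr mD nuD (fun _ : 'I_n => n%:R^-1) bk k0.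
have -> : E (fun u => (\sum_i n%:R^-1 * (t (tnth u i) ^+ 2 - m)) ^+ 2)
    = E (fun u => (\sum_i n%:R^-1 * t (tnth u i) ^+ 2 - m) ^+ 2).
  apply: expect_eq => u _; congr (_ ^+ 2); under eq_bigr do rewrite mulrBr.
  by rewrite sumrB; congr (_ - _); rewrite sumr_const card_ord -[LHS]mulr_natl mulrA divff ?mul1r// gt_eqF.
move=> ->; rewrite sumr_const card_ord -[X in _ * X]mulr_natl expr2 mulrA divff ?gt_eqF// mul1r ler_wpM2r ?invr_ge0//.
have -> : E1 (fun z => (t z ^+ 2 - m) ^+ 2) = E1 (fun z => (t z ^+ 2) ^+ 2) - m ^+ 2.
  transitivity (E1 (fun z => (t z ^+ 2) ^+ 2 - (2 * m * t z ^+ 2 - m ^+ 2))).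
    by apply: expect_eq => z _; ring.
  have b1 := bndX 2 (bndX 2 bt); have b2 : bounded_on D (fun z => 2 * m * t z ^+ 2) by apply: bndM; [exact: bnd_cst|exact: (bndX 2 bt)].
  rewrite (expectB mD nuD b1 (bndB b2 (bnd_cst D _))) (expectB mD nuD b2 (bnd_cst D _)).
  rewrite (expectZl mD nuD _ (bndX 2 bt)) (expect_cst mD nuD) -/m; ring.
apply: (@le_trans _ _ (E1 (fun z => (t z ^+ 2) ^+ 2))); first by rewrite gerBl sqr_ge0.
apply: (@le_trans _ _ (E1 (fun z => M ^+ 2 * t z ^+ 2))).
  apply: (expect_le mD nuD (bndX 2 (bndX 2 bt))).
    by apply: bndM; [exact: bnd_cst|exact: (bndX 2 bt)].
  move=> z Dz; rewrite [leLHS]expr2 ler_wpM2r ?sqr_ge0// -real_normK ?num_real//.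
  by rewrite lerXn2r ?nnegrE ?tM// ltW.
by rewrite (expectZl mD nuD _ (bndX 2 bt)) ler_piMr ?sqr_ge0.
Qed.

Definition kernel_bias i u : R :=
  Lam (tnth u i) - n%:R^-1 * \sum_(j | j != i) f (tnth u i) (tnth u j) * t (tnth u j).

Let bf2 : bounded_on (D `*` D) (fun x => f x.1 x.2).
Proof.
apply: (bnd_le (M := 1)) => // -[x z] [/= Dx Dz].
by have /andP[h0 h1] := f01 Dx Dz; rewrite ger0_norm.
Qed.

Let bLam : bounded_on D Lam. Proof. exact: (bnd_le mLam Lam1). Qed.

Let bfx x : D x -> bounded_on D (fun z => f x z).
Proof. by move=> Dx; exact: (bnd_section Dx bf2). Qed.

Lemma bnd_kernel_entry i j : bounded_on Dn (fun u => f (tnth u i) (tnth u j)).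
Proof.
apply: (bnd_le (M := 1)) => [|u Du].
  apply: (measurableT_comp mf (_ : measurable_fun setT (fun u => (tnth u i, tnth u j)))).
  by apply: measurable_fun_pair; exact: measurable_tnth.
by have /andP[h0 h1] := f01 (Du i) (Du j); rewrite ger0_norm.
Qed.

Lemma bnd_kernel_bias i : bounded_on Dn (kernel_bias i).
Proof.
apply: bndB; first exact: (bnd_tnth i bLam).
apply: bndM; first exact: bnd_cst.
apply: bnd_sum => j _; apply: bndM; first exact: bnd_kernel_entry.
exact: (bnd_tnth j bt).
Qed.

(** With U_i frozen at z the other terms are independent and identically distributed. The mean is
    off by the truncation error 1/M and by the missing diagonal term of order 1/n, and the variance
    adds another 1/n. *)
Let frozen_bias i z : D z ->
  E (fun u => (Lam z - n%:R^-1 * \sum_(j | j != i) f z (tnth u j) * t (tnth u j)) ^+ 2)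
  <= 4 * M^-1 ^+ 2 + 6 * n%:R^-1.
Proof.
move=> Dz; set r := E1 (fun x => f z x * t x).
have bft : bounded_on D (fun x => f z x * t x) by apply: bndM; [exact: bfx|exact: bt].
pose k x := f z x * t x - r.
have bk : bounded_on D k by apply: bndB; [exact: bft|exact: bnd_cst].
have k0 : E1 k = 0 by rewrite (expectB mD nuD bft (bnd_cst D r)) (expect_cst mD nuD) subrr.
(* A weight 0 at i encodes the omitted index in a sum over all coordinates. *)
pose a j : R := if j == i then 0 else n%:R^-1.
pose b : R := Lam z - (1 - n%:R^-1) * r.
have e u : Lam z - n%:R^-1 * \sum_(j | j != i) f z (tnth u j) * t (tnth u j) = b - \sum_j a j * k (tnth u j).
  rewrite [X in b - X](bigD1 i)//= /a eqxx mul0r add0r /b /k.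
  under [X in _ = _ - X]eq_bigr => j ji do rewrite (negbTE ji) mulrBr.
  rewrite sumrB -mulr_sumr sumr_const -(mulr_natl (n%:R^-1 * r)).
  have -> : #|(fun j : 'I_n => j != i)| = n.-1.
    by have := cardC1 i; rewrite card_ord => <-; apply: eq_card => j; rewrite !inE.
  have -> : n.-1%:R = n%:R - 1 :> R by rewrite -[in RHS](prednK n0) -natr1 addrK.
  by field; rewrite gt_eqF.
have bS : bounded_on Dn (fun u => \sum_j a j * k (tnth u j)).
  by apply: bnd_sum => j _; apply: bndM; [exact: bnd_cst|exact: (bnd_tnth j bk)].
apply: (@le_trans _ _ (E (fun u => 2 * b ^+ 2 + 2 * (\sum_j a j * k (tnth u j)) ^+ 2))).
  apply: (expect_le mDn PDn).
  - rewrite (_ : (fun u => _) = (fun u => (b - \sum_j a j * k (tnth u j)) ^+ 2)).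
      by apply: (bndX 2); apply: bndB; [exact: bnd_cst|exact: bS].
    by apply/funext => u; rewrite e.
  - by apply: bndD; [exact: bnd_cst|apply: bndM; [exact: bnd_cst|exact: (bndX 2 bS)]].
  - move=> u _; rewrite e; set x := \sum_j _; have := sqr_ge0 (b + x); lra.
have b2S : bounded_on Dn (fun u => 2 * (\sum_j a j * k (tnth u j)) ^+ 2) by apply: bndM; [exact: bnd_cst|exact: (bndX 2 bS)].
rewrite (expectD mDn PDn (bnd_cst _ _) b2S) (expect_cst mDn PDn) (expectZl mDn PDn _ (bndX 2 bS)).
rewrite (centered_sum_sqr mD nuD a bk k0).
have k2 : E1 (fun x => k x ^+ 2) <= 1.
  have -> : E1 (fun x => k x ^+ 2) = E1 (fun x => (f z x * t x) ^+ 2) - r ^+ 2.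
    transitivity (E1 (fun x => (f z x * t x) ^+ 2 - (2 * r * (f z x * t x) - r ^+ 2))).
      by apply: expect_eq => x _; rewrite /k; ring.
    have b2 : bounded_on D (fun x => 2 * r * (f z x * t x)) by apply: bndM; [exact: bnd_cst|exact: bft].
    rewrite (expectB mD nuD (bndX 2 bft) (bndB b2 (bnd_cst D _))) (expectB mD nuD b2 (bnd_cst D _)).
    rewrite (expectZl mD nuD _ bft) (expect_cst mD nuD) -/r; ring.
  apply: (@le_trans _ _ (E1 (fun x => (f z x * t x) ^+ 2))); first by rewrite gerBl sqr_ge0.
  apply: le_trans t2; apply: (expect_le mD nuD (bndX 2 bft) (bndX 2 bt)) => x Dx.
  have /andP[h0 h1] := f01 Dz Dx.
  by rewrite exprMn ler_piMl ?sqr_ge0// exprn_ile1.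
have k20 : 0 <= E1 (fun x => k x ^+ 2) by apply: Rintegral_ge0 => x _; exact: sqr_ge0.
have a2 : \sum_j a j ^+ 2 <= n%:R^-1.
  apply: (@le_trans _ _ (\sum_(j < n) n%:R^-1 ^+ 2)).
    apply: ler_sum => j _; rewrite /a; case: ifP => _ //; rewrite expr0n /=; exact: sqr_ge0.
  by rewrite sumr_const card_ord -[leLHS]mulr_natl expr2 mulrA divff ?mul1r// gt_eqF.
have a20 : 0 <= \sum_j a j ^+ 2 by apply: sumr_ge0 => j _; exact: sqr_ge0.
have ni : 0 <= n%:R^-1 :> R by rewrite invr_ge0.
have ni1 : n%:R^-1 <= 1 :> R by rewrite invf_le1.
have bb : b ^+ 2 <= 2 * M^-1 ^+ 2 + 2 * n%:R^-1.
  have -> : b = (1 - n%:R^-1) * (Lam z - r) + n%:R^-1 * Lam z by rewrite /b; ring.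
  set p := (1 - n%:R^-1) * _; set s := n%:R^-1 * _.
  have p2 : p ^+ 2 <= M^-1 ^+ 2.
    rewrite -[leLHS]real_normK ?num_real// lerXn2r ?nnegrE ?invr_ge0 ?(ltW M0)//.
    have h : `|Lam z - r| <= M^-1 by rewrite distrC; exact: Lam_f.
    by rewrite normrM -[leRHS]mul1r ler_pM// ger0_norm ?subr_ge0// gerBl.
  have s2 : s ^+ 2 <= n%:R^-1.
    rewrite exprMn expr2 -mulrA ler_piMr// -[leRHS]mulr1 ler_pM ?sqr_ge0//.
    by rewrite -real_normK ?num_real// exprn_ile1// Lam1.
  by have := sqr_ge0 (p - s); lra.
have kk : E1 (fun x => k x ^+ 2) * \sum_j a j ^+ 2 <= n%:R^-1.
  by rewrite -[leRHS]mul1r ler_pM.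
lra.
Qed.

Lemma kernel_bias_sqr i : E (fun u => kernel_bias i u ^+ 2) <= 4 * M^-1 ^+ 2 + 6 * n%:R^-1.
Proof.
have bb := bndX 2 (bnd_kernel_bias i).
rewrite (expect_resample mD nuD i bb).
have bu := bnd_upd i bb.
rewrite (@expect_swap _ _ _ _ _ (prob_pow nu n) nu Dn D mDn PDn mD nuD _ bu).
have cst := expect_cst mD nuD (4 * M^-1 ^+ 2 + 6 * n%:R^-1).
rewrite -[leRHS]cst; apply: (expect_le mD nuD).
- have bsw : bounded_on (D `*` Dn) (fun x : T * n.-tuple T => kernel_bias i (upd x.2 i x.1) ^+ 2).
    have [m [B hB]] := bu; split.
      by apply: (measurableT_comp m (_ : measurable_fun setT (fun x : T * n.-tuple T => (x.2, x.1)))); exact: measurable_swap.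
    by exists B => -[x u] [/= Dx Du]; apply: (hB (u, x)).
  exact: (bnd_expect mDn PDn bsw).
- exact: bnd_cst.
move=> z Dz; apply: le_trans (frozen_bias i Dz).
rewrite le_eqVlt; apply/orP; left; apply/eqP; apply: expect_eq => u _.
rewrite /kernel_bias tnth_upd eqxx; congr ((_ - _ * _) ^+ 2); apply: eq_bigr => j ji.
by rewrite tnth_upd (negbTE ji).
Qed.

End sampled_kernel.

(** * The graph conditionally on the types *)

Section graph_given_types.
Context (R : realType) (n : nat) (N theta : R).
Hypotheses (n0 : (0 < n)%N) (N1 : 1 <= N) (theta1 : `|theta| <= 1).
Variables (F : 'I_n -> 'I_n -> R) (t Lam : 'I_n -> R).
Hypotheses (F01 : forall i j, 0 <= F i j <= 1) (Fs : forall i j, F i j = F j i).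
Implicit Types (g : 'M[bool]_n) (i j : 'I_n).
Let p i j : R := F i j / N.

Let N0 : 0 < N. Proof. exact: lt_le_trans N1. Qed.
Let nR : 0 < n%:R :> R. Proof. by rewrite ltr0n. Qed.
Let p0 i j : 0 <= p i j.
Proof. by rewrite divr_ge0 ?(ltW N0)//; have /andP[] := F01 i j. Qed.
Let p1 i j : p i j <= 1.
Proof. by rewrite ler_pdivrMr// mul1r (le_trans _ N1)//; have /andP[] := F01 i j. Qed.
Let ps i j : p i j = p j i. Proof. by rewrite /p Fs. Qed.

Local Notation pmf g := (adj_pmf p g).
Local Notation rn := ((Num.sqrt n%:R)^-1 : R).

Let rn2 : rn ^+ 2 = n%:R^-1. Proof. by rewrite exprVn sqr_sqrtr. Qed.

(** Entry i of theta lambda q - A q, with [Lam] in the role of lambda Q and the truncated [t] fed to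
    A; truncation is void on the good event. *)
Definition eigen_defect g i : R :=
  theta * (Lam i * rn) - \sum_j (theta * (g i j)%:R * N / n%:R) * (t j * rn).

(** Squared mean plus variance: the first term is the sampling error of the kernel operator, the
    second the noise of the edges, each of variance at most 1/N before rescaling by N / n. *)
Lemma adj_eigen_defect :
  \sum_(g | adjb g) pmf g * (\sum_i eigen_defect g i ^+ 2)
  <= n%:R^-1 * (\sum_i (Lam i - n%:R^-1 * \sum_(j | j != i) F i j * t j) ^+ 2)
     + N / n%:R * (n%:R^-1 * \sum_j t j ^+ 2).
Proof.
pose b i := Lam i - n%:R^-1 * \sum_(j | j != i) F i j * t j.
pose a j := N / n%:R * (rn * t j).
have dE g i : adjb g -> eigen_defect g i
    = theta * (rn * b i - \sum_(j | j != i) a j * ((g i j)%:R - p i j)).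
  move=> /adjP[_ gd]; rewrite /eigen_defect (bigD1 i)//= gd mulr0 !mul0r add0r.
  under [X in _ = _ * (_ - X)]eq_bigr do rewrite mulrBr.
  rewrite sumrB /b.
  have -> : \sum_(j | j != i) a j * p i j = rn * (n%:R^-1 * \sum_(j | j != i) F i j * t j).
    rewrite !mulr_sumr; apply: eq_bigr => j _; rewrite /a /p; field.
    by rewrite !gt_eqF ?sqrtr_gt0.
  have -> : \sum_(j | j != i) theta * (g i j)%:R * N / n%:R * (t j * rn)
      = theta * \sum_(j | j != i) a j * (g i j)%:R.
    by rewrite mulr_sumr; apply: eq_bigr => j _; rewrite /a; ring.
  ring.
rewrite (eq_bigr (fun g => \sum_i pmf g * (theta ^+ 2 * (rn * b i - \sum_(j | j != i) a j * ((g i j)%:R - p i j)) ^+ 2))); last first.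
  by move=> g ga; rewrite mulr_sumr; apply: eq_bigr => i _; rewrite dE// exprMn.
rewrite exchange_big/=.
have th2 : theta ^+ 2 <= 1 by rewrite -real_normK ?num_real// exprn_ile1.
apply: (@le_trans _ _ (\sum_i ((rn * b i) ^+ 2 + \sum_(j | j != i) a j ^+ 2 * p i j))).
  apply: ler_sum => i _.
  apply: (@le_trans _ _ (\sum_(g | adjb g) pmf g * (rn * b i - \sum_(j | j != i) a j * ((g i j)%:R - p i j)) ^+ 2)).
    by apply: ler_sum => g _; rewrite ler_wpM2l ?adj_pmf_ge0// ler_piMl ?sqr_ge0.
  exact: adj_row_sqr.
rewrite big_split/= lerD//.
  by under eq_bigr do rewrite exprMn rn2; rewrite -mulr_sumr.
apply: (@le_trans _ _ (\sum_(i < n) (N / n%:R ^+ 2 * (n%:R^-1 * \sum_j t j ^+ 2)))).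
  apply: ler_sum => i _; rewrite mulrA mulr_sumr [leRHS](bigD1 i)//= ler_wpDl//.
    by rewrite mulr_ge0 ?sqr_ge0// mulr_ge0 ?invr_ge0 ?(ltW nR)// divr_ge0 ?(ltW N0)// exprn_ge0// ltW.
  apply: ler_sum => j _; rewrite /a /p !exprMn rn2.
  have /andP[f0 f1] := F01 i j.
  have -> : N ^+ 2 * n%:R^-1 ^+ 2 * (n%:R^-1 * t j ^+ 2) * (F i j / N) = N / n%:R ^+ 2 / n%:R * t j ^+ 2 * F i j.
    by field; rewrite !gt_eqF.
  rewrite ler_piMr// mulr_ge0 ?sqr_ge0// mulr_ge0 ?invr_ge0 ?(ltW nR)//.
  by rewrite divr_ge0 ?(ltW N0)// exprn_ge0// ltW.
rewrite sumr_const card_ord -[leLHS]mulr_natl le_eqVlt; apply/orP; left; apply/eqP.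
by field; rewrite gt_eqF.
Qed.

Lemma adj_degree_exp (r : R) : 0 <= r ->
  \sum_(g | adjb g) pmf g * (\sum_i expR (r * \sum_j (g i j)%:R))
  <= n%:R * expR ((expR r - 1) * (n%:R / N)).
Proof.
move=> r0; under eq_bigr do rewrite mulr_sumr; rewrite exchange_big/=.
rewrite mulr_natl -[n in X in _ <= X](card_ord n) -sumr_const; apply: ler_sum => i _.
apply: (le_trans (adj_exp_degree p0 p1 ps i r0)); rewrite ler_expR ler_wpM2l//.
  by rewrite subr_ge0 -[leLHS]expR0 ler_expR.
rewrite -mulr_suml ler_wpM2r ?invr_ge0 ?(ltW N0)//.
apply: (@le_trans _ _ (\sum_(j < n) 1)); last by rewrite sumr_const card_ord.
by apply: ler_sum => j _; have /andP[] := F01 i j.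
Qed.

End graph_given_types.

Section product_pmf.
Context (R : realType) (f : R -> R -> R) (gamma : R) (n : nat).

Lemma edge_pmfE (u : n.-tuple (Borel R)) (g : 'M[bool]_n) :
  edge_pmf f gamma u g
  = adj_pmf (fun i j => f (tnth u i) (tnth u j) / n%:R `^ gamma) g.
Proof. by rewrite /edge_pmf pair_big_dep. Qed.

End product_pmf.

(** * Independence of the field and the graph *)

Section restricted_law.
Context d d1 (T : measurableType d) (T1 : measurableType d1) (R : realType) (P : probability T R).
Variables (X : T -> T1) (S : set T).

Definition restricted_law (mX : measurable_fun [set: T] X) (mS : measurable S) : set T1 -> \bar R :=
  fun B => P (X @^-1` B `&` S).

Hypotheses (mX : measurable_fun [set: T] X) (mS : measurable S).
Local Notation law := (restricted_law mX mS).

Let mpre B : measurable B -> measurable (X @^-1` B).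
Proof. by move=> mB; rewrite -[X in measurable X]setTI; exact: mX. Qed.

Let law0 : law set0 = 0%E.
Proof. by rewrite /restricted_law preimage_set0 set0I measure0. Qed.

Let law_ge0 B : (0 <= law B)%E. Proof. exact: measure_ge0. Qed.

Let law_sigma_additive : semi_sigma_additive law.
Proof.
move=> F mF tF mUF; rewrite /restricted_law preimage_bigcup setI_bigcupl.
apply: measure_semi_sigma_additive.
- by move=> n; apply: measurableI => //; exact: mpre.
- apply/trivIsetP => /= i j _ _ ij; rewrite setIACA -preimage_setI.
  by move/trivIsetP : tF => /(_ _ _ _ _ ij) ->//; rewrite preimage_set0 set0I.
- by rewrite -setI_bigcupl -preimage_bigcup; apply: measurableI => //; exact: mpre.
Qed.

HB.instance Definition _ := isMeasure.Build _ _ _ law law0 law_ge0 law_sigma_additive.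

Let law_finite : fin_num_fun law.
Proof.
by move=> B mB; apply: fin_num_measure; apply: measurableI => //; exact: mpre.
Qed.

HB.instance Definition _ := Measure_isFinite.Build _ _ _ law law_finite.

End restricted_law.

Section restricted_product.
Context d d1 d2 (T : measurableType d) (T1 : measurableType d1) (T2 : measurableType d2).
Context (R : realType) (P : probability T R) (nu : probability T2 R).
Variables (X : T -> T1) (Y : T -> T2) (S : set T).
Hypotheses (mX : measurable_fun [set: T] X) (mY : measurable_fun [set: T] Y) (mS : measurable S).
Hypothesis indep : forall A B, measurable A -> measurable B ->
  (P (X @^-1` A `&` S `&` Y @^-1` B) = P (X @^-1` A `&` S) * nu B)%E.

(** On [S] the pair (X, Y) has a product law, by uniqueness from rectangles; the bound on sections
    is then integrated over the law of X. *)
Lemma restricted_product_le (V : set (T1 * T2)) (r : R) : measurable V ->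
  (forall x, (nu (xsection V x) <= r%:E)%E) ->
  (P ([set w | V (X w, Y w)] `&` S) <= r%:E * P S)%E.
Proof.
move=> mV Vr.
have mXY : measurable_fun [set: T] (fun w => (X w, Y w)) by exact: measurable_fun_pair.
pose m1 := restricted_law P mX mS; pose m' := restricted_law P mXY mS.
have e : (m1 \x nu)%E V = m' V.
  apply: product_measure_unique => // A B mA mB.
  rewrite /m' /m1 /restricted_law /= -indep//; congr (P _).
  by apply/seteqP; split => w /= [] // [] ? ? ?; split.
have -> : P ([set w | V (X w, Y w)] `&` S) = m' V by [].
rewrite -e /product_measure1.
apply: (@le_trans _ _ (\int[m1]_x (cst r%:E x))%E).
  apply: ge0_le_integral => //.
  - exact: measurable_fun_xsection.
  - by move=> x _; rewrite (le_trans _ (Vr x)).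
have <- : m1 setT = P S by rewrite /m1 /restricted_law/= preimage_setT setTI.
by rewrite integral_cst.
Qed.

End restricted_product.

Lemma measure_big_le d (T : measurableType d) (R : realType) (P : {measure set T -> \bar R})
    (I : Type) (r : seq I) (Q : pred I) (A : I -> set T) : (forall i, Q i -> measurable (A i)) ->
  (P (\big[setU/set0]_(i <- r | Q i) A i) <= \sum_(i <- r | Q i) P (A i))%E.
Proof.
move=> mA; elim: r => [|i r IH]; first by rewrite !big_nil measure0.
rewrite !big_cons; case: ifP => // Qi.
apply: (le_trans (measureU2 _ _ _)); first exact: mA.
  by apply: bigsetU_measurable.
by rewrite leeD2l.
Qed.

Section extension.
Context (R : realType).

Lemma measurable_I01 : measurable (I01 R).
Proof.
rewrite (_ : I01 R = `[0, 1]%classic); first exact: measurable_itv.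
by apply/seteqP; split => x; rewrite /= in_itv.
Qed.

Lemma unif01_I01 : unif01 R (I01 R) = 1%E.
Proof.
by apply: (@integral_uniform_pdf1 R 0 1 (I01 R) ltr01) => x; rewrite /= in_itv.
Qed.

Lemma unif01_integral (g : R -> R) : measurable_fun [set: R] g ->
  \int[unif01 R]_(x in I01 R) g x = \int[@lebesgue_measure R]_(x in I01 R) g x.
Proof.
move=> mg; rewrite /Rintegral; congr fine.
have mG : measurable_fun [set: R] ((EFin \o g) \_ (I01 R)).
  apply/(measurable_restrictT _ _).1; first exact: measurable_I01.
  by apply/measurable_EFinP; exact: measurable_funTS.
have I01E : I01 R = `[0, 1]%classic by apply/seteqP; split => x; rewrite /= in_itv.
have key (h : R -> \bar R) : measurable_fun [set: R] h -> (forall x, 0 <= h x)%E ->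
    (forall x, ~ I01 R x -> h x = 0%E) ->
    (\int[unif01 R]_x h x = \int[@lebesgue_measure R]_x h x)%E.
  move=> mh h0 hI; rewrite integral_uniform// subr0 invr1 mul1e integral_mkcond.
  apply: eq_integral => x _; rewrite patchE -I01E; case: ifPn => // xI.
  by rewrite hI// => Ix; move: xI; rewrite mem_set.
rewrite integral_mkcond [RHS]integral_mkcond integralE [RHS]integralE; congr (_ - _)%E; apply: key.
- exact: measurable_funepos.
- by move=> x; exact: funepos_ge0.
- move=> x xI; rewrite funeposE patchE; case: ifPn => [/set_mem//|_].
  by rewrite maxxx.
- exact: measurable_funeneg.
- by move=> x; exact: funeneg_ge0.
- move=> x xI; rewrite funenegE patchE; case: ifPn => [/set_mem//|_].
  by rewrite oppe0 maxxx.
Qed.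

End extension.

(** * Probabilities under the sampling law *)

Section graph_probability.
Context (R : realType) (f : R -> R -> R) (gamma : R) (F : probability (Borel R) R) (n : nat).
Context d (T : measurableType d) (P : probability T R).
Context (U : {RV P >-> n.-tuple (Borel R)}) (G : T -> 'M[bool]_n) (c : {RV P >-> n.-tuple (Borel R)}).
Hypothesis hs : graphon_sample f gamma F U G c.
Local Notation D := (@box _ (Borel R) (I01 R) n).
Local Notation E h := (\int[prob_pow (unif01 R) n]_(u in D) h u).
Local Notation N := (n%:R `^ gamma).
Variable k : R -> R -> R.
Hypothesis mk : measurable_fun [set: Borel R * Borel R] (fun p => k p.1 p.2 : Borel R).
Hypothesis k01 : forall x y, 0 <= k x y <= 1.
Hypothesis kf : forall x y, I01 R x -> I01 R y -> k x y = f x y.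
Hypothesis N1 : 1 <= N.
Let pmf (u : n.-tuple (Borel R)) := adj_pmf (fun i j => k (tnth u i) (tnth u j) / N).

Let mD : measurable D. Proof. by apply: measurable_box; exact: measurable_I01. Qed.
Let PD : prob_pow (unif01 R) n D = 1%E.
Proof. by apply: prob_pow_box; [exact: measurable_I01|exact: unif01_I01]. Qed.
Let N0 : 0 < N. Proof. exact: lt_le_trans N1. Qed.

Let UD w : D (U w). Proof. by move=> i; have := gs_U01 hs w i. Qed.

Let pmf_ge0 u g : 0 <= pmf u g.
Proof.
apply: adj_pmf_ge0 => i j; have /andP[h0 h1] := k01 (tnth u i) (tnth u j).
  by rewrite divr_ge0// ltW.
by rewrite ler_pdivrMr// mul1r (le_trans h1).
Qed.

Let bern_le1 (x y : R) (b : bool) : `|bernoulli_pmf (k x y / N) b| <= 1.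
Proof.
have /andP[h0 h1] := k01 x y.
have p0 : 0 <= k x y / N by rewrite divr_ge0// ltW.
have p1 : k x y / N <= 1 by rewrite ler_pdivrMr// mul1r (le_trans h1).
rewrite ger0_norm ?bernoulli_pmf_ge0 ?p0//.
by rewrite /bernoulli_pmf; case: b => //; rewrite gerBl.
Qed.

Lemma bnd_pmf g : bounded_on D (pmf ^~ g).
Proof.
apply: bnd_prod => e _.
have mp : measurable_fun [set: n.-tuple (Borel R)] (fun u => k (tnth u e.1) (tnth u e.2) / N).
  apply: measurable_funM => //.
  apply: (measurableT_comp mk (_ : measurable_fun setT (fun u : n.-tuple (Borel R) => (tnth u e.1, tnth u e.2)))).
  by apply: measurable_fun_pair; exact: measurable_tnth.
apply: (bnd_le (M := 1)) => [|u _]; last exact: bern_le1.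
by rewrite /bernoulli_pmf; case: (g _ _) => //; exact: measurable_funB.
Qed.

Lemma sample_prob B g : measurable B -> adjacency g ->
  P (U @^-1` B `&` [set w | G w = g]) = (E (fun u => \1_B u * pmf u g))%:E.
Proof.
move=> mB ga; rewrite (gs_graph hs)//.
have b1 : bounded_on D (fun u => (\1_B u : R) * pmf u g) by apply: bndM; [exact: (bnd_indic R D mB)|exact: bnd_pmf].
have [m1 _] := b1.
pose h (u : n.-tuple (Borel R)) : R := \1_B u * pmf u g.
transitivity (\int[P]_w ((EFin \o h) \o U) w)%E.
  rewrite integral_mkcond; apply: eq_integral => w _.
  rewrite patchE /h /= indicE; have -> : (U w \in B) = (w \in U @^-1` B) by apply/idP/idP => /set_mem e; exact/mem_set.
  case: ifP => _; last by rewrite mul0r.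
  rewrite mul1r edge_pmfE /pmf; congr (_%:E); apply: eq_bigr => e _.
  by rewrite kf//; exact: UD.
have mh : measurable_fun setT (EFin \o h) by exact/measurable_EFinP.
have nn u : (0 <= (EFin \o h) u)%E by rewrite /= lee_fin mulr_ge0// ?indicE.
rewrite -[LHS](@ge0_integral_distribution _ _ _ _ _ P U _ mh nn).
rewrite (eq_measure_integral (prob_pow (unif01 R) n)); last by move=> A mA _; exact: (gs_U hs).
exact: (integral_fullE mD PD b1).
Qed.

(** Markov's inequality on each of the finitely many values of the graph, where the joint law with U
    is given by [sample_prob]. *)
Lemma sample_markov (H : 'M[bool]_n -> n.-tuple (Borel R) -> R) (r m : R) :
  (forall g, bounded_on D (H g)) -> (forall g u, 0 <= H g u) -> 0 < r ->
  E (fun u => \sum_(g | adjb g) pmf u g * H g u) <= m * r ->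
  (P [set w | (r < H (G w) (U w))%R] <= m%:E)%E.
Proof.
move=> bH H0 r0 hm.
have mB g : measurable [set u | r < H g u] by apply: measurable_gt; case: (bH g).
have mS g : measurable (U @^-1` [set u | r < H g u] `&` [set w | G w = g]).
  by apply: measurableI; [rewrite -[X in measurable X]setTI; exact: measurable_funPT|exact: (gs_Gmeas hs)].
rewrite [X in P X](_ : _ = \big[setU/set0]_(g <- index_enum _ | adjb g) (U @^-1` [set u | r < H g u] `&` [set w | G w = g])); last first.
  rewrite -bigcup_seq_cond; apply/seteqP; split => [w /= rw|w [g /= _ [rg gw]]]; last by rewrite gw.
  by exists (G w) => //=; rewrite mem_index_enum; apply/adjP; exact: (gs_adj hs).
apply: (@le_trans _ _ (\sum_(g | adjb g) P (U @^-1` [set u | (r < H g u)%R] `&` [set w | G w = g]))%E).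
  by apply: measure_big_le => g _; exact: mS.
have bI g : bounded_on D (fun u => (\1_[set u | r < H g u] u : R) * pmf u g).
  by apply: bndM; [exact: (bnd_indic R D (mB g))|exact: bnd_pmf].
have bS : bounded_on D (fun u => \sum_(g | adjb g) (\1_[set u | r < H g u] u : R) * pmf u g).
  by apply: bnd_sum => g _; exact: bI.
have bS' : bounded_on D (fun u => \sum_(g | adjb g) pmf u g * H g u).
  by apply: bnd_sum => g _; apply: bndM; [exact: bnd_pmf|exact: bH].
rewrite (eq_bigr (fun g => (E (fun u => \1_[set u | r < H g u] u * pmf u g))%:E)); last first.
  by move=> g /adjP ga; rewrite sample_prob.
rewrite sumEFin lee_fin -(expect_sum mD PD)//.
rewrite -(ler_pM2r r0) (le_trans _ hm)// mulrC -(expectZl mD PD)//.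
apply: (expect_le mD PD) => //; first by apply: bndM => //; exact: bnd_cst.
move=> u _; rewrite mulr_sumr; apply: ler_sum => g _.
rewrite indicE; have [/set_mem /= h|_] := boolP (_ \in _); last by rewrite mul0r mulr0 mulr_ge0.
by rewrite mul1r mulrC ler_wpM2l// ltW.
Qed.

End graph_probability.

Section measurable_field.
Context d (T : measurableType d) (R : realType) (mu F : probability (Borel R) R).
Hypothesis hmu : base_measure mu.
Context (n : nat) (A : 'M[R]_n) (N y : R).

Lemma measurable_field_defect (q w : 'I_n -> T -> R) (c : T -> n.-tuple (Borel R)) :
  (forall i, measurable_fun [set: T] (q i)) -> (forall i, measurable_fun [set: T] (w i)) ->
  measurable_fun [set: T] c ->
  measurable_fun [set: T] (fun x => field_defect mu F A (q ^~ x) (w ^~ x) N y (c x)).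
Proof.
move=> mq mw mc.
have mt i : measurable_fun [set: T] (fun x => tnth (c x) i : Borel R).
  by apply: (measurableT_comp (@measurable_tnth _ _ _ i)).
have m1 i : measurable_fun [set: T] (fun x => psi1 mu (tnth (c x) i)).
  exact: (measurableT_comp (measurable_psi1 hmu) (mt i)).
have m2 i : measurable_fun [set: T] (fun x => centered_var mu F (tnth (c x) i)).
  by apply: measurable_funB => //; exact: (measurableT_comp (measurable_psi2 hmu) (mt i)).
have ms (a : 'I_n -> R) (g : 'I_n -> T -> R) : (forall j, measurable_fun [set: T] (g j)) ->
    measurable_fun [set: T] (fun x => \sum_j a j * g j x).
  by move=> mg; apply: measurable_sum => j; apply: measurable_funM.
apply: measurable_funD; last first.
  apply: measurable_funM => //; apply: measurable_sum => i; apply: measurable_funX.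
  exact: (ms (A i) _ m1).
apply: measurable_funD; last first.
  apply: measurable_funX; apply: measurable_sum => i; apply: measurable_sum => j.
  by apply: measurable_funM; apply: measurable_funM.
apply: measurable_funD; last first.
  by apply: measurable_funX; apply: measurable_sum => i; exact: measurable_funM.
apply: measurable_funD; last first.
  apply: measurable_funX; apply: measurable_sum => i; apply: measurable_funM => //.
  exact: measurable_funX.
apply: measurable_funD.
  by apply: measurable_sum => i; apply: measurable_funX; exact: (ms (A i) _ m1).
apply: measurable_funM => //; apply: measurable_sum => i; apply: measurable_funX.
by apply: (ms (A i)) => j; apply: measurable_funM.
Qed.

End measurable_field.

Lemma measure_level_sets d (T : measurableType d) (R : realType) (P : {measure set T -> \bar R})
    (I : choiceType) (r : seq I) (Q : pred I) (X : T -> I) : uniq r ->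
  (forall i, measurable [set w | X w = i]) ->
  (P (\big[setU/set0]_(i <- r | Q i) [set w | X w = i]) = \sum_(i <- r | Q i) P [set w | X w = i])%E.
Proof.
move=> + mX; elim: r => [|i r IH] /=; first by rewrite !big_nil measure0.
move=> /andP[ir ur]; rewrite !big_cons; case: ifP => _; last exact: IH.
have mB : measurable (\big[setU/set0]_(j <- r | Q j) [set w | X w = j]) by exact: bigsetU_measurable.
suff d0 : [set w | X w = i] `&` \big[setU/set0]_(j <- r | Q j) [set w | X w = j] = set0.
  by rewrite (measureU P (mX i) mB d0); congr (_ + _)%E; exact: IH.
rewrite -bigcup_seq_cond; apply/seteqP; split => // w [/= wi [j /= /andP[jr _] wj]].
by move: ir; rewrite -wi wj jr.
Qed.

Section sampled_field.
Context (R : realType) (f : R -> R -> R) (gamma : R) (F : probability (Borel R) R) (n : nat).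
Context d (T : measurableType d) (P : probability T R).
Context (U : {RV P >-> n.-tuple (Borel R)}) (G : T -> 'M[bool]_n) (c : {RV P >-> n.-tuple (Borel R)}).
Hypothesis hs : graphon_sample f gamma F U G c.

Let mU B : measurable B -> measurable (U @^-1` B).
Proof. by move=> mB; rewrite -[X in measurable X]setTI; exact: measurable_funPT. Qed.

(** The graph takes finitely many values; on each level set the field is independent of the types,
    so a bound uniform in the types integrates. *)
Lemma sample_section_le (V : 'M[bool]_n -> set (n.-tuple (Borel R) * n.-tuple (Borel R))) (r : R) :
  (forall g, measurable (V g)) ->
  (forall g x, adjacency g -> (prob_pow F n (xsection (V g) x) <= r%:E)%E) ->
  (P [set w | V (G w) (U w, c w)] <= r%:E)%E.
Proof.
move=> mV Vr.
have mG g := gs_Gmeas hs g.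
have mUf : measurable_fun [set: T] U by exact: measurable_funPT.
have mcf : measurable_fun [set: T] c by exact: measurable_funPT.
have mS g : measurable ([set w | V g (U w, c w)] `&` [set w | G w = g]).
  apply: measurableI => //; rewrite -[X in measurable X]setTI.
  by apply: (measurable_fun_pair mUf mcf _ (mV g)).
have cover (S : 'M[bool]_n -> set T) : [set w | S (G w) w]
    = \big[setU/set0]_(g <- index_enum _ | adjb g) (S g `&` [set w | G w = g]).
  rewrite -bigcup_seq_cond; apply/seteqP; split => [w /= rw|w [g /= _ [rg gw]]]; last by rewrite gw.
  by exists (G w) => //=; rewrite mem_index_enum; apply/adjP; exact: (gs_adj hs).
rewrite (cover (fun g w => V g (U w, c w))).
apply: (@le_trans _ _ (\sum_(g | adjb g) r%:E * P [set w | G w = g])%E).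
  apply: (@le_trans _ _ (\sum_(g | adjb g) P ([set w | V g (U w, c w)] `&` [set w | G w = g]))%E).
    by apply: measure_big_le => g _; exact: mS.
  apply: lee_sum => g /adjP ga.
  apply: (restricted_product_le (nu := prob_pow F n) mUf mcf (mG g) _ (mV g)) => [A B mA mB|x].
    rewrite (gs_indep hs)//; congr (_ * _)%E; exact: (gs_c hs).
  exact: Vr.
rewrite -ge0_sume_distrr => [|g _]; last exact: measure_ge0.
have <- : P setT = (\sum_(g | adjb g) P [set w | G w = g])%E; last by rewrite probability_setT mule1.
have {1}-> : [set: T] = \big[setU/set0]_(g <- index_enum _ | adjb g) [set w | G w = g].
  have := cover (fun _ => setT); under eq_bigr do rewrite setTI.
  by move=> <-.
by rewrite measure_level_sets ?index_enum_uniq.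
Qed.

End sampled_field.

(** * Typical graphs *)

Section spread_graph.
Context (R : realType) (k : R -> R -> R) (Q : R -> R) (lambda theta gamma : R) (n : nat).
Local Notation D := (@box _ (Borel R) (I01 R) n).
Local Notation E h := (\int[prob_pow (unif01 R) n]_(u in D) h u).
Local Notation E1 h := (\int[unif01 R]_(x in I01 R) h x).
Local Notation N := (n%:R `^ gamma).
Hypothesis mk : measurable_fun [set: Borel R * Borel R] (fun p => k p.1 p.2 : Borel R).
Hypothesis k01 : forall x y, 0 <= k x y <= 1.
Hypothesis ks : forall x y, k x y = k y x.
Hypothesis mQ : measurable_fun [set: Borel R] (Q : Borel R -> Borel R).
Hypothesis Q2 : E1 (fun x => Q x ^+ 2) = 1.
Hypothesis kQ : forall x, I01 R x -> E1 (fun z => k x z * Q z) = lambda * Q x.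
Hypotheses (n0 : (0 < n)%N) (N1 : 1 <= N) (theta1 : `|theta| < 1).
Variables (delta y : R).
Hypotheses (delta0 : 0 < delta) (y0 : 0 < y).
Implicit Types (g : 'M[bool]_n) (u : n.-tuple (Borel R)) (i j : 'I_n).

Local Notation M := (delta * Num.sqrt n%:R).
Local Notation t := (fun x => trunc M (Q x)).
Local Notation slack := ((1 - `|theta|) / 2).
Local Notation pmf u := (adj_pmf (fun i j => k (tnth u i) (tnth u j) / N)).

(** Exponential, at the Chernoff exponent slack / 4, of the largest tolerated degree (1 + slack) n /
    N. The slack keeps |theta| (1 + slack) at most (1 + |theta|) / 2 < 1. *)
Definition degree_cap : R := expR (slack / 4 * ((1 + slack) * (n%:R / N))).

(* One quantity, so that a single Markov inequality excludes every failure of [well_spread]: an entry of Q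
   above the truncation level, a wrong value of sum_i q_i^2, A q far from theta lambda q, a large degree. *)
Definition graph_defect g u : R :=
  2 * (\sum_i \1_[set x : Borel R | M < `|Q x|] (tnth u i))
  + 4 / y ^+ 12 * (\sum_i n%:R^-1 * t (tnth u i) ^+ 2 - E1 (fun x => t x ^+ 2)) ^+ 2
  + N / y ^+ 6 * (\sum_i eigen_defect N theta (fun j => t (tnth u j)) (fun j => lambda * Q (tnth u j)) g i ^+ 2)
  + degree_cap^-1 * \sum_i expR (slack / 4 * \sum_j (g i j)%:R).

Definition graph_defect_bound : R :=
  2 * (tail (unif01 R) (I01 R) Q M / delta ^+ 2) + 4 / y ^+ 12 * delta ^+ 2
  + N / y ^+ 6 * (4 * M^-1 ^+ 2 + 6 * n%:R^-1 + N / n%:R)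
  + degree_cap^-1 * (n%:R * expR ((expR (slack / 4) - 1) * (n%:R / N))).

Let mI : measurable (I01 R). Proof. exact: measurable_I01. Qed.
Let UI : unif01 R (I01 R) = 1%E. Proof. exact: unif01_I01. Qed.
Let mD : measurable D. Proof. exact: measurable_box. Qed.
Let PD : prob_pow (unif01 R) n D = 1%E. Proof. exact: prob_pow_box. Qed.
Let nR : 0 < n%:R :> R. Proof. by rewrite ltr0n. Qed.
Let N0 : 0 < N. Proof. exact: lt_le_trans N1. Qed.
Let M0 : 0 < M. Proof. by rewrite mulr_gt0// sqrtr_gt0. Qed.
Let M2 : M ^+ 2 = delta ^+ 2 * n%:R. Proof. by rewrite exprMn sqr_sqrtr. Qed.
Let slack0 : 0 < slack. Proof. by rewrite divr_gt0// subr_gt0. Qed.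
Let bt : bounded_on (I01 R) (fun x : Borel R => t x).
Proof. exact: (bnd_trunc (I01 R) mQ (ltW M0)). Qed.
Let tM x : `|t x| <= M. Proof. exact: (trunc_le _ (ltW M0)). Qed.
Let t2 : E1 (fun x => t x ^+ 2) <= 1. Proof. exact: (trunc_sqr_le1 mI UI mQ Q2 (ltW M0)). Qed.
Let mkx x : measurable_fun [set: Borel R] (fun z : Borel R => k x z : Borel R).
Proof. exact: (measurableT_comp mk (measurable_pair1 x)). Qed.
Let kx1 x z : `|k x z| <= 1. Proof. by have /andP[h0 h1] := k01 x z; rewrite ger0_norm. Qed.
Let mLam : measurable_fun [set: Borel R] (fun x : Borel R => lambda * Q x : Borel R).
Proof. exact: measurable_funM. Qed.

Lemma eigenfunction_le1 x : I01 R x -> `|lambda * Q x| <= 1.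
Proof. by move=> Ix; rewrite -kQ//; exact: (kernel_le1 mI UI mQ Q2 (mkx x) (fun z _ => kx1 x z)). Qed.

Let Lam_t x : I01 R x -> `|E1 (fun z => k x z * t z) - lambda * Q x| <= M^-1.
Proof. by move=> Ix; rewrite -kQ//; exact: (kernel_trunc mI UI mQ Q2 (mkx x) (fun z _ => kx1 x z) M0). Qed.

Lemma bnd_graph_defect g : bounded_on D (graph_defect g).
Proof.
have bQ : bounded_on (I01 R) (fun x : Borel R => lambda * Q x) by exact: (bnd_le mLam eigenfunction_le1).
have mS : measurable [set x : Borel R | M < `|Q x|].
  by apply: measurable_gt; exact: measurableT_comp.
apply: bndD; last exact: bnd_cst.
apply: bndD; last first.
  apply: bndM; first exact: bnd_cst.
  apply: bnd_sum => i _; apply: (bndX 2); apply: bndB.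
    apply: bndM; first exact: bnd_cst.
    by apply: bndM; [exact: (bnd_tnth i bQ)|exact: bnd_cst].
  apply: bnd_sum => j _; apply: bndM; first exact: bnd_cst.
  by apply: bndM; [exact: (bnd_tnth j bt)|exact: bnd_cst].
apply: bndD.
  apply: bndM; first exact: bnd_cst.
  by apply: bnd_sum => i _; exact: (bnd_tnth i (bnd_indic R (I01 R) mS)).
apply: bndM; first exact: bnd_cst.
apply: (bndX 2); apply: bndB; last exact: bnd_cst.
apply: bnd_sum => i _; apply: bndM; first exact: bnd_cst.
exact: (bnd_tnth i (bndX 2 bt)).
Qed.

Lemma graph_defect_ge0 g u : 0 <= graph_defect g u.
Proof.
have c0 : 0 < degree_cap by exact: expR_gt0.
rewrite /graph_defect !addr_ge0// mulr_ge0 ?sqr_ge0// ?divr_ge0 ?exprn_ge0 ?invr_ge0 ?(ltW y0) ?(ltW N0) ?(ltW c0)//; apply: sumr_ge0 => i _.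
- by rewrite indicE.
- exact: sqr_ge0.
- exact: expR_ge0.
Qed.

Lemma expect_graph_defect :
  E (fun u => \sum_(g | adjb g) pmf u g * graph_defect g u) <= graph_defect_bound.
Proof.
have mS : measurable [set x : Borel R | M < `|Q x|].
  by apply: measurable_gt; exact: measurableT_comp.
have bS := bnd_indic R (I01 R) mS.
pose Ha u : R := \sum_i \1_[set x : Borel R | M < `|Q x|] (tnth u i).
pose Hb u := (\sum_i n%:R^-1 * t (tnth u i) ^+ 2 - E1 (fun x => t x ^+ 2)) ^+ 2.
pose Hc u := n%:R^-1 * (\sum_i kernel_bias k t (fun x => lambda * Q x) i u ^+ 2)
   + N / n%:R * (\sum_i n%:R^-1 * t (tnth u i) ^+ 2).
have bHa : bounded_on D Ha by apply: bnd_sum => i _; exact: (bnd_tnth i bS).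
have bT : bounded_on D (fun u => \sum_i n%:R^-1 * t (tnth u i) ^+ 2).
  by apply: bnd_sum => i _; apply: bndM; [exact: bnd_cst|exact: (bnd_tnth i (bndX 2 bt))].
have bHb : bounded_on D Hb by apply: (bndX 2); apply: bndB => //; exact: bnd_cst.
have bKi i : bounded_on D (fun u => kernel_bias k t (fun x => lambda * Q x) i u ^+ 2).
  by apply: (bndX 2); exact: (bnd_kernel_bias mk (fun x z _ _ => k01 x z) bt mLam eigenfunction_le1).
have bK : bounded_on D (fun u => \sum_i kernel_bias k t (fun x => lambda * Q x) i u ^+ 2) by apply: bnd_sum.
have bK' : bounded_on D (fun u => n%:R^-1 * (\sum_i kernel_bias k t (fun x => lambda * Q x) i u ^+ 2)).
  by apply: bndM => //; exact: bnd_cst.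
have bT' : bounded_on D (fun u => N / n%:R * (\sum_i n%:R^-1 * t (tnth u i) ^+ 2)).
  by apply: bndM => //; exact: bnd_cst.
have bHc : bounded_on D Hc by exact: bndD.
have y12 : 0 <= 4 / y ^+ 12 by rewrite divr_ge0// exprn_ge0// ltW.
have Ny : 0 <= N / y ^+ 6 by rewrite divr_ge0 ?exprn_ge0// ltW.
have c0 : 0 <= degree_cap^-1 by rewrite invr_ge0 expR_ge0.
set dg := degree_cap^-1 * (n%:R * expR ((expR (slack / 4) - 1) * (n%:R / N))).
have bZa : bounded_on D (fun u => 2 * Ha u) by apply: bndM => //; exact: bnd_cst.
have bZb : bounded_on D (fun u => 4 / y ^+ 12 * Hb u) by apply: bndM => //; exact: bnd_cst.
have bZc : bounded_on D (fun u => N / y ^+ 6 * Hc u) by apply: bndM => //; exact: bnd_cst.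
have bZab := bndD bZa bZb; have bZabc := bndD bZab bZc.
apply: (@le_trans _ _ (E (fun u => 2 * Ha u + 4 / y ^+ 12 * Hb u + N / y ^+ 6 * Hc u + dg))).
  apply: (expect_le mD PD).
  - apply: bnd_sum => g _; apply: bndM; last exact: bnd_graph_defect.
    exact: (bnd_pmf mk k01 N1).
  - by apply: bndD => //; exact: bnd_cst.
  move=> u Du; under eq_bigr do rewrite /graph_defect -/(Ha u) -/(Hb u) mulrDr mulrDr.
  rewrite !big_split/= -mulr_suml adj_pmf_sum mul1r -addrA; rewrite -[leRHS]addrA lerD2l lerD//.
    under eq_bigr do rewrite mulrCA; rewrite -mulr_sumr ler_wpM2l//.
    rewrite /Hc -mulr_sumr.
    exact: (adj_eigen_defect n0 N1 (ltW theta1) (fun j => t (tnth u j)) (fun j => lambda * Q (tnth u j)) (fun i j => k01 _ _) (fun i j => ks _ _)).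
  under eq_bigr do rewrite mulrCA; rewrite -mulr_sumr /dg ler_wpM2l//.
  apply: (adj_degree_exp N1 (fun i j => k01 _ _) (fun i j => ks _ _)).
  by rewrite divr_ge0// ltW.
rewrite (expectD mD PD bZabc (bnd_cst _ _)) (expectD mD PD bZab bZc) (expectD mD PD bZa bZb).
rewrite (expectZl mD PD _ bHa) (expectZl mD PD _ bHb) (expectZl mD PD _ bHc) (expect_cst mD PD).
rewrite /graph_defect_bound -/dg lerD2r lerD ?ler_wpM2l//; first (rewrite lerD ?ler_wpM2l//).
- rewrite (expect_sum mD PD) => [|i _]; last exact: (bnd_tnth i bS).
  under eq_bigr do rewrite (expect_coord mI UI _ bS).
  rewrite sumr_const card_ord ler_pdivlMr ?exprn_gt0//.
  rewrite -[X in X * _]mulr_natr -mulrA [n%:R * _]mulrC -M2.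
  exact: (tail_prob mI UI mQ Q2 M0).
- apply: (le_trans (sum_sqr_variance mI UI bt M0 (fun x _ => tM x) t2 n0)).
  by rewrite M2 mulfK// gt_eqF.
- rewrite (expectD mD PD bK' bT') (expectZl mD PD _ bK) (expectZl mD PD _ bT) lerD//.
    rewrite (expect_sum mD PD)// ler_pdivrMl//.
    apply: (@le_trans _ _ (\sum_(i < n) (4 * M^-1 ^+ 2 + 6 * n%:R^-1))).
      apply: ler_sum => i _.
      exact: (kernel_bias_sqr mI UI mk (fun x z _ _ => k01 x z) bt M0 t2 mLam eigenfunction_le1 Lam_t n0).
    by rewrite sumr_const card_ord [leRHS]mulr_natl.
  rewrite -[leRHS]mulr1 ler_wpM2l ?divr_ge0 ?(ltW N0) ?(ltW nR)//.
  rewrite (expect_sum mD PD) => [|i _]; last by apply: bndM; [exact: bnd_cst|exact: (bnd_tnth i (bndX 2 bt))].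
  apply: (@le_trans _ _ (\sum_(i < n) n%:R^-1)).
    apply: ler_sum => i _; rewrite (expectZl mD PD _ (bnd_tnth i (bndX 2 bt))).
    by rewrite (expect_coord mI UI _ (bndX 2 bt)) ler_piMr// invr_ge0.
  by rewrite sumr_const card_ord -[leLHS]mulr_natl divff// gt_eqF.
Qed.

Hypotheses (delta_y : delta <= y ^+ 6).
Hypothesis tail_y : tail (unif01 R) (I01 R) Q M <= y ^+ 6 / 2.

Lemma coupling_entry g i j : coupling theta gamma g i j = theta * (g i j)%:R * N / n%:R.
Proof.
rewrite mxE -!mulrA; congr (_ * (_ * _)).
have e : n%:R `^ (1 - gamma) * N = n%:R :> R.
  by rewrite -powRD ?subrK ?powRr1 ?ler0n// gt_eqF// implybT.
by rewrite -[X in _ = _ / X]e invfM mulrCA divff ?mulr1// gt_eqF.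
Qed.

Lemma coupling_coupling_matrix g : adjacency g -> coupling_matrix (coupling theta gamma g).
Proof.
move=> [gt gd]; split=> [|i]; last by rewrite mxE gd mulr0 mul0r.
by apply/matrixP => i j; rewrite !mxE -[in LHS]gt mxE.
Qed.

Lemma graph_defect_well_spread g u : graph_defect g u <= 1 ->
  well_spread ((1 + `|theta|) / 2) (theta * lambda) (N / n%:R) y (coupling theta gamma g)
    (fun i => Q (tnth u i) / Num.sqrt n%:R).
Proof.
rewrite /graph_defect; set Ha := \sum_i _; set Hb := (_ - _) ^+ 2; set Hc := \sum_i _; set Hd := \sum_i _ => h.
have cap0 : 0 < degree_cap by exact: expR_gt0.
have rn : 0 < Num.sqrt n%:R :> R by rewrite sqrtr_gt0.
have a0 : 0 <= 2 * Ha by rewrite mulr_ge0//; apply: sumr_ge0 => i _; rewrite indicE.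
have b0 : 0 <= 4 / y ^+ 12 * Hb by rewrite mulr_ge0 ?sqr_ge0// divr_ge0// exprn_ge0// ltW.
have c0 : 0 <= N / y ^+ 6 * Hc.
  rewrite mulr_ge0// ?divr_ge0 ?exprn_ge0 ?(ltW N0) ?(ltW y0)//.
  by apply: sumr_ge0 => i _; exact: sqr_ge0.
have d0 : 0 <= degree_cap^-1 * Hd.
  by rewrite mulr_ge0 ?invr_ge0 ?(ltW cap0)//; apply: sumr_ge0 => i _; exact: expR_ge0.
have ha : 2 * Ha <= 1 by lra.
have hb : 4 / y ^+ 12 * Hb <= 1 by lra.
have hc : N / y ^+ 6 * Hc <= 1 by lra.
have {a0 b0 c0 d0 h} hd : degree_cap^-1 * Hd <= 1 by lra.
have y6 : 0 < y ^+ 6 by exact: exprn_gt0.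
(* A single entry above M would contribute 2 to a quantity at most 1. *)
have QM i : `|Q (tnth u i)| <= M.
  rewrite leNgt; apply/negP => Qi; move: ha; rewrite /Ha (bigD1 i)//= indicE mem_set//.
  have s0 : 0 <= \sum_(j | j != i) \1_[set x : Borel R | M < `|Q x|] (tnth u j) :> R by apply: sumr_ge0 => j _; rewrite indicE.
  by move: s0; set s := \sum_(_ | _) _ => s0; rewrite -[1%:R]/(1 : R); lra.
have tQ i : t (tnth u i) = Q (tnth u i) by rewrite /trunc QM.
have deg i : \sum_j (g i j)%:R <= (1 + slack) * (n%:R / N).
  have : expR (slack / 4 * \sum_j (g i j)%:R) <= degree_cap.
    move: hd; rewrite ler_pdivrMl// mulr1; apply: le_trans.
    by rewrite /Hd [leRHS](bigD1 i)//= lerDl; apply: sumr_ge0 => j _; exact: expR_ge0.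
  by rewrite ler_expR ler_pM2l// divr_gt0.
have rho1 : `|theta| * (1 + slack) <= (1 + `|theta|) / 2.
  have := theta1; have := normr_ge0 theta; move: `|theta| => x x0 x1; nra.
have absA i : \sum_j `|coupling theta gamma g i j| <= (1 + `|theta|) / 2.
  apply: le_trans rho1.
  have -> : \sum_j `|coupling theta gamma g i j| = `|theta| * ((\sum_j (g i j)%:R) / (n%:R / N)).
    rewrite mulr_suml mulr_sumr; apply: eq_bigr => j _; rewrite coupling_entry.
    by rewrite !normrM normfV !normr_nat (gtr0_norm N0) invf_div !mulrA.
  by rewrite ler_wpM2l// ler_pdivrMr// divr_gt0.
split=> //.
- move=> i; have hN : 0 <= N / n%:R by rewrite divr_ge0// ltW.
  have r1 : (1 + `|theta|) / 2 <= 1 by have := theta1; lra.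
  apply: (@le_trans _ _ (\sum_j N / n%:R * `|coupling theta gamma g i j|)).
    apply: ler_sum => j _; rewrite -real_normK ?num_real// expr2 ler_wpM2r//.
    rewrite coupling_entry -!mulrA !normrM normfV !normr_nat (gtr0_norm N0) mulrA.
    rewrite ler_piMl// -[leRHS]mulr1 ler_pM// ?(ltW theta1)//.
    by case: (g i j); rewrite ?lexx ?ler01.
  by rewrite -mulr_sumr ler_piMr// (le_trans (absA i)).
- have -> : \sum_i (Q (tnth u i) / Num.sqrt n%:R) ^+ 2 = \sum_i n%:R^-1 * t (tnth u i) ^+ 2.
    by apply: eq_bigr => i _; rewrite tQ exprMn exprVn sqr_sqrtr// mulrC.
  (* The weight 4 / y^12 leaves y^6 / 2 here; the other half of y^6 is for the mass lost by
     truncation. *)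
  have e : `|\sum_i n%:R^-1 * t (tnth u i) ^+ 2 - E1 (fun x => t x ^+ 2)| <= y ^+ 6 / 2.
    rewrite -ler_sqr ?nnegrE ?divr_ge0 ?(ltW y6)// real_normK ?num_real// -/Hb.
    move: hb; rewrite mulrAC ler_pdivrMr ?exprn_gt0// mul1r => hb.
    have -> : (y ^+ 6 / 2) ^+ 2 = y ^+ 12 / 4 by field.
    by rewrite ler_pdivlMr// mulrC.
  have tl0 := tail_ge0 mI UI mQ Q2 (ltW M0).
  move: e tl0 tail_y; rewrite /tail; set m := Rintegral _ _ _; set s := \sum_i _.
  by rewrite ler_norml => /andP[e1 e2] h1 h2; rewrite ler_norml; apply/andP; split; lra.
- move=> i; rewrite normrM normfV (gtr0_norm rn) ler_pdivrMr//.
  by rewrite (le_trans (QM i))// ler_wpM2r// ltW.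
- rewrite mulrCA divff ?gt_eqF// mulr1.
  move: hc; rewrite mulrAC ler_pdivrMr// mul1r; apply: le_trans.
  rewrite ler_wpM2l ?(ltW N0)// le_eqVlt; apply/orP; left; apply/eqP; apply: eq_bigr => i _.
  congr (_ ^+ 2); rewrite /eigen_defect !mulrA; congr (_ - _).
  by apply: eq_bigr => j _; rewrite coupling_entry tQ mulrA.
Qed.

End spread_graph.

(** * Choice of the parameters *)

Section asymptotics.
Context (R : realType).
Implicit Types (n : nat).

(** N^2 / n is n to the power -(1 - 2 gamma), with 1 - 2 gamma > 0. *)
Lemma sparse_ratio (gamma r : R) : 0 <= gamma < 2^-1 -> 0 < r ->
  exists n0, forall n, (n0 <= n)%N ->
    [/\ (0 < n)%N, 1 <= n%:R `^ gamma & n%:R `^ gamma * (n%:R `^ gamma / n%:R) <= r].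
Proof.
move=> /andP[g0 g1] r0; set b := 1 - 2 * gamma.
have b0 : 0 < b by rewrite /b; lra.
pose z := r^-1 `^ b^-1.
exists (Num.truncn z).+1 => n zn.
have n0 : (0 < n)%N by exact: leq_ltn_trans zn.
have nR : 0 < n%:R :> R by rewrite ltr0n.
have n1 : 1 <= n%:R :> R by rewrite ler1n.
split=> //; first by rewrite -[leLHS](powRr0 n%:R) ler_powR.
have zn' : z <= n%:R by rewrite (le_trans (ltW (truncnS_gt _)))// ler_nat.
have rb : r^-1 <= n%:R `^ b.
  have -> : r^-1 = z `^ b by rewrite /z -powRrM mulVf ?gt_eqF// powRr1// invr_ge0 ltW.
  by apply: ge0_ler_powR => //; rewrite ?nnegrE ?(ltW b0) ?powR_ge0// ltW.
have -> : n%:R `^ gamma * (n%:R `^ gamma / n%:R) = (n%:R `^ b)^-1.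
  have e : n%:R `^ gamma * n%:R `^ gamma * n%:R `^ b = n%:R :> R.
    have gb : gamma + gamma + b = 1 by rewrite /b; lra.
    have pD u v : n%:R `^ (u + v) = n%:R `^ u * n%:R `^ v :> R by apply: powRD; apply/implyP => _; rewrite gt_eqF.
    by rewrite -!pD gb powRr1// ltW.
  apply: (mulIf (x := n%:R `^ b)); first by rewrite gt_eqF// powR_gt0.
  by rewrite mulVf ?gt_eqF ?powR_gt0// mulrA mulrAC e divff// gt_eqF.
by rewrite -[leRHS]invrK lef_pV2// posrE ?invr_gt0// powR_gt0.
Qed.

Lemma expR_ge_cube (z : R) : 0 <= z -> (z / 3) ^+ 3 <= expR z.
Proof.
move=> z0; have -> : expR z = expR (z / 3) ^+ 3 by rewrite -expRM_natr mulfVK.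
rewrite lerXn2r ?nnegrE ?expR_ge0 ?divr_ge0// (le_trans _ (expR_ge1Dx _))//.
by rewrite lerDr.
Qed.

(** The exponent is at most -a x / N with a = s^2 / 8, what remains of (s / 4)(1 + s) after the
    quadratic bound on exp(s / 4). A cubic lower bound on the exponential beats the prefactor x,
    leaving a multiple of N^2 / x. *)
Lemma chernoff_term (s N x : R) : 0 < s -> s <= 2^-1 -> 1 <= N -> 0 < x -> N * (N / x) <= 1 ->
  (expR (s / 4 * ((1 + s) * (x / N))))^-1 * (x * expR ((expR (s / 4) - 1) * (x / N)))
  <= 27 / (s ^+ 2 / 8) ^+ 3 * (N * (N / x)).
Proof.
move=> s0 s1 N1 x0 h; have N0 : 0 < N by exact: lt_le_trans N1.
set a := s ^+ 2 / 8; set z := x / N.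
have a0 : 0 < a by rewrite divr_gt0// exprn_gt0.
have z0 : 0 < z by rewrite divr_gt0.
rewrite mulrCA -expRN -expRD.
have hs : expR (s / 4) - 1 <= s / 4 * (1 + s) - a.
  have h4 : `|s / 4| <= 2^-1 by rewrite gtr0_norm ?divr_gt0//; lra.
  have := expR_quadratic h4; rewrite ler_norml => /andP[_]; rewrite /a; move: (expR _) => e.
  by rewrite expr2; nra.
apply: (@le_trans _ _ (x * (expR (a * z))^-1)).
  rewrite ler_wpM2l ?(ltW x0)// -expRN ler_expR.
  have := ler_wpM2r (ltW z0) hs; rewrite mulrBl; lra.
have cube : (expR (a * z))^-1 <= ((a * z / 3) ^+ 3)^-1.
  have az : 0 < a * z by rewrite mulr_gt0.
  by rewrite lef_pV2 ?posrE ?expR_gt0 ?exprn_gt0 ?divr_gt0// expR_ge_cube// ltW.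
rewrite (le_trans (ler_wpM2l (ltW x0) cube))//.
have -> : x * ((a * z / 3) ^+ 3)^-1 = 27 / a ^+ 3 * (N * (N / x) * (N / x)).
  by rewrite /z; field; rewrite !gt_eqF.
rewrite ler_wpM2l ?divr_ge0 ?exprn_ge0 ?(ltW a0)// ler_piMr//.
  by rewrite !mulr_ge0// ?invr_ge0 ltW.
by apply: le_trans h; rewrite ler_peMl// divr_ge0// ltW.
Qed.

(** delta depends on y and eta alone and is fixed before n; the tail, the sampling errors and the
    degrees are then small for large n. Each of the four terms receives eta / 4. *)
Lemma graph_defect_bound_small (Q : R -> R) (theta gamma : R) (y eta : R) :
  measurable_fun [set: Borel R] (Q : Borel R -> Borel R) ->
  \int[unif01 R]_(x in I01 R) (Q x ^+ 2) = 1 ->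
  0 <= gamma < 2^-1 -> `|theta| < 1 -> 0 < y -> 0 < eta ->
  exists delta n0, [/\ 0 < delta, delta <= y ^+ 6 & forall n, (n0 <= n)%N ->
    let N := n%:R `^ gamma in
    [/\ (0 < n)%N, 1 <= N, N / n%:R <= y ^+ 6 /\ N * (N / n%:R) <= y ^+ 6,
        tail (unif01 R) (I01 R) Q (delta * Num.sqrt n%:R) <= y ^+ 6 / 2 &
        graph_defect_bound Q theta gamma n delta y <= eta]].
Proof.
move=> mQ Q2 hg theta1 y0 eta0.
have y6 : 0 < y ^+ 6 by exact: exprn_gt0.
(* With delta = y^6 e the variance term equals 4 e^2, at most eta / 4. *)
pose e := Num.min 1 eta / 4.
have m0 : 0 < Num.min 1 eta by rewrite lt_min ltr01.
have e0 : 0 < e by rewrite divr_gt0.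
have m1 : Num.min 1 eta <= 1 by rewrite ge_min lexx.
have meta : Num.min 1 eta <= eta by rewrite ge_min lexx orbT.
pose delta := y ^+ 6 * e.
have d0 : 0 < delta by rewrite mulr_gt0.
have dy : delta <= y ^+ 6 by rewrite /delta ler_piMr ?(ltW y6)// /e; lra.
pose s := (1 - `|theta|) / 2.
have s0 : 0 < s by rewrite divr_gt0// subr_gt0.
have s1 : s <= 2^-1 by rewrite /s; have := normr_ge0 theta; lra.
pose tl := Num.min (y ^+ 6 / 2) (delta ^+ 2 * eta / 8).
have tl0 : 0 < tl by rewrite lt_min !divr_gt0// mulr_gt0// exprn_gt0.
have [M0 M00 hM] := tail_cvg0 (measurable_I01 (R := R)) (unif01_I01 R) mQ Q2 tl0.
pose c1 := (4 / delta ^+ 2 + 7) / y ^+ 6.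
pose c2 := 27 / (s ^+ 2 / 8) ^+ 3.
have c10 : 0 < c1 by rewrite divr_gt0// addr_gt0// divr_gt0// exprn_gt0.
have c20 : 0 < c2 by rewrite divr_gt0// exprn_gt0// divr_gt0// exprn_gt0.
pose r := Num.min (Num.min 1 (y ^+ 6)) (Num.min (eta / 4 / c1) (eta / 4 / c2)).
have r0 : 0 < r.
  have h1 : 0 < eta / 4 / c1 by apply: divr_gt0 => //; exact: divr_gt0.
  have h2 : 0 < eta / 4 / c2 by apply: divr_gt0 => //; exact: divr_gt0.
  by rewrite !lt_min ltr01 y6 h1 h2.
have [n1 hn1] := sparse_ratio hg r0.
pose z := (M0 / delta) ^+ 2.
exists delta, (maxn n1 (Num.truncn z).+1); split=> // n; rewrite geq_max => /andP[n1n zn] N.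
have [n0 N1 Nr] := hn1 n n1n; rewrite -/N in N1 Nr.
have nR : 0 < n%:R :> R by rewrite ltr0n.
have nn1 : 1 <= n%:R :> R by rewrite ler1n.
have N0 : 0 < N by exact: lt_le_trans N1.
have q0 : 0 < N / n%:R by rewrite divr_gt0.
set ra := N * (N / n%:R) in Nr *.
have qr : N / n%:R <= ra by rewrite /ra ler_peMl// ltW.
have ir : n%:R^-1 <= ra by rewrite (le_trans _ qr)// ler_peMl// invr_ge0 ltW.
have [r1 ry rc1 rc2] : [/\ ra <= 1, ra <= y ^+ 6, ra <= eta / 4 / c1 & ra <= eta / 4 / c2].
  by move: Nr; rewrite /r !le_min => /andP[/andP[-> ->] /andP[-> ->]].
have Mn : M0 <= delta * Num.sqrt n%:R.
  rewrite -ler_pdivrMl// mulrC -ler_sqr ?nnegrE ?sqrtr_ge0 ?divr_ge0 ?(ltW M00) ?(ltW d0)//.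
  by rewrite sqr_sqrtr// -/z (le_trans (ltW (truncnS_gt _)))// ler_nat.
have [t1 t2] : tail (unif01 R) (I01 R) Q (delta * Num.sqrt n%:R) <= y ^+ 6 / 2 /\
    tail (unif01 R) (I01 R) Q (delta * Num.sqrt n%:R) <= delta ^+ 2 * eta / 8.
  by have := hM _ Mn; rewrite le_min => /andP[-> ->].
split=> //; first by split=> //; exact: le_trans qr ry.
have d2 : 0 < delta ^+ 2 by exact: exprn_gt0.
have p1 : 2 * (tail (unif01 R) (I01 R) Q (delta * Num.sqrt n%:R) / delta ^+ 2) <= eta / 4.
  have : tail (unif01 R) (I01 R) Q (delta * Num.sqrt n%:R) / delta ^+ 2 <= eta / 8.
    by rewrite ler_pdivrMr// (le_trans t2)// le_eqVlt; apply/orP; left; apply/eqP; ring.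
  by move: (_ / delta ^+ 2) => x; lra.
have p2 : 4 / y ^+ 12 * delta ^+ 2 <= eta / 4.
  have -> : 4 / y ^+ 12 * delta ^+ 2 = 4 * e ^+ 2 by rewrite /delta; field; rewrite gt_eqF.
  have e1 : e <= 4^-1 by rewrite ler_piMl.
  have e2 : e <= eta / 4 by rewrite ler_wpM2r.
  by rewrite -ler_pdivlMl// expr2 ler_pM// ltW.
have p3 : N / y ^+ 6 * (4 * (delta * Num.sqrt n%:R)^-1 ^+ 2 + 6 * n%:R^-1 + N / n%:R) <= eta / 4.
  apply: (@le_trans _ _ (c1 * ra)); last by rewrite mulrC -ler_pdivlMr.
  have -> : (delta * Num.sqrt n%:R)^-1 ^+ 2 = (delta ^+ 2)^-1 * n%:R^-1.
    by rewrite exprVn exprMn sqr_sqrtr ?(ltW nR)// invfM.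
  apply: (@le_trans _ _ (N / y ^+ 6 * ((4 / delta ^+ 2 + 7) * (N / n%:R)))).
    rewrite ler_wpM2l ?divr_ge0 ?(ltW N0) ?(ltW y6)//.
    have iN : n%:R^-1 <= N / n%:R by rewrite ler_peMl// invr_ge0 ltW.
    have h : 4 / delta ^+ 2 * n%:R^-1 <= 4 / delta ^+ 2 * (N / n%:R) by rewrite ler_wpM2l// divr_ge0// ltW.
    move: h iN; rewrite mulrDl !mulrA; clear; lra.
  by rewrite /c1 /ra le_eqVlt; apply/orP; left; apply/eqP; field; rewrite !gt_eqF.
have p4 : (degree_cap theta gamma n)^-1 * (n%:R * expR ((expR (s / 4) - 1) * (n%:R / N))) <= eta / 4.
  apply: (le_trans (chernoff_term s0 s1 N1 nR r1)).
  by rewrite -/c2 -/ra mulrC -ler_pdivlMr.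
rewrite /graph_defect_bound -/N -/s.
have e4 : eta = eta / 4 + eta / 4 + eta / 4 + eta / 4 by clear; lra.
by rewrite [leRHS]e4; do 3 apply: lerD => //.
Qed.

End asymptotics.

(** Outer measure is monotone, so a measurable exceptional event suffices even when [X n] is not
    measurable. *)
Lemma cvg_in_prob0_le (R : realType) (d : nat -> measure_display)
    (T : forall n, measurableType (d n)) (P : forall n, probability (T n) R)
    (X : forall n, T n -> R) :
  (forall e eta : R, 0 < e -> 0 < eta -> exists n0, forall n, (n0 <= n)%N ->
     exists B : set (T n), [/\ measurable B, (P n B <= eta%:E)%E & forall w, ~ B w -> `|X n w| < e]) ->
  cvg_in_prob0 P X.
Proof.
move=> h e e0; pose S n := [set w | e <= `|X n w|].
have Sle eta : 0 < eta -> \forall n \near \oo, (0 <= mu_ext (P n) (S n) <= eta%:E)%E.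
  move=> eta0; have [n0 hn0] := h e eta e0 eta0; exists n0 => // n /= n0n.
  have P0 X' : (0 <= P n X')%E by exact: measure_ge0.
  rewrite mu_ext_ge0//=; have [B [mB PB XB]] := hn0 n n0n.
  apply: (@le_trans _ _ (mu_ext (P n) B)); last by rewrite measurable_mu_extE.
  apply: le_mu_ext => w /= ew; apply: contrapT => /XB.
  by rewrite ltNge ew.
apply/fine_cvgP; split.
  have := Sle 1 ltr01; apply: filterS => n /andP[h0 h1].
  by rewrite ge0_fin_numE// (le_lt_trans h1)// ltry.
apply/cvgrPdist_le => eta eta0; have := Sle eta eta0; apply: filterS => n /andP[h0 h1].
have fn : mu_ext (P n) (S n) \is a fin_num by rewrite ge0_fin_numE// (le_lt_trans h1)// ltry.
by rewrite /= sub0r normrN ger0_norm ?fine_ge0// -lee_fin fineK.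
Qed.

(** The level e is fixed first by the smoothing terms; y is then taken small against the factor e^-6
    in the others. *)
Lemma small_errors (R : realType) (mu F : probability (Borel R) R) (rho kappa K tol eta : R) :
  0 < rho -> rho < 1 -> 0 < kappa -> 1 <= K -> 0 < tol -> 0 < eta ->
  exists e y, [/\ 0 < e, e <= 1, 0 < y, y <= 1 &
    [/\ quenched_error mu F rho kappa K e y < tol,
        averaged_error mu F rho kappa K e y < tol & 13 * y ^+ 2 <= eta]].
Proof.
move=> rho0 rho1 kappa0 K1 tol0 eta0.
have K0 : 0 <= K by exact: le_trans K1.
rewrite /averaged_error /quenched_error.
set p1 := normal_peak _; set p2 := normal_peak _; set S := stein_cst rho kappa; set L := (1 - rho)^-1.
have p10 : 0 <= p1 by exact: normal_peak_ge0.
have p20 : 0 <= p2 by exact: normal_peak_ge0.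
have S0 : 0 <= S by exact: (stein_cst_ge0 (ltW rho0) rho1 (ltW kappa0)).
have L0 : 0 <= L by rewrite invr_ge0 subr_ge0 ltW.
clearbody p1 p2 S L.
pose a := 2 * (1 + p1) + 2 * (1 + p2).
have a0 : 0 < a by rewrite /a; lra.
pose e := Num.min 1 (tol / 3 / a).
have e0 : 0 < e.
  have h : 0 < tol / 3 / a by apply: divr_gt0 => //; exact: divr_gt0.
  by rewrite lt_min ltr01 h.
have e1 : e <= 1 by rewrite ge_min lexx.
have ea : a * e <= tol / 3 by rewrite mulrC -ler_pdivlMr// ge_min lexx orbT.
pose f := 2 * e^-1 ^+ 6.
have f0 : 0 <= f by rewrite mulr_ge0// exprn_ge0// invr_ge0 ltW.
have fE : f = 2 * e^-1 ^+ 6 by [].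
clearbody f; pose b := f * (S * (11 * K * L)) + p1 * (12 * K * L * L) + 13 + f * (5 * K ^+ 3).
have b0 : 0 < b.
  have h1 : 0 <= f * (S * (11 * K * L)) by rewrite !mulr_ge0.
  have h2 : 0 <= p1 * (12 * K * L * L) by rewrite !mulr_ge0.
  have h3 : 0 <= f * (5 * K ^+ 3) by rewrite !mulr_ge0// exprn_ge0.
  by rewrite /b; move: h1 h2 h3; move: (f * _) (p1 * _) (f * _) => x1 x2 x3; lra.
pose y := Num.min 1 (Num.min (tol / 3 / b) (eta / 13)).
have y0 : 0 < y.
  have h : 0 < tol / 3 / b by apply: divr_gt0 => //; exact: divr_gt0.
  have h' : 0 < eta / 13 by exact: divr_gt0.
  by rewrite !lt_min ltr01 h h'.
have y1 : y <= 1 by rewrite ge_min lexx.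
have yb : b * y <= tol / 3 by rewrite mulrC -ler_pdivlMr// !ge_min lexx !orbT.
have ye : y <= eta / 13 by rewrite !ge_min lexx !orbT.
have y2 : y ^+ 2 <= y by rewrite expr2 ler_piMr// ltW.
have y6 : y ^+ 6 <= y by rewrite (_ : 6 = 5 + 1)%N// exprD expr1 ler_piMl ?(ltW y0)// exprn_ile1// ltW.
have [h1 h2 h3] : [/\ 0 <= f * (S * (11 * K * L)) * y, 0 <= p1 * (12 * K * L * L) * y
    & f * (5 * K ^+ 3) * y ^+ 6 <= f * (5 * K ^+ 3) * y].
  have yy := ltW y0; split; first by rewrite mulr_ge0// !mulr_ge0.
    by rewrite mulr_ge0// !mulr_ge0.
  by rewrite ler_wpM2l// !mulr_ge0// exprn_ge0.
have h4 : 0 <= f * (5 * K ^+ 3) * y ^+ 6.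
  have yy := exprn_ge0 6 (ltW y0).
  by rewrite mulr_ge0// !mulr_ge0// exprn_ge0.
have aE : a * e = 2 * e * (1 + p1) + 2 * e * (1 + p2) by rewrite /a; ring.
have bE : b * y = f * (S * (11 * K * L)) * y + p1 * (12 * K * L * L) * y + 13 * y + f * (5 * K ^+ 3) * y.
  by rewrite /b; ring.
have q1 : f * (S * (11 * K * (L * y))) = f * (S * (11 * K * L)) * y by ring.
have q2 : p1 * (12 * K * L * (L * y)) = p1 * (12 * K * L * L) * y by ring.
have q3 : f * (5 * K ^+ 3 * y ^+ 6) = f * (5 * K ^+ 3) * y ^+ 6 by ring.
have e20 : 0 <= 2 * e * (1 + p2) by rewrite !mulr_ge0 ?(ltW e0)// addr_ge0.
exists e, y; rewrite -!fE q1 q2 q3; split=> //; rewrite aE in ea; rewrite bE in yb; clear q1 q2 q3 aE bE.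
move: h1 h2 h3 h4 e20 ea yb.
move: (f * (S * (11 * K * L)) * y) (p1 * (12 * K * L * L) * y) (f * (5 * K ^+ 3) * y ^+ 6)
  (f * (5 * K ^+ 3) * y) (2 * e * (1 + p2)) (2 * e * (1 + p1)) => x1 x2 x3 x4 x5 x6 h1 h2 h3 h4 e20 ea yb.
by split; move: y2 ye; move: (y ^+ 2) => z; lra.
Qed.

(** * Kolmogorov-Smirnov bounds and the exceptional event *)

Section spread_KS.
Context (R : realType) (mu F : probability (Borel R) R).
Hypothesis hmu : base_measure mu.
Hypothesis F0 : \int[F]_x psi1 mu x = 0.
Local Notation ups := (mean_var mu F).
Variables (rho tl kappa K : R).
Hypotheses (rho0 : 0 < rho) (rho1 : rho < 1).
Hypotheses (kappaE : kappa * (1 - tl * ups) = 1) (kappa0 : 0 < kappa) (kappaK : kappa <= K) (K1 : 1 <= K).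
Context (n : nat) (A : 'M[R]_n) (Q : R -> R) (v : n.-tuple (Borel R)) (alpha y : R).
Local Notation q := (fun i => Q (tnth v i) / Num.sqrt n%:R).
Hypotheses (hA : coupling_matrix A) (hq : well_spread rho tl alpha y A q).
Hypotheses (y0 : 0 < y) (y1 : y <= 1) (N1 : 1 <= n%:R * alpha).
Hypotheses (alpha_y : alpha <= y ^+ 6) (Nalpha : n%:R * alpha * alpha <= y ^+ 6).
Local Notation W := (field_defect mu F A q (fun i => tl * q i - \sum_j A i j * q j) (n%:R * alpha) y).

Let lin_statE (s m : n.-tuple (Borel R)) : lin_stat Q v s m = \sum_i q i * (tnth s i - tnth m i).
Proof. by rewrite /lin_stat mulr_sumr; apply: eq_bigr => i _; rewrite mulrA [_ / _]mulrC. Qed.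

Lemma quenched_KS (c m : n.-tuple (Borel R)) (e : R) : mf_optimizer mu A c m -> W c <= y ^+ 4 ->
  0 < e -> e <= 1 ->
  `|KS_dist (stat_law mu Q v A c m) (normal_prob 0 (Num.sqrt (kappa * ups)))|
  <= quenched_error mu F rho kappa K e y.
Proof.
move=> hm Wc e0 e1; apply: KS_dist_le => t.
have s0 : 0 < Num.sqrt (kappa * ups) by rewrite sqrtr_gt0 mulr_gt0// mean_var_gt0.
rewrite (stat_law_rayE (base_measureI hmu)) (normal_probE s0)//=.
have := quenched_clt hmu rho0 rho1 kappaE kappa0 kappaK K1 hA hq y0 y1 N1 alpha_y Nalpha
  (mf_optimizer_fixpoint hmu hA hm) Wc t e0 e1.
by under [X in `|gexp _ _ _ X - _|]eq_fun do rewrite -lin_statE.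
Qed.

Lemma averaged_KS (m : n.-tuple (Borel R) -> n.-tuple (Borel R)) (e : R) :
  (forall c, mf_optimizer mu A c (m c)) -> 0 < e -> e <= 1 ->
  `|KS_dist (avg_stat_law mu F Q v A [tuple 0 | i < n])
     (normal_prob 0 (Num.sqrt (kappa * ups + kappa ^+ 2 * var_mean mu F)))|
  <= averaged_error mu F rho kappa K e y.
Proof.
move=> hm e0 e1; apply: KS_dist_le => t.
have s0 : 0 < Num.sqrt (kappa * ups + kappa ^+ 2 * var_mean mu F).
  by rewrite sqrtr_gt0; exact: limit_variance_gt0.
have stE : (fun s => \1_(`]-oo, t]%classic) (lin_stat Q v s [tuple 0 | i < n]) : R)
   = (fun s => \1_(`]-oo, t]%classic) (\sum_i q i * tnth s i)).
  apply/funext => s; rewrite lin_statE; congr (\1_ _ _); apply: eq_bigr => i _.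
  by rewrite tnth_mktuple subr0.
rewrite (normal_probE s0)// /avg_stat_law.
under eq_integral do rewrite (stat_law_rayE (base_measureI hmu)) stE.
have mD : measurable (@box _ (Borel R) [set: Borel R] n) by exact: measurable_box.
have PD : prob_pow F n (@box _ (Borel R) [set: Borel R] n) = 1%E.
  by apply: prob_pow_box => //; exact: probability_setT.
rewrite (integral_fullE mD PD) => [|]; last first.
  apply: (bnd_gexp_field hmu A q) => // x.
  by rewrite indicE; case: (_ \in _); rewrite ?normr1 ?normr0.
exact: (averaged_clt hmu F0 rho0 rho1 kappaE kappa0 kappaK K1 hA hq y0 y1 N1 alpha_y Nalpha
  (fun c => mf_optimizer_fixpoint hmu hA (hm c)) t e0 e1).
Qed.

End spread_KS.

Section bad_event.
Context (R : realType) (mu F : probability (Borel R) R).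
Hypothesis hmu : base_measure mu.
Hypothesis F0 : \int[F]_x psi1 mu x = 0.
Context (f k : R -> R -> R) (Q : R -> R) (lambda theta gamma : R) (n : nat).
Context d (T : measurableType d) (P : probability T R).
Context (U : {RV P >-> n.-tuple (Borel R)}) (G : T -> 'M[bool]_n) (c : {RV P >-> n.-tuple (Borel R)}).
Hypothesis hs : graphon_sample f gamma F U G c.
Local Notation N := (n%:R `^ gamma).
Hypothesis mk : measurable_fun [set: Borel R * Borel R] (fun p => k p.1 p.2 : Borel R).
Hypothesis k01 : forall x y, 0 <= k x y <= 1.
Hypothesis ks : forall x y, k x y = k y x.
Hypothesis kf : forall x y, I01 R x -> I01 R y -> k x y = f x y.
Hypothesis mQ : measurable_fun [set: Borel R] (Q : Borel R -> Borel R).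
Hypothesis Q2 : \int[unif01 R]_(x in I01 R) (Q x ^+ 2) = 1.
Hypothesis kQ : forall x, I01 R x -> \int[unif01 R]_(z in I01 R) (k x z * Q z) = lambda * Q x.
Hypotheses (n0 : (0 < n)%N) (N1 : 1 <= N) (theta1 : `|theta| < 1).
Variables (delta y : R).
Hypotheses (delta0 : 0 < delta) (delta_y : delta <= y ^+ 6).
Hypotheses (y0 : 0 < y) (y1 : y <= 1).
Hypothesis tail_y : tail (unif01 R) (I01 R) Q (delta * Num.sqrt n%:R) <= y ^+ 6 / 2.
Hypotheses (ratio_y : N / n%:R <= y ^+ 6) (sparse_y : N * (N / n%:R) <= y ^+ 6).

Local Notation A g := (coupling theta gamma g).
Local Notation q v := (fun i => Q (tnth v i) / Num.sqrt n%:R).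
Local Notation W g v := (field_defect mu F (A g) (q v)
  (fun i => theta * lambda * q v i - \sum_j A g i j * q v j) (n%:R * (N / n%:R)) y).
Local Notation defect := (graph_defect Q lambda theta gamma delta y).

Let nN : n%:R * (N / n%:R) = N :> R.
Proof. by rewrite mulrCA divff ?mulr1// pnatr_eq0 -lt0n. Qed.

Let measurable_graph_event (S : 'M[bool]_n -> set T) : (forall g, measurable (S g)) ->
  measurable [set w | S (G w) w].
Proof.
move=> mS; have -> : [set w | S (G w) w] = \big[setU/set0]_(g : 'M[bool]_n) (S g `&` [set w | G w = g]).
  rewrite -bigcup_seq; apply/seteqP; split => [w /= Sw|w [g /= _ [Sg gw]]]; last by rewrite gw.
  by exists (G w) => //=; rewrite mem_index_enum.
by apply: bigsetU_measurable => g _; apply: measurableI; [exact: mS|exact: (gs_Gmeas hs)].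
Qed.

Let mU B : measurable B -> measurable (U @^-1` B).
Proof. by move=> mB; rewrite -[X in measurable X]setTI; exact: measurable_funPT. Qed.

Let mdefect g : measurable_fun [set: n.-tuple (Borel R)] (defect g).
Proof. by have [] := bnd_graph_defect theta gamma mk k01 mQ Q2 kQ n0 y delta0 g. Qed.

(** Fields that are bad for a good graph. With the goodness of the graph built in, every section is
    either empty or covered by [expect_bad_field]. *)
Let V g : set (n.-tuple (Borel R) * n.-tuple (Borel R)) :=
  [set p | defect g p.1 <= 1 /\ y ^+ 4 < W g p.1 p.2].

Let mV g : measurable (V g).
Proof.
have m1 : measurable_fun setT (fun p : n.-tuple (Borel R) * n.-tuple (Borel R) => defect g p.1).
  exact: (measurableT_comp (mdefect g) measurable_fst).
have -> : V g = ~` [set p | 1 < defect g p.1] `&` [set p | y ^+ 4 < W g p.1 p.2].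
  by apply/seteqP; split => p [/= h1 h2]; split=> //; [apply/negP; rewrite -leNgt|rewrite leNgt; exact/negP].
apply: measurableI; first by apply: measurableC; exact: measurable_gt.
have mq i : measurable_fun setT (fun p : n.-tuple (Borel R) * n.-tuple (Borel R) => q p.1 i).
  apply: measurable_funM => //; apply: (measurableT_comp mQ).
  exact: (measurableT_comp (@measurable_tnth _ _ _ i)).
apply: measurable_gt.
apply: (measurable_field_defect F hmu (A g) (n%:R * (N / n%:R)) y mq) => // i.
apply: measurable_funB; first exact: measurable_funM.
by apply: measurable_sum => j; exact: measurable_funM.
Qed.

(** The union of a graph failure, bounded by Markov, and a field failure on a good graph, bounded
    section by section. *)
Lemma bad_event : exists B : set T, [/\ measurable B,
  (P B <= (graph_defect_bound Q theta gamma n delta y + 13 * y ^+ 2)%:E)%E &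
  forall w, ~ B w -> defect (G w) (U w) <= 1 /\ W (G w) (U w) (c w) <= y ^+ 4].
Proof.
pose B1 := [set w | 1 < defect (G w) (U w)].
pose B2 := [set w | V (G w) (U w, c w)].
have mB1 : measurable B1.
  apply: (measurable_graph_event (S := fun g => [set w | 1 < defect g (U w)])) => g.
  by apply: (mU (B := [set v | 1 < defect g v])); exact: measurable_gt.
have mB2 : measurable B2.
  apply: (measurable_graph_event (S := fun g => [set w | V g (U w, c w)])) => g.
  rewrite -[X in measurable X]setTI.
  have mUc : measurable_fun setT (fun w => (U w, c w)) by apply: measurable_fun_pair; exact: measurable_funPT.
  exact: (mUc _ _ (mV g)).
exists (B1 `|` B2); split; first exact: measurableU.
  apply: (le_trans (measureU2 _ mB1 mB2)); rewrite EFinD leeD//.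
    apply: (sample_markov hs mk k01 kf N1 (r := 1)) => //.
    - exact: (bnd_graph_defect theta gamma mk k01 mQ Q2 kQ n0 y delta0).
    - by move=> g v; exact: graph_defect_ge0.
    - by rewrite mulr1; exact: (expect_graph_defect mk k01 ks mQ Q2 kQ n0 N1 theta1 delta0 y0).
  apply: (sample_section_le hs mV) => g v ga.
  have [h|h] := leP (defect g v) 1; last first.
    have -> : xsection (V g) v = set0.
      by apply/seteqP; split => // x /xsectionP [/= h' _]; move: h; rewrite ltNge h'.
    by rewrite measure0 lee_fin mulr_ge0// sqr_ge0.
  have -> : xsection (V g) v = [set x | y ^+ 4 < W g v x].
    by apply/seteqP; split => x /= => [/xsectionP[]|?]//; apply/xsectionP; split.
  have mD : measurable (@box _ (Borel R) [set: Borel R] n) by exact: measurable_box.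
  have PD : prob_pow F n (@box _ (Borel R) [set: Borel R] n) = 1%E.
    by apply: prob_pow_box => //; exact: probability_setT.
  have hA := coupling_coupling_matrix theta gamma ga.
  have hq := graph_defect_well_spread mQ Q2 n0 N1 theta1 delta0 y0 delta_y tail_y h.
  have mS : measurable [set x | y ^+ 4 < W g v x].
    by apply: measurable_gt; have [] := bnd_field_defect F hmu (A g) (q v) (fun i => theta * lambda * q v i - \sum_j A g i j * q v j) (n%:R * (N / n%:R)) y.
  set S := [set x | _] in mS *.
  have -> : prob_pow F n S = (\int[prob_pow F n]_x (\1_S x)%:E)%E by rewrite integral_indic// setIT.
  rewrite (integral_fullE mD PD); last exact: bnd_indic.
  rewrite lee_fin; apply: (expect_bad_field hmu F0 hA hq) => //; by rewrite nN.
move=> w /not_orP[/negP]; rewrite -leNgt => h1 h2; split=> //.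
by rewrite leNgt; apply/negP => h3; apply: h2; split.
Qed.

End bad_event.

(** * Extension of kernel and eigenfunction by zero *)

Section zero_extension.
Context (R : realType) (f : R -> R -> R) (Q : R -> R) (lambda : R).
Hypothesis f_meas : measurable_fun (I01 R `*` I01 R)
  (fun p : Borel R * Borel R => f p.1 p.2 : Borel R).
Hypothesis f_sym : forall x y, I01 R x -> I01 R y -> f x y = f y x.
Hypothesis f_01 : forall x y, I01 R x -> I01 R y -> 0 <= f x y <= 1.
Hypothesis Q_meas : measurable_fun (I01 R) (Q : Borel R -> Borel R).
Hypothesis Q_norm : \int[@lebesgue_measure R]_(y in I01 R) (Q y ^+ 2) = 1.
Hypothesis Q_eigen : forall x, I01 R x ->
  \int[@lebesgue_measure R]_(y in I01 R) (f x y * Q y) = lambda * Q x.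

Definition kernel0 (x y : R) : R :=
  ((fun p : Borel R * Borel R => f p.1 p.2) \_ (I01 R `*` I01 R)) (x, y).
Definition eigenfunction0 : R -> R := Q \_ (I01 R).
Local Notation k := kernel0.
Local Notation Q0 := eigenfunction0.

Lemma kernel0E x y : I01 R x -> I01 R y -> k x y = f x y.
Proof. by move=> Ix Iy; rewrite /k patchE mem_set. Qed.

Lemma eigenfunction0E x : I01 R x -> Q0 x = Q x.
Proof. by move=> Ix; rewrite /Q0 patchE mem_set. Qed.

Let kernel0_out x y : ~ (I01 R x /\ I01 R y) -> k x y = 0.
Proof. by move=> Ixy; rewrite /k patchE; case: ifPn => // /set_mem[/= Ix Iy]; case: Ixy. Qed.

Lemma measurable_kernel0 : measurable_fun [set: Borel R * Borel R] (fun p => k p.1 p.2 : Borel R).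
Proof.
have mI2 : measurable (I01 R `*` I01 R) by apply: measurableX; exact: measurable_I01.
have := (measurable_restrictT (fun p : Borel R * Borel R => f p.1 p.2 : Borel R) mI2).1 f_meas.
by rewrite (_ : patch _ _ _ = (fun p => k p.1 p.2))//; apply/funext => -[].
Qed.

Lemma measurable_eigenfunction0 : measurable_fun [set: Borel R] (Q0 : Borel R -> Borel R).
Proof. by apply/(measurable_restrictT _ _).1 => //; exact: measurable_I01. Qed.

Lemma kernel0_01 x y : 0 <= k x y <= 1.
Proof.
have [[Ix Iy]|Ixy] := pselect (I01 R x /\ I01 R y); last by rewrite kernel0_out ?lexx ?ler01.
by rewrite kernel0E//; exact: f_01.
Qed.

Lemma kernel0_sym x y : k x y = k y x.
Proof.
have [[Ix Iy]|Ixy] := pselect (I01 R x /\ I01 R y); first by rewrite !kernel0E//; exact: f_sym.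
by rewrite kernel0_out// kernel0_out// => -[? ?]; exact: Ixy.
Qed.

Lemma eigenfunction0_norm : \int[unif01 R]_(x in I01 R) (Q0 x ^+ 2) = 1.
Proof.
rewrite unif01_integral; last by apply: measurable_funX; exact: measurable_eigenfunction0.
by rewrite -Q_norm; apply: eq_Rintegral => x /set_mem Ix; rewrite eigenfunction0E.
Qed.

Lemma kernel0_eigen x : I01 R x -> \int[unif01 R]_(z in I01 R) (k x z * Q0 z) = lambda * Q0 x.
Proof.
move=> Ix; rewrite unif01_integral; last first.
  apply: measurable_funM; last exact: measurable_eigenfunction0.
  exact: (measurableT_comp measurable_kernel0 (measurable_pair1 x)).
rewrite eigenfunction0E// -Q_eigen//; apply: eq_Rintegral => z /set_mem Iz.
by rewrite kernel0E// eigenfunction0E.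
Qed.

(** |lambda Q| <= 1 pointwise on [0, 1]; integrating the square gives lambda^2 <= 1. *)
Lemma eigenvalue_le1 : `|lambda| <= 1.
Proof.
have mQ := measurable_eigenfunction0; have Q2 := eigenfunction0_norm.
have le1 x : I01 R x -> `|lambda * Q0 x| <= 1.
  exact: (eigenfunction_le1 measurable_kernel0 kernel0_01 mQ Q2 kernel0_eigen).
have mI := measurable_I01 (R := R); have UI := unif01_I01 R.
have mL : measurable_fun [set: Borel R] (fun x : Borel R => lambda * Q0 x : Borel R) by exact: measurable_funM.
have bL := bndX 2 (bnd_le mL le1).
rewrite -ler_sqr ?nnegrE// real_normK ?num_real// expr1n.
have <- : \int[unif01 R]_(x in I01 R) ((lambda * Q0 x) ^+ 2) = lambda ^+ 2.
  rewrite -[RHS]mulr1 -Q2 -RintegralZl//; last exact: (integrable_sqr mQ Q2).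
  by apply: eq_Rintegral => x _; rewrite exprMn.
apply: (expect_le_cst mI UI bL) => x Ix.
by rewrite -real_normK ?num_real// exprn_ile1// le1.
Qed.

End zero_extension.

Theorem corollary2p10 (R : realType)
  (mu : probability (Borel R) R) (hmu : base_measure mu)
  (f : R -> R -> R)
  (f_meas : measurable_fun (I01 R `*` I01 R)
     (fun p : Borel R * Borel R => f p.1 p.2 : Borel R))
  (f_sym : forall x y, I01 R x -> I01 R y -> f x y = f y x)
  (f_01 : forall x y, I01 R x -> I01 R y -> 0 <= f x y <= 1)
  (Q : R -> R) (lambda : R)
  (Q_meas : measurable_fun (I01 R) (Q : Borel R -> Borel R))
  (Q_norm : \int[@lebesgue_measure R]_(y in I01 R) (Q y ^+ 2) = 1)
  (Q_eigen : forall x, I01 R x ->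
     \int[@lebesgue_measure R]_(y in I01 R) (f x y * Q y) = lambda * Q x)
  (gamma : R) (hgamma : 0 <= gamma < 2^-1)
  (theta : R) (htheta : `|theta| < 1)
  (F : probability (Borel R) R)
  (F_centered : \int[F]_x derive1 (psi mu) x = 0)
  (f_pos : (0 < \int[unif01 R \x unif01 R]_(p in I01 R `*` I01 R)
     (f p.1 p.2)%:E)%E)
  (d : nat -> measure_display) (T : forall n, measurableType (d n))
  (P : forall n, probability (T n) R)
  (U : forall n, {RV (P n) >-> n.-tuple (Borel R)})
  (G : forall n, T n -> 'M[bool]_n)
  (c : forall n, {RV (P n) >-> n.-tuple (Borel R)})
  (hsample : forall n, graphon_sample f gamma F (U n) (G n) (c n))
  (u : forall n, 'M[R]_n -> n.-tuple (Borel R) -> n.-tuple (Borel R))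
  (hu : forall n A b, coupling_matrix A -> mf_optimizer mu A b (u n A b)) :
  let upsilon := \int[F]_x derive1n 2 (psi mu) x in
  let v1 := upsilon / (1 - theta * lambda * upsilon) in
  let v2 := v1 + (\int[F]_x (derive1 (psi mu) x) ^+ 2)
                 / (1 - theta * lambda * upsilon) ^+ 2 in
  let A n w := coupling theta gamma (G n w) in
  cvg_in_prob0 P (fun n w =>
    KS_dist (stat_law mu Q (U n w) (A n w) (c n w) (u n (A n w) (c n w)))
            (normal_prob 0 (Num.sqrt v1)))
  /\
  cvg_in_prob0 P (fun n w =>
    KS_dist (avg_stat_law mu F Q (U n w) (A n w) [tuple 0 | i < n])
            (normal_prob 0 (Num.sqrt v2))).
Proof.
move=> ups v1 v2 A.
have F0 : \int[F]_x psi1 mu x = 0 by rewrite -F_centered derive1_psi.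
have upsE : ups = mean_var mu F by rewrite /ups derive2_psi.
have vmE : \int[F]_x (derive1 (psi mu) x) ^+ 2 = var_mean mu F by rewrite derive1_psi.
have ups0 : 0 < ups by rewrite upsE mean_var_gt0.
have ups1 : ups <= 1 by rewrite upsE mean_var_le1.
have mk := measurable_kernel0 f_meas.
have k01 := kernel0_01 f_01.
have ks := kernel0_sym f_sym.
have mQ := measurable_eigenfunction0 Q_meas.
have Q2 := eigenfunction0_norm Q_meas Q_norm.
have kQ := kernel0_eigen f_meas Q_meas Q_eigen.
have lam1 := eigenvalue_le1 f_meas f_01 Q_meas Q_norm Q_eigen.
have tl1 : `|theta * lambda * ups| < 1.
  rewrite !normrM (gtr0_norm ups0); apply: le_lt_trans htheta.
  by rewrite -mulrA ler_piMr// -[leRHS]mulr1 ler_pM// ltW.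
have den0 : 0 < 1 - theta * lambda * ups by move: tl1; rewrite ltr_norml => /andP[_]; lra.
pose kappa := (1 - theta * lambda * ups)^-1.
have kappa0 : 0 < kappa by rewrite invr_gt0.
have kappaE : kappa * (1 - theta * lambda * mean_var mu F) = 1 by rewrite -upsE mulVf// gt_eqF.
pose K := Num.max 1 kappa.
have kappaK : kappa <= K by rewrite le_max lexx orbT.
have K1 : 1 <= K by rewrite le_max lexx.
pose rho := (1 + `|theta|) / 2.
have rho0 : 0 < rho by rewrite /rho; have := normr_ge0 theta; clear; lra.
have rho1 : rho < 1 by rewrite /rho; clear -htheta; lra.
have v1E : v1 = kappa * mean_var mu F by rewrite -upsE [RHS]mulrC.
have v2E : v2 = kappa * mean_var mu F + kappa ^+ 2 * var_mean mu F.
  by rewrite /v2 v1E vmE; congr (_ + _); rewrite /kappa exprVn [RHS]mulrC.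
(* The types lie in [0, 1] at every sample point, so the extended eigenfunction gives the same
   statistic. *)
have statE n w B b m : stat_law mu Q (U n w) B b m = stat_law mu (eigenfunction0 Q) (U n w) B b m.
  rewrite /stat_law; congr pushforward; apply/funext => s; rewrite /lin_stat; congr (_ * _).
  by apply: eq_bigr => i _; rewrite eigenfunction0E//; exact: (gs_U01 (hsample n) w i).
(* One exceptional event, on which graph or field is atypical, serves both limits. *)
have main (tol eta : R) : 0 < tol -> 0 < eta -> exists n0, forall n, (n0 <= n)%N ->
    exists B : set (T n), [/\ measurable B, (P n B <= eta%:E)%E & forall w, ~ B w ->
      `|KS_dist (stat_law mu Q (U n w) (A n w) (c n w) (u n (A n w) (c n w)))
          (normal_prob 0 (Num.sqrt v1))| < tol /\
      `|KS_dist (avg_stat_law mu F Q (U n w) (A n w) [tuple 0 | i < n])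
          (normal_prob 0 (Num.sqrt v2))| < tol].
  move=> tol0 eta0; have eta2 : 0 < eta / 2 by exact: divr_gt0.
  have [e [y [e0 e1 y0 y1 [quenched averaged ye]]]] := small_errors mu F rho0 rho1 kappa0 K1 tol0 eta2.
  have [delta [n0 [delta0 delta_y hn0]]] := graph_defect_bound_small mQ Q2 hgamma htheta y0 eta2.
  exists n0 => n /hn0[npos N1 [ratio_y sparse_y] tail_y bound].
  have nN : n%:R * (n%:R `^ gamma / n%:R) = n%:R `^ gamma :> R.
    by rewrite mulrCA divff ?mulr1// pnatr_eq0 -lt0n.
  have [B [mB PB hB]] := bad_event hmu F0 (hsample n) mk k01 ks (@kernel0E R f) mQ Q2 kQ npos N1 htheta
    delta0 delta_y y0 y1 tail_y ratio_y sparse_y.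
  exists B; split=> //.
    by apply: (le_trans PB); rewrite lee_fin [leRHS]splitr lerD.
  move=> w /hB[good_graph good_field].
  have hA : coupling_matrix (A n w) by apply: coupling_coupling_matrix; exact: (gs_adj (hsample n)).
  have hq := graph_defect_well_spread mQ Q2 npos N1 htheta delta0 y0 delta_y tail_y good_graph.
  have N1' : 1 <= n%:R * (n%:R `^ gamma / n%:R) by rewrite nN.
  have Nalpha : n%:R * (n%:R `^ gamma / n%:R) * (n%:R `^ gamma / n%:R) <= y ^+ 6 by rewrite nN.
  rewrite v1E v2E; split.
    rewrite statE; apply: le_lt_trans quenched.
    exact: (quenched_KS hmu rho0 rho1 kappaE kappa0 kappaK K1 hA hq y0 y1 N1' ratio_y Nalpha
      (hu _ _ _ hA) good_field e0 e1).
  rewrite /avg_stat_law; under eq_fun do under eq_integral do rewrite statE.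
  apply: le_lt_trans averaged.
  exact: (averaged_KS hmu F0 rho0 rho1 kappaE kappa0 kappaK K1 hA hq y0 y1 N1' ratio_y Nalpha
    (fun b => hu _ _ b hA) e0 e1).
split; apply: cvg_in_prob0_le => tol eta tol0 eta0; have [n0 hn0] := main tol eta tol0 eta0;
  exists n0 => n /hn0[B [mB PB hB]]; exists B; split=> // w /hB[] //.
Qed.
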